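(* Let $\varphi$ be a convex $C^2$ function on a bounded interval $I\subset\mathbb R$, let $\kappa=\varphi''\ge0$, and let $\mu$ be the measure on $I$ given by $d\mu(x)=\kappa(x)^{1/3}\,dx$, which is assumed to be finite. Let $\chi\in\mathcal S(\mathbb R)$ be even with $\int_{\mathbb R}\chi=1$, put $\chi_\varepsilon(s)=\varepsilon^{-1}\chi(s/\varepsilon)$, and define, for $x\in I$, $$\mathcal M f(x)=\sup_{0<\varepsilon',\varepsilon''<1}\Big|\int_{\mathbb R^2}\widehat f\big(x+s,\varphi(x)+t\big)\,\chi_{\varepsilon'}(s)\,\chi_{\varepsilon''}(t)\,ds\,dt\Big|.$$ Then for all exponents $p,q$ (with $1\le q\le\infty$) satisfying $1\le p<\frac43$ and $p'\ge3q$, the inequality $$\|\mathcal M f\|_{L^q(I,\mu)}\le C_p\,\|f\|_{L^p(\mathbb R^2)}$$ holds for every $f\in L^p(\mathbb R^2)$, with a constant $C_p$ independent of $f$ (it may depend on $\chi$, $\varphi$ and $I$).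
   Context: $\mathcal S(\mathbb R)$ is the Schwartz space. The Fourier transform is $\widehat f(\xi)=\int_{\mathbb R^2}f(x)e^{-ix\cdot\xi}\,dx$ for $f\in L^1(\mathbb R^2)$, extended to $L^p(\mathbb R^2)$, $1\le p\le2$, in the usual way, so that $\widehat f\in L^{p'}(\mathbb R^2)$. Here $p'$ is the conjugate exponent, $\frac1p+\frac1{p'}=1$ ($p'=\infty$ if $p=1$). The measure $\mu$ is the pull-back to $I$ of the affine arclength measure on the graph $S=\{(x,\varphi(x)):x\in I\}$. *)

(* Defs.v *)
From HB Require Import structures.
From mathcomp Require Import all_boot all_order all_algebra.
From mathcomp Require Import complex.
From mathcomp Require Import all_classical all_reals all_analysis.

Set Implicit Arguments.
Unset Strict Implicit.
Unset Printing Implicit Defensive.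

Import Order.TTheory GRing.Theory Num.Theory.
Import numFieldNormedType.Exports.

Local Open Scope classical_set_scope.
Local Open Scope ring_scope.
Local Open Scope complex_scope.

(* The limit is taken inside I only, so that it is one-sided at an endpoint
   belonging to I; the values of h outside I are irrelevant. *)
Definition is_derive_within {R : realType} (I : set R) (h h' : R -> R) : Prop :=
  forall x, I x ->
    (fun y => (h y - h x) / (y - x)) @ within I x^' --> h' x.

Definition is_C2_within {R : realType} (I : set R) (phi kappa : R -> R) : Prop :=
  {within I, continuous kappa} /\
  exists phi' : R -> R,
    is_derive_within I phi phi' /\ is_derive_within I phi' kappa.

Definition schwartz {R : realType} (g : R -> R) : Prop :=
  (forall (n : nat) (x : R), derivable (derive1n n g) x 1) /\
  (forall k n : nat, exists C : R, forall x : R, `|x ^+ k * derive1n n g x| <= C).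

Definition cschwartz {R : realType} (chi : R -> R[i]) : Prop :=
  schwartz (fun x => complex.Re (chi x)) /\ schwartz (fun x => complex.Im (chi x)).

Definition cmeasurable {d} {T : measurableType d} {R : realType}
    (f : T -> R[i]) : Prop :=
  measurable_fun setT (fun x => complex.Re (f x)) /\
  measurable_fun setT (fun x => complex.Im (f x)).

(* Only meaningful for integrable f. *)
Definition cintegral {d} {T : measurableType d} {R : realType}
    (mu : {measure set T -> \bar R}) (f : T -> R[i]) : R[i] :=
  (\int[mu]_x complex.Re (f x)) +i* (\int[mu]_x complex.Im (f x)).

Definition cLnorm {d} {T : measurableType d} {R : realType}
    (mu : {measure set T -> \bar R}) (p : \bar R) (f : T -> R[i]) : \bar R :=
  Lnorm mu p (fun x => (Normc.normc (f x))%:E).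

Definition in_cLp {d} {T : measurableType d} {R : realType}
    (mu : {measure set T -> \bar R}) (p : \bar R) (f : T -> R[i]) : Prop :=
  cmeasurable f /\ (cLnorm mu p f < +oo)%E.

Notation lebesgue2 R :=
  (@lebesgue_measure R \x @lebesgue_measure R)%E.

Definition fourier1 {R : realType} (f : R * R -> R[i]) (xi : R * R) : R[i] :=
  cintegral (lebesgue2 R) (fun x =>
    let u := x.1 * xi.1 + x.2 * xi.2 in f x * (cos u -i* sin u)).

(* g is a version of the Fourier transform of f \in L^p, 1 <= p <= 2, i.e. of
   the value at f of the continuous extension L^p -> L^p' of the integral
   transform fourier1 on L^1 `&` L^p.  For 1 <= p <= 2 any two such g agree
   almost everywhere, and for p = 1 they agree almost everywhere with
   fourier1 f. *)
Definition is_fourier {R : realType} (p : \bar R) (f g : R * R -> R[i]) : Prop :=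
  let p' := hoelder_conjugate p in
  in_cLp (lebesgue2 R) p' g /\
  exists F : nat -> R * R -> R[i],
    [/\ forall n, in_cLp (lebesgue2 R) 1 (F n) /\ in_cLp (lebesgue2 R) p (F n),
        cLnorm (lebesgue2 R) p (fun x => F n x - f x) @[n --> \oo] --> 0%E
      & cLnorm (lebesgue2 R) p' (fun xi => fourier1 (F n) xi - g xi)
          @[n --> \oo] --> 0%E].

Definition dilate {R : realType} (chi : R -> R[i]) (eps s : R) : R[i] :=
  (eps^-1)%:C * chi (s / eps).

(* To be applied with fhat the Fourier transform of f; the value does not
   depend on the version of fhat. *)
Definition maximal {R : realType} (chi : R -> R[i]) (phi : R -> R)
    (fhat : R * R -> R[i]) (x : R) : \bar R :=
  ereal_sup [set (Normc.normc (cintegral (lebesgue2 R) (fun st : R * R =>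
                fhat (x + st.1, phi x + st.2) *
                dilate chi e1 st.1 * dilate chi e2 st.2)))%:E
            | e1 in [set e : R | 0 < e < 1] & e2 in [set e : R | 0 < e < 1]].

(* The measure d mu = kappa^(1/3) dx on I, viewed as a measure on the line. *)
Definition is_affine_arclength {R : realType} (I : set R) (kappa : R -> R)
    (mu : set R -> \bar R) : Prop :=
  forall A : set R, measurable A ->
    mu A = (\int[@lebesgue_measure R]_(x in A `&` I) (kappa x `^ 3^-1)%:E)%E.

(* Main.v *)
From HB Require Import structures.
Require Import Defs.
From mathcomp Require Import all_boot all_order all_algebra.
From mathcomp Require Import complex.
From mathcomp Require Import all_classical all_reals all_analysis.
From mathcomp Require Import measurable_realfun ess_sup_inf.
From mathcomp Require Import ring lra.
Import Order.TTheory GRing.Theory Num.Theory.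
Import numFieldNormedType.Exports.
Local Open Scope classical_set_scope.
Local Open Scope ring_scope.

(* The maximal operator is linearised (finitely many dilations, a measurable
   choice of the dilation at each point) and dualised: testing against
   g = a^(q0-1) kappa^(1/3), q0 = p'/3, reduces the estimate to an L^p' bound
   for T(xi) = int G(X) e^(i Gamma(X).xi) dX, where Gamma(x,s,t) is the point
   of the curve over x displaced by (E1(x) s, E2(x) t).  With r' = p'/2 and
   h = |T|^(2(r'-1)) on a large box, int h |T|^2 is a quadratic form whose
   kernel is at most Phi h (gamma(x) - gamma(y)), where Phi h is a double
   strong maximal function of the Fourier transform of h.  The map Phi is
   bounded L^1 -> L^oo and L^2 -> L^2 (Plancherel and the L^2 strong maximal
   theorem), hence L^r -> L^r' by Marcinkiewicz.  Hoelder's inequality with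
   the weight |phi'(x) - phi'(y)| splits the form into
   int int (Phi h)^r' |phi'(x) - phi'(y)|, controlled by the change of
   variables (x,y) -> gamma(x) - gamma(y), whose Jacobian is that weight, and
   a fractional integral in the variable phi', controlled by the
   Hardy-Littlewood-Sobolev inequality. *)

(** The threshold p < 4/3 says r' = p'/2 > 2. It lets Phi be interpolated between its two endpoint
    bounds with a target exponent above 2, and it makes the singularity exponent 1/(r'-1) of the
    fractional integral smaller than 1. The power 1/3 of the curvature is the one for which the last
    two inequalities return the very quantity that was dualised. The argument closes twice by
    dividing an inequality by a power of its own left side, which must therefore be finite in
    advance. Hence the finitely many dilations, integrable [f], compact subintervals and the
    truncation to a box; no constant depends on them and limits remove them. All averages use the
    Poisson kernel: it dominates Schwartz functions, it is the cosine transform of a decaying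
    exponential, which yields Plancherel, and its quasi-triangle inequality gives the L^2 maximal
    theorem by a TT-star argument instead of a covering lemma. The maximal function enters the final
    norm only through a measurable majorant of one of its powers. *)

Set Implicit Arguments.
Unset Strict Implicit.
Unset Printing Implicit Defensive.

(** * Integrals of nonnegative functions and measures with a density *)

Section nonneg_integrals.
Context d (T : measurableType d) (R : realType).
Local Open Scope ereal_scope.
Import HBNNSimple.

(** The integral of a nonnegative function is a supremum over the simple functions below it, and
    such a supremum is monotone for arbitrary functions. This admits integrands whose measurability
    is unknown. *)
Lemma le_integral_nonmeas (mu : {measure set T -> \bar R}) (f g : T -> \bar R) :
  (forall x, 0 <= f x) -> (forall x, f x <= g x) ->
  \int[mu]_x f x <= \int[mu]_x g x.
Proof.
move=> f0 fg; have g0 x : 0 <= g x := le_trans (f0 x) (fg x).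
rewrite !ge0_integralE//= !patch_setT ge_ereal_sup// => _ [h /= hf] <-.
by apply: ereal_sup_ubound; exists h => // x; exact: le_trans (fg x).
Qed.

Variables (mu : {measure set T -> \bar R}) (w : T -> R).
Hypotheses (mw : measurable_fun setT w) (w0 : forall x, (0 <= w x)%R).

(** The two proofs are arguments so that the measure structure declared below can be inferred from
    the term alone. *)
Definition density of measurable_fun setT w & (forall x, 0 <= w x)%R :=
  fun A : set T => \int[mu]_(x in A) (w x)%:E.

Local Notation dens := (density mw w0).

Let density0 : dens set0 = 0.
Proof. exact: integral_set0. Qed.

Let density_ge0 A : 0 <= dens A.
Proof. by apply: integral_ge0 => x _; rewrite lee_fin. Qed.

Let density_sigma_additive : semi_sigma_additive dens.
Proof.
move=> F mF tF mUF; rewrite /density ge0_integral_bigcup//.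
- apply: is_cvg_ereal_nneg_natsum => n _.
  by apply: integral_ge0 => x _; rewrite lee_fin.
- by apply/measurable_EFinP; exact: measurable_funS mw.
- by move=> x _; rewrite lee_fin.
Qed.

HB.instance Definition _ := isMeasure.Build _ _ _ dens
  density0 density_ge0 density_sigma_additive.

(** Both sides pass to the limit along simple approximations of [f]; for a simple function the claim
    is the definition of [density] on its level sets. *)
Lemma integral_density (f : T -> \bar R) :
  measurable_fun setT f -> (forall x, 0 <= f x) ->
  \int[dens]_x f x = \int[mu]_x (f x * (w x)%:E).
Proof.
move=> mf f0; pose g := nnsfun_approx measurableT mf.
have g0 n x : 0 <= (g n x)%:E by rewrite lee_fin.
have mg n : measurable_fun setT (EFin \o g n) by exact/measurable_EFinP.
have nd x m n : (m <= n)%N -> (g m x <= g n x)%R.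
  by move=> mn; exact/lefP/nd_nnsfun_approx.
have cg x : EFin \o g ^~ x @ \oo --> f x by exact: cvg_nnsfun_approx.
transitivity (\int[dens]_x (limn (EFin \o g ^~ x))).
  by apply: eq_integral => x _; apply/esym/cvg_lim => //; exact: cg.
rewrite [LHS]monotone_convergence//; last first.
  by move=> x _ m n mn; rewrite lee_fin; exact: nd.
transitivity (\int[mu]_x (limn (fun n => (g n x)%:E * (w x)%:E))); last first.
  by apply: eq_integral => x _; apply/cvg_lim => //; apply: cvgeZr => //; exact: cg.
rewrite [RHS]monotone_convergence//; first last.
- move=> x _ m n mn; apply: lee_wpmul2r; first by rewrite lee_fin.
  by rewrite lee_fin; exact: nd.
- by move=> n x _; rewrite mule_ge0// lee_fin.
- by move=> n; apply: emeasurable_funM => //; exact/measurable_EFinP.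
congr (limn _); apply/funext => n.
rewrite integralT_nnsfun sintegralE.
transitivity (\int[mu]_x
    (\sum_(y \in range (g n)) (y%:E * (w x * \1_(g n @^-1` [set y]) x)%:E))).
  rewrite ge0_integral_fsum//; last 2 first.
  - move=> y; apply/measurable_EFinP; apply: measurable_funM => //.
    by apply: measurable_funM => //; exact: measurable_indic.
  - move=> y x _; rewrite -EFinM lee_fin indicE.
    have [|_] := boolP (x \in _); last by rewrite !mulr0.
    by rewrite inE mulr1 /= => <-; rewrite mulr_ge0.
  apply: eq_fsbigr => y yg; rewrite ge0_integralZl//.
  - congr (_ * _); transitivity (\int[mu]_(x in g n @^-1` [set y]) (w x)%:E) => //; rewrite integral_mkcond; apply: eq_integral => x _.
    rewrite patchE indicE; case: ifPn => _; first by rewrite mulr1.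
    by rewrite mulr0.
  - by apply/measurable_EFinP; apply: measurable_funM => //; exact: measurable_indic.
  - by move=> x _; rewrite lee_fin mulr_ge0.
  - by move: yg; rewrite inE => -[x _ <-]; rewrite lee_fin.
apply: eq_integral => x _; rewrite [in RHS]fimfunE -fsumEFin//.
rewrite ge0_mule_fsuml; last first.
  move=> y; rewrite lee_fin indicE; have [|_] := boolP (x \in _).
    by rewrite inE mulr1 /= => <-.
  by rewrite mulr0.
by apply: eq_fsbigr => y _; rewrite -!EFinM [(w x * _)%R]mulrC mulrA.
Qed.

End nonneg_integrals.

(** * Lebesgue measure: comparison with other measures, affine substitutions *)

Section lebesgue_comparison.
Context {R : realType}.
Local Open Scope ereal_scope.
Notation leb := (@lebesgue_measure R).

(** Lebesgue measure is an infimum over countable covers by half-open intervals, so subadditivity of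
    [nu] along each cover reduces the comparison to intervals. *)
Lemma le_lebesgue_measure (nu : {measure set (measurableTypeR R) -> \bar R}) :
  (forall a b : R, (a < b)%R -> nu `]a, b]%classic <= (b - a)%:E) ->
  forall A, measurable A -> nu A <= leb A.
Proof.
move=> nuab A mA.
rewrite /lebesgue_measure /lebesgue_stieltjes_measure /measure_extension.
apply: le_ereal_inf_tmp => _ [F [mF AF] <-].
have F_ocitv k : exists ab : R * R, F k = `]ab.1, ab.2]%classic.
  by have [ab _ <-] := mF k; exists ab.
have mF' k : measurable (F k : set (measurableTypeR R)).
  by have [ab ->] := F_ocitv k; exact: measurable_itv.
apply: (@le_trans _ _ (\sum_(k <oo) nu (F k))).
  exact: measure_sigma_subadditive.
apply: lee_nneseries => // k _.
have [[a b] ->] := F_ocitv k.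
rewrite /=; have [ab|ba] := ltP a b; first by rewrite wlength_itv_bnd ?nuab// ltW.
by rewrite set_itv_ge ?bnd_simp -?leNgt// measure0 wlength0.
Qed.

Lemma measurable_affine (c b : R) : measurable_fun setT (fun x : R => c * x + b)%R.
Proof. by apply: measurable_funD => //; exact: measurable_funM. Qed.

Lemma lebesgue_measure_affine (c b : R) (A : set R) : (0 < c)%R -> measurable A ->
  leb A = c%:E * leb ((fun x => c * x + b)%R @^-1` A).
Proof.
move=> c0 mA.
pose h (x : measurableTypeR R) : measurableTypeR R := (c * x + b)%R.
have mh : measurable_fun setT h by exact: measurable_affine.
pose nu : {measure set (measurableTypeR R) -> \bar R} :=
  mscale (NngNum (ltW c0)) (pushforward leb h).
rewrite -[RHS]/(nu mh A); apply: lebesgue_measure_unique => //= _ [[u v]] _ <-.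
transitivity (c%:E * leb `]((u - b) / c)%R, ((v - b) / c)%R]%classic); last first.
  congr (_ * leb _); apply/seteqP; split => x /=; rewrite !in_itv/= /h.
    by rewrite ltr_pdivrMr// ler_pdivlMr// mulrC ltrBlDr lerBrDr.
  by rewrite ltr_pdivrMr// ler_pdivlMr// mulrC ltrBlDr lerBrDr.
rewrite !lebesgue_measure_itv/= !lte_fin ltr_pM2r ?invr_gt0// ltrD2r.
by case: ifPn => _; rewrite ?mule0// -!EFinB -EFinM -mulrBl mulrCA divff ?gt_eqF// mulr1; congr EFin; ring.
Qed.

Lemma ge0_integral_oppr (f : R -> \bar R) :
  measurable_fun setT f -> (forall x, 0 <= f x) ->
  \int[leb]_x f (- x)%R = \int[leb]_x f x.
Proof.
move=> mf f0.
pose h (x : measurableTypeR R) : measurableTypeR R := (- x)%R.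
have mh : measurable_fun setT h by exact: measurable_funN.
pose nu : {measure set (measurableTypeR R) -> \bar R} := pushforward leb h.
transitivity (\int[nu mh]_x f x); first by rewrite ge0_integral_pushforward.
apply: (@eq_measure_integral _ _ _ setT leb) => A mA _.
exact: lebesgue_measureN.
Qed.

Lemma ge0_integral_affine (c b : R) (f : R -> \bar R) :
  c != 0%R -> measurable_fun setT f -> (forall x, 0 <= f x) ->
  \int[leb]_x f (c * x + b)%R = `|c|^-1%:E * \int[leb]_x f x.
Proof.
wlog c0 : c / (0 < c)%R => [pos|] c_neq0 mf f0.
  have [c0|c0|c0] := ltgtP 0%R c; first exact: pos.
  - rewrite -(@ge0_integral_oppr (fun x => f (c * x + b)%R))//; last first.
      by apply: measurableT_comp => //; exact: measurable_affine.
    rewrite -normrN -pos ?oppr_gt0 ?oppr_eq0//.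
    by apply: eq_integral => x _; rewrite mulrN mulNr.
  - by rewrite -c0 eqxx in c_neq0.
pose h (x : measurableTypeR R) : measurableTypeR R := (c * x + b)%R.
have mh : measurable_fun setT h by exact: measurable_affine.
pose nu : {measure set (measurableTypeR R) -> \bar R} :=
  mscale (NngNum (ltW c0)) (pushforward leb h).
transitivity (`|c|^-1%:E * \int[nu mh]_x f x).
  rewrite ge0_integral_mscale// ge0_integral_pushforward//= gtr0_norm//.
  by rewrite muleA -EFinM mulVf ?gt_eqF// mul1e.
congr (_ * _); apply: (@eq_measure_integral _ _ _ setT leb) => A mA _.
by rewrite [RHS](lebesgue_measure_affine b c0).
Qed.

Lemma ge0_integral_shift (b : R) (f : R -> \bar R) :
  measurable_fun setT f -> (forall x, 0 <= f x) ->
  \int[leb]_x f (x + b)%R = \int[leb]_x f x.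
Proof.
move=> mf f0; have := @ge0_integral_affine 1 b f (oner_neq0 _) mf f0.
by rewrite normr1 invr1 mul1e => <-; apply: eq_integral => x _; rewrite mul1r.
Qed.

End lebesgue_comparison.

(** * A change of variables inequality for nondecreasing C^1 maps *)

Section change_of_variables.
Context {R : realType}.
Notation leb := (@lebesgue_measure R).
Variables (a b : R) (psi dpsi : R -> R).
Hypothesis psi_derive : forall x, a <= x <= b -> is_derive x 1 psi (dpsi x).
Hypothesis dpsi_cont : {within `[a, b], continuous dpsi}.
Hypothesis dpsi_ge0 : forall x, a <= x <= b -> 0 <= dpsi x.

Let psi_cvg x : a <= x <= b -> {for x, continuous psi}.
Proof.
move=> axb; apply/differentiable_continuous/derivable1_diffP.
by have [] := psi_derive axb.
Qed.

Lemma integral_derive_itv (u v : R) : a <= u -> u <= v -> v <= b ->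
  (\int[leb]_(x in `[u, v]) (dpsi x)%:E = (psi v - psi u)%:E)%E.
Proof.
move=> au uv vb; have [uv'|vu] := ltP u v; last first.
  have -> : v = u by apply/eqP; rewrite eq_le vu uv.
  by rewrite set_itv1 integral_set1 subrr.
rewrite (@continuous_FTC2 _ _ psi)// ?EFinB//.
- by apply: continuous_subspaceW dpsi_cont; apply: subset_itvScc; rewrite bnd_simp.
- split.
  + move=> x; rewrite in_itv/= => /andP[ux xv].
    have axb : a <= x <= b.
      by rewrite (le_trans au (ltW ux)) (le_trans (ltW xv) vb).
    by have [] := psi_derive axb.
  + by apply: cvg_at_right_filter; apply: psi_cvg; rewrite au (le_trans uv vb).
  + by apply: cvg_at_left_filter; apply: psi_cvg; rewrite vb (le_trans au uv).
- move=> x; rewrite in_itv/= => /andP[ux xv].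
  have axb : a <= x <= b by rewrite (le_trans au (ltW ux)) (le_trans (ltW xv) vb).
  by rewrite derive1E; have [_ ->] := psi_derive axb.
Qed.

Let w x := if a <= x <= b then dpsi x else 0.

Let w0 x : 0 <= w x.
Proof. by rewrite /w; case: ifPn => // /dpsi_ge0. Qed.

Let wE : w = dpsi \_ `[a, b].
Proof.
by apply/funext => x; rewrite patchE /w mem_setE in_itv.
Qed.

Let mw : measurable_fun setT w.
Proof.
have mab : measurable (`[a, b]%classic : set R) by exact: measurable_itv.
rewrite wE; apply/(measurable_restrictT _ mab).
by apply: subspace_continuous_measurable_fun => //; exact: measurable_itv.
Qed.

(** Extension by 0 may add points outside [[a, b]] to a preimage, but the density [w] vanishes
    there. *)
Let psi' : measurableTypeR R -> measurableTypeR R := psi \_ `[a, b].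

Let mpsi' : measurable_fun setT psi'.
Proof.
have mab : measurable (`[a, b]%classic : set R) by exact: measurable_itv.
suff : measurable_fun `[a, b] psi by move/(measurable_restrictT _ mab).
apply: subspace_continuous_measurable_fun => //.
apply: derivable_within_continuous => x; rewrite in_itv/= => axb.
by have [] := psi_derive axb.
Qed.

(** The points of [[a, b]] sent into []c, d]] lie between their infimum [u] and supremum [v], and
    continuity gives c <= psi u and psi v <= d. The density has mass psi v - psi u on [[u, v]], so
    intervals where [psi] is constant cost nothing. *)
Let density_preimage_itv (c d : R) : c < d ->
  (density leb mw w0 (psi' @^-1` `]c, d]) <= (d - c)%:E :> \bar R)%E.
Proof.
move=> cd; pose E := [set x | a <= x <= b /\ c < psi x <= d].
have mE : measurable (psi' @^-1` `]c, d] : set (measurableTypeR R)).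
  by rewrite -[X in measurable X]setTI; exact: mpsi'.
have [E0|/set0P[e Ee]] := eqVneq E set0.
  rewrite /density (_ : (\int[_]_(x in _) _ = 0)%E) ?lee_fin ?subr_ge0 ?ltW//.
  apply: integral0_eq => x /=; rewrite in_itv/= /psi' patchE mem_setE in_itv/=.
  rewrite /w; case: ifPn => // axb cxd.
  by move: E0; rewrite -subset0 => /(_ x) []; split.
have ubE : ubound E b by move=> x [/andP[]].
have lbE : lbound E a by move=> x [/andP[]].
have supE : has_sup E by split; [exists e|exists b].
have infE : has_inf E by split; [exists e|exists a].
set u := inf E; set v := sup E.
have au : a <= u by apply: lb_le_inf => //; exists e.
have vb : v <= b by apply: ge_sup => //; exists e.
have ue : u <= e by apply: ge_inf => //; exists a.
have ev : e <= v by apply: ub_le_sup => //; exists b.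
have psiv : psi v <= d.
  rewrite leNgt; apply/negP => dv.
  have := psi_cvg (x := v).
  rewrite (le_trans au (le_trans ue ev)) vb => /(_ isT).
  move=> /cvgr_gt /(_ _ dv) [eps/= eps0 He].
  have [x Ex vx] := sup_adherent eps0 supE.
  have [_ /andP[_ xd]] := Ex.
  have xv : x <= v by apply: ub_le_sup => //; exists b.
  suff : d < psi x by rewrite ltNge xd.
  by apply: He; rewrite /= ger0_norm ?subr_ge0// ltrBlDr -ltrBlDl.
have psiu : c <= psi u.
  rewrite leNgt; apply/negP => uc.
  have := psi_cvg (x := u).
  rewrite au (le_trans ue (le_trans ev vb)) => /(_ isT).
  move=> /cvgr_lt /(_ _ uc) [eps/= eps0 He].
  have [x Ex xu] := inf_adherent eps0 infE.
  have ux : u <= x by apply: ge_inf => //; exists a.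
  have [_ /andP[cx _]] := Ex.
  suff : psi x < c by rewrite ltNge (ltW cx).
  by apply: He; rewrite /= distrC ger0_norm ?subr_ge0// ltrBlDl.
apply: (@le_trans _ _ (psi v - psi u)%:E); last by rewrite lee_fin lerB.
rewrite -integral_derive_itv ?(le_trans ue ev)//.
rewrite /density integral_mkcond [leRHS]integral_mkcond.
apply: le_integral_nonmeas => x.
  by rewrite patchE; case: ifPn => // _; rewrite lee_fin.
rewrite !patchE !mem_setE !in_itv/=.
have [xE|xE] := ifP; last first.
  case: ifPn => // /andP[ux xv]; rewrite lee_fin dpsi_ge0//.
  by rewrite (le_trans au ux) (le_trans xv vb).
have {xE} : c < psi' x <= d := xE.
rewrite /psi' patchE mem_setE in_itv/= /w.
case: ifPn => [axb cxd|axb _]; last first.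
  case: ifPn => // /andP[ux xv]; rewrite lee_fin dpsi_ge0//.
  by rewrite (le_trans au ux) (le_trans xv vb).
have -> // : u <= x <= v.
by apply/andP; split; [apply: ge_inf; [exists a|]|apply: ub_le_sup; [exists b|]].
Qed.

(** The image of the density [dpsi] under [psi] is dominated by Lebesgue measure, by the bound on
    half-open intervals just obtained. Being one-sided, the inequality tolerates a derivative that
    vanishes, as [kappa] may. *)
Lemma le_integral_change (H : R -> \bar R) :
  measurable_fun setT H -> (forall x, 0 <= H x)%E ->
  (\int[leb]_(x in `[a, b]) (H (psi x) * (dpsi x)%:E) <= \int[leb]_x H x)%E.
Proof.
move=> mH H0.
pose nu0 : {measure set (measurableTypeR R) -> \bar R} := density leb mw w0.
pose nu : {measure set (measurableTypeR R) -> \bar R} := pushforward nu0 psi'.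
have -> : (\int[leb]_(x in `[a, b]) (H (psi x) * (dpsi x)%:E) =
    \int[nu mpsi']_x H x)%E.
  rewrite ge0_integral_pushforward//= integral_density//; last first.
    exact: (measurableT_comp mH mpsi').
  rewrite [LHS]integral_mkcond. apply: eq_integral => x _.
  rewrite patchE /w /psi' patchE mem_setE in_itv/=.
  by case: ifP => //; rewrite mule0.
apply: ge0_le_measure_integral => //.
exact: le_lebesgue_measure.
Qed.

End change_of_variables.

(** * Young's inequality and absorption in the extended reals *)

Section ereal_absorption.
Context {R : realType}.
Local Open Scope ereal_scope.
Implicit Types x y : \bar R.

Lemma lee_amgm (t : R) x y : (0 < t)%R -> 0 <= x -> 0 <= y ->
  x * y <= t%:E * (x * x) + (4 * t)^-1%:E * (y * y).
Proof.
move=> t0; have t40 : (0 < (4 * t)^-1)%R by rewrite invr_gt0 mulr_gt0.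
have poo z : (0 < z)%R -> z%:E * (+oo * +oo) = +oo :> \bar R.
  by move=> z0; rewrite mulyy gt0_muley ?lte_fin.
move: x y => [x| |] [y| |]//; rewrite ?lee_fin; last 3 first.
- by move=> _ _; rewrite [X in _ <= _ + X]poo// -!EFinM addey ?leey.
- by move=> _ _; rewrite [X in _ <= X + _]poo// -!EFinM addye ?leey.
- by move=> _ _; rewrite [X in _ <= _ + X]poo// [X in _ <= X + _]poo.
- move=> x0 y0; rewrite -subr_ge0.
  have -> : (t * (x * x) + (4 * t)^-1 * (y * y) - x * y =
      (4 * t)^-1 * (2 * t * x - y) ^+ 2)%R by field; rewrite gt_eqF.
  by rewrite mulr_ge0 ?sqr_ge0// ltW.
Qed.

(** Half of [x] is moved to the left, which is legitimate only for finite [x]; each use is therefore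
    preceded by an a priori bound. *)
Lemma lee_absorb_half x y : 0 <= x -> x < +oo -> x <= 2^-1%:E * x + y -> x <= 2%:E * y.
Proof.
move: x y => [x| |] [y| |]//; rewrite ?lee_fin.
- by move=> x0 _ xy; lra.
- by move=> _ _ _; rewrite gt0_muley ?lte_fin// leey.
Qed.

End ereal_absorption.

(** * L^2 bounds for positive kernels by the TT-star method *)

Section TTstar.
Context d (T : measurableType d) (R : realType).
Local Open Scope ereal_scope.
Variable m : {sigma_finite_measure set T -> \bar R}.
Variables (K : T * T -> R) (c : R).
Hypotheses (mK : measurable_fun setT K) (K0 : forall z, (0 <= K z)%R).
Hypothesis c0 : (0 < c)%R.
Hypothesis KK : forall z w, \int[m]_u (K (z, u) * K (w, u))%:E <=
  (c * (K (z, w) + K (w, z)))%:E.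

Let mK' : measurable_fun setT (fun z => (K z)%:E).
Proof. exact/measurable_EFinP. Qed.

Let mK1 z : measurable_fun setT (fun u => (K (z, u))%:E).
Proof. by apply/measurable_EFinP; exact: measurableT_comp. Qed.

Let mK2 u : measurable_fun setT (fun z => (K (z, u))%:E).
Proof. by apply/measurable_EFinP; exact: measurableT_comp. Qed.

Let K0' z : 0 <= (K z)%:E. Proof. by rewrite lee_fin. Qed.

Lemma measurable_kernel_adjoint (G : T -> \bar R) : measurable_fun setT G ->
  (forall z, 0 <= G z) -> measurable_fun setT (fun u => \int[m]_z (G z * (K (z, u))%:E)).
Proof.
move=> mG G0.
apply: (measurable_fun_fubini_tonelli_G (fun z => G z.1 * (K z)%:E)).
  by apply: emeasurable_funM => //; exact: measurableT_comp.
by move=> z; rewrite mule_ge0.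
Qed.

(** Write A for the adjoint of K applied to G. By [KK], the square norm of A is at most c times the
    form of K plus its transpose at G, that is 2c <G, A>. Young's inequality with parameter [c]
    leaves half of the square norm of A, which is absorbed. *)
Lemma TTstar_adjoint (G : T -> \bar R) (A := fun u => \int[m]_z (G z * (K (z, u))%:E)) :
  measurable_fun setT G -> (forall z, 0 <= G z) ->
  \int[m]_u (A u * A u) < +oo ->
  \int[m]_u (A u * A u) <= (4 * c ^+ 2)%:E * \int[m]_z (G z * G z).
Proof.
move=> mG G0 Afin.
have mA : measurable_fun setT A by exact: measurable_kernel_adjoint.
have A0 u : 0 <= A u by apply: integral_ge0 => z _; rewrite mule_ge0.
have mGA : measurable_fun setT (fun z => G z * A z) by exact: emeasurable_funM.
have inner z : \int[m]_u ((K (z, u))%:E * A u) <=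
    c%:E * (\int[m]_w (G w * (K (z, w))%:E) + A z).
  have -> : \int[m]_u ((K (z, u))%:E * A u) =
      \int[m]_u \int[m]_w (G w * ((K (z, u))%:E * (K (w, u))%:E)).
    apply: eq_integral => u _; rewrite -ge0_integralZl//.
    - by apply: eq_integral => w _; rewrite muleCA.
    - exact: emeasurable_funM.
    - by move=> w _; rewrite mule_ge0.
  rewrite (fubini_tonelli (fun uw => G uw.2 * ((K (z, uw.1))%:E * (K (uw.2, uw.1))%:E))); first last.
  - by move=> uw; rewrite !mule_ge0.
  - apply: emeasurable_funM; first exact: measurableT_comp.
    apply: emeasurable_funM; apply/measurable_EFinP; apply: measurableT_comp => //.
      exact: measurable_fun_pair.
    exact: measurable_fun_pair.
  rewrite /A -ge0_integralD//; last 4 first.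
  - by move=> w _; rewrite mule_ge0.
  - exact: emeasurable_funM.
  - by move=> w _; rewrite mule_ge0.
  - exact: emeasurable_funM.
  rewrite -ge0_integralZl ?lee_fin ?(ltW c0)//; last 2 first.
  - by apply: emeasurable_funD; exact: emeasurable_funM.
  - by move=> w _; rewrite adde_ge0// mule_ge0.
  apply: le_integral_nonmeas => w.
    by apply: integral_ge0 => u _; rewrite !mule_ge0.
  rewrite /= ge0_integralZl//; last 2 first.
  - exact: emeasurable_funM.
  - by move=> u _; rewrite mule_ge0.
  rewrite -ge0_muleDr// -EFinD muleCA -EFinM.
  apply: lee_wpmul2l => //.
  under eq_integral do rewrite -EFinM.
  exact: KK.
have swap (H : T -> \bar R) (L : T * T -> R) : measurable_fun setT H ->
    (forall z, 0 <= H z) -> measurable_fun setT L -> (forall z, 0 <= L z)%R ->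
    \int[m]_u (H u * \int[m]_z (G z * (L (z, u))%:E)) =
    \int[m]_z (G z * \int[m]_u ((L (z, u))%:E * H u)).
  move=> mH H0 mL L0; have L0' z : 0 <= (L z)%:E by rewrite lee_fin.
  have mL' : measurable_fun setT (fun z => (L z)%:E) by exact/measurable_EFinP.
  have mL1 z : measurable_fun setT (fun u => (L (z, u))%:E).
    by apply/measurable_EFinP; exact: measurableT_comp.
  have mL2 u : measurable_fun setT (fun z => (L (z, u))%:E).
    by apply/measurable_EFinP; exact: measurableT_comp.
  transitivity (\int[m]_u \int[m]_z (H u * (G z * (L (z, u))%:E))).
    apply: eq_integral => u _; rewrite ge0_integralZl//.
    - exact: emeasurable_funM.
    - by move=> z _; rewrite mule_ge0.
  rewrite (fubini_tonelli (fun uz => H uz.1 * (G uz.2 * (L (uz.2, uz.1))%:E))); first last.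
  - by move=> uz; rewrite !mule_ge0.
  - apply: emeasurable_funM; first exact: measurableT_comp.
    apply: emeasurable_funM; first exact: measurableT_comp.
    apply/measurable_EFinP; apply: measurableT_comp => //.
    exact: measurable_fun_pair.
  apply: eq_integral => z _; rewrite -ge0_integralZl//.
  - by apply: eq_integral => u _; rewrite muleCA [H u * _]muleC.
  - exact: emeasurable_funM.
  - by move=> u _; rewrite mule_ge0.
have AA : \int[m]_u (A u * A u) <= (2 * c)%:E * \int[m]_z (G z * A z).
  rewrite (swap A K)//.
  apply: (@le_trans _ _ (\int[m]_z (G z * (c%:E * (\int[m]_w (G w * (K (z, w))%:E) + A z))))).
    apply: le_integral_nonmeas => z.
      by rewrite mule_ge0// integral_ge0// => u _; rewrite mule_ge0.
    exact: lee_wpmul2l.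
  have mKG : measurable_fun setT (fun z => \int[m]_w (G w * (K (z, w))%:E)).
    apply: (measurable_fun_fubini_tonelli_F (fun z => G z.2 * (K z)%:E)).
      by apply: emeasurable_funM => //; exact: measurableT_comp.
    by move=> z; rewrite mule_ge0.
  have KG0 z : 0 <= \int[m]_w (G w * (K (z, w))%:E).
    by apply: integral_ge0 => w _; rewrite mule_ge0.
  rewrite (_ : \int[m]_z _ = c%:E * (\int[m]_z (G z * \int[m]_w (G w * (K (z, w))%:E)) + \int[m]_z (G z * A z))).
    rewrite (swap G (fun z => K (z.2, z.1)))//; last first.
      by apply: measurableT_comp => //; exact: measurable_fun_pair.
    have -> : \int[m]_z (G z * \int[m]_u ((K (u, z))%:E * G u)) = \int[m]_z (G z * A z).
      apply: eq_integral => z _; congr (_ * _).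
      by apply: eq_integral => u _; rewrite muleC.
    by rewrite -mule2n -mule_natl muleA -EFinM mulrC.
  rewrite -ge0_integralD//; last 3 first.
  - by move=> z _; rewrite mule_ge0.
  - exact: emeasurable_funM.
  - by move=> z _; rewrite mule_ge0.
  rewrite -ge0_integralZl ?lee_fin ?(ltW c0)//; last 2 first.
  - by apply: emeasurable_funD => //; exact: emeasurable_funM.
  - by move=> z _; rewrite adde_ge0// mule_ge0.
  by apply: eq_integral => z _; rewrite muleCA ge0_muleDr.
clearbody A.
have := lee_absorb_half (x := \int[m]_u (A u * A u)) (y := (2 * c ^+ 2)%:E * \int[m]_z (G z * G z)).
rewrite muleA -EFinM; have -> : (2 * (2 * c ^+ 2) = 4 * c ^+ 2)%R by ring.
apply => //; first by apply: integral_ge0 => u _; rewrite mule_ge0.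
rewrite (le_trans AA)//.
rewrite -ge0_integralZl//; last 2 first.
- by move=> z _; rewrite mule_ge0.
- by rewrite lee_fin mulr_ge0 ?ltW.
rewrite -[X in _ <= X + _]ge0_integralZl//; last 2 first.
- exact: emeasurable_funM.
- by move=> z _; rewrite mule_ge0.
rewrite -[X in _ <= _ + X]ge0_integralZl//; last 3 first.
- exact: emeasurable_funM.
- by move=> z _; rewrite mule_ge0.
- by rewrite lee_fin mulr_ge0// sqr_ge0.
rewrite -ge0_integralD//; last 4 first.
- by move=> z _; rewrite !mule_ge0.
- by apply: emeasurable_funM => //; exact: emeasurable_funM.
- by move=> z _; rewrite !mule_ge0// lee_fin mulr_ge0// sqr_ge0.
- by apply: emeasurable_funM => //; exact: emeasurable_funM.
apply: le_integral_nonmeas => z.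
  by rewrite !mule_ge0// lee_fin mulr_ge0// ltW.
apply: (@le_trans _ _ ((2 * c)%:E *
    (c%:E * (G z * G z) + (4 * c)^-1%:E * (A z * A z)))).
  by apply: lee_wpmul2l; [rewrite lee_fin mulr_ge0 ?ltW|exact: lee_amgm].
rewrite ge0_muleDr ?mule_ge0 ?lee_fin ?invr_ge0 ?mulr_ge0 ?(ltW c0)//.
rewrite addeC [X in X + _]muleA [X in _ + X]muleA -!EFinM.
have -> : (2 * c * (4 * c)^-1 = 2^-1)%R by field; rewrite gt_eqF.
by have -> : (2 * c * c = 2 * c ^+ 2)%R by ring.
Qed.

(** The square norm of G = Kf is the pairing of f with A, and [TTstar_adjoint] bounds A by G.
    Young's inequality with parameter 2c^2 then leaves exactly half of the square norm of G on the
    right. *)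
Lemma TTstar_bound (f : T -> \bar R) (G := fun z => \int[m]_u ((K (z, u))%:E * f u))
    (A := fun u => \int[m]_z (G z * (K (z, u))%:E)) :
  measurable_fun setT f -> (forall u, 0 <= f u) ->
  \int[m]_z (G z * G z) < +oo -> \int[m]_u (A u * A u) < +oo ->
  \int[m]_z (G z * G z) <= (4 * c ^+ 2)%:E * \int[m]_u (f u * f u).
Proof.
move=> mf f0 Gfin Afin.
have mKf : measurable_fun setT (fun z => (K z)%:E * f z.2).
  by apply: emeasurable_funM => //; exact: measurableT_comp.
have Kf0 z : 0 <= (K z)%:E * f z.2 by rewrite mule_ge0.
have mG : measurable_fun setT G.
  exact: (measurable_fun_fubini_tonelli_F (fun z => (K z)%:E * f z.2)).
have G0 z : 0 <= G z by apply: integral_ge0 => u _; rewrite mule_ge0.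
have mA : measurable_fun setT A by exact: measurable_kernel_adjoint.
have A0 u : 0 <= A u by apply: integral_ge0 => z _; rewrite mule_ge0.
have GfA : \int[m]_z (G z * G z) = \int[m]_u (f u * A u).
  transitivity (\int[m]_z \int[m]_u (G z * ((K (z, u))%:E * f u))).
    by apply: eq_integral => z _; rewrite ge0_integralZl//; exact: emeasurable_funM.
  rewrite (fubini_tonelli (fun z => G z.1 * ((K (z.1, z.2))%:E * f z.2))); first last.
  - by move=> z; rewrite !mule_ge0.
  - apply: emeasurable_funM; first exact: measurableT_comp.
    apply: emeasurable_funM; last exact: measurableT_comp.
    by apply/measurable_EFinP; apply: measurableT_comp => //; exact: measurable_fun_pair.
  apply: eq_integral => u _; rewrite -ge0_integralZl//.
  - by apply: eq_integral => z _; rewrite [RHS]muleC muleA.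
  - exact: emeasurable_funM.
  - by move=> z _; rewrite mule_ge0.
have AG : \int[m]_u (A u * A u) <= (4 * c ^+ 2)%:E * \int[m]_z (G z * G z).
  exact: TTstar_adjoint.
have c2 : (0 < 2 * c ^+ 2)%R by rewrite mulr_gt0// exprn_gt0.
have k0 : (0 <= (4 * (2 * c ^+ 2))^-1)%R by rewrite invr_ge0 mulr_ge0// ltW.
have ff0 : 0 <= \int[m]_u (f u * f u) by apply: integral_ge0 => u _; rewrite mule_ge0.
have AA0 : 0 <= \int[m]_u (A u * A u) by apply: integral_ge0 => u _; rewrite mule_ge0.
have -> : (4 * c ^+ 2)%:E * \int[m]_u (f u * f u) =
    2%:E * ((2 * c ^+ 2)%:E * \int[m]_u (f u * f u)).
  by rewrite muleA -EFinM; congr (_%:E * _); ring.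
clearbody A G.
apply: (lee_absorb_half _ Gfin); first by apply: integral_ge0 => z _; rewrite mule_ge0.
rewrite GfA; apply: (@le_trans _ _ ((2 * c ^+ 2)%:E * \int[m]_u (f u * f u) +
    (4 * (2 * c ^+ 2))^-1%:E * \int[m]_u (A u * A u))).
  have mff : measurable_fun setT (fun u => f u * f u) by exact: emeasurable_funM.
  have mAA : measurable_fun setT (fun u => A u * A u) by exact: emeasurable_funM.
  rewrite -ge0_integralZl ?lee_fin ?(ltW c2)//; last by move=> u _; rewrite mule_ge0.
  rewrite -[X in _ <= _ + X]ge0_integralZl ?lee_fin//; last first.
    by move=> u _; rewrite mule_ge0.
  rewrite -ge0_integralD//; first last.
  - exact: emeasurable_funM.
  - by move=> u _; rewrite !mule_ge0 ?lee_fin.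
  - exact: emeasurable_funM.
  - by move=> u _; rewrite !mule_ge0 ?lee_fin ?(ltW c2).
  apply: le_integral_nonmeas => u; first by rewrite mule_ge0.
  exact: lee_amgm.
rewrite addeC leeD// -GfA.
apply: (@le_trans _ _ ((4 * (2 * c ^+ 2))^-1%:E * ((4 * c ^+ 2)%:E * \int[m]_z (G z * G z)))).
  by apply: lee_wpmul2l; rewrite ?lee_fin.
rewrite muleA -EFinM.
by have -> : ((4 * (2 * c ^+ 2))^-1 * (4 * c ^+ 2) = 2^-1)%R by field; rewrite gt_eqF.
Qed.

End TTstar.

(** * Measurable selection of a maximiser and finite maxima *)

Section argmax.
Context d (T : measurableType d) (R : realType) (U : eqType).
Variable v : U -> T -> \bar R.
Hypothesis mv : forall u, measurable_fun setT (v u).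

(** The index type carries no sigma-algebra, so measurability of the selection is expressed by the
    last clause: a family that is measurable for each index stays measurable along [E]. *)
Lemma measurable_argmax (u0 : U) (l : seq U) : exists E : T -> U,
  [/\ forall x, E x \in u0 :: l,
      forall x u, u \in u0 :: l -> (v u x <= v (E x) x)%E &
      forall d' (W : measurableType d') (w : U -> T -> W),
        (forall u, measurable_fun setT (w u)) ->
        measurable_fun setT (fun x => w (E x) x)].
Proof.
elim: l u0 => [|u1 l IH] u0.
  exists (fun=> u0); split=> [x|x u|d' W w mw]; first by rewrite inE.
    by rewrite inE => /eqP ->.
  exact: mw.
have [E [Emem Emax mE]] := IH u1.
exists (fun x => if (v (E x) x <= v u0 x)%E then u0 else E x); split.
- by move=> x; case: ifP => _; rewrite inE ?eqxx// Emem orbT.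
- move=> x u; rewrite inE => /predU1P[->|ul].
    by case: ifPn => //; rewrite -ltNge => /ltW.
  by case: ifPn => // h; [exact: le_trans (Emax x u ul) h|exact: Emax].
- move=> d' W w mw.
  rewrite (_ : (fun x => _) = (fun x => if (v (E x) x <= v u0 x)%E then w u0 x else w (E x) x)).
    apply: measurable_fun_ifT; [|exact: mw|exact: mE].
    by apply: measurable_fun_lee => //; exact: mE.
  by apply/funext => x; case: ifP.
Qed.

Definition maxfun (l : seq U) (x : T) : \bar R := \big[maxe/0%E]_(u <- l) v u x.

Lemma maxfun_ge0 l x : (0 <= maxfun l x)%E.
Proof. by rewrite /maxfun; elim: l => [|u l IH]; rewrite ?big_nil// big_cons le_max IH orbT. Qed.

Lemma maxfun_ge l u x : u \in l -> (v u x <= maxfun l x)%E.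
Proof.
rewrite /maxfun; elim: l => // u1 l IH; rewrite inE big_cons le_max.
by case/predU1P => [->|/IH ->]; rewrite ?lexx// orbT.
Qed.

Lemma maxfun_le l x (y : \bar R) : (0 <= y)%E ->
  (forall u, u \in l -> (v u x <= y)%E) -> (maxfun l x <= y)%E.
Proof.
move=> y0; rewrite /maxfun; elim: l => [|u1 l IH] h; first by rewrite big_nil.
rewrite big_cons ge_max h ?mem_head//= IH// => u ul.
by apply: h; rewrite inE ul orbT.
Qed.

Lemma measurable_maxfun l : measurable_fun setT (maxfun l).
Proof.
elim: l => [|u l IH]; rewrite /maxfun.
  by under eq_fun do rewrite big_nil; exact: measurable_cst.
by under eq_fun do rewrite big_cons; exact: measurable_maxe.
Qed.

End argmax.

(** * The Cauchy-Schwarz inequality with a weight *)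

Section cauchy_schwarz.
Context d (T : measurableType d) (R : realType).
Local Open Scope ereal_scope.
Variable m : {sigma_finite_measure set T -> \bar R}.

(** The square is a double integral, to which 2 g(x) g(y) <= g(x)^2 + g(y)^2 is applied pointwise.
    This covers infinite integrals without a case distinction. *)
Lemma weighted_integral_sqr (w g : T -> \bar R) :
  measurable_fun setT w -> (forall x, 0 <= w x) ->
  measurable_fun setT g -> (forall x, 0 <= g x) ->
  (\int[m]_x (w x * g x)) * (\int[m]_x (w x * g x)) <=
  (\int[m]_x w x) * \int[m]_x (w x * (g x * g x)).
Proof.
move=> mw w0 mg g0.
have mwg : measurable_fun setT (fun x => w x * g x) by exact: emeasurable_funM.
have mgg : measurable_fun setT (fun x => g x * g x) by exact: emeasurable_funM.
have mwgg : measurable_fun setT (fun x => w x * (g x * g x)) by exact: emeasurable_funM.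
have wg0 x : 0 <= w x * g x by rewrite mule_ge0.
have wgg0 x : 0 <= w x * (g x * g x) by rewrite !mule_ge0.
set I := \int[m]_x (w x * g x); set J := \int[m]_x (w x * (g x * g x)).
have h0 : (0 <= 2^-1 :> R)%R by [].
have -> : I * I = \int[m]_x \int[m]_y ((w x * g x) * (w y * g y)).
  rewrite -ge0_integralZr//; last exact: integral_ge0.
  by apply: eq_integral => x _; rewrite ge0_integralZl.
apply: (@le_trans _ _ (\int[m]_x (2^-1%:E * (w x * (g x * g x) * \int[m]_y w y) + 2^-1%:E * (w x * J)))).
  apply: le_integral_nonmeas => x.
    by apply: integral_ge0 => y _; rewrite mule_ge0.
  rewrite -[X in _ <= _ * X + _]ge0_integralZl// -[X in _ <= _ + _ * X]ge0_integralZl//.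
  rewrite -ge0_integralZl//; last 2 first.
    by apply: emeasurable_funM.
    by move=> y _; rewrite mule_ge0.
  rewrite -[X in _ <= _ + X]ge0_integralZl//; last 2 first.
    by apply: emeasurable_funM.
    by move=> y _; rewrite mule_ge0.
  rewrite -ge0_integralD//; first last.
  - by do 2 apply: emeasurable_funM => //.
  - by move=> y _; rewrite !mule_ge0.
  - by do 2 apply: emeasurable_funM => //.
  - by move=> y _; rewrite !mule_ge0.
  apply: le_integral_nonmeas => y; first by rewrite mule_ge0.
  have := @lee_amgm R 2^-1 (g x) (g y) _ (g0 x) (g0 y).
  rewrite invr_gt0 ltr0n => /(_ isT).
  have -> : (4 * 2^-1 = 2 :> R)%R by lra.
  move=> /(lee_wpmul2l (mule_ge0 (w0 x) (w0 y))) h.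
  rewrite [X in X <= _](_ : _ = w x * w y * (g x * g y)); last by rewrite muleACA.
  rewrite (le_trans h)// ge0_muleDr ?mule_ge0//.
  rewrite le_eqVlt; apply/orP; left; apply/eqP; congr (_ + _).
    rewrite muleCA; congr (_ * _); rewrite -!muleA; congr (_ * _).
    by rewrite muleC -!muleA.
  by rewrite muleCA -!muleA.
rewrite ge0_integralD//; last 4 first.
- by move=> x _; rewrite !mule_ge0// integral_ge0.
- by apply: emeasurable_funM => //; exact: emeasurable_funM.
- by move=> x _; rewrite !mule_ge0// integral_ge0.
- by apply: emeasurable_funM => //; exact: emeasurable_funM.
rewrite !ge0_integralZl//; last 4 first.
- exact: emeasurable_funM.
- by move=> x _; rewrite mule_ge0// integral_ge0.
- exact: emeasurable_funM.
- by move=> x _; rewrite mule_ge0// integral_ge0.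
rewrite !ge0_integralZr//; last 2 first.
- exact: integral_ge0.
- exact: integral_ge0.
rewrite -/J [J * _]muleC -ge0_muleDl// -EFinD.
have -> : (2^-1 + 2^-1 = 1 :> R)%R by lra.
by rewrite mul1e.
Qed.

End cauchy_schwarz.

(** * The Poisson kernel *)

Section poisson.
Context {R : realType}.
Notation leb := (@lebesgue_measure R).
Implicit Types (e a : R) (f : R -> \bar R).

(** The Poisson kernel without its factor 1/pi, so its total mass is [pi]. *)
Definition poisson e a : R := e / (e ^+ 2 + a ^+ 2).

Lemma poisson_den_gt0 e a : 0 < e -> 0 < e ^+ 2 + a ^+ 2.
Proof. by move=> e0; rewrite ltr_pwDl ?sqr_ge0// exprn_gt0. Qed.

Lemma poisson_gt0 e a : 0 < e -> 0 < poisson e a.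
Proof. by move=> e0; rewrite divr_gt0// poisson_den_gt0. Qed.

Lemma poissonN e a : poisson e (- a) = poisson e a.
Proof. by rewrite /poisson sqrrN. Qed.

Lemma poisson1 a : poisson 1 a = (oneDsqr a)^-1.
Proof. by rewrite /poisson expr1n mul1r. Qed.

Lemma poisson_scale e s : 0 < e -> e * poisson e (e * s) = poisson 1 s.
Proof.
move=> e0; rewrite /poisson expr1n exprMn.
have s1 : 1 + s ^+ 2 != 0 by rewrite gt_eqF// ltr_pwDl ?sqr_ge0.
have -> : e ^+ 2 + e ^+ 2 * s ^+ 2 = e ^+ 2 * (1 + s ^+ 2) by ring.
by field; rewrite s1 gt_eqF.
Qed.

(* The reciprocal of the kernel satisfies a quasi-triangle inequality. *)
Lemma poisson_mul_le (e1 e2 a b : R) : 0 < e2 -> e2 <= e1 ->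
  poisson e1 a * poisson e2 b <=
  2 * poisson e1 (a + b) * (poisson e1 a + poisson e2 b).
Proof.
move=> e20 e21; have e10 : 0 < e1 := lt_le_trans e20 e21.
have d1 := poisson_den_gt0 a e10; have d2 := poisson_den_gt0 b e20.
have d3 := poisson_den_gt0 (a + b) e10.
set x := e1 ^+ 2 + a ^+ 2 in d1; set y := e2 ^+ 2 + b ^+ 2 in d2.
set z := e1 ^+ 2 + (a + b) ^+ 2 in d3.
rewrite /poisson -/x -/y -/z.
suff h : e2 * z <= 2 * (e1 * y + e2 * x).
  rewrite -subr_ge0.
  have -> : 2 * (e1 / z) * (e1 / x + e2 / y) - e1 / x * (e2 / y) =
      e1 / (x * y * z) * (2 * (e1 * y + e2 * x) - e2 * z).
    by field; rewrite !gt_eqF.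
  by rewrite mulr_ge0 ?subr_ge0// divr_ge0 ?ltW// !mulr_gt0.
have h1 : z <= e1 ^+ 2 + 2 * a ^+ 2 + 2 * b ^+ 2.
  rewrite /z -addrA lerD2l -subr_ge0.
  have -> : 2 * a ^+ 2 + 2 * b ^+ 2 - (a + b) ^+ 2 = (a - b) ^+ 2 by ring.
  exact: sqr_ge0.
apply: (le_trans (ler_wpM2l (ltW e20) h1)).
have := ler_wpM2r (sqr_ge0 b) e21.
have := mulr_ge0 (ltW e10) (sqr_ge0 e2).
have := mulr_ge0 (ltW e20) (sqr_ge0 e1).
by rewrite /x /y; nra.
Qed.

Lemma continuous_poisson e : 0 < e -> continuous (poisson e).
Proof.
move=> e0 x; apply: cvgM; first exact: cvg_cst.
apply: cvgV; first by rewrite gt_eqF// poisson_den_gt0.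
by apply: cvgD; [exact: cvg_cst|exact: exprn_continuous].
Qed.

Lemma measurable_funV_gt0 d (T : measurableType d) (h : T -> R) :
  measurable_fun setT h -> (forall x, 0 < h x) ->
  measurable_fun setT (fun x => (h x)^-1).
Proof.
move=> mh h0; rewrite (_ : (fun x => _) = (fun x => h x `^ (-1))).
  exact: (measurableT_comp (measurable_powR _)).
by apply/funext => x; rewrite powR_inv1// ltW.
Qed.

Lemma measurable_poisson d (T : measurableType d) (e a : T -> R) :
  measurable_fun setT e -> measurable_fun setT a -> (forall x, 0 < e x) ->
  measurable_fun setT (fun x => poisson (e x) (a x)).
Proof.
move=> me ma e0; apply: measurable_funM => //; apply: measurable_funV_gt0.
  by apply: measurable_funD; exact: measurable_funX.
by move=> x; exact: poisson_den_gt0.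
Qed.

Lemma integral_poisson1 : (\int[leb]_a (poisson 1 a)%:E = pi%:E)%E.
Proof.
rewrite (@ge0_symfun_integralT R (poisson 1)).
- have -> : [set x : R | 0 <= x] = `[0, +oo[%classic.
    by apply/seteqP; split => x /=; rewrite in_itv/= andbT.
  under eq_integral do rewrite poisson1.
  by rewrite integral0y_oneDsqr -EFinM mulrCA divff// mulr1.
- by move=> x; rewrite ltW// poisson_gt0.
- exact: continuous_poisson.
- by move=> x; rewrite /= poissonN.
Qed.

End poisson.

(** * The L^2 maximal theorem for Poisson averages on the line *)

Section poisson_averages.
Context {R : realType}.
Local Open Scope ereal_scope.
Notation leb := (@lebesgue_measure R).
Implicit Types (e a z : R) (f : R -> \bar R).

(** The dilation sits in the argument of [f], so [e] may have either sign; negative scales occur for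
    the second point of a pair. *)
Definition avg e f z : \bar R := \int[leb]_s ((poisson 1 s)%:E * f (z + e * s)%R).

Let poisson0 e a : (0 < e)%R -> 0 <= (poisson e a)%:E :> \bar R.
Proof. by move=> e0; rewrite lee_fin ltW// poisson_gt0. Qed.

Let poisson10 a : 0 <= (poisson 1 a)%:E :> \bar R.
Proof. exact: poisson0. Qed.

Let measurable_poisson1 : measurable_fun setT (fun s : R => (poisson 1 s)%:E).
Proof. by apply/measurable_EFinP; exact: measurable_poisson. Qed.

Lemma avg_ge0 e f z : (forall x, 0 <= f x) -> 0 <= avg e f z.
Proof. by move=> f0; apply: integral_ge0 => s _; rewrite mule_ge0. Qed.

Lemma avgE e f z : e != 0%R -> measurable_fun setT f -> (forall x, 0 <= f x) ->
  avg e f z = \int[leb]_u ((poisson `|e| (z - u))%:E * f u).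
Proof.
move=> e0 mf f0; have ne0 : (0 < `|e|)%R by rewrite normr_gt0.
pose g u := (poisson `|e| (z - u))%:E * f u.
have mg : measurable_fun setT g.
  apply: emeasurable_funM => //; apply/measurable_EFinP; apply: measurable_poisson => //.
  exact: measurable_funB.
have g0 u : 0 <= g u by rewrite mule_ge0// poisson0.
have := ge0_integral_affine z e0 mg g0.
move=> /(congr1 (fun x => `|e|%:E * x)); rewrite muleA -EFinM divff ?gt_eqF// mul1e => <-.
rewrite -ge0_integralZl//; last first.
  by apply: (measurableT_comp mg); exact: measurable_affine.
apply: eq_integral => s _; rewrite /g muleA -EFinM (addrC (e * s)%R z).
have -> : (z - (z + e * s) = - (e * s))%R by ring.
rewrite poissonN; congr (_%:E * _).
rewrite -(poisson_scale s ne0); congr (_ * _)%R.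
by rewrite /poisson !exprMn real_normK ?num_real.
Qed.

Lemma integral_poisson e z : (0 < e)%R ->
  \int[leb]_u (poisson e (z - u))%:E = pi%:E.
Proof.
move=> e0; have := @avgE e (cst 1) z (lt0r_neq0 e0) (measurable_cst _) (fun=> lee01).
rewrite gtr0_norm// /avg => h.
rewrite -integral_poisson1; transitivity (\int[leb]_u ((poisson e (z - u))%:E * cst 1 u)).
  by apply: eq_integral => u _; rewrite mule1.
by rewrite -h; apply: eq_integral => u _; rewrite mule1.
Qed.

Lemma measurable_avg e f : measurable_fun setT f -> (forall x, 0 <= f x) ->
  measurable_fun setT (avg e f).
Proof.
move=> mf f0.
apply: (measurable_fun_fubini_tonelli_F (m2 := leb)
  (fun zs : R * R => (poisson 1 zs.2)%:E * f (zs.1 + e * zs.2)%R)).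
  apply: emeasurable_funM; first exact: (measurableT_comp measurable_poisson1).
  apply: (measurableT_comp mf); apply: measurable_funD => //.
  exact: measurable_funM.
by move=> zs; rewrite mule_ge0.
Qed.

(** Cauchy-Schwarz against a kernel of mass pi, then translation invariance. This is the a priori
    bound behind the absorption in [maxfun_avg_le]. *)
Lemma avg_sqr_le e f : measurable_fun setT f -> (forall x, 0 <= f x) ->
  \int[leb]_z (avg e f z * avg e f z) <= (pi ^+ 2)%:E * \int[leb]_z (f z * f z).
Proof.
move=> mf f0.
have mff : measurable_fun setT (fun u => f u * f u) by exact: emeasurable_funM.
have ff0 u : 0 <= f u * f u by rewrite mule_ge0.
have mz z (h : R -> \bar R) : measurable_fun setT h -> measurable_fun setT (fun s => h (z + e * s)%R).
  move=> mh; apply: (measurableT_comp mh).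
  by under eq_fun do rewrite addrC; exact: measurable_affine.
have pi0 : (0 <= pi :> R)%R := pi_ge0 R.
apply: (@le_trans _ _ (\int[leb]_z (pi%:E * \int[leb]_s ((poisson 1 s)%:E * (f (z + e * s)%R * f (z + e * s)%R))))).
  apply: le_integral_nonmeas => z; first by rewrite mule_ge0// avg_ge0.
  rewrite -integral_poisson1.
  by apply: (@weighted_integral_sqr _ _ _ leb (fun s => (poisson 1 s)%:E) (fun s => f (z + e * s)%R)) => //; exact: mz.
have mpf : measurable_fun setT (fun zs : R * R =>
    (poisson 1 zs.2)%:E * (f (zs.1 + e * zs.2)%R * f (zs.1 + e * zs.2)%R)).
  apply: emeasurable_funM; first exact: (measurableT_comp measurable_poisson1).
  apply: (measurableT_comp mff); apply: measurable_funD => //.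
  exact: measurable_funM.
have pf0 (zs : R * R) : 0 <= (poisson 1 zs.2)%:E * (f (zs.1 + e * zs.2)%R * f (zs.1 + e * zs.2)%R).
  by rewrite mule_ge0.
rewrite ge0_integralZl//; last 2 first.
- exact: (measurable_fun_fubini_tonelli_F (m2 := leb) _ mpf).
- by move=> z _; apply: integral_ge0 => s _; exact: (pf0 (z, s)).
rewrite (fubini_tonelli (m1 := leb) (m2 := leb) _ mpf pf0)/=.
rewrite expr2 EFinM -muleA; apply: lee_wpmul2l; first by rewrite lee_fin.
rewrite (_ : \int[leb]_y _ = \int[leb]_y ((poisson 1 y)%:E * \int[leb]_z (f z * f z))).
  by rewrite ge0_integralZr// ?integral_poisson1// integral_ge0.
apply: eq_integral => s _; rewrite ge0_integralZl//; last first.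
  have mfs : measurable_fun setT (fun z => f (z + e * s)%R).
    by apply: (measurableT_comp mf); exact: measurable_funD.
  exact: emeasurable_funM.
congr (_ * _); exact: (@ge0_integral_shift R (e * s) (fun u => f u * f u)).
Qed.

(** A crude comparison of every scale with scale 1, meant for finiteness alone: the factor is
    unbounded in [e] and does not enter the maximal bound. *)
Lemma poisson_le1 e a : (0 < e)%R -> (poisson e a <= (e + e^-1) * poisson 1 a)%R.
Proof.
move=> e0; have d1 := poisson_den_gt0 a e0; have d2 := poisson_den_gt0 a (@ltr01 R).
rewrite /poisson expr1n in d2 *.
rewrite mulrA mulr1 ler_pdivrMr// mulrAC ler_pdivlMr// -subr_ge0.
have -> : ((e + e^-1) * (e ^+ 2 + a ^+ 2) - e * (1 + a ^+ 2) = e ^+ 3 + a ^+ 2 / e)%R.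
  by field; rewrite gt_eqF.
by rewrite addr_ge0 ?exprn_ge0 ?divr_ge0 ?sqr_ge0 ?(ltW e0).
Qed.

(** Choosing the best scale at each point makes the operator linear, with kernel [K]. By
    [poisson_mul_le], integrating K(z,u) K(w,u) in [u] gives at most 4 pi times the kernel at the
    larger of the two scales, which is K(z,w) or K(w,z). So the TT-star bound applies with c = 4
    pi. *)
Lemma maxfun_avg_le (l : seq R) f : (forall e, e \in l -> e != 0%R) ->
  measurable_fun setT f -> (forall x, 0 <= f x) ->
  \int[leb]_z (maxfun (avg ^~ f) l z * maxfun (avg ^~ f) l z) <=
  (4 * (4 * pi) ^+ 2)%:E * \int[leb]_z (f z * f z).
Proof.
move=> l0 mf f0.
have pi0 : (0 < pi :> R)%R := pi_gt0 R.
have C0 : (0 < 4 * (4 * pi) ^+ 2 :> R)%R by rewrite mulr_gt0// exprn_gt0// mulr_gt0.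
have ff0 : 0 <= \int[leb]_z (f z * f z) by apply: integral_ge0 => z _; rewrite mule_ge0.
case: l l0 => [|e0 l] l0.
  rewrite integral0_eq ?mule_ge0 ?lee_fin ?(ltW C0)// => z _.
  by rewrite /maxfun big_nil mule0.
have [E [El Emax mE]] := measurable_argmax (v := avg ^~ f) (fun e => measurable_avg e mf f0) e0 l.
have E0 z : (0 < `|E z|)%R by rewrite normr_gt0 l0.
have mnE : measurable_fun setT (fun z => `|E z|%R).
  exact: (mE _ _ (fun u : R => cst `|u|%R) (fun u => measurable_cst _)).
pose K (z : R * R) := poisson `|E z.1| (z.1 - z.2).
have mK : measurable_fun setT K.
  apply: measurable_poisson => //; first exact: (measurableT_comp mnE).
  exact: measurable_funB.
have K0 (z : R * R) : (0 <= K z)%R by rewrite ltW// poisson_gt0.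
pose G z := \int[leb]_u ((K (z, u))%:E * f u).
have GE z : maxfun (avg ^~ f) (e0 :: l) z = G z.
  rewrite /G /K /= -avgE ?l0//; apply/eqP; rewrite eq_le; apply/andP; split.
    by apply: maxfun_le => [|u ul]; [exact: avg_ge0|exact: Emax].
  exact: maxfun_ge.
under eq_integral do rewrite GE.
have [ffoo|ffoo] := eqVneq (\int[leb]_z (f z * f z)) +oo.
  by rewrite ffoo gt0_muley ?lte_fin// leey.
have {}ffoo : \int[leb]_z (f z * f z) < +oo by rewrite ltey.
(* The list is finite, so one constant compares all selected kernels with scale 1. It shows that [G]
   and its adjoint image are square integrable and then disappears. *)
pose C := (\sum_(e <- e0 :: l) (`|e| + `|e|^-1))%R.
have EC z : (`|E z| + `|E z|^-1 <= C)%R.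
  rewrite /C (big_rem _ (El z)) lerDl; apply: sumr_ge0 => i _.
  by rewrite addr_ge0 ?invr_ge0.
have C_ge0 : (0 <= C)%R by apply: sumr_ge0 => i _; rewrite addr_ge0 ?invr_ge0.
have KC z u : (K (z, u) <= C * poisson 1 (z - u))%R.
  rewrite (le_trans (poisson_le1 _ (E0 z)))// ler_wpM2r ?EC//.
  by rewrite ltW// poisson_gt0.
have fin_avg g (H : R -> \bar R) : measurable_fun setT g -> (forall x, 0 <= g x) ->
    (forall z, 0 <= H z) -> (forall z, H z <= C%:E * avg 1 g z) ->
    \int[leb]_z (g z * g z) < +oo -> \int[leb]_z (H z * H z) < +oo.
  move=> mg g0 H0 HC ggoo.
  apply: (@le_lt_trans _ _ (\int[leb]_z ((C * C)%:E * (avg 1 g z * avg 1 g z)))).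
    apply: le_integral_nonmeas => z; first by rewrite mule_ge0.
    by rewrite EFinM muleACA; apply: lee_pmul.
  have mavg := measurable_avg 1 mg g0; have avg0 z := avg_ge0 1 z g0.
  rewrite ge0_integralZl//; last 3 first.
  - exact: emeasurable_funM.
  - by move=> z _; rewrite mule_ge0.
  - by rewrite lee_fin mulr_ge0.
  rewrite lte_mul_pinfty ?lee_fin ?mulr_ge0//.
  apply: (le_lt_trans (avg_sqr_le 1 mg g0)).
  by rewrite lte_mul_pinfty// lee_fin sqr_ge0.
have mKf (h : R -> \bar R) : measurable_fun setT h ->
    measurable_fun setT (fun z : R * R => (K z)%:E * h z.2).
  move=> mh; apply: emeasurable_funM; first exact/measurable_EFinP.
  exact: (measurableT_comp mh).
have mG : measurable_fun setT G.
  apply: (measurable_fun_fubini_tonelli_F (m2 := leb) _ (mKf f mf)).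
  by move=> z; rewrite mule_ge0// lee_fin.
have G0 z : 0 <= G z by apply: integral_ge0 => u _; rewrite mule_ge0// lee_fin.
have GC z : G z <= C%:E * avg 1 f z.
  rewrite avgE ?oner_neq0// normr1 -ge0_integralZl//; last 2 first.
  - apply: emeasurable_funM => //; apply/measurable_EFinP.
    by apply: measurable_poisson => //; exact: measurable_funB.
  - by move=> u _; rewrite mule_ge0.
  apply: le_integral_nonmeas => u; first by rewrite mule_ge0// lee_fin.
  by rewrite muleA -EFinM lee_wpmul2r// lee_fin.
have Gfin : \int[leb]_z (G z * G z) < +oo by exact: (fin_avg f).
have Afin : \int[leb]_u ((\int[leb]_z (G z * (K (z, u))%:E)) * (\int[leb]_z (G z * (K (z, u))%:E))) < +oo.
  apply: (fin_avg G) => // u.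
    by apply: integral_ge0 => z _; rewrite mule_ge0// lee_fin.
  rewrite avgE ?oner_neq0// normr1 -ge0_integralZl//; last 2 first.
  - apply: emeasurable_funM => //; apply/measurable_EFinP.
    by apply: measurable_poisson => //; exact: measurable_funB.
  - by move=> z _; rewrite mule_ge0.
  apply: le_integral_nonmeas => z; first by rewrite mule_ge0// lee_fin.
  by rewrite muleA -EFinM muleC lee_wpmul2r// lee_fin -opprB poissonN.
have pi40 : (0 < 4 * pi :> R)%R by rewrite mulr_gt0.
refine (@TTstar_bound _ _ _ leb K (4 * pi) mK K0 pi40 _ f mf f0 Gfin Afin) => z w.
wlog zw : z w / (`|E w| <= `|E z|)%R => [wl|].
  have [|/ltW] := leP `|E w|%R `|E z|%R; first exact: wl.
  move=> /wl; rewrite [in X in _ -> X <= _](_ : \int[leb]_u _ = \int[leb]_u (K (w, u) * K (z, u))%:E); last first.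
    by apply: eq_integral => u _; rewrite mulrC.
  by rewrite [(K (w, z) + _)%R]addrC.
apply: (@le_trans _ _ (\int[leb]_u ((2 * K (z, w))%:E * ((K (z, u))%:E + (K (w, u))%:E)))).
  apply: le_integral_nonmeas => u; first by rewrite lee_fin mulr_ge0.
  rewrite -EFinD -EFinM lee_fin /K /=.
  have := @poisson_mul_le R `|E z| `|E w| (z - u) (u - w) (E0 w) zw.
  have -> : (z - u + (u - w) = z - w)%R by ring.
  by rewrite -[(w - u)%R]opprB poissonN.
have mK1 x : measurable_fun setT (fun u => (K (x, u))%:E).
  apply/measurable_EFinP.
  have mxu : measurable_fun setT (fun u : R => x - u)%R by exact: measurable_funB.
  exact: (measurable_poisson (e := fun=> `|E x|%R) (measurable_cst _) mxu).
rewrite ge0_integralZl//; last 3 first.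
- apply: emeasurable_funD; exact: mK1.
- by move=> u _; apply: adde_ge0; rewrite lee_fin.
- by rewrite lee_fin mulr_ge0.
rewrite ge0_integralD//; last 4 first.
- by move=> u _; rewrite lee_fin.
- exact: mK1.
- by move=> u _; rewrite lee_fin.
- exact: mK1.
rewrite /K/= !integral_poisson// -/(K (z, w)) -EFinD -EFinM lee_fin.
have := K0 (w, z); rewrite /K /= => h.
have : (0 <= 4 * pi * poisson `|E w| (w - z))%R by apply: mulr_ge0 => //; exact: ltW.
nra.
Qed.

End poisson_averages.

(** * Products of sigma-finite measures *)

Section product.
Context d1 d2 (R : realType) (T1 : measurableType d1) (T2 : measurableType d2).
Variables (m1 : {sigma_finite_measure set T1 -> \bar R})
  (m2 : {sigma_finite_measure set T2 -> \bar R}).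
Local Open Scope ereal_scope.

Lemma sigma_finite_product : sigma_finite setT (m1 \x m2).
Proof.
have /sigma_finiteP[F [TF ndF Foo]] := sigma_finiteT m1.
have /sigma_finiteP[G [TG ndG Goo]] := sigma_finiteT m2.
exists (fun n => F n `*` G n) => [|n].
  apply/esym; rewrite -subTset => -[x y] _.
  have [i _ Fix] : (\bigcup_i F i) x by rewrite -TF.
  have [j _ Gjy] : (\bigcup_i G i) y by rewrite -TG.
  exists (maxn i j) => //; split => /=.
    by move: Fix; exact/subsetPset/ndF/leq_maxl.
  by move: Gjy; exact/subsetPset/ndG/leq_maxr.
have [? ?] := Foo n; have [? ?] := Goo n; split; first exact: measurableX.
by rewrite product_measure1E// lte_mul_pinfty// ge0_fin_numE.
Qed.

(** The product is packaged as a sigma-finite measure again so that it can be iterated, as in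
    [pmeasure leb2 leb2]. *)
Definition pmeasure : {sigma_finite_measure set (T1 * T2)%type -> \bar R} :=
  HB.pack (m1 \x m2) (Measure_isSigmaFinite.Build _ _ _ (m1 \x m2) sigma_finite_product).

Lemma integral_pmeasure12 (f : T1 * T2 -> \bar R) :
  measurable_fun setT f -> (forall x, 0 <= f x) ->
  \int[pmeasure]_z f z = \int[m1]_x \int[m2]_y f (x, y).
Proof. by move=> mf f0; rewrite [LHS](fubini_tonelli1 f). Qed.

Lemma integral_pmeasure21 (f : T1 * T2 -> \bar R) :
  measurable_fun setT f -> (forall x, 0 <= f x) ->
  \int[pmeasure]_z f z = \int[m2]_y \int[m1]_x f (x, y).
Proof. by move=> mf f0; rewrite [LHS](fubini_tonelli2 f). Qed.

Lemma measurable_integral12 (f : T1 * T2 -> \bar R) :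
  measurable_fun setT f -> (forall x, 0 <= f x) ->
  measurable_fun setT (fun x => \int[m2]_y f (x, y)).
Proof. exact: measurable_fun_fubini_tonelli_F. Qed.

Lemma measurable_integral21 (f : T1 * T2 -> \bar R) :
  measurable_fun setT f -> (forall x, 0 <= f x) ->
  measurable_fun setT (fun y => \int[m1]_x f (x, y)).
Proof. exact: measurable_fun_fubini_tonelli_G. Qed.

End product.

(** * The L^2 strong maximal theorem in the plane *)

Section strong_maximal.
Context {R : realType}.
Local Open Scope ereal_scope.
Notation leb := (@lebesgue_measure R).

Definition leb2 : {sigma_finite_measure set _ -> \bar R} := pmeasure leb leb.

Definition avg2 (e : R * R) (f : R * R -> \bar R) (z : R * R) : \bar R :=
  avg e.1 (fun x => avg e.2 (fun y => f (x, y)) z.2) z.1.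

Implicit Types f : R * R -> \bar R.

Lemma avg2_ge0 e f z : (forall x, 0 <= f x) -> 0 <= avg2 e f z.
Proof. by move=> f0; apply: avg_ge0 => x; exact: avg_ge0. Qed.

Let measurable_poisson1 : measurable_fun setT (fun s : R => (poisson 1 s)%:E).
Proof. by apply/measurable_EFinP; exact: measurable_poisson. Qed.

Let poisson10 (a : R) : 0 <= (poisson 1 a)%:E :> \bar R.
Proof. by rewrite lee_fin ltW// poisson_gt0. Qed.

Lemma measurable_avg_param2 d (T : measurableType d) (f : T * R -> \bar R) (e : R) :
  measurable_fun setT f -> (forall x, 0 <= f x) ->
  measurable_fun setT (fun z : T * R => avg e (fun y => f (z.1, y)) z.2).
Proof.
move=> mf f0; apply: (@measurable_integral12 _ _ _ _ _ leb
  (fun zs : (T * R) * R => (poisson 1 zs.2)%:E * f (zs.1.1, zs.1.2 + e * zs.2)%R)).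
  apply: emeasurable_funM; first exact: (measurableT_comp measurable_poisson1).
  apply: (measurableT_comp mf); apply: measurable_fun_pair.
    exact: measurableT_comp.
  apply: measurable_funD; first exact: measurableT_comp.
  exact: measurable_funM.
by move=> zs; rewrite mule_ge0.
Qed.

Lemma measurable_avg_param1 d (T : measurableType d) (f : R * T -> \bar R) (e : R) :
  measurable_fun setT f -> (forall x, 0 <= f x) ->
  measurable_fun setT (fun z : R * T => avg e (fun x => f (x, z.2)) z.1).
Proof.
move=> mf f0.
have mfs : measurable_fun setT (fun z : T * R => f (z.2, z.1)).
  by apply: (measurableT_comp mf); exact: measurable_fun_pair.
have := measurable_avg_param2 e mfs (fun z => f0 (z.2, z.1)).
move=> h.
have ms : measurable_fun setT (fun z : R * T => (z.2, z.1)) by exact: measurable_fun_pair.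
exact: (measurableT_comp h ms).
Qed.

Lemma measurable_avg2 e f : measurable_fun setT f -> (forall x, 0 <= f x) ->
  measurable_fun setT (avg2 e f).
Proof.
move=> mf f0; apply: (@measurable_avg_param1 _ _
  (fun z : R * R => avg e.2 (fun y => f (z.1, y)) z.2)).
  exact: measurable_avg_param2.
by move=> z; exact: avg_ge0.
Qed.

Lemma le_avg e (f g : R -> \bar R) z : (forall x, 0 <= f x) -> (forall x, f x <= g x) ->
  avg e f z <= avg e g z.
Proof.
move=> f0 fg; apply: le_integral_nonmeas => s; first by rewrite mule_ge0.
exact: lee_wpmul2l.
Qed.

(** A two-parameter average is dominated by the composition of the one-parameter maximal functions
    over the first scales and over the second scales. The bound on the line is then applied to
    slices, once in each variable. *)
Lemma maxfun_avg2_le (l : seq (R * R)) f :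
  (forall e, e \in l -> (e.1 != 0%R) && (e.2 != 0%R)) ->
  measurable_fun setT f -> (forall x, 0 <= f x) ->
  \int[leb2]_z (maxfun (avg2 ^~ f) l z * maxfun (avg2 ^~ f) l z) <=
  ((4 * (4 * pi) ^+ 2) ^+ 2)%:E * \int[leb2]_z (f z * f z).
Proof.
move=> l0 mf f0; set C := (4 * (4 * pi) ^+ 2)%R.
have C0 : (0 <= C)%R by rewrite mulr_ge0// sqr_ge0.
pose l1 := [seq e.1 | e <- l]; pose l2 := [seq e.2 | e <- l].
have l10 e : e \in l1 -> e != 0%R by case/mapP => e' /l0 /andP[+ _] ->.
have l20 e : e \in l2 -> e != 0%R by case/mapP => e' /l0 /andP[_ +] ->.
pose M2 (z : R * R) := maxfun (fun e (z : R * R) => avg e (fun y => f (z.1, y)) z.2) l2 z.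
have mM2 : measurable_fun setT M2.
  by apply: measurable_maxfun => e; exact: measurable_avg_param2.
have M20 z : 0 <= M2 z by exact: maxfun_ge0.
pose M1 (z : R * R) := maxfun (fun e (z : R * R) => avg e (fun x => M2 (x, z.2)) z.1) l1 z.
have mM1 : measurable_fun setT M1.
  by apply: measurable_maxfun => e; exact: measurable_avg_param1.
have M10 z : 0 <= M1 z by exact: maxfun_ge0.
have msq (h : R * R -> \bar R) : measurable_fun setT h -> measurable_fun setT (fun z => h z * h z).
  by move=> mh; exact: emeasurable_funM.
have sq0 (h : R * R -> \bar R) : (forall z, 0 <= h z) -> forall z, 0 <= h z * h z.
  by move=> h0 z; rewrite mule_ge0.
have sec1 (h : R * R -> \bar R) y : measurable_fun setT h -> measurable_fun setT (fun x => h (x, y)).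
  by move=> mh; apply: (measurableT_comp mh); exact: measurable_fun_pair.
have sec2 (h : R * R -> \bar R) x : measurable_fun setT h -> measurable_fun setT (fun y => h (x, y)).
  by move=> mh; apply: (measurableT_comp mh); exact: measurable_fun_pair.
apply: (@le_trans _ _ (\int[leb2]_z (M1 z * M1 z))).
  have le_M1 z : maxfun (avg2 ^~ f) l z <= M1 z.
    apply: maxfun_le => // e el.
    apply: (@le_trans _ _ (avg e.1 (fun x => M2 (x, z.2)) z.1)).
      apply: le_avg => x; first exact: avg_ge0.
      have /(maxfun_ge (fun e (z : R * R) => avg e (fun y => f (z.1, y)) z.2) (x, z.2)) : e.2 \in l2 by apply/mapP; exists e.
      exact.
    have /(maxfun_ge (fun e (z : R * R) => avg e (fun x => M2 (x, z.2)) z.1) z) : e.1 \in l1 by apply/mapP; exists e.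
    exact.
  apply: le_integral_nonmeas => z; first by rewrite mule_ge0// maxfun_ge0.
  by apply: lee_pmul => //; exact: maxfun_ge0.
apply: (@le_trans _ _ (C%:E * \int[leb2]_z (M2 z * M2 z))).
  rewrite [X in X <= _]integral_pmeasure21; [|exact: msq|exact: sq0].
  rewrite [X in _ <= _ * X]integral_pmeasure21; [|exact: msq|exact: sq0].
  rewrite -ge0_integralZl ?lee_fin//; last 2 first.
  - exact: (measurable_integral21 leb (msq _ mM2) (sq0 _ M20)).
  - by move=> y _; apply: integral_ge0 => x _; rewrite mule_ge0.
  apply: le_integral_nonmeas => y.
    by apply: integral_ge0 => x _; rewrite mule_ge0.
  exact: (@maxfun_avg_le R l1 (fun x => M2 (x, y)) l10 (sec1 _ _ mM2)).
rewrite (_ : ((C ^+ 2)%:E = C%:E * C%:E)); last by rewrite -EFinM expr2.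
rewrite -muleA; apply: lee_wpmul2l; first by rewrite lee_fin.
rewrite [X in X <= _]integral_pmeasure12; [|exact: msq|exact: sq0].
rewrite [X in _ <= _ * X]integral_pmeasure12; [|exact: msq|exact: sq0].
rewrite -ge0_integralZl ?lee_fin//; last 2 first.
- exact: (measurable_integral12 leb (msq _ mf) (sq0 _ f0)).
- by move=> x _; apply: integral_ge0 => y _; rewrite mule_ge0.
apply: le_integral_nonmeas => x.
  by apply: integral_ge0 => y _; rewrite mule_ge0.
exact: (@maxfun_avg_le R l2 (fun y => f (x, y)) l20 (sec2 _ _ mf)).
Qed.

End strong_maximal.

(** * Integrable real functions and Fubini's theorem *)

Section real_fubini.
Context d (T : measurableType d) (R : realType).

Definition L1 (m : {measure set T -> \bar R}) (f : T -> R) :=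
  m.-integrable setT (EFin \o f).

Lemma L1_measurable (m : {measure set T -> \bar R}) (f : T -> R) : L1 m f -> measurable_fun setT f.
Proof. by move=> /measurable_int /measurable_EFinP. Qed.

Lemma L1_dom (m : {measure set T -> \bar R}) (f g : T -> R) : L1 m g -> measurable_fun setT f ->
  (forall x, `|f x| <= g x) -> L1 m f.
Proof.
move=> gi mf fg; apply: (le_integrable _ _ _ gi) => //; first exact/measurable_EFinP.
by move=> x _; rewrite /= lee_fin (le_trans (fg x))// ler_norm.
Qed.

Lemma L1_norm (m : {measure set T -> \bar R}) (f : T -> R) : L1 m f -> L1 m (fun x => `|f x|).
Proof. exact: integrable_norm. Qed.

Lemma Rintegral_EFin (m : {measure set T -> \bar R}) (f : T -> R) : L1 m f ->
  ((\int[m]_x f x)%:E = \int[m]_x (f x)%:E)%E.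
Proof. by move=> fi; rewrite fineK//; exact: (integrable_fin_num _ fi). Qed.

Lemma L1_bounded_prod (m : {measure set T -> \bar R}) (f g : T -> R) (b : R) : L1 m f ->
  measurable_fun setT g -> (forall x, `|g x| <= b) -> L1 m (fun x => f x * g x).
Proof.
move=> fi mg gb.
apply: (@L1_dom m _ (fun x => b * `|f x|)).
- by have := integrableZl measurableT b (L1_norm fi).
- by apply: measurable_funM => //; exact: L1_measurable fi.
- by move=> x; rewrite normrM mulrC ler_wpM2r.
Qed.

Lemma Rintegral_sum (m : {measure set T -> \bar R}) (U : Type) (s : seq U) (f : U -> T -> R) :
  (forall u, L1 m (f u)) ->
  L1 m (fun x => \sum_(u <- s) f u x) /\
  \int[m]_x (\sum_(u <- s) f u x) = \sum_(u <- s) \int[m]_x f u x.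
Proof.
move=> fi; elim: s => [|u s [IH1 IH2]].
  rewrite big_nil; split.
    by rewrite /L1 (_ : _ \o _ = cst 0%E)//; [exact: integrable0|apply/funext => x /=; rewrite big_nil].
  by under eq_Rintegral do rewrite big_nil; rewrite Rintegral_cst// mul0r.
split.
  rewrite /L1 (_ : _ \o _ = (fun x => (f u x)%:E + (\sum_(u <- s) f u x)%:E)%E).
    exact: (integrableD measurableT (fi u) IH1).
  by apply/funext => x /=; rewrite big_cons.
under eq_Rintegral do rewrite big_cons.
by rewrite (RintegralD measurableT (fi u) IH1) IH2 big_cons.
Qed.

End real_fubini.

Section real_fubini2.
Context d1 d2 (R : realType) (T1 : measurableType d1) (T2 : measurableType d2).
Variables (m1 : {sigma_finite_measure set T1 -> \bar R})
  (m2 : {sigma_finite_measure set T2 -> \bar R}).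
Notation m12 := (pmeasure m1 m2).

Lemma L1_tensor (f : T1 -> R) (g : T2 -> R) : L1 m1 f -> L1 m2 g ->
  L1 m12 (fun z => f z.1 * g z.2).
Proof.
move=> fi gi; have mf := L1_measurable fi; have mg := L1_measurable gi.
have mfg : measurable_fun setT (fun z : T1 * T2 => f z.1 * g z.2).
  by apply: measurable_funM; exact: measurableT_comp.
apply/integrableP; split; first exact/measurable_EFinP.
rewrite integral_pmeasure12//; last first.
  by apply: measurableT_comp => //; exact/measurable_EFinP.
have ne : (forall x, \int[m2]_y `|(f x * g y)%:E| = `|f x|%:E * \int[m2]_y `|(g y)%:E|)%E.
  move=> x; rewrite -ge0_integralZl//; last first.
    by apply: measurableT_comp => //; exact/measurable_EFinP.
  by apply: eq_integral => y _; rewrite -abse_EFin -abseM.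
under eq_integral do rewrite /= ne.
rewrite ge0_integralZr//; last 2 first.
- by apply/measurable_EFinP; exact: measurableT_comp.
- exact: integral_ge0.
have /integrableP[_ foo] := fi; have /integrableP[_ goo] := gi.
by rewrite lte_mul_pinfty// ?integral_ge0// ge0_fin_numE// integral_ge0.
Qed.

Variable f : T1 * T2 -> R.
Hypothesis fi : L1 m12 f.

Let fi' : (m1 \x m2)%E.-integrable setT (EFin \o f).
Proof. exact: fi. Qed.

Lemma measurable_Rintegral12 : measurable_fun setT (fun x => \int[m2]_y f (x, y)).
Proof.
have := measurable_fubini_F fi'; rewrite /fubini_F => h.
exact: (measurableT_comp (@fine_measurable R setT measurableT) h).
Qed.

Lemma L1_Rintegral12 : L1 m1 (fun x => \int[m2]_y f (x, y)).
Proof.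
apply: (le_integrable _ _ _ (integrable_fubini_F fi')) => //.
  exact/measurable_EFinP/measurable_Rintegral12.
(* [fine] sends infinite values to 0, so passing to real values can only lower the modulus. *)
by move=> x _; rewrite /= /Rintegral /fubini_F /=; case: (\int[m2]_y _)%E => //= ; rewrite leey.
Qed.

(** The real and the extended inner integrals are compared where the section is integrable, which is
    almost everywhere. *)
Lemma Rfubini12 : \int[m12]_z f z = \int[m1]_x \int[m2]_y f (x, y).
Proof.
rewrite /Rintegral -[X in fine X](integral12_prod_meas1 fi').
congr fine; apply: ae_eq_integral => //; first exact: measurable_fubini_F fi'.
  exact/measurable_EFinP/measurable_Rintegral12.
apply: filterS (ae_integrable1 fi') => x xi _.
by rewrite /= Rintegral_EFin.
Qed.

End real_fubini2.

Section real_fubini_swap.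
Context d1 d2 (R : realType) (T1 : measurableType d1) (T2 : measurableType d2).
Variables (m1 : {sigma_finite_measure set T1 -> \bar R})
  (m2 : {sigma_finite_measure set T2 -> \bar R}).
Variable f : T1 * T2 -> R.
Hypothesis fi : L1 (pmeasure m1 m2) f.

Lemma L1_swap : L1 (pmeasure m2 m1) (fun z => f (z.2, z.1)).
Proof.
have mf := L1_measurable fi.
have mfs : measurable_fun setT (fun z : T2 * T1 => f (z.2, z.1)).
  by apply: (measurableT_comp mf); exact: measurable_fun_pair.
apply/integrableP; split; first exact/measurable_EFinP.
rewrite integral_pmeasure12//; last first.
  by apply: measurableT_comp => //; exact/measurable_EFinP.
have /integrableP[_] := fi; rewrite integral_pmeasure21//.
by apply: measurableT_comp => //; exact/measurable_EFinP.
Qed.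

Lemma Rfubini : \int[m1]_x \int[m2]_y f (x, y) = \int[m2]_y \int[m1]_x f (x, y).
Proof.
rewrite -Rfubini12// -(Rfubini12 L1_swap) /Rintegral.
rewrite -[X in fine X](integral12_prod_meas1 (f := EFin \o f) fi).
rewrite -[in RHS](integral21_prod_meas1 L1_swap) //.
Qed.

End real_fubini_swap.

(** * Weighted square norms of oscillatory integrals as quadratic forms *)

Section quadratic_form.
Context dx dz (R : realType) (X : measurableType dx) (Z : measurableType dz).
Variables (m : {sigma_finite_measure set X -> \bar R})
  (n : {sigma_finite_measure set Z -> \bar R}).
Variables (u : X -> R) (w : Z -> R).
Hypotheses (ui : L1 m u) (wi : L1 n w).
Notation mm := (pmeasure m m).

Lemma sqr_Rintegral (k : X -> R) : measurable_fun setT k -> (forall x, `|k x| <= 1) ->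
  (\int[m]_x (u x * k x)) ^+ 2 = \int[mm]_z (u z.1 * u z.2 * (k z.1 * k z.2)).
Proof.
move=> mk k1; have uki : L1 m (fun x => u x * k x) by exact: L1_bounded_prod mk k1.
transitivity (\int[mm]_z ((u z.1 * k z.1) * (u z.2 * k z.2))); last first.
  by apply: eq_Rintegral => z _; rewrite mulrACA.
rewrite (Rfubini12 (L1_tensor uki uki))/= expr2 -RintegralZr//.
by apply: eq_Rintegral => x _; rewrite RintegralZl.
Qed.

Section one_kernel.
Variable k : Z * X -> R.
Hypotheses (mk : measurable_fun setT k) (k1 : forall z, `|k z| <= 1).

(** The integrand after the square has been expanded. It is dominated by the tensor product of [w],
    [u] and [u], which justifies every exchange of integrals. *)
Let F (v : Z * (X * X)) := w v.1 * (u v.2.1 * u v.2.2) * (k (v.1, v.2.1) * k (v.1, v.2.2)).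

Let Fi : L1 (pmeasure n mm) F.
Proof.
apply: L1_bounded_prod.
- exact: (L1_tensor wi (L1_tensor ui ui)).
- apply: measurable_funM; apply: (measurableT_comp mk); apply: measurable_fun_pair => //.
  + exact: (measurableT_comp measurable_fst measurable_snd).
  + exact: (measurableT_comp measurable_snd measurable_snd).
- by move=> v; rewrite normrM; apply: mulr_ile1.
Qed.

Let mk1 z : measurable_fun setT (fun x => k (z, x)).
Proof. by apply: (measurableT_comp mk); exact: measurable_fun_pair. Qed.

Let kernel_sqr z : w z * (\int[m]_x (u x * k (z, x))) ^+ 2 = \int[mm]_xy F (z, xy).
Proof.
rewrite (sqr_Rintegral (mk1 z) (fun x => k1 (z, x))) -RintegralZl//; last first.
  apply: L1_bounded_prod (L1_tensor ui ui) _ _.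
    by apply: measurable_funM; apply: (measurableT_comp (mk1 z)).
  by move=> v; rewrite normrM; apply: mulr_ile1.
by apply: eq_Rintegral => xy _; rewrite /F/= mulrA.
Qed.

Let kernel_dual xy : u xy.1 * u xy.2 * (\int[n]_z (w z * (k (z, xy.1) * k (z, xy.2)))) =
  \int[n]_z F (z, xy).
Proof.
rewrite -RintegralZl//; last first.
  apply: (L1_bounded_prod (b := 1) wi).
    by apply: measurable_funM; apply: (measurableT_comp mk); exact: measurable_fun_pair.
  by move=> v; rewrite normrM; apply: mulr_ile1.
by apply: eq_Rintegral => z _; rewrite /F/=; ring.
Qed.

Lemma L1_kernel_sqr : L1 n (fun z => w z * (\int[m]_x (u x * k (z, x))) ^+ 2).
Proof.
by under eq_fun do rewrite kernel_sqr; exact: L1_Rintegral12.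
Qed.

Lemma L1_kernel_dual :
  L1 mm (fun xy => u xy.1 * u xy.2 * (\int[n]_z (w z * (k (z, xy.1) * k (z, xy.2))))).
Proof.
under eq_fun do rewrite kernel_dual.
exact: (L1_Rintegral12 (L1_swap Fi)).
Qed.

Lemma quadratic_form_kernel :
  \int[n]_z (w z * (\int[m]_x (u x * k (z, x))) ^+ 2) =
  \int[mm]_xy (u xy.1 * u xy.2 * (\int[n]_z (w z * (k (z, xy.1) * k (z, xy.2))))).
Proof.
under eq_Rintegral do rewrite kernel_sqr.
under [RHS]eq_Rintegral do rewrite kernel_dual.
exact: Rfubini.
Qed.

End one_kernel.

Variables (I : finType) (k : I -> Z * X -> R).
Hypotheses (mk : forall i, measurable_fun setT (k i)) (k1 : forall i z, `|k i z| <= 1).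

(** The sum over kernels stays inside the modulus: for cosine and sine it collapses by the addition
    formula to a function of a difference, and this is where cancellation is kept. *)
Lemma quadratic_form_le :
  ((\int[n]_z (w z * \sum_i (\int[m]_x (u x * k i (z, x))) ^+ 2))%:E <=
   \int[mm]_xy (`|u xy.1| * `|u xy.2| *
     `|\int[n]_z (w z * \sum_i k i (z, xy.1) * k i (z, xy.2))|)%:E)%E.
Proof.
have sqri i := L1_kernel_sqr (mk i) (k1 i).
have duali i := L1_kernel_dual (mk i) (k1 i).
have -> : \int[n]_z (w z * \sum_i (\int[m]_x (u x * k i (z, x))) ^+ 2) =
    \int[mm]_xy (\sum_i u xy.1 * u xy.2 *
      (\int[n]_z (w z * (k i (z, xy.1) * k i (z, xy.2))))).
  under eq_Rintegral do rewrite mulr_sumr.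
  have [_ ->] := Rintegral_sum (index_enum I) sqri.
  have [_ ->] := Rintegral_sum (index_enum I) duali.
  by apply: eq_bigr => i _; exact: quadratic_form_kernel.
have [sumi _] := Rintegral_sum (index_enum I) duali.
rewrite Rintegral_EFin//; apply: (le_trans (lee_abs _)).
apply: (le_trans (le_abse_integral _ _ _)) => //; first exact: (measurable_int _ sumi).
apply: le_integral_nonmeas => xy; first by rewrite abse_ge0.
rewrite abse_EFin lee_fin -mulr_sumr !normrM ler_wpM2l// ?mulr_ge0//.
have wki i : L1 n (fun z => w z * (k i (z, xy.1) * k i (z, xy.2))).
  apply: (L1_bounded_prod (b := 1) wi).
    by apply: measurable_funM; apply: (measurableT_comp (mk i)); exact: measurable_fun_pair.
  by move=> v; rewrite normrM; apply: mulr_ile1.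
have [_ <-] := Rintegral_sum (index_enum I) wki.
by under [in leRHS]eq_Rintegral do rewrite mulr_sumr.
Qed.

End quadratic_form.

(** * The Poisson kernel as a cosine transform *)

Section exponential_weight.
Context {R : realType}.
Notation leb := (@lebesgue_measure R).
Implicit Types (e a t : R).

Definition expweight e t : R := if 0 <= t then expR (- (e * t)) else 0.

Lemma expweight_ge0 e t : 0 <= expweight e t.
Proof. by rewrite /expweight; case: ifP => // _; exact: expR_ge0. Qed.

Lemma measurable_expweight e : measurable_fun setT (expweight e).
Proof.
apply: measurable_fun_ifT => //; first exact: measurable_fun_ler.
apply: continuous_measurable_fun => t; apply: continuous_comp; last exact: continuous_expR.
by apply: cvgN; apply: cvgM; [exact: cvg_cst|exact: cvg_id].
Qed.

(** Adding 1 to the cosine makes the integrand nonnegative, so that the fundamental theorem of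
    calculus applies on a half-line; [Rintegral_expweight_cos] takes the constant part away
    again. *)
Lemma integral_expweight_cos e a : 0 < e ->
  (\int[leb]_t (expweight e t * (1 + cos (t * a)))%:E = (e^-1 + poisson e a)%:E)%E.
Proof.
move=> e0; have d0 := poisson_den_gt0 a e0.
pose f t := expR (- (e * t)) * (1 + cos (t * a)).
(* Obtained by integrating the exponential times the cosine by parts twice; it vanishes at
   infinity. *)
pose F t := expR (- (e * t)) * ((a * sin (t * a) - e * cos (t * a)) / (e ^+ 2 + a ^+ 2) - e^-1).
have dF t : is_derive t 1 F (f t).
  rewrite /F /f; apply: is_derive_eq.
  rewrite /GRing.scale/= !mulr1 !mulr0 ?addr0 ?add0r ?scale0r.
  by field; rewrite !gt_eqF.
have df t : derivable F t 1 by have [] := dF t.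
have cF : continuous F by move=> t; exact/differentiable_continuous/derivable1_diffP.
have f0 t : 0 <= f t.
  by rewrite mulr_ge0 ?expR_ge0// -lerBlDl sub0r cos_geN1.
have cf : continuous f.
  move=> t; apply: cvgM.
    apply: continuous_comp; last exact: continuous_expR.
    by apply: cvgN; apply: cvgM; [exact: cvg_cst|exact: cvg_id].
  apply: cvgD; first exact: cvg_cst.
  apply: continuous_comp; last exact: continuous_cos.
  by apply: cvgM; [exact: cvg_id|exact: cvg_cst].
have cE : expR (- (e * t)) @[t --> +oo] --> 0.
  have := cvg_comp _ _ (gt0_cvgMry e0 (@cvg_id _ (+oo : set_system R))) (@cvgr_expR R).
  exact.
have F0 : F t @[t --> +oo] --> 0.
  pose C := (`|a| + e) / (e ^+ 2 + a ^+ 2) + e^-1.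
  apply/norm_cvg0P.
  apply: (@squeeze_cvgr _ _ _ _ (cst 0) (fun t => expR (- (e * t)) * C)).
  - apply: nearW => t; rewrite normr_ge0/= normrM ger0_norm ?expR_ge0//.
    rewrite ler_wpM2l ?expR_ge0// (le_trans (ler_normB _ _))//.
    rewrite [`|e^-1|]ger0_norm ?invr_ge0 ?(ltW e0)// lerD2r.
    rewrite normrM [`|_^-1|]ger0_norm ?invr_ge0 ?(ltW d0)//.
    rewrite ler_wpM2r ?invr_ge0 ?(ltW d0)// (le_trans (ler_normB _ _))//.
    rewrite !normrM [`|e|]ger0_norm ?(ltW e0)//; apply: lerD.
      by rewrite ler_piMr// sin_max.
    by rewrite ler_piMr ?(ltW e0)// cos_max.
  - exact: cvg_cst.
  - by rewrite -(mul0r C); apply: cvgM => //; exact: cvg_cst.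
transitivity (\int[leb]_(t in `[0%R, +oo[) (f t)%:E)%E.
  rewrite [RHS]integral_mkcond; apply: eq_integral => t _.
  rewrite patchE mem_setE in_itv/= andbT /expweight /f.
  by case: ifP => //; rewrite mul0r.
rewrite (@ge0_continuous_FTC2y R f F 0 0)//.
- rewrite /F mulr0 oppr0 expR0 mul1r mul0r sin0 cos0 mulr0 mulr1 sub0r /poisson.
  by rewrite -EFinB; congr EFin; ring.
- exact: continuous_subspaceT.
- by apply: cvg_at_right_filter; exact: cF.
- by move=> t _; rewrite derive1E; exact: derive_val.
Qed.

Lemma L1_expweight e : 0 < e -> L1 leb (expweight e).
Proof.
move=> e0; have me := measurable_expweight e.
apply/integrableP; split; first exact/measurable_EFinP.
apply: (@le_lt_trans _ _ (\int[leb]_t (expweight e t * (1 + cos (t * 0)))%:E)%E).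
  apply: le_integral_nonmeas => t; first exact: abse_ge0.
  rewrite /= lee_fin ger0_norm ?expweight_ge0// mulr0 cos0.
  by rewrite ler_peMr ?expweight_ge0// lerDl.
by rewrite integral_expweight_cos// ltry.
Qed.

Lemma L1_expweight_cos e a : 0 < e -> L1 leb (fun t => expweight e t * cos (t * a)).
Proof.
move=> e0; apply: (L1_bounded_prod (b := 1) (L1_expweight e0)); last by move=> t; exact: cos_max.
apply: (measurableT_comp (continuous_measurable_fun (@continuous_cos R))).
exact: measurable_funM.
Qed.

(** The case a = 0 of the preceding formula shows that the weight itself has integral 1/e, which is
    then subtracted. *)
Lemma Rintegral_expweight_cos e a : 0 < e ->
  \int[leb]_t (expweight e t * cos (t * a)) = poisson e a.
Proof.
move=> e0.
have sum b : \int[leb]_t (expweight e t) + \int[leb]_t (expweight e t * cos (t * b)) =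
    e^-1 + poisson e b.
  rewrite -RintegralD//; last 2 first.
  - exact: L1_expweight.
  - exact: L1_expweight_cos.
  rewrite /Rintegral -[RHS]/(fine (e^-1 + poisson e b)%:E) -integral_expweight_cos//.
  by congr fine; apply: eq_integral => t _; rewrite mulrDr mulr1.
have := sum 0; rewrite {1}(_ : \int[leb]_t (expweight e t * cos (t * 0)) =
   \int[leb]_t (expweight e t)); last first.
  by apply: eq_Rintegral => t _; rewrite mulr0 cos0 mulr1.
have -> : poisson e 0 = e^-1 by rewrite /poisson expr0n addr0; field; rewrite gt_eqF.
by have := sum a; lra.
Qed.

End exponential_weight.

(** * Reflections of the plane and integrals depending on a parameter *)

Section reflection.
Context {R : realType}.
Notation leb := (@lebesgue_measure R).
Notation leb2 := (@leb2 R).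
Local Open Scope ereal_scope.
Implicit Types f : R * R -> \bar R.

Lemma integral_reflect1 f : measurable_fun setT f -> (forall z, 0 <= f z) ->
  \int[leb2]_z f (- z.1, z.2)%R = \int[leb2]_z f z.
Proof.
move=> mf f0; rewrite [LHS]integral_pmeasure21//; last first.
  apply: (measurableT_comp mf); apply: measurable_fun_pair => //.
  exact: measurableT_comp.
rewrite (integral_pmeasure21 leb leb mf f0); apply: eq_integral => y _ /=.
apply: (@ge0_integral_oppr _ (fun x => f (x, y))) => //.
by apply: (measurableT_comp mf); exact: measurable_fun_pair.
Qed.

Lemma integral_reflect2 f : measurable_fun setT f -> (forall z, 0 <= f z) ->
  \int[leb2]_z f (z.1, - z.2)%R = \int[leb2]_z f z.
Proof.
move=> mf f0; rewrite [LHS]integral_pmeasure12//; last first.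
  apply: (measurableT_comp mf); apply: measurable_fun_pair => //.
  exact: measurableT_comp.
rewrite (integral_pmeasure12 leb leb mf f0); apply: eq_integral => x _ /=.
apply: (@ge0_integral_oppr _ (fun y => f (x, y))) => //.
by apply: (measurableT_comp mf); exact: measurable_fun_pair.
Qed.

End reflection.

(** The inner integrals of the positive and negative parts are measurable by Tonelli, and both the
    difference and [fine] preserve this. *)
Lemma measurable_Rintegral_param d1 d2 (R : realType) (T1 : measurableType d1)
    (T2 : measurableType d2) (m2 : {sigma_finite_measure set T2 -> \bar R}) (F : T1 * T2 -> R) :
  measurable_fun setT F -> measurable_fun setT (fun x => \int[m2]_y F (x, y)).
Proof.
move=> mF; have mF' : measurable_fun setT (EFin \o F) by exact/measurable_EFinP.
have mpos : measurable_fun setT (EFin \o F)^\+%E by exact: measurable_funepos.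
have mneg : measurable_fun setT (EFin \o F)^\-%E by exact: measurable_funeneg.
have h : measurable_fun setT (fun x => \int[m2]_y (F (x, y))%:E)%E.
  rewrite (_ : (fun x => _) = (fun x => \int[m2]_y ((EFin \o F)^\+ (x, y)) -
      \int[m2]_y ((EFin \o F)^\- (x, y)))%E).
    apply: emeasurable_funB.
      by apply: (measurable_fun_fubini_tonelli_F (m2 := m2) _ mpos) => z; exact: funepos_ge0.
    by apply: (measurable_fun_fubini_tonelli_F (m2 := m2) _ mneg) => z; exact: funeneg_ge0.
  by apply/funext => x; rewrite integralE; congr (_ - _)%E; apply: eq_integral => y _; rewrite ?funeposE ?funenegE.
exact: (measurableT_comp (@fine_measurable R setT measurableT) h).
Qed.

(** * A Plancherel inequality for the cosine transform in the plane *)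

Section plancherel.
Context {R : realType}.
Notation leb := (@lebesgue_measure R).
Notation leb2 := (@leb2 R).

Definition trig (b : bool) : R -> R := if b then cos else sin.

Lemma trig_max b x : `|trig b x| <= 1.
Proof. by case: b; [exact: cos_max|exact: sin_max]. Qed.

Lemma measurable_trig b : measurable_fun setT (trig b).
Proof.
by case: b; apply: continuous_measurable_fun; [exact: continuous_cos|exact: continuous_sin].
Qed.

(** The four products of a cosine or sine in each coordinate replace the complex exponential: summed
    over [i], their products at two points depend only on the difference of the points
    ([sum_tker]). *)
Definition tker (i : bool * bool) (v : (R * R) * (R * R)) : R :=
  trig i.1 (v.1.1 * v.2.1) * trig i.2 (v.1.2 * v.2.2).

Lemma tker_max i v : `|tker i v| <= 1.
Proof. by rewrite normrM mulr_ile1// trig_max. Qed.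

Lemma measurable_tker i : measurable_fun setT (tker i).
Proof.
apply: measurable_funM; apply: (measurableT_comp (measurable_trig _));
  apply: measurable_funM.
- exact: (measurableT_comp measurable_fst measurable_fst).
- exact: (measurableT_comp measurable_fst measurable_snd).
- exact: (measurableT_comp measurable_snd measurable_fst).
- exact: (measurableT_comp measurable_snd measurable_snd).
Qed.

Lemma sum_tker z x y : \sum_i tker i (z, x) * tker i (z, y) =
  cos (z.1 * (x.1 - y.1)) * cos (z.2 * (x.2 - y.2)).
Proof.
rewrite -(pair_bigA _ (fun a b => tker (a, b) (z, x) * tker (a, b) (z, y)))/=.
by rewrite !big_bool /tker/= !mulrBr !cosB; ring.
Qed.

Variable h : R * R -> R.
Hypothesis hi : L1 leb2 h.
Let mh : measurable_fun setT h. Proof. exact: L1_measurable hi. Qed.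

Definition tint i z := \int[leb2]_x (h x * tker i (z, x)).
Definition tsum z := \sum_i (tint i z) ^+ 2.

Let hker i z : L1 leb2 (fun x => h x * tker i (z, x)).
Proof.
apply: (L1_bounded_prod (b := 1) hi); last by move=> x; exact: tker_max.
by apply: (measurableT_comp (measurable_tker i)); exact: measurable_fun_pair.
Qed.

Lemma measurable_tint i : measurable_fun setT (tint i).
Proof.
apply: (@measurable_Rintegral_param _ _ _ _ _ leb2 (fun v => h v.2 * tker i v)).
apply: measurable_funM; last exact: measurable_tker.
exact: (measurableT_comp mh measurable_snd).
Qed.

Lemma measurable_tsum : measurable_fun setT tsum.
Proof. by apply: measurable_sum => i; apply: measurable_funX; exact: measurable_tint. Qed.

Lemma tsum_ge0 z : 0 <= tsum z.
Proof. by apply: sumr_ge0 => i _; exact: sqr_ge0. Qed.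

(** The weight lives on one quadrant, where its transform is a product of Poisson kernels; the other
    quadrants are recovered by symmetry. *)
Let ew e (z : R * R) := expweight e z.1 * expweight e z.2.

Let ew0 e z : 0 <= ew e z.
Proof. by rewrite mulr_ge0 ?expweight_ge0. Qed.

Let L1_ew e : 0 < e -> L1 leb2 (ew e).
Proof. by move=> e0; apply: L1_tensor; exact: L1_expweight. Qed.

Let ew_tker e x y : 0 < e ->
  \int[leb2]_z (ew e z * \sum_i tker i (z, x) * tker i (z, y)) =
  poisson e (x.1 - y.1) * poisson e (x.2 - y.2).
Proof.
move=> e0; rewrite -!Rintegral_expweight_cos//.
pose f a t : R := expweight e t * cos (t * a).
transitivity (\int[leb2]_z (f (x.1 - y.1) z.1 * f (x.2 - y.2) z.2)).
  by apply: eq_Rintegral => z _; rewrite sum_tker mulrACA.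
rewrite (Rfubini12 (L1_tensor (L1_expweight_cos _ e0) (L1_expweight_cos _ e0)))/=.
rewrite -RintegralZr//; last exact: L1_expweight_cos.
by apply: eq_Rintegral => t _; rewrite RintegralZl//; exact: L1_expweight_cos.
Qed.

Lemma integral_poisson2 e (x : R * R) : 0 < e ->
  (\int[leb2]_y (poisson e (x.1 - y.1) * poisson e (x.2 - y.2))%:E = (pi ^+ 2)%:E)%E.
Proof.
move=> e0; have P0 a : (0 <= (poisson e a)%:E)%E by rewrite lee_fin ltW// poisson_gt0.
have mP a : measurable_fun setT (fun y : R => (poisson e (a - y))%:E).
  by apply/measurable_EFinP; apply: measurable_poisson => //; exact: measurable_funB.
rewrite integral_pmeasure12/=; last 2 first.
- apply/measurable_EFinP; apply: measurable_funM; apply: measurable_poisson => //;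
    exact: measurable_funB.
- by move=> y; rewrite EFinM mule_ge0.
transitivity (\int[leb]_u ((poisson e (x.1 - u))%:E * pi%:E))%E.
  apply: eq_integral => u _; rewrite -(integral_poisson x.2 e0).
  rewrite -ge0_integralZl//.
  exact: mP.
rewrite ge0_integralZr ?lee_fin ?pi_ge0//; last exact: mP.
by rewrite integral_poisson// -EFinM expr2.
Qed.

(** The quadratic form has the positive symmetric kernel [P], of mass pi^2 in each variable. Schur's
    test, in the form 2|ab| <= a^2 + b^2, bounds it. *)
Let weighted_plancherel e : 0 < e ->
  ((\int[leb2]_z (ew e z * tsum z))%:E <=
   (pi ^+ 2)%:E * \int[leb2]_x (h x ^+ 2)%:E)%E.
Proof.
move=> e0.
have := @quadratic_form_le _ _ _ _ _ leb2 leb2 h (ew e) hi (L1_ew e0) _ tker measurable_tker tker_max.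
move=> /le_trans; apply.
pose P (x y : R * R) := poisson e (x.1 - y.1) * poisson e (x.2 - y.2).
have P0 x y : 0 <= P x y by rewrite mulr_ge0// ltW// poisson_gt0.
have PC x y : P x y = P y x.
  by rewrite /P -[x.1 - y.1]opprB -[x.2 - y.2]opprB !poissonN.
have mP : measurable_fun setT (fun v : (R * R) * (R * R) => P v.1 v.2).
  apply: measurable_funM; apply: measurable_poisson => //; apply: measurable_funB.
  - exact: (measurableT_comp measurable_fst measurable_fst).
  - exact: (measurableT_comp measurable_fst measurable_snd).
  - exact: (measurableT_comp measurable_snd measurable_fst).
  - exact: (measurableT_comp measurable_snd measurable_snd).
have mh2 : measurable_fun setT (fun x => (h x ^+ 2)%:E).
  by apply/measurable_EFinP; exact: measurable_funX.
have half0 : 0 <= 2^-1 :> R by [].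
pose A1 (v : (R * R) * (R * R)) : \bar R := (2^-1 * (h v.1 ^+ 2 * P v.1 v.2))%:E.
pose A2 (v : (R * R) * (R * R)) : \bar R := (2^-1 * (h v.2 ^+ 2 * P v.1 v.2))%:E.
have A10 v : (0 <= A1 v)%E.
  by rewrite lee_fin; apply: mulr_ge0 => //; apply: mulr_ge0 => //; exact: sqr_ge0.
have A20 v : (0 <= A2 v)%E.
  by rewrite lee_fin; apply: mulr_ge0 => //; apply: mulr_ge0 => //; exact: sqr_ge0.
have mA1 : measurable_fun setT A1.
  apply/measurable_EFinP; apply: measurable_funM => //; apply: measurable_funM => //.
  by apply: measurable_funX; exact: measurableT_comp.
have mA2 : measurable_fun setT A2.
  apply/measurable_EFinP; apply: measurable_funM => //; apply: measurable_funM => //.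
  by apply: measurable_funX; exact: measurableT_comp.
have p20 : 0 <= 2^-1 * pi ^+ 2 :> R by apply: mulr_ge0 => //; exact: sqr_ge0.
have P1 x : (\int[leb2]_y (2^-1 * (h x ^+ 2 * P x y))%:E = (2^-1 * pi ^+ 2)%:E * (h x ^+ 2)%:E)%E.
  under eq_integral do rewrite mulrA EFinM.
  have mPx : measurable_fun setT (fun y => (P x y)%:E).
    apply/measurable_EFinP; apply: measurable_funM; apply: measurable_poisson => //;
      exact: measurable_funB.
  have h0 : (0 <= (2^-1 * h x ^+ 2)%:E)%E.
    by rewrite lee_fin; apply: mulr_ge0 => //; exact: sqr_ge0.
  rewrite ge0_integralZl//; last by move=> y _; rewrite lee_fin.
  by rewrite integral_poisson2// -!EFinM mulrAC.
have half (B : \bar R) : (0 <= B)%E -> ((2^-1 * pi ^+ 2)%:E * B + (2^-1 * pi ^+ 2)%:E * B = (pi ^+ 2)%:E * B)%E.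
  move=> B0; rewrite -ge0_muleDl ?lee_fin// -EFinD.
  by have -> : 2^-1 * pi ^+ 2 + 2^-1 * pi ^+ 2 = pi ^+ 2 :> R by lra.
apply: (@le_trans _ _ (\int[pmeasure leb2 leb2]_v (A1 v + A2 v)%E)%E).
  apply: le_integral_nonmeas => v; first by rewrite lee_fin; apply: mulr_ge0.
  rewrite ew_tker// -/(P v.1 v.2) ger0_norm// /A1 /A2 -EFinD lee_fin.
  have := P0 v.1 v.2; have := sqr_ge0 (`|h v.1| - `|h v.2|).
  rewrite -(real_normK (num_real (h v.1))) -(real_normK (num_real (h v.2))).
  by nra.
pose I := (\int[leb2]_x (h x ^+ 2)%:E)%E.
have h20 x : (0 <= (h x ^+ 2)%:E)%E by rewrite lee_fin sqr_ge0.
have IZ : (\int[leb2]_x ((2^-1 * pi ^+ 2)%:E * (h x ^+ 2)%:E) = (2^-1 * pi ^+ 2)%:E * I)%E.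
  by rewrite ge0_integralZl ?lee_fin.
have I1 : (\int[pmeasure leb2 leb2]_v A1 v = (2^-1 * pi ^+ 2)%:E * I)%E.
  rewrite (integral_pmeasure12 leb2 leb2 mA1 A10) -IZ.
  by apply: eq_integral => x _; exact: P1.
have I2 : (\int[pmeasure leb2 leb2]_v A2 v = (2^-1 * pi ^+ 2)%:E * I)%E.
  rewrite (integral_pmeasure21 leb2 leb2 mA2 A20) -IZ.
  apply: eq_integral => y _; rewrite -P1; apply: eq_integral => x _.
  by rewrite /A2 /= PC.
rewrite ge0_integralD// I1 I2 half//; exact: integral_ge0.
Qed.

Let Q (z : R * R) : \bar R := if (0 <= z.1) && (0 <= z.2) then (tsum z)%:E else 0%E.

Let Q0 z : (0 <= Q z)%E.
Proof. by rewrite /Q; case: ifP => // _; rewrite lee_fin tsum_ge0. Qed.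

Let mQ : measurable_fun setT Q.
Proof.
have mS : measurable_fun setT (fun z => (tsum z)%:E) by apply/measurable_EFinP; exact: measurable_tsum.
apply: measurable_fun_ifT; [|exact: mS|exact: measurable_cst].
by apply: measurable_and; apply: measurable_fun_ler.
Qed.

Let expweight_cvg (t : R) : 0 <= t -> expweight n.+1%:R^-1 t @[n --> \oo] --> (1 : R).
Proof.
move=> t0; rewrite (_ : (fun n => _) = (fun n : nat => expR (- (n.+1%:R^-1 * t)))); last first.
  by apply/funext => n; rewrite /expweight t0.
have cv : (- (n.+1%:R^-1 * t)) @[n --> \oo] --> (- (0 * t) : R).
  by apply: cvgN; apply: cvgM; [exact: cvg_harmonic|exact: cvg_cst].
rewrite mul0r oppr0 in cv.
have := cvg_comp _ _ cv (@continuous_expR R 0).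
by rewrite expR0.
Qed.

Let expweight_nd (t : R) m n : (m <= n)%N -> expweight m.+1%:R^-1 t <= expweight n.+1%:R^-1 t.
Proof.
move=> mn; rewrite /expweight; case: ifP => // t0.
rewrite ler_expR lerN2 ler_wpM2r// lef_pV2 ?posrE ?ltr0n// ler_nat.
by rewrite ltnS.
Qed.

(** As e decreases to 0 the weights increase to the indicator of the quadrant. *)
Let plancherel_quadrant :
  (\int[leb2]_z Q z <= (pi ^+ 2)%:E * \int[leb2]_x (h x ^+ 2)%:E)%E.
Proof.
pose f n z : \bar R := (ew n.+1%:R^-1 z * tsum z)%:E.
have f0 n z : (0 <= f n z)%E by rewrite lee_fin mulr_ge0 ?ew0 ?tsum_ge0.
have mf n : measurable_fun setT (f n).
  apply/measurable_EFinP; apply: measurable_funM; last exact: measurable_tsum.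
  apply: measurable_funM; apply: (measurableT_comp (measurable_expweight _)).
    exact: measurable_fst.
  exact: measurable_snd.
have fQ z : f n z @[n --> \oo] --> Q z.
  rewrite /f /Q /ew; have [/andP[z10 z20]|] := boolP ((0 <= z.1) && (0 <= z.2)).
    apply: cvg_EFin; first exact: nearW.
    rewrite /comp /=; rewrite -[X in _ --> X]mul1r.
    apply: cvgM; last exact: cvg_cst.
    rewrite -[X in _ --> X]mul1r; apply: cvgM; exact: expweight_cvg.
  rewrite negb_and => z12.
  rewrite (_ : (fun n => _) = cst 0%E); first exact: cvg_cst.
  apply/funext => n /=; congr EFin.
  by case/orP: z12 => /negbTE h0; rewrite /expweight h0 ?(mul0r, mulr0).
have nd z m n : (m <= n)%N -> (f m z <= f n z)%E.
  move=> mn; rewrite lee_fin ler_wpM2r ?tsum_ge0// /ew.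
  by apply: ler_pM; rewrite ?expweight_ge0// expweight_nd.
have -> : (\int[leb2]_z Q z = \int[leb2]_z limn (f ^~ z))%E.
  by apply: eq_integral => z _; apply/esym/cvg_lim => //; exact: fQ.
have fnd z : [set: R * R] z -> nondecreasing_seq (f ^~ z).
  by move=> _ m n mn; exact: nd.
rewrite (monotone_convergence leb2 measurableT mf (fun n z _ => f0 n z) fnd).
apply: lime_le.
  apply: ereal_nondecreasing_is_cvgn => m n mn.
  by apply: le_integral_nonmeas => z; [exact: f0|exact: nd].
apply: nearW => n.
have n0 : 0 < n.+1%:R^-1 :> R by rewrite invr_gt0.
have Li : L1 leb2 (fun z => ew n.+1%:R^-1 z * tsum z).
  have := Rintegral_sum (index_enum (bool * bool)%type)
    (fun i => L1_kernel_sqr hi (L1_ew n0) (measurable_tker i) (tker_max i)).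
  move=> [+ _]; rewrite /L1; under eq_fun do rewrite -mulr_sumr; exact.
rewrite -(Rintegral_EFin Li); exact: weighted_plancherel.
Qed.

Let tint_sqr_opp1 i z : tint i (- z.1, z.2) ^+ 2 = tint i z ^+ 2.
Proof.
case: i => -[] b.
  by congr (_ ^+ 2); apply: eq_Rintegral => x _; rewrite /tker/= mulNr cosN.
rewrite -[RHS]sqrrN; congr (_ ^+ 2); rewrite -mulN1r /tint -RintegralZl//; last exact: hker.
by apply: eq_Rintegral => x _; rewrite /tker/= mulNr sinN; ring.
Qed.

Let tint_sqr_opp2 i z : tint i (z.1, - z.2) ^+ 2 = tint i z ^+ 2.
Proof.
case: i => b -[].
  by congr (_ ^+ 2); apply: eq_Rintegral => x _; rewrite /tker/= mulNr cosN.
rewrite -[RHS]sqrrN; congr (_ ^+ 2); rewrite -mulN1r /tint -RintegralZl//; last exact: hker.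
by apply: eq_Rintegral => x _; rewrite /tker/= mulNr sinN; ring.
Qed.

Definition hatc (z : R * R) := \int[leb2]_x (h x * cos (z.1 * x.1 + z.2 * x.2)).

(** [hatc] is a difference of two of the four transforms, which costs a factor 2. The four quadrants
    contribute equally because [tsum] is even in each coordinate, which gives the factor 4. *)
Lemma plancherel_le : (\int[leb2]_z (hatc z ^+ 2)%:E <=
  (8 * pi ^+ 2)%:E * \int[leb2]_x (h x ^+ 2)%:E)%E.
Proof.
have hatE z : hatc z = tint (true, true) z - tint (false, false) z.
  rewrite /tint -RintegralB//; try exact: hker.
  apply: eq_Rintegral => x _.
  by rewrite cosD /tker/= mulrBr.
have hat_le z : hatc z ^+ 2 <= 2 * tsum z.
  rewrite hatE /tsum.
  rewrite -(pair_bigA _ (fun a b => tint (a, b) z ^+ 2))/= !big_bool.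
  move: (tint (true, true) z) (tint (true, false) z) (tint (false, true) z) (tint (false, false) z).
  move=> a b c d; rewrite -subr_ge0.
  have -> : 2 * (a ^+ 2 + b ^+ 2 + (c ^+ 2 + d ^+ 2)) - (a - d) ^+ 2 =
    (a + d) ^+ 2 + 2 * (b ^+ 2 + c ^+ 2) by ring.
  by rewrite addr_ge0 ?sqr_ge0// mulr_ge0// addr_ge0 ?sqr_ge0.
have S1 z : tsum (- z.1, z.2) = tsum z by apply: eq_bigr => i _; rewrite tint_sqr_opp1.
have S2 z : tsum (z.1, - z.2) = tsum z by apply: eq_bigr => i _; rewrite tint_sqr_opp2.
pose H1 z : \bar R := (Q z + Q (- z.1, z.2)%R)%E.
have H10 z : (0 <= H1 z)%E by exact: adde_ge0.
have mQ1 : measurable_fun setT (fun z : R * R => Q (- z.1, z.2)%R).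
  by apply: (measurableT_comp mQ); apply: measurable_fun_pair => //; exact: measurableT_comp.
have mH1 : measurable_fun setT H1 by exact: emeasurable_funD.
have mH2 : measurable_fun setT (fun z : R * R => H1 (z.1, - z.2)%R).
  by apply: (measurableT_comp mH1); apply: measurable_fun_pair => //; exact: measurableT_comp.
have IH1 : (\int[leb2]_z H1 z = 2%:E * \int[leb2]_z Q z)%E.
  rewrite ge0_integralD// [X in (_ + X)%E](integral_reflect1 mQ Q0).
  by rewrite -mule2n -mule_natl.
have IH2 : (\int[leb2]_z (H1 z + H1 (z.1, - z.2)%R) = 4%:E * \int[leb2]_z Q z)%E.
  rewrite ge0_integralD// [X in (_ + X)%E](integral_reflect2 mH1 H10) IH1.
  rewrite -mule2n -mule_natl muleA -EFinM.
  by have -> : 2 * 2 = 4 :> R by lra.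
apply: (@le_trans _ _ (2%:E * \int[leb2]_z (H1 z + H1 (z.1, - z.2)%R)%E)%E).
  have sum0 z : (0 <= H1 z + H1 (z.1, - z.2)%R)%E by exact: adde_ge0.
  rewrite -ge0_integralZl//; last exact: emeasurable_funD.
  apply: le_integral_nonmeas => z; first by rewrite lee_fin sqr_ge0.
  apply: (@le_trans _ _ (2%:E * (tsum z)%:E)%E); first by rewrite -EFinM lee_fin.
  (* One of the four reflections of [z] lies in the closed first quadrant, and its summand alone
     already equals [tsum z]. *)
  have key (x y : \bar R) : (0 <= x)%E -> (0 <= y)%E -> ((tsum z)%:E <= x \/ (tsum z)%:E <= y)%E -> ((tsum z)%:E <= x + y)%E.
    move=> x0 y0 [h0|h0].
      by rewrite -[leLHS]adde0; exact: leeD.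
    by rewrite -[leLHS]add0e; exact: leeD.
  apply: lee_wpmul2l; first by rewrite lee_fin.
  apply: (@key _ _) => //.
  have [z20|z20] := leP 0 z.2; [left|right]; rewrite /H1/=; apply: (@key _ _) => //.
    have [z10|z10] := leP 0 z.1; [left|right]; rewrite /Q/= ?z20 ?z10 ?S1//.
    by rewrite oppr_ge0 (ltW z10).
  have [z10|z10] := leP 0 z.1; [left|right]; rewrite /Q/= !oppr_ge0 (ltW z20) ?z10 ?(ltW z10)/=.
    by rewrite S2.
  by rewrite -(S1 z) -(S2 (- z.1, z.2)%R).
rewrite IH2 muleA -EFinM.
have -> : 8 * pi ^+ 2 = (2 * 4) * pi ^+ 2 :> R by ring.
rewrite [in leRHS]EFinM -[in leRHS]muleA; apply: lee_wpmul2l => //.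
Qed.

End plancherel.

Lemma indic_ge0 T (R : realType) (A : set T) (x : T) : (0 <= (\1_A x : R)%:E)%E.
Proof. by rewrite lee_fin. Qed.

(** * Integrals of powers near 0 *)

Section power_integral.
Context {R : realType}.
Local Notation leb := (@lebesgue_measure R).

Lemma measurable_bool_natr d (T : measurableType d) (b : T -> bool) :
  measurable_fun setT b -> measurable_fun setT (fun z => (b z)%:R : R).
Proof.
move=> mb; rewrite (_ : (fun z => _) = (fun z => if b z then 1 else 0)).
  by apply: measurable_fun_ifT => //; exact: measurable_cst.
by apply/funext => z; case: (b z).
Qed.

Lemma continuous_powR_gt0 (a x : R) : 0 < x -> {for x, continuous (fun y : R => y `^ a)}.
Proof.
move=> x0; apply: differentiable_continuous; apply/derivable1_diffP.
by apply: derivable_powR; rewrite in_itv/= x0.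
Qed.

(** On [[e, X]] with e > 0 the substitution x^b / b carries the integral into the length of an
    interval; then e tends to 0. *)
Lemma integral_powR_le (b X : R) : 0 < b ->
  (\int[leb]_x ((0 < x <= X)%R%:R * x `^ (b - 1))%:E <= (b^-1 * X `^ b)%:E)%E.
Proof.
move=> b0.
have nn : (0 <= b^-1 * X `^ b) by rewrite mulr_ge0 ?powR_ge0 ?invr_ge0 ?ltW.
pose psi x := b^-1 * x `^ b.
have piece e : 0 < e -> (\int[leb]_(x in `[e, X]) (x `^ (b - 1))%:E <= (b^-1 * X `^ b)%:E)%E.
  move=> e0; have [Xe|eX] := ltP X e.
    rewrite set_itv_ge ?integral_set0 ?lee_fin// bnd_simp -ltNge//.
  have D x : e <= x <= X -> is_derive x 1 psi (x `^ (b - 1)).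
    move=> /andP[ex _]; have x0 := lt_le_trans e0 ex.
    have D := @is_derive1_powR R b x x0.
    have Z := @is_deriveZ R R R (fun y => @powR R y b) b^-1 x 1 _ D.
    have E : b^-1 * (b * x `^ (b - 1)) = x `^ (b - 1) by rewrite mulKf// gt_eqF.
    rewrite -[X in is_derive _ _ _ X]E; exact: Z.
  have C : {within `[e, X], continuous (fun y : R => @powR R y (b - 1))}.
    apply: continuous_in_subspaceT => x; rewrite inE/= in_itv/= => /andP[ex _].
    exact: continuous_powR_gt0 (lt_le_trans e0 ex).
  have mA : measurable_fun setT (fun y => (\1_(`[0, b^-1 * X `^ b]) y)%:E : \bar R).
    by apply/measurable_EFinP; exact: measurable_indic.
  have lebI (a c : R) : leb `[a, c]%classic = if a < c then (c - a)%:E else 0%E.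
    by rewrite lebesgue_measure_itv/= lte_fin.
  have I1 : (\int[leb]_x (\1_(`[0%R, (b^-1 * X `^ b)%R]) x)%:E <= (b^-1 * X `^ b)%:E)%E.
    rewrite integral_indic// setIT [leLHS](lebI _ _) subr0.
    by case: ifPn => // _; rewrite lee_fin.
  have I2 := @le_integral_change _ _ _ _ _ D C (fun x _ => powR_ge0 _ _) _ mA (fun x => indic_ge0 R _ x).
  apply: le_trans (le_trans I2 I1).
  rewrite le_eqVlt; apply/orP; left; apply/eqP; apply: eq_integral => x.
  rewrite inE/= in_itv/= => /andP[ex xX]; rewrite indicE mem_set ?mul1e//= in_itv/=.
  have x0 := lt_le_trans e0 ex.
  rewrite mulr_ge0 ?powR_ge0 ?invr_ge0 ?(ltW b0)//= ler_pM2l ?invr_gt0//.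
  by apply: ge0_ler_powR; rewrite ?nnegrE ?(ltW b0) ?(ltW x0)// (le_trans (ltW x0)).
pose F n := `[n.+1%:R^-1, X]%classic : set R.
have Fm n : measurable (F n) by exact: measurable_itv.
have Fh : {homo F : n m / (n <= m)%N >-> (n <= m)%O}.
  move=> n k nk; rewrite subsetEset => x; rewrite /F/= !in_itv/= => /andP[nx ->]; rewrite andbT.
  by apply: le_trans nx; rewrite lef_pV2 ?posrE// ler_nat.
have mp : measurable_fun setT (fun x : R => (x `^ (b - 1))%:E).
  by apply/measurable_EFinP; exact: measurable_powR.
have cv := @ge0_nondecreasing_set_cvg_integral _ (measurableTypeR R) R F (fun x => (x `^ (b - 1))%:E) leb
  Fh Fm (fun i => measurable_funTS mp) (fun i x _ => powR_ge0 x (b - 1)).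
have UF : \bigcup_i F i = [set x | 0 < x <= X].
  apply/seteqP; split=> x /=.
    by move=> [n _]; rewrite /F/= in_itv/= => /andP[nx ->]; rewrite andbT (lt_le_trans _ nx)// invr_gt0.
  move=> /andP[x0 xX]; have [n nx] := ltr_add_invr x0.
  by exists n => //; rewrite /F/= in_itv/= xX andbT ltW//; move: nx; rewrite add0r.
have E : (\int[leb]_x ((0 < x <= X)%R%:R * x `^ (b - 1))%:E =
  \int[leb]_(x in \bigcup_i F i) (x `^ (b - 1))%:E)%E.
  rewrite UF [RHS]integral_mkcond; apply: eq_integral => x _; rewrite patchE.
  have [xX|xX] := boolP (0 < x <= X); first by rewrite mem_set// mul1r.
  by rewrite memNset ?mul0r//; exact/negP.
rewrite E -(cvg_lim _ cv)//; apply: lime_le; first by apply/cvg_ex; eexists; exact: cv.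
by apply: nearW => n; apply: piece; rewrite invr_gt0.
Qed.

End power_integral.

(** * Marcinkiewicz interpolation between L^1 -> L^oo and L^2 -> L^2 *)

Section marcinkiewicz.
Context {d} {T : measurableType d} {R : realType}.
Variable m : {sigma_finite_measure set T -> \bar R}.
Local Notation leb := (@lebesgue_measure R).
Local Notation lebR := (leb : {sigma_finite_measure set (measurableTypeR R) -> \bar R}).
Variables (r s : R).
Hypotheses (r1 : 1 < r) (s2 : 2 < s) (rs : (r - 1) * (s - 1) = 1).

(** A one-sided layer-cake formula: the heights between y/2 and y alone already give (y/2)^s. *)
Lemma powR_le_layer (y : R) : 0 <= y ->
  ((y `^ s)%:E <= (2 `^ s)%:E * \int[leb]_t ((0 < t < y)%R%:R * t `^ (s - 1))%:E)%E.
Proof.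
rewrite le_eqVlt => /orP[/eqP<-|y0].
  rewrite powR0 ?gt_eqF ?(lt_trans _ s2)//; apply: mule_ge0; first by rewrite lee_fin powR_ge0.
  by apply: integral_ge0 => t _; rewrite lee_fin mulr_ge0 ?powR_ge0.
have -> : y `^ s = 2 `^ s * (y / 2 * (y / 2) `^ (s - 1)).
  rewrite mulr_powRB1 ?divr_ge0 ?(ltW y0) ?(lt_trans _ s2)// -powRM ?divr_ge0 ?(ltW y0)//.
  by rewrite mulrC divfK.
rewrite [leLHS]EFinM; apply: lee_wpmul2l; first by rewrite lee_fin powR_ge0.
have -> : (y / 2 * (y / 2) `^ (s - 1))%:E =
    (\int[leb]_t ((y / 2) `^ (s - 1) * \1_(`]y / 2, y[) t)%:E)%E.
  under eq_integral do rewrite EFinM.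
  rewrite ge0_integralZl//; last 2 first.
  - by apply/measurable_EFinP; exact: measurable_indic.
  - by rewrite lee_fin powR_ge0.
  have lebI (a c : R) : leb `]a, c[%classic = if a < c then (c - a)%:E else 0%E.
    by rewrite lebesgue_measure_itv/= lte_fin.
  rewrite integral_indic// setIT [X in (_ * X)%E](lebI _ _) ifT; last by lra.
  by rewrite -EFinM mulrC; congr (_ * _)%:E; lra.
apply: le_integral_nonmeas => t; first by rewrite lee_fin mulr_ge0 ?powR_ge0.
rewrite lee_fin indicE; case: (boolP (t \in _)) => [|_]; last by rewrite mulr0 mulr_ge0 ?powR_ge0.
rewrite inE/= in_itv/= => /andP[yt ty]; rewrite mulr1.
have t0 : 0 < t by lra.
rewrite t0 ty/= mul1r; apply: ge0_ler_powR.
- by rewrite subr_ge0 (le_trans _ (ltW s2))// ler1n.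
- by rewrite nnegrE divr_ge0// ltW.
- by rewrite nnegrE ltW.
- exact: ltW.
Qed.

(** The relation [rs] says that [r] and [s] are conjugate. The hypothesis describes the splitting of
    [h] at height t: the part above it contributes at most N t^(1-r) in sup norm, the part below it
    a function [Q] controlled in L^2. *)
Lemma marcinkiewicz (N C2 : R) (Psi h : T -> R) : 0 < N -> 0 <= C2 ->
  measurable_fun setT Psi -> (forall z, 0 <= Psi z) ->
  measurable_fun setT h -> (forall z, 0 <= h z) ->
  (forall t, 0 < t -> exists Q : T -> \bar R,
    [/\ measurable_fun setT Q, forall z, (0 <= Q z)%E,
       forall z, ((Psi z)%:E <= (N * t `^ (1 - r))%:E + Q z)%E &
       (\int[m]_z (Q z * Q z) <= C2%:E * \int[m]_z ((h z <= t)%R%:R * h z ^+ 2)%:E)%E]) ->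
  (\int[m]_z (Psi z `^ s)%:E <=
   (2 `^ s * (4 * C2) * ((s - 2)^-1 * (2 * N) `^ (s - 2)))%:E *
   \int[m]_z (h z `^ r)%:E)%E.
Proof.
move=> N0 C20 mPsi Psi0 mh h0 split.
have c0 : 0 <= 2 `^ s * (4 * C2) by rewrite mulr_ge0 ?powR_ge0 ?mulr_ge0.
pose K (w : T * measurableTypeR R) := ((0 < w.2) && (w.2 < Psi w.1))%R%:R * w.2 `^ (s - 1).
have m2 : measurable_fun setT (fun w : T * measurableTypeR R => w.2 : R) by exact: measurable_snd.
have mp2 a : measurable_fun setT (fun w : T * measurableTypeR R => (w.2 : R) `^ a).
  exact: (measurableT_comp (measurable_powR a) m2).
have mPsi1 : measurable_fun setT (fun w : T * measurableTypeR R => Psi w.1).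
  exact: (measurableT_comp mPsi measurable_fst).
have mh1 : measurable_fun setT (fun w : T * measurableTypeR R => h w.1).
  exact: (measurableT_comp mh measurable_fst).
have mpos : measurable_fun setT (fun w : T * measurableTypeR R => 0 < (w.2 : R)).
  by apply: measurable_fun_ltr => //; exact: measurable_cst.
have mK : measurable_fun setT (fun w => (K w)%:E).
  apply/measurable_EFinP; apply: measurable_funM => //.
  apply: measurable_bool_natr; apply: measurable_and => //.
  exact: measurable_fun_ltr.
have K0 w : (0 <= (K w)%:E)%E by rewrite lee_fin mulr_ge0 ?powR_ge0.
pose G (w : T * measurableTypeR R) :=
  ((0 < w.2) && (w.2 * h w.1 `^ (r - 1) <= 2 * N))%R%:R * (h w.1 ^+ 2 * w.2 `^ (s - 2 - 1)).
have mG : measurable_fun setT (fun w => (G w)%:E).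
  apply/measurable_EFinP; apply: measurable_funM; last first.
    apply: measurable_funM; last exact: mp2.
    exact: measurable_funX.
  apply: measurable_bool_natr; apply: measurable_and => //.
  apply: measurable_fun_ler; last exact: measurable_cst.
  apply: measurable_funM => //.
  exact: (measurableT_comp (measurable_powR (r - 1)) mh1).
have G0 w : (0 <= (G w)%:E)%E by rewrite lee_fin mulr_ge0 ?mulr_ge0 ?sqr_ge0 ?powR_ge0.
have level t : (\int[m]_z (K (z, t))%:E <= (4 * C2)%:E * \int[m]_z (G (z, t))%:E)%E.
  have [t0|t0] := leP t 0.
    rewrite (_ : (fun z => (K (z, t))%:E) = cst 0%E); last first.
      by apply/funext => z; rewrite /K/= ltNge t0 mul0r.
    rewrite integral0; apply: mule_ge0; first by rewrite lee_fin mulr_ge0.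
    by apply: integral_ge0 => z _.
  (* The splitting height at which the bounded part equals t/2, so that Q >= t/2 wherever Psi > t,
     and Chebyshev's inequality applies to Q^2. *)
  pose u := (2 * N / t) `^ (r - 1)^-1.
  have r10 : 0 < r - 1 by rewrite subr_gt0.
  have Nt : 0 < 2 * N / t by rewrite divr_gt0// mulr_gt0.
  have u0 : 0 < u by exact: powR_gt0.
  have ur : u `^ (r - 1) = 2 * N / t.
    by rewrite /u -powRrM mulVf ?gt_eqF// powRr1// ltW.
  have [Q [mQ Q0 PQ IQ]] := split u u0.
  have NU : N * u `^ (1 - r) = t / 2.
    rewrite -opprB powRN ur; field; rewrite !gt_eqF//.
  apply: (@le_trans _ _ ((4 * t `^ (s - 2 - 1))%:E * \int[m]_z (Q z * Q z))%E).
    have mQQ : measurable_fun setT (fun z => (Q z * Q z)%E) by exact: emeasurable_funM.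
    have QQ0 z : (0 <= Q z * Q z)%E by exact: mule_ge0.
    rewrite -ge0_integralZl//; last by rewrite lee_fin mulr_ge0// powR_ge0.
    apply: le_integral_nonmeas => z; first exact: K0.
    rewrite /K/= t0/=; have [tP|tP] := ltP t (Psi z); last first.
      by rewrite mul0r; apply: mule_ge0 => //; rewrite lee_fin mulr_ge0// powR_ge0.
    have Qt : ((t / 2)%:E <= Q z)%E.
      have := PQ z; rewrite NU; case: (Q z) (Q0 z) => [q||]//; last by move=> _ _; exact: leey.
      by rewrite -EFinD !lee_fin => _; lra.
    rewrite mul1r; have -> : t `^ (s - 1) = 4 * t `^ (s - 2 - 1) * (t / 2 * (t / 2)) :> R.
      have -> : s - 1 = s - 2 - 1 + 2%:R by rewrite -addrA; ring.
      rewrite powRD; last by rewrite (gt_eqF t0) implybT.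
      by rewrite powR_mulrn ?(ltW t0)//; field.
        rewrite [leLHS]EFinM; apply: lee_wpmul2l; first by rewrite lee_fin mulr_ge0 ?powR_ge0.
    by rewrite EFinM; apply: lee_pmul => //; rewrite lee_fin; lra.
  have c1 : (0 <= (4 * t `^ (s - 2 - 1))%:E :> \bar R)%E by rewrite lee_fin mulr_ge0 ?powR_ge0.
  apply: (le_trans (lee_wpmul2l c1 IQ)).
  rewrite muleA -EFinM mulrAC (EFinM (4 * C2)) -muleA.
  apply: lee_wpmul2l; first by rewrite lee_fin mulr_ge0.
  have mhu : measurable_fun setT (fun z => ((h z <= u)%R%:R * h z ^+ 2)%:E : \bar R).
    apply/measurable_EFinP; apply: measurable_funM; last exact: measurable_funX.
    by apply: measurable_bool_natr; apply: measurable_fun_ler => //; exact: measurable_cst.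
  rewrite -ge0_integralZl//; last 2 first.
  - by move=> z _; rewrite lee_fin mulr_ge0 ?sqr_ge0.
  - by rewrite lee_fin powR_ge0.
  apply: le_integral_nonmeas => z.
    by rewrite -EFinM lee_fin mulr_ge0 ?powR_ge0// mulr_ge0 ?sqr_ge0.
  rewrite -EFinM lee_fin /G/= t0/=; have [hu|hu] := leP (h z) u; last first.
    by rewrite mul0r mulr0 mulr_ge0// mulr_ge0 ?sqr_ge0 ?powR_ge0.
  have -> : t * h z `^ (r - 1) <= 2 * N.
    rewrite mulrC -ler_pdivlMr// -ur; apply: ge0_ler_powR => //.
    - exact: ltW.
    - by rewrite nnegrE.
    - by rewrite nnegrE ltW.
  by rewrite !mul1r mulrC.
apply: (@le_trans _ _ (\int[m]_z ((2 `^ s)%:E * \int[lebR]_t (K (z, t))%:E))%E).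
  apply: le_integral_nonmeas => z; first by rewrite lee_fin powR_ge0.
  exact: powR_le_layer.
have mI : measurable_fun setT (fun z => (\int[lebR]_t (K (z, t))%:E)%E).
  exact: (measurable_integral12 lebR mK K0).
have c2s : (0 <= (2 `^ s)%:E :> \bar R)%E by rewrite lee_fin powR_ge0.
have I0 z : (0 <= \int[lebR]_t (K (z, t))%:E)%E by apply: integral_ge0 => t _; exact: K0.
have I0' t : (0 <= \int[m]_z (K (z, t))%:E)%E by apply: integral_ge0 => z _; exact: K0.
have J0 t : (0 <= \int[m]_z (G (z, t))%:E)%E by apply: integral_ge0 => z _; exact: G0.
have J0' z : (0 <= \int[lebR]_t (G (z, t))%:E)%E by apply: integral_ge0 => t _; exact: G0.
have mJ : measurable_fun setT (fun t => (\int[m]_z (G (z, t))%:E)%E).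
  exact: (measurable_integral21 m mG G0).
rewrite ge0_integralZl//.
rewrite -(integral_pmeasure12 m lebR mK K0) (integral_pmeasure21 m lebR mK K0).
apply: (@le_trans _ _ ((2 `^ s)%:E * ((4 * C2)%:E * \int[pmeasure m lebR]_w (G w)%:E))%E).
  apply: lee_wpmul2l; first by rewrite lee_fin powR_ge0.
  rewrite (integral_pmeasure21 m lebR mG G0) -ge0_integralZl//; last by rewrite lee_fin mulr_ge0.
  apply: le_integral_nonmeas => t; last exact: level.
  exact: I0'.
rewrite muleA -EFinM [in leRHS]EFinM -[in leRHS]muleA; apply: lee_wpmul2l; first by rewrite lee_fin.
have s20 : 0 < s - 2 by rewrite subr_gt0.
have c2 : 0 <= (s - 2)^-1 * (2 * N) `^ (s - 2) by rewrite mulr_ge0 ?powR_ge0// invr_ge0 ltW.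
have mhr : measurable_fun setT (fun z => (h z `^ r)%:E : \bar R).
  by apply/measurable_EFinP; exact: (measurableT_comp (measurable_powR r) mh).
rewrite (integral_pmeasure12 m lebR mG G0) -ge0_integralZl//; last first.
  by move=> z _; rewrite lee_fin powR_ge0.
apply: le_integral_nonmeas => z; first exact: J0'.
have := h0 z; rewrite le_eqVlt => /orP[/eqP hz|hz].
  rewrite (_ : (fun t => (G (z, t))%:E) = cst 0%E); last first.
    by apply/funext => t; rewrite /G/= -hz expr0n/= mul0r mulr0.
  by rewrite integral0 -EFinM lee_fin mulr_ge0// powR_ge0.
(* The condition that [h z] lies below the splitting height, solved for t. Integrating t^(s-3) up to
   [X] supplies the missing power of [h z]. *)
pose X := 2 * N * h z `^ (1 - r).
have X0 : 0 <= X by rewrite mulr_ge0 ?powR_ge0// mulr_ge0// ltW.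
have hr0 : 0 < h z `^ (r - 1) by exact: powR_gt0.
have GE t : (G (z, t))%:E = ((h z ^+ 2)%:E * ((0 < t <= X)%R%:R * t `^ (s - 2 - 1))%:E)%E.
  rewrite -EFinM /G/= mulrCA; congr (_ * (_ * _))%:E; congr (nat_of_bool _)%:R; congr (_ && _).
  by rewrite -ler_pdivlMr// /X -powRN opprB.
under eq_integral do rewrite GE.
have mt : measurable_fun setT (fun t : measurableTypeR R => ((0 < t <= X)%R%:R * (t : R) `^ (s - 2 - 1))%:E : \bar R).
  apply/measurable_EFinP; apply: measurable_funM; last exact: measurable_powR.
  apply: measurable_bool_natr; apply: measurable_and.
    by apply: measurable_fun_ltr => //; exact: measurable_cst.
  by apply: measurable_fun_ler => //; exact: measurable_cst.
have t00 (t : R) : (0 <= ((0 < t <= X)%R%:R * t `^ (s - 2 - 1))%:E :> \bar R)%E.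
  by rewrite lee_fin mulr_ge0 ?powR_ge0.
rewrite ge0_integralZl//; last by rewrite lee_fin sqr_ge0.
apply: (le_trans (lee_wpmul2l _ (integral_powR_le X s20))); first by rewrite lee_fin sqr_ge0.
(* By conjugacy (r-1)(s-2) = 2 - r, so the exponents add up to r. *)
have hE : h z ^+ 2 * (h z `^ (1 - r)) `^ (s - 2) = h z `^ r.
  rewrite -powRrM -(powR_mulrn 2 (h0 z)) -powRD; last by rewrite (gt_eqF hz) implybT.
  have -> : (1 - r) * (s - 2) = r - 1 - (r - 1) * (s - 1) by ring.
  by rewrite rs; congr (_ `^ _); lra.
rewrite -!EFinM lee_fin /X powRM ?powR_ge0 ?mulr_ge0 ?(ltW N0)// -hE.
by rewrite le_eqVlt; apply/orP; left; apply/eqP; ring.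
Qed.

End marcinkiewicz.

(** * The double strong maximal function of a cosine transform *)

Section maxhat.
Context {R : realType}.
Local Notation leb := (@lebesgue_measure R).
Implicit Types (f g : R * R -> \bar R) (l : seq (R * R)) (h : R * R -> R).

Lemma avg_le_add (e c z : R) (f g : R -> \bar R) : 0 <= c ->
  (forall x, (0 <= f x)%E) -> measurable_fun setT g -> (forall x, (0 <= g x)%E) ->
  (forall x, (f x <= c%:E + g x)%E) -> (avg e f z <= (pi * c)%:E + avg e g z)%E.
Proof.
move=> c0 f0 mg g0 fg; rewrite /avg.
have mp : measurable_fun setT (fun s : R => (poisson 1 s)%:E : \bar R).
  apply/measurable_EFinP; exact: measurable_poisson.
have p0 (s : R) : (0 <= (poisson 1 s)%:E :> \bar R)%E by rewrite lee_fin ltW// poisson_gt0.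
have mg' : measurable_fun setT (fun s : R => g (z + e * s)).
  apply: (measurableT_comp mg).
  by under eq_fun do rewrite addrC; exact: measurable_affine.
have mpg : measurable_fun setT (fun s : R => ((poisson 1 s)%:E * g (z + e * s)%R)%E).
  exact: emeasurable_funM.
have pg0 (s : R) : (0 <= (poisson 1 s)%:E * g (z + e * s)%R)%E by exact: mule_ge0.
have mc : measurable_fun setT (fun s : R => (c%:E * (poisson 1 s)%:E : \bar R)%E).
  by apply: emeasurable_funM => //; exact: measurable_cst.
have cp0 (s : R) : (0 <= c%:E * (poisson 1 s)%:E :> \bar R)%E by rewrite mule_ge0.
have -> : (pi * c)%:E = (\int[leb]_s (c%:E * (poisson 1 s)%:E) : \bar R)%E.
  by rewrite ge0_integralZl//; rewrite integral_poisson1 -EFinM mulrC.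
rewrite -ge0_integralD//; apply: le_integral_nonmeas => s; first exact: mule_ge0.
apply: (@le_trans _ _ ((poisson 1 s)%:E * (c%:E + g (z + e * s)%R))%E).
  exact: lee_wpmul2l.
rewrite ge0_muleDr// [in leLHS]muleC//.
Qed.

Lemma avg2_le_add (e : R * R) (c : R) z f g : 0 <= c ->
  (forall x, (0 <= f x)%E) -> measurable_fun setT g -> (forall x, (0 <= g x)%E) ->
  (forall x, (f x <= c%:E + g x)%E) -> (avg2 e f z <= (pi ^+ 2 * c)%:E + avg2 e g z)%E.
Proof.
move=> c0 f0 mg g0 fg; rewrite /avg2 expr2 -mulrA.
apply: avg_le_add => [|x||x|x].
- by rewrite mulr_ge0// pi_ge0.
- exact: avg_ge0.
- have m1 := measurable_avg_param2 e.2 mg g0.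
  exact: (measurableT_comp m1 (measurable_pair2 z.2)).
- exact: avg_ge0.
- apply: avg_le_add => //; exact: (measurableT_comp mg (measurable_pair1 x)).
Qed.

Definition maxavg l f := maxfun (avg2^~ f) l.

Lemma maxavg_ge0 l f z : (0 <= maxavg l f z)%E. Proof. exact: maxfun_ge0. Qed.

Lemma measurable_maxavg l f : measurable_fun setT f -> (forall z, (0 <= f z)%E) ->
  measurable_fun setT (maxavg l f).
Proof. by move=> mf f0; apply: measurable_maxfun => e; exact: measurable_avg2. Qed.

Lemma maxavg_le_add l (c : R) z f g : 0 <= c ->
  (forall x, (0 <= f x)%E) -> measurable_fun setT g -> (forall x, (0 <= g x)%E) ->
  (forall x, (f x <= c%:E + g x)%E) ->
  (maxavg l f z <= (pi ^+ 2 * c)%:E + maxavg l g z)%E.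
Proof.
move=> c0 f0 mg g0 fg; apply: maxfun_le => [|e el].
  by rewrite adde_ge0 ?maxavg_ge0// lee_fin mulr_ge0 ?sqr_ge0.
apply: (le_trans (avg2_le_add e z c0 f0 mg g0 fg)).
by apply: leeD => //; exact: (@maxfun_ge _ _ _ _ (avg2^~ g)).
Qed.

(** This is the Phi of the overview. There are two maximal operators because the two points of a
    pair carry independent dilations; [l2] will be the negative of [l1]. *)
Definition maxhat l1 l2 h := maxavg l1 (maxavg l2 (fun z => `|hatc h z|%:E)).

Lemma measurable_hatc h : measurable_fun setT h -> measurable_fun setT (hatc h).
Proof.
move=> mh; rewrite /hatc; apply: (@measurable_Rintegral_param _ _ _ _ _ leb2
  (fun w : (R * R) * (R * R) => h w.2 * cos (w.1.1 * w.2.1 + w.1.2 * w.2.2))).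
have m1 : measurable_fun setT (fun w : (R * R) * (R * R) => w.1.1).
  exact: (measurableT_comp measurable_fst measurable_fst).
have m2 : measurable_fun setT (fun w : (R * R) * (R * R) => w.1.2).
  exact: (measurableT_comp measurable_snd measurable_fst).
have m3 : measurable_fun setT (fun w : (R * R) * (R * R) => w.2.1).
  exact: (measurableT_comp measurable_fst measurable_snd).
have m4 : measurable_fun setT (fun w : (R * R) * (R * R) => w.2.2).
  exact: (measurableT_comp measurable_snd measurable_snd).
apply: measurable_funM; first exact: (measurableT_comp mh measurable_snd).
have mc : measurable_fun setT (@cos R).
  by apply: continuous_measurable_fun; exact: continuous_cos.
apply: (measurableT_comp mc).
by apply: measurable_funD; apply: measurable_funM.
Qed.

Lemma measurable_abs_hatc h : measurable_fun setT h ->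
  measurable_fun setT (fun z => `|hatc h z|%:E : \bar R).
Proof.
move=> mh; apply/measurable_EFinP; apply: measurableT_comp => //.
exact: measurable_hatc.
Qed.

Lemma measurable_maxhat l1 l2 h : measurable_fun setT h -> measurable_fun setT (maxhat l1 l2 h).
Proof.
move=> mh; apply: measurable_maxavg => [|z]; last exact: maxavg_ge0.
by apply: measurable_maxavg => //; exact: measurable_abs_hatc.
Qed.

(** The transform of [h1] is at most the integral of [h1], and four one-dimensional averages of mass
    pi act on it, whence pi^4. *)
Lemma maxhat_le_add l1 l2 h h1 h2 z : L1 leb2 h1 -> L1 leb2 h2 ->
  (forall x, h x = h1 x + h2 x) -> (forall x, 0 <= h1 x) ->
  (maxhat l1 l2 h z <= (pi ^+ 4 * \int[leb2]_x h1 x)%:E + maxhat l1 l2 h2 z)%E.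
Proof.
move=> L1h1 L1h2 hE h10.
have mh2 := L1_measurable L1h2.
have c0 : 0 <= \int[leb2]_x h1 x by apply: Rintegral_ge0 => x _.
have c1 : 0 <= pi ^+ 2 * \int[leb2]_x h1 x by rewrite mulr_ge0 ?sqr_ge0.
have -> : pi ^+ 4 * \int[leb2]_x h1 x = pi ^+ 2 * (pi ^+ 2 * \int[leb2]_x h1 x) by ring.
have m2 := measurable_abs_hatc mh2.
apply: maxavg_le_add => // [x||x|x]; try exact: maxavg_ge0.
  exact: measurable_maxavg.
apply: maxavg_le_add => // y.
have cosb (w : R * R) : `|cos (y.1 * w.1 + y.2 * w.2)| <= 1 by rewrite ler_norml cos_geN1 cos_le1.
have mcos : measurable_fun setT (fun x : R * R => cos (y.1 * x.1 + y.2 * x.2)).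
  have mc : measurable_fun setT (@cos R).
    by apply: continuous_measurable_fun; exact: continuous_cos.
  apply: (measurableT_comp mc); apply: measurable_funD; apply: measurable_funM => //; exact: measurable_cst.
have La := L1_bounded_prod L1h1 mcos cosb.
have Lb := L1_bounded_prod L1h2 mcos cosb.
have -> : hatc h y = hatc h1 y + hatc h2 y.
  rewrite /hatc -RintegralD//; apply: eq_Rintegral => w _; rewrite hE; ring.
rewrite -EFinD lee_fin; apply: (le_trans (ler_normD _ _)); rewrite lerD2r.
apply: (le_trans (le_normr_Rintegral measurableT La)); apply: le_Rintegral => //.
- exact: (L1_norm La).
- by move=> w _; rewrite normrM (ger0_norm (h10 w)) ler_piMr.
Qed.

Lemma maxhat_sqr_le l1 l2 h : L1 leb2 h ->
  (forall e, e \in l1 -> (e.1 != 0) && (e.2 != 0)) ->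
  (forall e, e \in l2 -> (e.1 != 0) && (e.2 != 0)) ->
  (\int[leb2]_z (maxhat l1 l2 h z * maxhat l1 l2 h z) <=
    ((4 * (4 * pi) ^+ 2) ^+ 4 * (8 * pi ^+ 2))%:E * \int[leb2]_z (h z ^+ 2)%:E)%E.
Proof.
move=> Lh l10 l20; have mh := L1_measurable Lh.
have m2 := measurable_abs_hatc mh.
have mm : measurable_fun setT (maxavg l2 (fun z => `|hatc h z|%:E)) by exact: measurable_maxavg.
have c0 : 0 <= (4 * (4 * pi) ^+ 2) ^+ 2 :> R by exact: sqr_ge0.
apply: (le_trans (maxfun_avg2_le l10 mm (maxavg_ge0 l2 _))).
have -> : (4 * (4 * pi) ^+ 2) ^+ 4 * (8 * pi ^+ 2) =
  (4 * (4 * pi) ^+ 2) ^+ 2 * ((4 * (4 * pi) ^+ 2) ^+ 2 * (8 * pi ^+ 2)) :> R by ring.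
rewrite (EFinM ((4 * (4 * pi) ^+ 2) ^+ 2)) -muleA.
apply: lee_wpmul2l; first by rewrite lee_fin.
have abs0 z : (0 <= `|hatc h z|%:E :> \bar R)%E by rewrite lee_fin.
apply: (le_trans (maxfun_avg2_le l20 m2 abs0)).
rewrite (EFinM ((4 * (4 * pi) ^+ 2) ^+ 2)) -muleA.
apply: lee_wpmul2l; first by rewrite lee_fin.
apply: le_trans (plancherel_le Lh); apply: le_integral_nonmeas => z.
  by rewrite -EFinM lee_fin mulr_ge0.
by rewrite -EFinM lee_fin -expr2 real_normK// num_real.
Qed.

Definition maxhat_const (s : R) :=
  2 `^ s * (4 * ((4 * (4 * pi) ^+ 2) ^+ 4 * (8 * pi ^+ 2))) *
  ((s - 2)^-1 * (2 * pi ^+ 4) `^ (s - 2)).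

(** Finiteness at every point, so that [fine] loses nothing below. *)
Lemma maxhat_fin l1 l2 h z : L1 leb2 h -> (forall x, 0 <= h x) ->
  (maxhat l1 l2 h z <= (pi ^+ 4 * \int[leb2]_x h x)%:E)%E.
Proof.
move=> Lh h0.
have L0 : L1 leb2 (fun _ : R * R => 0 : R) by exact: integrable0.
apply: (le_trans (maxhat_le_add l1 l2 z Lh L0 _ h0)) => [x|]; first by rewrite addr0.
rewrite (_ : maxhat _ _ _ _ = 0%E) ?adde0//.
have h00 : (fun z : R * R => `|hatc (fun=> 0) z|%:E) = (fun=> 0%E : \bar R).
  apply/funext => x; rewrite /hatc; under eq_Rintegral do rewrite mul0r.
  by rewrite Rintegral_cst// mul0r normr0.
have a0 (l : seq (R * R)) : maxavg l (fun=> 0%E) = (fun=> 0%E : \bar R).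
  apply/funext => x; apply/eqP; rewrite eq_le maxavg_ge0 andbT.
  apply: maxfun_le => // e _; rewrite /avg2 /avg.
  under eq_integral do [under eq_integral do rewrite mule0; rewrite integral0 mule0].
  by rewrite integral0.
by rewrite /maxhat h00 !a0.
Qed.

(** Since s/r = s - 1 for conjugate exponents, the right side is the s-th power of the bound W^(1/r)
    for the norm of [h], up to a constant. *)
Lemma maxhat_le (r s : R) l1 l2 h (W : R) : 1 < r -> 2 < s -> (r - 1) * (s - 1) = 1 ->
  (forall e, e \in l1 -> (e.1 != 0) && (e.2 != 0)) ->
  (forall e, e \in l2 -> (e.1 != 0) && (e.2 != 0)) ->
  L1 leb2 h -> (forall x, 0 <= h x) -> 0 <= W ->
  (\int[leb2]_z (h z `^ r)%:E <= W%:E)%E ->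
  (\int[leb2]_z (fine (maxhat l1 l2 h z) `^ s)%:E <= (maxhat_const s * W `^ (s - 1))%:E)%E.
Proof.
move=> r1 s2 rs l10 l20 Lh h0 W0 hW; have mh := L1_measurable Lh.
have pi40 : 0 < pi ^+ 4 :> R by rewrite exprn_gt0// pi_gt0.
have mm := measurable_maxhat l1 l2 mh.
have fin z : maxhat l1 l2 h z \is a fin_num.
  by rewrite ge0_fin_numE ?maxavg_ge0// (le_lt_trans (maxhat_fin l1 l2 z Lh h0))// ltry.
(* Interpolation asks for a positive [N]. If W = 0 any positive value serves, because the resulting
   bound is multiplied by [W]. *)
pose N := if W == 0 then 1 else pi ^+ 4 * W.
have N0 : 0 < N.
  by rewrite /N; case: eqP => // /eqP W00; rewrite mulr_gt0// lt_def W00.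
have NW : pi ^+ 4 * W <= N by rewrite /N; case: eqP => [->|//]; rewrite mulr0.
have C20 : 0 <= (4 * (4 * pi) ^+ 2) ^+ 4 * (8 * pi ^+ 2) :> R.
  apply: mulr_ge0; last by apply: mulr_ge0 => //; exact: sqr_ge0.
  by apply: exprn_ge0; apply: mulr_ge0 => //; exact: sqr_ge0.
have mr : measurable_fun setT (fun z => (h z `^ r)%:E : \bar R).
  by apply/measurable_EFinP; exact: (measurableT_comp (measurable_powR r) mh).
have M := @marcinkiewicz _ _ R leb2 r s r1 s2 rs N _ (fun z => fine (maxhat l1 l2 h z)) h N0 C20 _ _ mh h0.
have {M} := M (measurableT_comp (@fine_measurable R setT measurableT) mm) (fun z => fine_ge0 (maxavg_ge0 _ _ z)).
move=> M; apply: (le_trans (M _)); last first.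
  have A0 : 0 <= 2 `^ s * (4 * ((4 * (4 * pi) ^+ 2) ^+ 4 * (8 * pi ^+ 2))) :> R.
    by apply: mulr_ge0; [exact: powR_ge0|exact: mulr_ge0].
  apply: (@le_trans _ _ ((2 `^ s * (4 * ((4 * (4 * pi) ^+ 2) ^+ 4 * (8 * pi ^+ 2))) *
      ((s - 2)^-1 * (2 * N) `^ (s - 2)))%:E * W%:E)%E).
    apply: lee_wpmul2l => //; rewrite lee_fin; apply: mulr_ge0 => //.
    by apply: mulr_ge0; [rewrite invr_ge0 subr_ge0 ltW|exact: powR_ge0].
  rewrite -EFinM lee_fin /maxhat_const /N; case: eqP => [->|/eqP Wn0].
    by rewrite mulr0 powR0 ?mulr0// gt_eqF// subr_gt0 (lt_trans _ s2)// ltr1n.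
  have -> : 2 * (pi ^+ 4 * W) = 2 * pi ^+ 4 * W by rewrite mulrA.
  rewrite powRM//; last by rewrite mulr_ge0// ltW.
  have <- : W * W `^ (s - 2) = W `^ (s - 1).
    have -> : s - 2 = s - 1 - 1 by rewrite -addrA; congr (_ + _); lra.
    by rewrite mulr_powRB1// subr_gt0 (lt_trans _ s2)// ltr1n.
  by rewrite le_eqVlt; apply/orP; left; apply/eqP; ring.
move=> t t0.
pose h2 x := (h x <= t)%R%:R * h x; pose h1 x := (t < h x)%R%:R * h x.
have mle : measurable_fun setT (fun x => (h x <= t)%R%:R : R).
  apply: measurable_bool_natr; apply: measurable_fun_ler => //; exact: measurable_cst.
have mlt : measurable_fun setT (fun x => (t < h x)%R%:R : R).
  apply: measurable_bool_natr; apply: measurable_fun_ltr => //; exact: measurable_cst.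
have b1 (b : bool) : `|b%:R : R| <= 1 by case: b; rewrite ?normr1 ?normr0.
have L2 : L1 leb2 h2.
  by rewrite /h2; under eq_fun do rewrite mulrC; apply: (L1_bounded_prod Lh mle) => x.
have L1' : L1 leb2 h1.
  by rewrite /h1; under eq_fun do rewrite mulrC; apply: (L1_bounded_prod Lh mlt) => x.
have h10 x : 0 <= h1 x by rewrite mulr_ge0.
have hE x : h x = h1 x + h2 x.
  by rewrite /h1 /h2; case: leP => _; rewrite ?mul1r ?mul0r ?add0r ?addr0.
exists (maxhat l1 l2 h2); split.
- exact: measurable_maxhat (L1_measurable L2).
- by move=> z; exact: maxavg_ge0.
- move=> z; rewrite fineK//; apply: (le_trans (maxhat_le_add l1 l2 z L1' L2 hE h10)).
  apply: leeD => //; rewrite lee_fin.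
  apply: (@le_trans _ _ (pi ^+ 4 * W * t `^ (1 - r))); last by rewrite ler_wpM2r ?powR_ge0.
  rewrite -mulrA ler_wpM2l ?(ltW pi40)// -lee_fin Rintegral_EFin//.
  apply: (@le_trans _ _ ((t `^ (1 - r))%:E * \int[leb2]_z (h z `^ r)%:E)%E); last first.
    by rewrite mulrC EFinM lee_wpmul2l// lee_fin powR_ge0.
  rewrite -ge0_integralZl//; last 2 first.
  - by move=> x _; rewrite lee_fin powR_ge0.
  - by rewrite lee_fin powR_ge0.
  apply: le_integral_nonmeas => x; first by rewrite lee_fin.
  rewrite -EFinM lee_fin /h1; case: ltP => [tx|_]; last by rewrite mul0r mulr_ge0 ?powR_ge0.
  rewrite mul1r -opprB powRN mulrC ler_pdivlMr ?powR_gt0//.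
  have hx0 := lt_trans t0 tx.
  have -> : h x `^ r = h x * h x `^ (r - 1) by rewrite mulr_powRB1// (lt_trans _ r1).
  rewrite ler_wpM2l// ge0_ler_powR ?nnegrE ?subr_ge0 ?ltW//.
- apply: (le_trans (maxhat_sqr_le L2 l10 l20)).
  apply: lee_wpmul2l; first by rewrite lee_fin.
  apply: le_integral_nonmeas => x; first by rewrite lee_fin sqr_ge0.
  by rewrite lee_fin /h2; case: (h x <= t)%R; rewrite /= ?mul1r// ?mul0r ?expr0n.
Qed.

End maxhat.

(** * The Hardy-Littlewood-Sobolev inequality in the variable phi' *)

Section hls.
Context {R : realType}.
Local Notation leb := (@lebesgue_measure R).
Local Notation lebR := (leb : {sigma_finite_measure set (measurableTypeR R) -> \bar R}).
Variables (gam : R).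
Hypotheses (gam0 : 0 < gam) (gam1 : gam < 1).
Let s := 2 / (2 - gam).

Let ell0 (t : R) := (0 < t <= 1)%R%:R * t `^ (- gam).
(** An even integrable function: [ell0] carries the singularity at 0 from either side, and the
    Poisson kernel dominates t^-2 at infinity. *)
Let ell (t : R) := ell0 t + ell0 (- t) + 2 * poisson 1 t.

Let ell0_ge0 t : 0 <= ell0 t. Proof. by rewrite mulr_ge0 ?powR_ge0. Qed.

Let ell_ge0 t : 0 <= ell t.
Proof. by rewrite !addr_ge0// mulr_ge0// ltW// poisson_gt0. Qed.

Let measurable_ell0 : measurable_fun setT (fun t : measurableTypeR R => ell0 t).
Proof.
apply: measurable_funM; last exact: measurable_powR.
apply: measurable_bool_natr; apply: measurable_and.
  by apply: measurable_fun_ltr => //; exact: measurable_cst.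
by apply: measurable_fun_ler => //; exact: measurable_cst.
Qed.

Let measurable_ell0N : measurable_fun setT (fun t : measurableTypeR R => ell0 (- t)).
Proof. by apply: (measurableT_comp measurable_ell0). Qed.

Let measurable_poi : measurable_fun setT (fun t : measurableTypeR R => poisson 1 t : R).
Proof. exact: measurable_poisson. Qed.

Let measurable_ell : measurable_fun setT (fun t : measurableTypeR R => ell t).
Proof.
apply: measurable_funD; first by apply: measurable_funD.
by apply: measurable_funM => //; exact: measurable_cst.
Qed.

Let integral_ell : (\int[leb]_t (ell t)%:E <= (2 / (1 - gam) + 2 * pi)%:E)%E.
Proof.
have m0 : measurable_fun setT (fun t : measurableTypeR R => (ell0 t)%:E : \bar R) by exact/measurable_EFinP.
have mN : measurable_fun setT (fun t : measurableTypeR R => (ell0 (- t))%:E : \bar R) by exact/measurable_EFinP.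
have mp : measurable_fun setT (fun t : measurableTypeR R => (poisson 1 t)%:E : \bar R) by exact/measurable_EFinP.
have p0 (t : R) : (0 <= (poisson 1 t)%:E :> \bar R)%E by rewrite lee_fin ltW// poisson_gt0.
have e0 t : (0 <= (ell0 t)%:E :> \bar R)%E by rewrite lee_fin.
have e0N t : (0 <= (ell0 (- t))%:E :> \bar R)%E by rewrite lee_fin.
have m2p : measurable_fun setT (fun t : measurableTypeR R => (2%:E * (poisson 1 t)%:E : \bar R)%E).
  by apply: emeasurable_funM => //; exact: measurable_cst.
have p20 (t : R) : (0 <= 2%:E * (poisson 1 t)%:E :> \bar R)%E by exact: mule_ge0.
have e12 t : (0 <= (ell0 t)%:E + (ell0 (- t))%:E :> \bar R)%E by exact: adde_ge0.
have m12 : measurable_fun setT (fun t : measurableTypeR R => ((ell0 t)%:E + (ell0 (- t))%:E : \bar R)%E).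
  exact: emeasurable_funD.
have -> : (\int[leb]_t (ell t)%:E = \int[leb]_t ((ell0 t)%:E + (ell0 (- t))%:E + 2%:E * (poisson 1 t)%:E)%E)%E.
  by apply: eq_integral => t _; rewrite /ell !EFinD EFinM.
rewrite ge0_integralD// ge0_integralD// ge0_integralZl// integral_poisson1.
rewrite (ge0_integral_oppr m0 e0) -EFinM EFinD; apply: leeD => //.
have g1 : 0 < 1 - gam by rewrite subr_gt0.
have I0 : (\int[leb]_t (ell0 t)%:E <= ((1 - gam)^-1)%:E)%E.
  have := integral_powR_le 1 g1; rewrite powR1 mulr1; apply: le_trans.
  by rewrite le_eqVlt; apply/orP; left; apply/eqP; apply: eq_integral => t _; rewrite /ell0; congr (_ * (_ `^ _))%:E; ring.
apply: (le_trans (leeD I0 I0)); rewrite -EFinD lee_fin.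
by rewrite le_eqVlt; apply/orP; left; apply/eqP; ring.
Qed.

Let s1 : 1 < s.
Proof.
have g0 := gam0; have g1 := gam1; have g2 : 0 < 2 - gam by lra.
by rewrite /s ltr_pdivlMr//; lra.
Qed.

(** For t <= 1 the function [ell0] suffices. For t > 1, either t^(-gam) <= u^(s-1), and u^s
    suffices, or u <= t^(-2/s) because gam = (s-1) 2/s, and then the product is at most t^-2. *)
Let young (u t : R) : 0 <= u -> u <= 1 -> 0 < t -> u * t `^ (- gam) <= u `^ s + ell t.
Proof.
move=> u0 u1 t0; have s0 : 0 < s by rewrite (lt_trans _ s1).
have us0 : 0 <= u `^ s by exact: powR_ge0.
have [t1|t1] := leP t 1.
  apply: (@le_trans _ _ (ell0 t)).
    by rewrite /ell0 t0 t1 mul1r ler_piMl ?powR_ge0.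
  have := ell0_ge0 (- t); have := poisson_gt0 t (@ltr01 R); rewrite /ell; lra.
have [le_u|lt_u] := leP (t `^ (- gam)) (u `^ (s - 1)).
  apply: (@le_trans _ _ (u `^ s)); last by rewrite lerDl.
  by rewrite -(mulr_powRB1 u0 s0) ler_wpM2l.
have gs : gam = (s - 1) * (2 / s).
  rewrite /s; field; rewrite subr_eq0; apply/eqP => g2; have := gam1; lra.
have u_le : u <= t `^ (- (2 / s)).
  rewrite leNgt; apply/negP => u_gt; move: lt_u; rewrite ltNge => /negP; apply.
  have -> : - gam = - (2 / s) * (s - 1) by rewrite {1}gs; ring.
  rewrite powRrM ge0_ler_powR ?nnegrE ?powR_ge0 ?subr_ge0 ?(ltW s1) ?(ltW u_gt)//.
apply: (@le_trans _ _ (t `^ (- 2%:R))).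
  apply: (@le_trans _ _ (t `^ (- (2 / s)) * t `^ (- gam))); first by rewrite ler_wpM2r ?powR_ge0.
  rewrite -powRD; last by rewrite (gt_eqF t0) implybT.
  have -> // : - (2 / s) + - gam = - 2%:R.
  rewrite {1}gs; field; exact: lt0r_neq0.
rewrite powR_invn ?(ltW t0)//.
apply: (@le_trans _ _ (2 * poisson 1 t)).
  rewrite /poisson expr1n mul1r ler_pdivlMr ?ltr_pwDl ?sqr_ge0//.
  rewrite mulrC ler_pdivrMr ?exprn_gt0//.
  have : 1 <= t ^+ 2 by rewrite exprn_ege1// ltW.
  lra.
have := ell0_ge0 t; have := ell0_ge0 (- t); rewrite /ell; lra.
Qed.

Definition hls_const := 2 * (1 + 2 * (2 / (1 - gam) + 2 * pi)) : R.

Variables (a b : R) (dphi kappa : R -> R).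
Hypotheses (dphi_derive : forall x, a <= x <= b -> is_derive x 1 dphi (kappa x))
  (kappa_cont : {within `[a, b], continuous kappa})
  (kappa_ge0 : forall x, a <= x <= b -> 0 <= kappa x).

Let L := 2 / (1 - gam) + 2 * pi : R.

Let integral_ell_change (c rho : R) : 0 < rho ->
  (\int[leb]_(y in `[a, b]) (ell (rho^-1 * dphi y + c) * kappa y)%:E <= (rho * L)%:E)%E.
Proof.
move=> rho0; have r1 : rho^-1 != 0 by rewrite invr_eq0 gt_eqF.
have me : measurable_fun setT (fun t : R => (ell t)%:E : \bar R) by exact/measurable_EFinP.
have e0 t : (0 <= (ell t)%:E :> \bar R)%E by rewrite lee_fin.
have mH : measurable_fun setT (fun t : R => (ell (rho^-1 * t + c))%:E : \bar R).
  by apply: (measurableT_comp me); exact: measurable_affine.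
have H0 t : (0 <= (ell (rho^-1 * t + c))%:E :> \bar R)%E by rewrite lee_fin.
under eq_integral do rewrite EFinM.
apply: (le_trans (le_integral_change dphi_derive kappa_cont kappa_ge0 mH H0)).
rewrite (ge0_integral_affine c r1 me e0) gtr0_norm ?invr_gt0// invrK EFinM.
by apply: lee_wpmul2l; [rewrite lee_fin ltW|exact: integral_ell].
Qed.

Variables (A P k : R -> R) (delta W : R).
Hypotheses (mA : measurable_fun setT A) (A0 : forall x, 0 <= A x)
  (mP : measurable_fun setT P) (PE : forall x, a <= x <= b -> P x = dphi x)
  (mk : measurable_fun setT k) (kE : forall x, k x = (a <= x <= b)%R%:R * kappa x)
  (delta0 : 0 < delta) (W0 : 0 < W)
  (AW : (\int[leb]_x (A x `^ s * k x)%:E <= W%:E)%E).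

Let k0 x : 0 <= k x.
Proof. by rewrite kE; case: (boolP (a <= x <= b)) => [/kappa_ge0 h|_]; rewrite ?mul1r ?mul0r. Qed.

(** The shift [delta] keeps the negative power meaningful where [P] repeats a value, since by
    convention such a power of 0 is 0. The bound obtained does not depend on it. *)
Let D (z : R * R) := `|P z.1 - P z.2| + delta.

Let D0 z : 0 < D z. Proof. by rewrite ltr_wpDl. Qed.

(** Half of the symmetric form, on which the ratio A(y)/A(x) is at most 1, as [young] requires. *)
Let T1 (z : R * R) := (A z.2 <= A z.1)%R%:R * (A z.1 * A z.2 * D z `^ (- gam) * (k z.1 * k z.2)).

Let mA1 : measurable_fun setT (fun z : R * R => A z.1). Proof. exact: (measurableT_comp mA measurable_fst). Qed.
Let mA2 : measurable_fun setT (fun z : R * R => A z.2). Proof. exact: (measurableT_comp mA measurable_snd). Qed.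
Let mk1 : measurable_fun setT (fun z : R * R => k z.1). Proof. exact: (measurableT_comp mk measurable_fst). Qed.
Let mk2 : measurable_fun setT (fun z : R * R => k z.2). Proof. exact: (measurableT_comp mk measurable_snd). Qed.
Let mD : measurable_fun setT (fun z : R * R => D z `^ (- gam)).
Proof.
apply: (measurableT_comp (measurable_powR (- gam))).
apply: measurable_funD; last exact: measurable_cst.
apply: measurableT_comp => //; apply: measurable_funB.
  exact: (measurableT_comp mP measurable_fst).
exact: (measurableT_comp mP measurable_snd).
Qed.

Let mT1 : measurable_fun setT (fun z => (T1 z)%:E).
Proof.
apply/measurable_EFinP; apply: measurable_funM.
  by apply: measurable_bool_natr; apply: measurable_fun_ler.
by apply: measurable_funM; apply: measurable_funM => //; exact: measurable_funM.
Qed.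

Let T10 z : (0 <= (T1 z)%:E)%E.
Proof. by rewrite lee_fin !mulr_ge0 ?powR_ge0. Qed.

Let mAk : measurable_fun setT (fun y : measurableTypeR R => (A y `^ s * k y)%:E : \bar R).
Proof.
apply/measurable_EFinP; apply: measurable_funM => //.
exact: (measurableT_comp (measurable_powR s) mA).
Qed.

Let ellN t : ell (- t) = ell t.
Proof. by rewrite /ell opprK poissonN (addrC (ell0 (- t))). Qed.

(** With u = A(y)/A(x) and t the shifted distance in units of [rho], [young] bounds the integral by
    A(x) rho^(-gam) times W A(x)^(-s) + 2 rho L. The value of [rho] makes both terms multiples of
    [rho]. *)
Let inner x : a <= x <= b -> 0 < A x ->
  (\int[leb]_y ((A y <= A x)%R%:R * (A y * D (x, y) `^ (- gam) * k y))%:E <=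
   (A x * (W * A x `^ (- s)) `^ (1 - gam) * (1 + 2 * L))%:E)%E.
Proof.
move=> xab Ax0; set rho := W * A x `^ (- s).
have rho0 : 0 < rho by rewrite mulr_gt0// powR_gt0.
(* Depending on the order of dphi x and dphi y, the shifted distance is the affine expression with
   [c1] or minus the one with [c2]. As [ell] is even, the sum of the two terms covers both cases. *)
pose c1 := rho^-1 * (- dphi x + delta); pose c2 := rho^-1 * (- dphi x - delta).
pose E c y := (ell (rho^-1 * dphi y + c) * kappa y)%:E.
have E0 c y : a <= y <= b -> (0 <= E c y)%E by move=> yab; rewrite lee_fin mulr_ge0// kappa_ge0.
pose F c y := ((fun y => E c y) \_ `[a, b]) y.
have F0 c y : (0 <= F c y)%E.
  by rewrite /F patchE; case: ifPn => //; rewrite mem_setE/= in_itv/= => /E0.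
have FE c y : F c y = (ell (rho^-1 * P y + c) * k y)%:E.
  rewrite /F patchE mem_setE/= in_itv/= kE; case: (boolP (a <= y <= b)) => yab.
    by rewrite mul1r PE.
  by rewrite mul0r mulr0.
have mF c : measurable_fun setT (F c).
  rewrite (_ : F c = (fun y => (ell (rho^-1 * P y + c) * k y)%:E)); last by apply/funext => y; exact: FE.
  apply/measurable_EFinP; apply: measurable_funM => //.
  apply: (measurableT_comp measurable_ell).
  by apply: measurable_funD; [apply: measurable_funM => //; exact: measurable_cst|exact: measurable_cst].
have IF c : (\int[leb]_y F c y <= (rho * L)%:E)%E.
  have := integral_ell_change c rho0; rewrite [X in (X <= _)%E]integral_mkcond; exact.
have As0 y : (0 <= (A y `^ s * k y)%:E)%E by rewrite lee_fin mulr_ge0 ?powR_ge0.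
have pas : (0 <= (A x `^ (- s))%:E :> \bar R)%E by rewrite lee_fin powR_ge0.
have mS : measurable_fun setT (fun y : measurableTypeR R => ((A x `^ (- s))%:E * (A y `^ s * k y)%:E)%E).
  by apply: emeasurable_funM => //; exact: measurable_cst.
have S0 y : (0 <= (A x `^ (- s))%:E * (A y `^ s * k y)%:E)%E by exact: mule_ge0.
have mSF : measurable_fun setT (fun y : measurableTypeR R => ((A x `^ (- s))%:E * (A y `^ s * k y)%:E + F c1 y)%E).
  by apply: emeasurable_funD; [exact: mS|exact: mF].
have SF0 y : (0 <= (A x `^ (- s))%:E * (A y `^ s * k y)%:E + F c1 y)%E by exact: adde_ge0.
have mSFF : measurable_fun setT (fun y : measurableTypeR R => ((A x `^ (- s))%:E * (A y `^ s * k y)%:E + F c1 y + F c2 y)%E).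
  by apply: emeasurable_funD; [exact: mSF|exact: mF].
have SFF0 y : (0 <= (A x `^ (- s))%:E * (A y `^ s * k y)%:E + F c1 y + F c2 y)%E by exact: adde_ge0.
have mF1 : measurable_fun setT (fun y : measurableTypeR R => F c1 y) by exact: mF.
have mF2 : measurable_fun setT (fun y : measurableTypeR R => F c2 y) by exact: mF.
have co : 0 <= A x * rho `^ (- gam) by rewrite mulr_ge0 ?powR_ge0.
apply: (@le_trans _ _ ((A x * rho `^ (- gam))%:E *
  \int[leb]_y ((A x `^ (- s))%:E * (A y `^ s * k y)%:E + F c1 y + F c2 y))%E); last first.
  rewrite (ge0_integralD leb measurableT (fun y _ => SF0 y) mSF (fun y _ => F0 c2 y) mF2).
  rewrite (ge0_integralD leb measurableT (fun y _ => S0 y) mS (fun y _ => F0 c1 y) mF1).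
  rewrite ge0_integralZl//.
  apply: (@le_trans _ _ ((A x * rho `^ (- gam))%:E * ((A x `^ (- s))%:E * W%:E + (rho * L)%:E + (rho * L)%:E))%E).
    apply: lee_wpmul2l; first by rewrite lee_fin.
    by apply: leeD => //; apply: leeD => //; exact: lee_wpmul2l.
  have -> : ((A x `^ (- s))%:E * W%:E + (rho * L)%:E + (rho * L)%:E = (A x `^ (- s) * W + rho * L + rho * L)%:E)%E by [].
  rewrite -EFinM lee_fin.
  have -> : rho `^ (1 - gam) = rho `^ (- gam) * rho.
    by rewrite powRD ?(gt_eqF rho0) ?implybT// powRr1 ?(ltW rho0)// mulrC.
  by rewrite (mulrC _ W) -/rho le_eqVlt; apply/orP; left; apply/eqP; ring.
rewrite -ge0_integralZl//.
apply: le_integral_nonmeas => y; first by rewrite lee_fin !mulr_ge0 ?powR_ge0.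
rewrite !FE.
have -> : ((A x `^ (- s))%:E * (A y `^ s * k y)%:E + (ell (rho^-1 * P y + c1) * k y)%:E + (ell (rho^-1 * P y + c2) * k y)%:E =
  (A x `^ (- s) * (A y `^ s * k y) + ell (rho^-1 * P y + c1) * k y + ell (rho^-1 * P y + c2) * k y)%:E)%E by [].
rewrite -EFinM lee_fin.
have [yx|_] := leP (A y) (A x); last first.
  by rewrite mul0r; apply: mulr_ge0 => //; rewrite !addr_ge0 ?mulr_ge0 ?powR_ge0.
rewrite mul1r -mulrA.
have -> : A x `^ (- s) * (A y `^ s * k y) + ell (rho^-1 * P y + c1) * k y + ell (rho^-1 * P y + c2) * k y =
  (A x `^ (- s) * A y `^ s + ell (rho^-1 * P y + c1) + ell (rho^-1 * P y + c2)) * k y by ring.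
rewrite 2!mulrA; have [yab|yab] := boolP (a <= y <= b); last by rewrite !kE (negbTE yab) !mul0r !mulr0.
apply: ler_wpM2r => //.
have t0 : 0 < D (x, y) / rho by rewrite divr_gt0.
have u0 : 0 <= A y / A x by rewrite divr_ge0.
have u1 : A y / A x <= 1 by rewrite ler_pdivrMr// mul1r.
have key := young u0 u1 t0.
have uE : (A y / A x) `^ s = A x `^ (- s) * A y `^ s.
  have -> : A y `^ s = (A x * (A y / A x)) `^ s by rewrite mulrC divfK// gt_eqF.
  by rewrite [in RHS]powRM// mulrA powRN mulVf ?mul1r// gt_eqF// powR_gt0.
have tE : D (x, y) `^ (- gam) = rho `^ (- gam) * (D (x, y) / rho) `^ (- gam).
  by rewrite -powRM ?(ltW rho0) ?(ltW t0)// mulrC divfK// gt_eqF.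
have ellE : ell (D (x, y) / rho) <= ell (rho^-1 * P y + c1) + ell (rho^-1 * P y + c2).
  rewrite /D/= !PE//; have [le|/ltW le] := leP (dphi x) (dphi y).
    have -> : rho^-1 * dphi y + c1 = (`|dphi x - dphi y| + delta) / rho.
      by rewrite distrC ger0_norm ?subr_ge0// /c1; ring.
    by rewrite lerDl.
  have -> : rho^-1 * dphi y + c2 = - ((`|dphi x - dphi y| + delta) / rho).
    by rewrite ger0_norm ?subr_ge0// /c2; ring.
  by rewrite ellN lerDr.
rewrite tE.
have -> : A y * (rho `^ (- gam) * (D (x, y) / rho) `^ (- gam)) =
   A x * rho `^ (- gam) * (A y / A x * (D (x, y) / rho) `^ (- gam)).
  by field; exact: lt0r_neq0.
apply: ler_wpM2l => //; apply: (le_trans key); rewrite uE -addrA; exact: lerD.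
Qed.

(** The exponent s = 2/(2 - gam) is the diagonal one, and W^(2 - gam) is the square of the bound
    W^(1/s) for the norm of [A]. *)
Lemma hls : (\int[leb2]_z (A z.1 * A z.2 * (`|P z.1 - P z.2| + delta) `^ (- gam) * (k z.1 * k z.2))%:E <=
  (hls_const * W `^ (2 - gam))%:E)%E.
Proof.
have L0 : 0 <= L by rewrite addr_ge0 ?divr_ge0 ?subr_ge0 ?(ltW gam1)// mulr_ge0// pi_ge0.
have mT1s : measurable_fun setT (fun z : R * R => (T1 (z.2, z.1))%:E).
  apply: (measurableT_comp mT1); apply: measurable_fun_pair.
    exact: measurable_snd.
  exact: measurable_fst.
have T10s (z : R * R) : (0 <= (T1 (z.2, z.1))%:E)%E by exact: T10.
have I1 : (\int[leb2]_z (T1 z)%:E <= ((1 + 2 * L) * W `^ (2 - gam))%:E)%E.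
  rewrite (integral_pmeasure12 lebR lebR mT1 T10).
  apply: (@le_trans _ _ ((W `^ (1 - gam) * (1 + 2 * L))%:E * \int[leb]_x (A x `^ s * k x)%:E)%E).
    have c0 : 0 <= W `^ (1 - gam) * (1 + 2 * L) by rewrite mulr_ge0 ?powR_ge0// addr_ge0// mulr_ge0.
    have As0 y : (0 <= (A y `^ s * k y)%:E)%E by rewrite lee_fin mulr_ge0 ?powR_ge0.
    rewrite -ge0_integralZl//.
    apply: le_integral_nonmeas => x; first by apply: integral_ge0 => y _; exact: T10.
    have [xab|xab] := boolP (a <= x <= b); last first.
      rewrite (_ : (fun y => _) = cst 0%E).
        by rewrite integral0 mule_ge0.
      by apply/funext => y; rewrite /T1/= (kE x) (negbTE xab) !mul0r !mulr0.
    have := A0 x; rewrite le_eqVlt => /orP[/eqP Ax|Ax].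
      rewrite (_ : (fun y => _) = cst 0%E).
        by rewrite integral0 mule_ge0.
      by apply/funext => y; rewrite /T1/= -Ax !mul0r mulr0.
    have Ak0 : (0 <= (A x * k x)%:E :> \bar R)%E by rewrite lee_fin mulr_ge0.
    have min : measurable_fun setT (fun y : measurableTypeR R => ((A y <= A x)%R%:R * (A y * D (x, y) `^ (- gam) * k y))%:E : \bar R).
      apply/measurable_EFinP; apply: measurable_funM.
        by apply: measurable_bool_natr; apply: measurable_fun_ler => //; exact: measurable_cst.
      apply: measurable_funM => //; apply: measurable_funM => //.
      exact: (measurableT_comp mD (measurable_pair1 x)).
    have in0 y : (0 <= ((A y <= A x)%R%:R * (A y * D (x, y) `^ (- gam) * k y))%:E :> \bar R)%E.
      by rewrite lee_fin !mulr_ge0 ?powR_ge0.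
    have -> : (\int[lebR]_y (T1 (x, y))%:E = (A x * k x)%:E *
        \int[leb]_y ((A y <= A x)%R%:R * (A y * D (x, y) `^ (- gam) * k y))%:E)%E.
      rewrite -ge0_integralZl//; apply: eq_integral => y _.
      by rewrite -EFinM /T1/=; congr EFin; ring.
    apply: (le_trans (lee_wpmul2l Ak0 (inner xab Ax))).
    rewrite -!EFinM lee_fin powRM ?powR_ge0 ?(ltW W0)//.
    have -> : A x `^ s = A x * A x * (A x `^ (- s)) `^ (1 - gam).
      rewrite -expr2 -powRrM -powR_mulrn ?A0// -powRD; last by rewrite (gt_eqF Ax) implybT.
      congr (_ `^ _); rewrite /s; field; rewrite subr_eq0; apply/eqP => g2; have := gam1; lra.
    by rewrite le_eqVlt; apply/orP; left; apply/eqP; ring.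
  apply: (@le_trans _ _ ((W `^ (1 - gam) * (1 + 2 * L))%:E * W%:E)%E).
    by apply: lee_wpmul2l => //; rewrite lee_fin mulr_ge0 ?powR_ge0// addr_ge0// mulr_ge0.
  rewrite -EFinM lee_fin.
  have -> : W `^ (2 - gam) = W `^ (1 - gam) * W.
    have -> : 2 - gam = (1 - gam) + 1 by ring.
    by rewrite [LHS]powRD ?powRr1 ?(ltW W0)// (gt_eqF W0) implybT.
  by rewrite le_eqVlt; apply/orP; left; apply/eqP; ring.
apply: (@le_trans _ _ (\int[leb2]_z ((T1 z)%:E + (T1 (z.2, z.1))%:E)%E)%E).
  apply: le_integral_nonmeas => z; first by rewrite lee_fin !mulr_ge0 ?powR_ge0.
  rewrite -EFinD lee_fin /T1 /D/= (distrC (P z.2)) (mulrC (A z.2)) (mulrC (k z.2)).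
  have : 0 <= A z.1 * A z.2 * (`|P z.1 - P z.2| + delta) `^ (- gam) * (k z.1 * k z.2).
    by rewrite !mulr_ge0 ?powR_ge0.
  move: (_ * (k z.1 * k z.2)) => c c0; have [_|/ltW ->] := leP (A z.2) (A z.1).
    by rewrite mul1r lerDl mulr_ge0.
  by rewrite mul0r mul1r add0r.
rewrite ge0_integralD//.
have -> : (\int[leb2]_z (T1 (z.2, z.1))%:E = \int[leb2]_z (T1 z)%:E)%E.
  by rewrite (integral_pmeasure12 lebR lebR mT1s T10s) (integral_pmeasure21 lebR lebR mT1 T10).
apply: (le_trans (leeD I1 I1)); rewrite -EFinD lee_fin /hls_const -/L.
by rewrite le_eqVlt; apply/orP; left; apply/eqP; ring.
Qed.

End hls.

Lemma hoelder_le d (T : measurableType d) (R : realType)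
    (m : {measure set T -> \bar R}) (f g : T -> R) (p q a b : R) :
  measurable_fun setT f -> (forall x, 0 <= f x) ->
  measurable_fun setT g -> (forall x, 0 <= g x) ->
  0 < p -> 0 < q -> p^-1 + q^-1 = 1 -> 0 <= a -> 0 <= b ->
  (\int[m]_x (f x `^ p)%:E <= a%:E)%E -> (\int[m]_x (g x `^ q)%:E <= b%:E)%E ->
  (\int[m]_x (f x * g x)%:E <= (a `^ p^-1 * b `^ q^-1)%:E)%E.
Proof.
move=> mf f0 mg g0 p0 q0 pq a0 b0 fa gb.
have := hoelder m mf mg p0 q0 pq; rewrite Lnorm1.
have -> : (\int[m]_x `|(EFin \o (f \* g)%R) x| = \int[m]_x (f x * g x)%:E)%E.
  by apply: eq_integral => x _; rewrite /= ger0_norm// mulr_ge0.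
move=> /le_trans; apply; rewrite EFinM.
have aux (h : T -> R) (r c : R) : 0 < r -> 0 <= c -> (forall x, 0 <= h x) ->
    (\int[m]_x (h x `^ r)%:E <= c%:E)%E -> ('N[m]_r%:E[EFin \o h] <= (c `^ r^-1)%:E)%E.
  move=> r0 c0 h0 hc; rewrite unlock -poweR_EFin.
  have -> : (\int[m]_x (`|(EFin \o h) x| `^ r) = \int[m]_x (h x `^ r)%:E)%E.
    by apply: eq_integral => x _; rewrite /= ger0_norm.
  have I0 : (0 <= \int[m]_x (h x `^ r)%:E)%E by apply: integral_ge0 => x _; rewrite lee_fin powR_ge0.
  apply: gt0_ler_poweR => //; first by rewrite invr_ge0 ltW.
    by rewrite in_itv/= I0 leey.
  by rewrite in_itv/= leey lee_fin c0.
by apply: lee_pmul; rewrite ?Lnorm_ge0//; exact: aux.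
Qed.

(** * Pairs of points on the curve: Jacobian and weighted energy *)

Section energy.
Context {R : realType}.
Local Notation leb := (@lebesgue_measure R).
Local Notation lebR := (leb : {sigma_finite_measure set (measurableTypeR R) -> \bar R}).
Variables (a b : R) (phi dphi kappa : R -> R).
Hypotheses (ab : a <= b)
  (phi_derive : forall x, a <= x <= b -> is_derive x 1 phi (dphi x))
  (dphi_derive : forall x, a <= x <= b -> is_derive x 1 dphi (kappa x))
  (kappa_cont : {within `[a, b], continuous kappa})
  (kappa_ge0 : forall x, a <= x <= b -> 0 <= kappa x).
Variables (F P : R -> R).
Hypotheses (mF : measurable_fun setT F) (FE : forall x, a <= x <= b -> F x = phi x)
  (mP : measurable_fun setT P) (PE : forall x, a <= x <= b -> P x = dphi x).

Let j (x : R) : R := (a <= x <= b)%R%:R.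

Let mj : measurable_fun setT (fun x : measurableTypeR R => j x).
Proof.
apply: measurable_bool_natr; apply: measurable_and; apply: measurable_fun_ler => //; exact: measurable_cst.
Qed.

Let j0 x : 0 <= j x. Proof. by []. Qed.

Let dphi_nd x y : a <= x -> x <= y -> y <= b -> dphi x <= dphi y.
Proof.
move=> ax xy yb; rewrite -subr_ge0 -lee_fin.
rewrite -(integral_derive_itv dphi_derive kappa_cont ax xy yb).
apply: integral_ge0 => z /=; rewrite in_itv/= => /andP[xz zy]; rewrite lee_fin.
by apply: kappa_ge0; rewrite (le_trans ax xz) (le_trans zy yb).
Qed.

Let dphi_cvg x : a <= x <= b -> {for x, continuous dphi}.
Proof.
move=> axb; apply/differentiable_continuous/derivable1_diffP.
by have [] := dphi_derive axb.
Qed.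

Let is_derive_shift (f df : R -> R) (c x : R) :
  is_derive (x + c) 1 f (df (x + c)) -> is_derive x 1 (fun y => f (y + c)) (df (x + c)).
Proof.
move=> D; have Dc : is_derive x 1 (fun y => y + c : R) 1.
  have := @is_deriveD R R R id (cst c) x 1 _ _ (is_derive_id x 1) (is_derive_cst c x 1).
  by rewrite addr0.
by have := @is_derive1_comp R f (fun y => y + c) x _ _ D Dc; rewrite mulr1.
Qed.

Let mF1 : measurable_fun setT (fun z : R * R => F z.1). Proof. exact: (measurableT_comp mF measurable_fst). Qed.
Let mF2 : measurable_fun setT (fun z : R * R => F z.2). Proof. exact: (measurableT_comp mF measurable_snd). Qed.
Let mP1 : measurable_fun setT (fun z : R * R => P z.1). Proof. exact: (measurableT_comp mP measurable_fst). Qed.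
Let mP2 : measurable_fun setT (fun z : R * R => P z.2). Proof. exact: (measurableT_comp mP measurable_snd). Qed.
Let mj1 : measurable_fun setT (fun z : R * R => j z.1). Proof. exact: (measurableT_comp mj measurable_fst). Qed.
Let mj2 : measurable_fun setT (fun z : R * R => j z.2). Proof. exact: (measurableT_comp mj measurable_snd). Qed.

Definition chord (z : R * R) := (z.1 - z.2, F z.1 - F z.2).

Lemma measurable_chord : measurable_fun setT chord.
Proof.
by apply: measurable_fun_pair; apply: measurable_funB.
Qed.

Let jP (z : R * R) := j z.1 * j z.2 * `|P z.1 - P z.2|.

Let jP0 z : 0 <= jP z. Proof. by rewrite !mulr_ge0. Qed.

Let mjP : measurable_fun setT jP.
Proof.
apply: measurable_funM; first exact: measurable_funM.
by apply: measurableT_comp => //; exact: measurable_funB.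
Qed.

(** For a fixed difference t = x - y > 0 the second coordinate phi(y+t) - phi(y) is nondecreasing in
    y, and its derivative is the weight. The planar substitution thus reduces to
    [le_integral_change] on each slice. *)
Let half (H : R * R -> \bar R) (mH : measurable_fun setT H) (H0 : forall u, (0 <= H u)%E) :
  (\int[leb2]_z (H (chord z) * ((z.2 < z.1)%R%:R * jP z)%:E) <= \int[leb2]_u H u)%E.
Proof.
pose G (z : R * R) := (H (chord z) * ((z.2 < z.1)%R%:R * jP z)%:E)%E.
have mG : measurable_fun setT G.
  apply: emeasurable_funM; first exact: (measurableT_comp mH measurable_chord).
  apply/measurable_EFinP; apply: measurable_funM => //; apply: measurable_bool_natr.
  by apply: measurable_fun_ltr; [exact: measurable_snd|exact: measurable_fst].
have G0 z : (0 <= G z)%E by rewrite mule_ge0// lee_fin mulr_ge0.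
rewrite -/(G _) (integral_pmeasure21 lebR lebR mG G0).
pose K (w : R * R) := G (w.2 + w.1, w.1).
have mK : measurable_fun setT K.
  apply: (measurableT_comp mG); apply: measurable_fun_pair; last exact: measurable_fst.
  by apply: measurable_funD; [exact: measurable_snd|exact: measurable_fst].
have K0 w : (0 <= K w)%E by exact: G0.
have -> : (\int[lebR]_y \int[lebR]_x G (x, y) = \int[lebR]_y \int[lebR]_x K (y, x))%E.
  apply: eq_integral => y _; apply/esym.
  have mGy : measurable_fun setT (fun x : R => G (x, y)).
    exact: (measurableT_comp mG (measurable_pair2 y)).
  exact: (ge0_integral_shift y mGy (fun x => G0 (x, y))).
rewrite -(integral_pmeasure12 lebR lebR mK K0) (integral_pmeasure21 lebR lebR mK K0).
rewrite (integral_pmeasure12 lebR lebR mH H0).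
apply: le_integral_nonmeas => t; first by apply: integral_ge0 => y _; exact: K0.
have [t0|t0] := leP t 0.
  rewrite (_ : (fun y => K (y, t)) = cst 0%E); last first.
    by apply/funext => y; rewrite /K /G/= ltNge gerDr t0 /= mul0r mule0.
  by rewrite integral0; apply: integral_ge0 => u _; exact: H0.
have inab y : a <= y <= b - t -> (a <= y <= b) /\ (a <= y + t <= b).
  by move=> /andP[ay yb]; split; apply/andP; split; lra.
have D y : a <= y <= b - t -> is_derive y 1 (fun y => phi (y + t) - phi y) (dphi (y + t) - dphi y).
  move=> /inab[y1 y2]; have D2 := phi_derive y1.
  have D1 := is_derive_shift (phi_derive y2).
  exact: (@is_deriveB R R R _ _ y 1 _ _ D1 D2).
have C : {within `[a, b - t], continuous (fun y => dphi (y + t) - dphi y)}.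
  apply: continuous_in_subspaceT => y; rewrite inE/= in_itv/= => /inab[y1 y2].
  have E1 := is_derive_shift (dphi_derive y2); have E2 := dphi_derive y1.
  have E := @is_deriveB R R R _ _ y 1 _ _ E1 E2.
  by apply/differentiable_continuous/derivable1_diffP; have [] := E.
have N y : a <= y <= b - t -> 0 <= dphi (y + t) - dphi y.
  move=> /inab[/andP[y1 y2] /andP[y3 y4]]; rewrite subr_ge0 dphi_nd//; lra.
have mHt : measurable_fun setT (fun u : R => H (t, u)).
  exact: (measurableT_comp mH (measurable_pair1 t)).
apply: le_trans (le_integral_change D C N mHt (fun u => H0 (t, u))).
rewrite [leRHS]integral_mkcond; apply: le_integral_nonmeas => y; first exact: K0.
rewrite patchE mem_setE/= in_itv/=; rewrite /K /G /chord /jP/= addrK ltrDr t0 mul1r.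
have [yab|yab] := boolP (a <= y <= b - t).
  have [y1 y2] := inab _ yab.
  rewrite /j (addrC t y) y1 y2 !mul1r !FE// !PE// ger0_norm//.
  exact: N.
rewrite (_ : j (t + y) * j y = 0) ?mul0r ?mule0//.
rewrite /j; have [y1|_] := boolP (a <= t + y <= b); last by rewrite mul0r.
have [y2|_] := boolP (a <= y <= b); last by rewrite mulr0.
exfalso; move: yab y1 y2; rewrite negb_and => /orP[h|h] /andP[h1 h2] /andP[h3 h4].
  by rewrite h3 in h.
by move: h; rewrite -ltNge; lra.
Qed.

(** The half x < y is the half y < x for the reflected function, which has the same integral; hence
    the factor 2. *)
Lemma pairs_le (H : R * R -> \bar R) : measurable_fun setT H -> (forall u, (0 <= H u)%E) ->
  (\int[leb2]_z (H (chord z) * (j z.1 * j z.2 * `|P z.1 - P z.2|)%:E) <=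
   2%:E * \int[leb2]_u H u)%E.
Proof.
move=> mH H0.
pose H' (u : R * R) := H (- u.1, - u.2).
have mH' : measurable_fun setT H'.
  by apply: (measurableT_comp mH); apply: measurable_fun_pair; apply: measurableT_comp.
have H'0 u : (0 <= H' u)%E by exact: H0.
have IH' : (\int[leb2]_u H' u = \int[leb2]_u H u)%E.
  have mH1 : measurable_fun setT (fun u : R * R => H (- u.1, u.2)).
    by apply: (measurableT_comp mH); apply: measurable_fun_pair => //; apply: measurableT_comp.
  rewrite -(integral_reflect1 mH H0).
  exact: (integral_reflect2 mH1 (fun u => H0 _)).
pose G (H : R * R -> \bar R) (z : R * R) := (H (chord z) * ((z.2 < z.1)%R%:R * jP z)%:E)%E.
have mG (H1 : R * R -> \bar R) : measurable_fun setT H1 -> measurable_fun setT (G H1).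
  move=> mH1; apply: emeasurable_funM; first exact: (measurableT_comp mH1 measurable_chord).
  apply/measurable_EFinP; apply: measurable_funM => //; apply: measurable_bool_natr.
  by apply: measurable_fun_ltr; [exact: measurable_snd|exact: measurable_fst].
have G0 (H1 : R * R -> \bar R) : (forall u, (0 <= H1 u)%E) -> forall z, (0 <= G H1 z)%E.
  by move=> H10 z; rewrite mule_ge0// lee_fin mulr_ge0.
have mGH := mG _ mH; have mGH' := mG _ mH'; have GH0 := G0 _ H0; have GH'0 := G0 _ H'0.
have mGs : measurable_fun setT (fun z : R * R => G H' (z.2, z.1)).
  apply: (measurableT_comp mGH'); apply: measurable_fun_pair; [exact: measurable_snd|exact: measurable_fst].
have Gs0 (z : R * R) : (0 <= G H' (z.2, z.1))%E by exact: GH'0.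
apply: (@le_trans _ _ (\int[leb2]_z (G H z + G H' (z.2, z.1)))%E).
  apply: le_integral_nonmeas => z; first by rewrite mule_ge0// lee_fin; exact: jP0.
  rewrite -/(jP z).
  have jPs : jP (z.2, z.1) = jP z by rewrite /jP/= distrC (mulrC (j z.2)).
  rewrite /G /H' jPs /chord/= !opprB.
  have [zz|zz|zz] := ltgtP z.1 z.2; rewrite /= ?mul1r ?mul0r ?mule0 ?adde0 ?add0e//.
  have -> : jP z = 0 by rewrite /jP zz subrr normr0 mulr0.
  by rewrite mule0.
rewrite ge0_integralD//.
have -> : (\int[leb2]_z G H' (z.2, z.1) = \int[leb2]_z G H' z)%E.
  by rewrite (integral_pmeasure12 lebR lebR mGs Gs0) (integral_pmeasure21 lebR lebR mGH' GH'0).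
have -> : (2%:E * \int[leb2]_u H u = \int[leb2]_u H u + \int[leb2]_u H u)%E.
  by rewrite mule_natl mule2n.
by apply: leeD; [exact: half|rewrite -[leRHS]IH'; exact: half].
Qed.

Variables (sg : R).
Hypothesis sg2 : 2 < sg.
(** [sg] is the r' of the overview and [r] its conjugate. The number gam = r - 1 = r/sg is the power
    of the weight that Hoelder's inequality leaves in the second factor. *)
Let r := sg / (sg - 1).
Let gam := (sg - 1)^-1.

Definition energy_const := (3 * maxhat_const sg) `^ sg^-1 * hls_const gam `^ r^-1 : R.

Lemma maxhat_const_gt0 : 0 < maxhat_const sg.
Proof.
rewrite /maxhat_const; have p0 := @pi_gt0 R.
rewrite !mulr_gt0// ?exprn_gt0 ?mulr_gt0 ?powR_gt0 ?invr_gt0 ?subr_gt0 ?exprn_gt0 ?mulr_gt0//.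
Qed.

Let sg1 : 0 < sg - 1.
Proof. by rewrite subr_gt0 (lt_trans _ sg2)// ltr1n. Qed.

Let sg0 : 0 < sg.
Proof. exact: lt_trans sg2. Qed.

Let r_gam : r - 1 = gam.
Proof. by rewrite /r /gam; field; exact: lt0r_neq0. Qed.

Let gam_gt0 : 0 < gam. Proof. by rewrite /gam invr_gt0. Qed.

Let gam_lt1 : gam < 1.
Proof. by rewrite /gam invf_lt1// ltrBrDr -[_ + 1]/(2 : R). Qed.

Variables (l1 l2 : seq (R * R)) (h : R * R -> R) (g A k : R -> R) (W Wh : R).
Hypotheses (l10 : forall e, e \in l1 -> (e.1 != 0) && (e.2 != 0))
  (l20 : forall e, e \in l2 -> (e.1 != 0) && (e.2 != 0))
  (hi : L1 leb2 h) (h0 : forall x, 0 <= h x)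
  (Wh0 : 0 < Wh) (hWh : (\int[leb2]_z (h z `^ r)%:E <= Wh%:E)%E)
  (mg : measurable_fun setT g) (g0 : forall x, 0 <= g x)
  (g_out : forall x, ~~ (a <= x <= b) -> g x = 0)
  (mA : measurable_fun setT A) (A0 : forall x, 0 <= A x)
  (mk : measurable_fun setT k) (kE : forall x, k x = (a <= x <= b)%R%:R * kappa x)
  (gE : forall x, g x `^ r = A x * k x)
  (W0 : 0 < W) (AW : (\int[leb]_x (A x `^ (2 / (2 - gam)) * k x)%:E <= W%:E)%E).

Let N u := fine (maxhat l1 l2 h u).

Let mxh_fin u : maxhat l1 l2 h u \is a fin_num.
Proof.
by rewrite ge0_fin_numE ?maxavg_ge0// (le_lt_trans (maxhat_fin l1 l2 u hi h0))// ltry.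
Qed.

Let N0 u : 0 <= N u. Proof. by apply: fine_ge0; exact: maxavg_ge0. Qed.

Let Mx := pi ^+ 4 * \int[leb2]_x h x.

Let N_le u : N u <= Mx.
Proof. by rewrite -lee_fin fineK//; exact: maxhat_fin. Qed.

Let Mx0 : 0 <= Mx. Proof. exact: le_trans (N_le (0, 0)). Qed.

Let mN : measurable_fun setT N.
Proof.
apply: (measurableT_comp (@fine_measurable R setT measurableT)).
exact: measurable_maxhat (L1_measurable hi).
Qed.

Let mNchord : measurable_fun setT (fun z => N (chord z)).
Proof. exact: (measurableT_comp mN measurable_chord). Qed.

Let integral_j : (\int[leb]_x (j x)%:E = (b - a)%:E)%E.
Proof.
have lebI : leb `[a, b]%classic = (b - a)%:E.
  rewrite lebesgue_measure_itv/= lte_fin; case: ltP => // ba.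
  by have -> : a = b; [apply/eqP; rewrite eq_le ab|rewrite subrr].
rewrite -lebI.
have -> : (\int[leb]_x (j x)%:E = \int[leb]_x (\1_(`[a, b]%classic : set R) x)%:E)%E.
  by apply: eq_integral => x _; rewrite indicE /j mem_setE in_itv.
by rewrite integral_indic// setIT.
Qed.

(** The hypothesis [gE] writes g^r as [A] times the density [k], so the second Hoelder factor is an
    integral in the variable dphi, as [hls] expects. *)
Lemma energy_le :
  (\int[leb2]_z ((g z.1 * g z.2)%:E * maxhat l1 l2 h (chord z)) <=
   (energy_const * Wh `^ r^-1 * W `^ ((2 - gam) / r))%:E)%E.
Proof.
have K0 := maxhat_const_gt0; have r0 : 0 < r by rewrite /r divr_gt0.
pose WK := maxhat_const sg * Wh `^ (sg - 1).
have WK0 : 0 < WK by rewrite mulr_gt0// powR_gt0.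
pose c := Mx `^ sg * (b - a) ^+ 2.
have c0 : 0 <= c by rewrite mulr_ge0 ?powR_ge0 ?sqr_ge0.
(* The weight must be positive to be divided out again. This [delta] is so small that the term it
   adds, at most delta times [c], stays below [WK]; with the 2 from [pairs_le] this gives the 3 in
   [energy_const]. *)
pose delta := WK / (c + 1).
have delta0 : 0 < delta by rewrite divr_gt0// ltr_wpDl.
have deltac : delta * c <= WK.
  rewrite /delta -mulrA ler_piMr ?(ltW WK0)// mulrC ler_pdivrMr ?ltr_wpDl// mul1r; lra.
pose D (z : R * R) := `|P z.1 - P z.2| + delta.
have D0 z : 0 < D z by rewrite ltr_wpDl.
have mD : measurable_fun setT D.
  apply: measurable_funD; last exact: measurable_cst.
  by apply: measurableT_comp => //; exact: measurable_funB.
have mDp c' : measurable_fun setT (fun z => D z `^ c').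
  exact: (measurableT_comp (measurable_powR c') mD).
pose f1 z := j z.1 * j z.2 * (N (chord z) * D z `^ sg^-1).
pose f2 (z : R * R) := g z.1 * g z.2 * D z `^ (- sg^-1).
have mg1 : measurable_fun setT (fun z : R * R => g z.1) by exact: (measurableT_comp mg measurable_fst).
have mg2 : measurable_fun setT (fun z : R * R => g z.2) by exact: (measurableT_comp mg measurable_snd).
have mf1 : measurable_fun setT f1.
  by apply: measurable_funM; apply: measurable_funM.
have mf2 : measurable_fun setT f2.
  by apply: measurable_funM => //; exact: measurable_funM.
have f10 z : 0 <= f1 z by rewrite !mulr_ge0 ?powR_ge0.
have f20 z : 0 <= f2 z by rewrite !mulr_ge0 ?powR_ge0.
have rsg : sg^-1 + r^-1 = 1 by rewrite /r; field; rewrite !lt0r_neq0.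
have jj (x y : R) : j x * j y = 0 \/ j x * j y = 1.
  by rewrite /j; case: (a <= x <= b); case: (a <= y <= b); rewrite ?mulr1 ?mulr0; [right|left|left|left].
have mNs : measurable_fun setT (fun u => (N u `^ sg)%:E : \bar R).
  by apply/measurable_EFinP; exact: (measurableT_comp (measurable_powR sg) mN).
have Ns0 u : (0 <= (N u `^ sg)%:E :> \bar R)%E by rewrite lee_fin powR_ge0.
have mjj : measurable_fun setT (fun z : R * R => (j z.1 * j z.2)%:E : \bar R).
  by apply/measurable_EFinP; exact: measurable_funM.
have jj0 (z : R * R) : (0 <= (j z.1 * j z.2)%:E :> \bar R)%E by rewrite lee_fin mulr_ge0.
have Ijj : (\int[leb2]_z (j z.1 * j z.2)%:E = ((b - a) ^+ 2)%:E)%E.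
  rewrite (integral_pmeasure12 lebR lebR mjj jj0)/=.
  have mjE : measurable_fun setT (fun x : measurableTypeR R => (j x)%:E : \bar R) by exact/measurable_EFinP.
  have jE0 x : (0 <= (j x)%:E :> \bar R)%E by rewrite lee_fin.
  have E x : (\int[lebR]_y (j x * j y)%:E = (b - a)%:E * (j x)%:E)%E.
    under eq_integral do rewrite EFinM.
    by rewrite ge0_integralZl// integral_j muleC.
  under eq_integral do rewrite E.
  by rewrite ge0_integralZl ?integral_j ?lee_fin ?subr_ge0// -EFinM expr2.
have I1 : (\int[leb2]_z (f1 z `^ sg)%:E <= (3 * WK)%:E)%E.
  have mU : measurable_fun setT (fun z => ((N (chord z) `^ sg)%:E * (j z.1 * j z.2 * `|P z.1 - P z.2|)%:E : \bar R)%E).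
    apply: emeasurable_funM; first exact: (measurableT_comp mNs measurable_chord).
    by apply/measurable_EFinP; exact: mjP.
  have U0 z : (0 <= (N (chord z) `^ sg)%:E * (j z.1 * j z.2 * `|P z.1 - P z.2|)%:E :> \bar R)%E.
    by rewrite mule_ge0// lee_fin !mulr_ge0.
  have cd0 : (0 <= (Mx `^ sg * delta)%:E :> \bar R)%E by rewrite lee_fin mulr_ge0 ?powR_ge0 ?ltW.
  have mV : measurable_fun setT (fun z : R * R => ((Mx `^ sg * delta)%:E * (j z.1 * j z.2)%:E : \bar R)%E).
    by apply: emeasurable_funM => //; exact: measurable_cst.
  have V0 (z : R * R) : (0 <= (Mx `^ sg * delta)%:E * (j z.1 * j z.2)%:E :> \bar R)%E by exact: mule_ge0.
  apply: (@le_trans _ _ (\int[leb2]_z ((N (chord z) `^ sg)%:E * (j z.1 * j z.2 * `|P z.1 - P z.2|)%:E +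
      (Mx `^ sg * delta)%:E * (j z.1 * j z.2)%:E))%E).
    apply: le_integral_nonmeas => z; first by rewrite lee_fin powR_ge0.
    rewrite -!EFinM -EFinD lee_fin /f1; have [->|->] := jj z.1 z.2.
      by rewrite !mul0r !mulr0 powR0 ?addr0// gt_eqF.
    rewrite !mul1r mulr1 powRM ?powR_ge0// -powRrM mulVf ?gt_eqF// powRr1 ?(ltW (D0 z))//.
    rewrite /D mulrDr lerD2l ler_wpM2r ?(ltW delta0)// ge0_ler_powR ?nnegrE ?(ltW sg0)//.
  rewrite ge0_integralD// ge0_integralZl// Ijj.
  apply: (@le_trans _ _ (2%:E * WK%:E + WK%:E)%E).
    apply: leeD.
      apply: (le_trans (pairs_le mNs Ns0)); apply: lee_wpmul2l; first by rewrite lee_fin.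
      apply: (@maxhat_le _ r) => //; rewrite ?r_gam ?/gam ?mulVf ?gt_eqF ?(ltW Wh0)//.
      by rewrite -subr_gt0 r_gam.
    by rewrite -EFinM lee_fin (mulrC _ delta) -mulrA.
  by rewrite -EFinM -EFinD lee_fin le_eqVlt; apply/orP; left; apply/eqP; ring.
have I2 : (\int[leb2]_z (f2 z `^ r)%:E <= (hls_const gam * W `^ (2 - gam))%:E)%E.
  have := hls gam_gt0 gam_lt1 dphi_derive kappa_cont kappa_ge0 mA A0 mP PE mk kE delta0 W0 AW.
  apply: le_trans; rewrite le_eqVlt; apply/orP; left; apply/eqP.
  apply: eq_integral => z _; congr EFin.
  rewrite /f2 powRM ?powR_ge0 ?mulr_ge0// powRM// !gE -powRrM.
  have -> : - sg^-1 * r = - gam by rewrite /r /gam; field; rewrite !lt0r_neq0.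
  rewrite /D; ring.
have hls0 : 0 <= hls_const gam.
  rewrite /hls_const mulr_ge0// addr_ge0// mulr_ge0// addr_ge0 ?mulr_ge0 ?pi_ge0// invr_ge0 subr_ge0 ltW//.
have WK30 : 0 <= 3 * WK by rewrite mulr_ge0// ltW.
have hW0 : 0 <= hls_const gam * W `^ (2 - gam) by rewrite mulr_ge0 ?powR_ge0.
have := @hoelder_le _ _ R leb2 f1 f2 _ _ _ _ mf1 f10 mf2 f20 sg0 r0 rsg WK30 hW0 I1 I2.
rewrite (_ : _ * _ = energy_const * Wh `^ r^-1 * W `^ ((2 - gam) / r)); last first.
  have K30 : 0 <= 3 * maxhat_const sg by exact: mulr_ge0 (ltW K0).
  rewrite /energy_const /WK mulrA (powRM _ K30) ?powR_ge0//.
  rewrite (powRM _ hls0) ?powR_ge0// -!powRrM.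
  have -> : (sg - 1) * sg^-1 = r^-1 by rewrite /r; field; rewrite !lt0r_neq0.
  ring.
move=> I3; apply: le_trans I3; apply: (@le_integral_nonmeas _ _ R leb2) => z.
  by rewrite mule_ge0 ?maxavg_ge0// lee_fin mulr_ge0.
rewrite -(fineK (mxh_fin (chord z))) -EFinM lee_fin -/(N (chord z)) /f1 /f2.
have [gz|gz] := eqVneq (g z.1 * g z.2) 0; first by rewrite gz !mul0r mulr0.
have [j1 j2] : j z.1 = 1 /\ j z.2 = 1.
  move: gz; rewrite mulf_eq0 negb_or /j => /andP[g1 g2]; split.
    by case: (boolP (a <= z.1 <= b)) g1 => // /g_out ->; rewrite eqxx.
  by case: (boolP (a <= z.2 <= b)) g2 => // /g_out ->; rewrite eqxx.
rewrite j1 j2 !mul1r powRN le_eqVlt; apply/orP; left; apply/eqP.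
by field; rewrite gt_eqF// powR_gt0.
Qed.

End energy.

(** * Displaced points and their reduction to maximal averages *)

Section smear.
Context {R : realType}.
Local Notation leb := (@lebesgue_measure R).
Local Notation lebR := (leb : {sigma_finite_measure set (measurableTypeR R) -> \bar R}).
Local Notation RR := (measurableTypeR R).
Implicit Type f : R * R -> \bar R.

Definition poisson2 (st : R * R) := poisson 1 st.1 * poisson 1 st.2.

Lemma poisson2_ge0 st : 0 <= poisson2 st.
Proof. by rewrite mulr_ge0// ltW// poisson_gt0. Qed.

Lemma measurable_poisson2 : measurable_fun setT poisson2.
Proof.
have mp : measurable_fun setT (fun t : RR => poisson 1 t : R) by exact: measurable_poisson.
by apply: measurable_funM; [exact: (measurableT_comp mp measurable_fst)|exact: (measurableT_comp mp measurable_snd)].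
Qed.

Lemma measurable_shift2 (z e : R * R) :
  measurable_fun setT (fun st : R * R => (z.1 + e.1 * st.1, z.2 + e.2 * st.2)).
Proof.
apply: measurable_fun_pair; apply: measurable_funD; try exact: measurable_cst.
  by apply: measurable_funM; [exact: measurable_cst|exact: measurable_fst].
by apply: measurable_funM; [exact: measurable_cst|exact: measurable_snd].
Qed.

Lemma avg2E (e : R * R) f z : measurable_fun setT f -> (forall x, (0 <= f x)%E) ->
  avg2 e f z = (\int[leb2]_st ((poisson2 st)%:E * f (z.1 + e.1 * st.1, z.2 + e.2 * st.2)%R))%E.
Proof.
move=> mf f0.
have mfs : measurable_fun setT (fun st : R * R => f (z.1 + e.1 * st.1, z.2 + e.2 * st.2)).
  exact: (measurableT_comp mf (measurable_shift2 z e)).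
have mi : measurable_fun setT (fun st : R * R => ((poisson2 st)%:E * f (z.1 + e.1 * st.1, z.2 + e.2 * st.2)%R)%E).
  by apply: emeasurable_funM => //; apply/measurable_EFinP; exact: measurable_poisson2.
have i0 (st : R * R) : (0 <= (poisson2 st)%:E * f (z.1 + e.1 * st.1, z.2 + e.2 * st.2)%R)%E.
  by rewrite mule_ge0// lee_fin poisson2_ge0.
rewrite (integral_pmeasure12 lebR lebR mi i0) /avg2 /avg; apply: eq_integral => s _.
have p0 (t : R) : (0 <= (poisson 1 t)%:E :> \bar R)%E by rewrite lee_fin ltW// poisson_gt0.
have mt : measurable_fun setT (fun t : RR => ((poisson 1 t)%:E * f (z.1 + e.1 * s, z.2 + e.2 * t)%R)%E).
  apply: emeasurable_funM; first by apply/measurable_EFinP; exact: measurable_poisson.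
  exact: (measurableT_comp mfs (measurable_pair1 s)).
have t0 (t : R) : (0 <= (poisson 1 t)%:E * f (z.1 + e.1 * s, z.2 + e.2 * t)%R)%E by rewrite mule_ge0.
rewrite -ge0_integralZl//; apply: eq_integral => t _.
by rewrite muleA -EFinM.
Qed.

Variables (F g : R -> R) (E : R -> R * R) (l : seq (R * R)).
Hypotheses (mF : measurable_fun setT F) (mg : measurable_fun setT g) (g0 : forall x, 0 <= g x)
  (mE : measurable_fun setT E) (El : forall x, E x \in l).

(** The Gamma(x,s,t) of the overview; the dilation depends on the base point only. *)
Definition smear (X : R * (R * R)) :=
  (X.1 + (E X.1).1 * X.2.1, F X.1 + (E X.1).2 * X.2.2).

Let m := pmeasure lebR (@leb2 R).

Lemma measurable_smear : measurable_fun setT smear.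
Proof.
have m1 : measurable_fun setT (fun X : R * (R * R) => X.1) by exact: measurable_fst.
have m21 : measurable_fun setT (fun X : R * (R * R) => X.2.1) by exact: (measurableT_comp measurable_fst measurable_snd).
have m22 : measurable_fun setT (fun X : R * (R * R) => X.2.2) by exact: (measurableT_comp measurable_snd measurable_snd).
have mE1 : measurable_fun setT (fun X : R * (R * R) => E X.1) by exact: (measurableT_comp mE measurable_fst).
apply: measurable_fun_pair; apply: measurable_funD => //.
- by apply: measurable_funM => //; exact: (measurableT_comp measurable_fst mE1).
- exact: (measurableT_comp mF measurable_fst).
- by apply: measurable_funM => //; exact: (measurableT_comp measurable_snd mE1).
Qed.

Let wt (X : R * (R * R)) := g X.1 * poisson2 X.2.

Let wt0 X : 0 <= wt X. Proof. by rewrite mulr_ge0// poisson2_ge0. Qed.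

Let mwt : measurable_fun setT wt.
Proof.
apply: measurable_funM; first exact: (measurableT_comp mg measurable_fst).
exact: (measurableT_comp measurable_poisson2 measurable_snd).
Qed.

Let neg (e : R * R) := (- e.1, - e.2).

Let inner f (z : R * R) : measurable_fun setT f -> (forall x, (0 <= f x)%E) ->
  (\int[m]_Y ((wt Y)%:E * f (z.1 - (smear Y).1, z.2 - (smear Y).2)%R) <=
   \int[leb]_y ((g y)%:E * maxavg (map neg l) f (z.1 - y, z.2 - F y)%R))%E.
Proof.
move=> mf f0.
have msm : measurable_fun setT (fun Y : R * (R * R) => (z.1 - (smear Y).1, z.2 - (smear Y).2)).
  apply: measurable_fun_pair; apply: measurable_funB; try exact: measurable_cst.
    exact: (measurableT_comp measurable_fst measurable_smear).
  exact: (measurableT_comp measurable_snd measurable_smear).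
have mi : measurable_fun setT (fun Y : R * (R * R) => ((wt Y)%:E * f (z.1 - (smear Y).1, z.2 - (smear Y).2)%R)%E).
  apply: emeasurable_funM; first exact/measurable_EFinP.
  exact: (measurableT_comp mf msm).
have i0 (Y : R * (R * R)) : (0 <= (wt Y)%:E * f (z.1 - (smear Y).1, z.2 - (smear Y).2)%R)%E.
  by rewrite mule_ge0// lee_fin.
rewrite (integral_pmeasure12 lebR leb2 mi i0).
apply: le_integral_nonmeas => y; first by apply: integral_ge0 => st _; exact: i0.
have -> : (\int[leb2]_st ((wt (y, st))%:E * f (z.1 - (smear (y, st)).1, z.2 - (smear (y, st)).2)%R) =
   (g y)%:E * avg2 (neg (E y)) f (z.1 - y, z.2 - F y)%R)%E.
  rewrite avg2E// -ge0_integralZl//; last 3 first.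
  - apply: emeasurable_funM; first by apply/measurable_EFinP; exact: measurable_poisson2.
    exact: (measurableT_comp mf (measurable_shift2 (z.1 - y, z.2 - F y) (neg (E y)))).
  - by move=> st _; rewrite mule_ge0// lee_fin poisson2_ge0.
  - by rewrite lee_fin.
  apply: eq_integral => st _; rewrite muleA -EFinM /wt /smear/=.
  by congr (_ * f (_, _))%E; ring.
apply: lee_wpmul2l; first by rewrite lee_fin.
by apply: (@maxfun_ge _ _ _ _ (avg2^~ f)); apply: map_f.
Qed.

(** Integrating over the displacement of the second point averages [f] with scales - E(y), negative
    because that point is subtracted. Integrating over that of the first averages the result around
    the chord with scales E(x). Replacing each average by a maximal function removes the dependence
    on the selection. *)
Lemma smear_pairs_le f : measurable_fun setT f -> (forall x, (0 <= f x)%E) ->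
  (\int[pmeasure m m]_XY ((g XY.1.1 * poisson2 XY.1.2 * (g XY.2.1 * poisson2 XY.2.2))%:E *
     f ((smear XY.1).1 - (smear XY.2).1, (smear XY.1).2 - (smear XY.2).2)%R) <=
   \int[leb2]_z ((g z.1 * g z.2)%:E * maxavg l (maxavg (map neg l) f) (chord F z)))%E.
Proof.
move=> mf f0; set Mf := maxavg (map neg l) f.
have mMf : measurable_fun setT Mf by exact: measurable_maxavg.
have Mf0 z : (0 <= Mf z)%E by exact: maxavg_ge0.
have mMMf : measurable_fun setT (maxavg l Mf) by exact: measurable_maxavg.
have ms1 : measurable_fun setT (fun XY : (R * (R * R)) * (R * (R * R)) => smear XY.1).
  exact: (measurableT_comp measurable_smear measurable_fst).
have ms2 : measurable_fun setT (fun XY : (R * (R * R)) * (R * (R * R)) => smear XY.2).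
  exact: (measurableT_comp measurable_smear measurable_snd).
have mQ : measurable_fun setT (fun XY : (R * (R * R)) * (R * (R * R)) => ((wt XY.1 * wt XY.2)%:E *
     f ((smear XY.1).1 - (smear XY.2).1, (smear XY.1).2 - (smear XY.2).2)%R)%E).
  apply: emeasurable_funM.
    apply/measurable_EFinP; apply: measurable_funM.
      exact: (measurableT_comp mwt measurable_fst).
    exact: (measurableT_comp mwt measurable_snd).
  apply: (measurableT_comp mf); apply: measurable_fun_pair; apply: measurable_funB.
  - exact: (measurableT_comp measurable_fst ms1).
  - exact: (measurableT_comp measurable_fst ms2).
  - exact: (measurableT_comp measurable_snd ms1).
  - exact: (measurableT_comp measurable_snd ms2).
have Q0 (XY : (R * (R * R)) * (R * (R * R))) : (0 <= (wt XY.1 * wt XY.2)%:E *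
     f ((smear XY.1).1 - (smear XY.2).1, (smear XY.1).2 - (smear XY.2).2)%R)%E.
  by rewrite mule_ge0// lee_fin mulr_ge0.
rewrite (integral_pmeasure12 m m mQ Q0).
pose S (X : R * (R * R)) := (\int[leb]_y ((g y)%:E * Mf ((smear X).1 - y, (smear X).2 - F y)%R))%E.
apply: (@le_trans _ _ (\int[m]_X ((wt X)%:E * S X))%E).
  apply: le_integral_nonmeas => X; first by apply: integral_ge0 => Y _; exact: Q0.
  have w0 : (0 <= (wt X)%:E :> \bar R)%E by rewrite lee_fin.
  apply: le_trans (lee_wpmul2l w0 (inner (smear X) mf f0)).
  rewrite -ge0_integralZl//; last 2 first.
  - apply: emeasurable_funM; first exact/measurable_EFinP.
    apply: (measurableT_comp mf); apply: measurable_fun_pair; apply: measurable_funB; try exact: measurable_cst.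
      exact: (measurableT_comp measurable_fst measurable_smear).
    exact: (measurableT_comp measurable_snd measurable_smear).
  - by move=> Y _; rewrite mule_ge0// lee_fin.
  by rewrite le_eqVlt; apply/orP; left; apply/eqP; apply: eq_integral => Y _; rewrite EFinM muleA.
pose G (w : (R * (R * R)) * R) := ((g w.2)%:E * Mf ((smear w.1).1 - w.2, (smear w.1).2 - F w.2)%R)%E.
have mG : measurable_fun setT G.
  apply: emeasurable_funM; first by apply/measurable_EFinP; exact: (measurableT_comp mg measurable_snd).
  have msw : measurable_fun setT (fun w : (R * (R * R)) * R => smear w.1).
    exact: (measurableT_comp measurable_smear measurable_fst).
  apply: (measurableT_comp mMf); apply: measurable_fun_pair; apply: measurable_funB.
  - exact: (measurableT_comp measurable_fst msw).
  - exact: measurable_snd.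
  - exact: (measurableT_comp measurable_snd msw).
  - exact: (measurableT_comp mF measurable_snd).
have G0 w : (0 <= G w)%E by rewrite mule_ge0// lee_fin.
have mS : measurable_fun setT S by exact: (measurable_integral12 lebR mG G0).
have S0 X : (0 <= S X)%E by apply: integral_ge0 => y _; exact: (G0 (X, y)).
have mwS : measurable_fun setT (fun X => ((wt X)%:E * S X)%E).
  by apply: emeasurable_funM => //; exact/measurable_EFinP.
have wS0 X : (0 <= (wt X)%:E * S X)%E by rewrite mule_ge0// lee_fin.
rewrite (integral_pmeasure12 lebR leb2 mwS wS0).
have mU : measurable_fun setT (fun z : R * R => ((g z.1 * g z.2)%:E * maxavg l Mf (chord F z))%E).
  apply: emeasurable_funM; last exact: (measurableT_comp mMMf (measurable_chord mF)).
  apply/measurable_EFinP; apply: measurable_funM.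
    exact: (measurableT_comp mg measurable_fst).
  exact: (measurableT_comp mg measurable_snd).
have U0 (z : R * R) : (0 <= (g z.1 * g z.2)%:E * maxavg l Mf (chord F z))%E.
  by rewrite mule_ge0 ?maxavg_ge0// lee_fin mulr_ge0.
rewrite (integral_pmeasure12 lebR lebR mU U0).
apply: le_integral_nonmeas => x; first by apply: integral_ge0 => st _; exact: wS0.
have gx0 : (0 <= (g x)%:E :> \bar R)%E by rewrite lee_fin.
pose T (w : (R * R) * R) := ((poisson2 w.1)%:E * G ((x, w.1), w.2))%E.
have mGx : measurable_fun setT (fun w : (R * R) * R => G ((x, w.1), w.2)).
  apply: (measurableT_comp mG); apply: measurable_fun_pair; last exact: measurable_snd.
  by apply: measurable_fun_pair; [exact: measurable_cst|exact: measurable_fst].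
have mT : measurable_fun setT T.
  apply: emeasurable_funM => //; apply/measurable_EFinP.
  exact: (measurableT_comp measurable_poisson2 measurable_fst).
have T0 w : (0 <= T w)%E by rewrite mule_ge0// lee_fin poisson2_ge0.
have IT0 st : (0 <= \int[lebR]_y T (st, y))%E by apply: integral_ge0 => y _; exact: T0.
have IT0' y : (0 <= \int[leb2]_st T (st, y))%E by apply: integral_ge0 => st _; exact: T0.
have mIT : measurable_fun setT (fun st => \int[lebR]_y T (st, y))%E by exact: (measurable_integral12 lebR mT T0).
have mIT' : measurable_fun setT (fun y => \int[leb2]_st T (st, y))%E by exact: (measurable_integral21 leb2 mT T0).
have -> : (\int[leb2]_st ((wt (x, st))%:E * S (x, st)) = (g x)%:E * \int[leb2]_st \int[lebR]_y T (st, y))%E.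
  rewrite -(@ge0_integralZl _ _ R leb2 setT measurableT _ mIT (g x)%:E (fun st _ => IT0 st) gx0).
  apply: eq_integral => st _; rewrite /wt/= EFinM -muleA; congr (_ * _)%E.
  have mGs : measurable_fun setT (fun y : RR => G ((x, st), y)) by exact: (measurableT_comp mG (measurable_pair1 (x, st))).
  rewrite /T/= ge0_integralZl//; last by rewrite lee_fin poisson2_ge0.
rewrite -(integral_pmeasure12 leb2 lebR mT T0) (integral_pmeasure21 leb2 lebR mT T0).
rewrite -(@ge0_integralZl _ _ R lebR setT measurableT _ mIT' (g x)%:E (fun y _ => IT0' y) gx0).
apply: le_integral_nonmeas => y; first by rewrite mule_ge0.
rewrite /= EFinM -muleA; apply: lee_wpmul2l => //.
have gy0 : (0 <= (g y)%:E :> \bar R)%E by rewrite lee_fin.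
have -> : (\int[leb2]_st T (st, y) = (g y)%:E * avg2 (E x) Mf (chord F (x, y)))%E.
  have mI : measurable_fun setT (fun st : R * R => ((poisson2 st)%:E *
      Mf ((chord F (x, y)).1 + (E x).1 * st.1, (chord F (x, y)).2 + (E x).2 * st.2)%R)%E).
    apply: emeasurable_funM; first by apply/measurable_EFinP; exact: measurable_poisson2.
    exact: (measurableT_comp mMf (measurable_shift2 (chord F (x, y)) (E x))).
  have I0 (st : R * R) : (0 <= (poisson2 st)%:E *
      Mf ((chord F (x, y)).1 + (E x).1 * st.1, (chord F (x, y)).2 + (E x).2 * st.2)%R)%E.
    by rewrite mule_ge0// lee_fin poisson2_ge0.
  rewrite (avg2E (E x) (chord F (x, y)) mMf Mf0).
  rewrite -(@ge0_integralZl _ _ R leb2 setT measurableT _ mI (g y)%:E (fun st _ => I0 st) gy0).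
  apply: eq_integral => st _; rewrite /T /G /chord/= muleCA.
  have -> : x + (E x).1 * st.1 - y = x - y + (E x).1 * st.1 by ring.
  by have -> : F x + (E x).2 * st.2 - F y = F x - F y + (E x).2 * st.2 by ring.
apply: lee_wpmul2l => //; exact: (@maxfun_ge _ _ _ _ (avg2^~ Mf)).
Qed.

End smear.

Lemma L1_scale d (T : measurableType d) (R : realType) (m : {measure set T -> \bar R})
  (c : R) (f : T -> R) : L1 m f -> L1 m (fun x => c * f x).
Proof.
move=> Lf; under eq_fun do rewrite mulrC.
by apply: (@L1_bounded_prod _ _ _ _ _ _ `|c| Lf) => //; exact: measurable_cst.
Qed.

(** * The linearised estimate for a real integrable function on a compact interval *)

Section core.
Context {R : realType}.
Local Notation leb := (@lebesgue_measure R).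
Local Notation lebR := (leb : {sigma_finite_measure set (measurableTypeR R) -> \bar R}).
Local Notation RR := (measurableTypeR R).
Let m := pmeasure lebR (@leb2 R).

Lemma L1_poisson2 : L1 leb2 (@poisson2 R).
Proof.
have L : L1 lebR (fun t : RR => poisson 1 t).
  apply/integrableP; split; first by apply/measurable_EFinP; exact: measurable_poisson.
  rewrite (_ : (\int[lebR]_x `|_| = \int[leb]_t (poisson 1 t)%:E)%E).
    by rewrite integral_poisson1 ltry.
  by apply: eq_integral => t _; rewrite /= ger0_norm// ltW// poisson_gt0.
exact: (L1_tensor L L).
Qed.

Lemma L1_itv (c d : R) : L1 lebR (fun t : RR => (c <= t <= d)%R%:R : R).
Proof.
have mb : measurable_fun setT (fun t : RR => (c <= t <= d)%R%:R : R).
  apply: measurable_bool_natr; apply: measurable_and; apply: measurable_fun_ler => //; exact: measurable_cst.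
apply/integrableP; split; first exact/measurable_EFinP.
have -> : (\int[lebR]_x `|(EFin \o (fun t : RR => (c <= t <= d)%R%:R : R)) x| =
    \int[leb]_x (\1_(`[c, d]%classic : set R) x)%:E)%E.
  by apply: eq_integral => x _; rewrite /= indicE mem_setE in_itv/= normr_nat.
have lebI : leb `[c, d]%classic = if c < d then (d - c)%:E else 0%E.
  by rewrite lebesgue_measure_itv/= lte_fin.
rewrite integral_indic// setIT [ltLHS]lebI.
by case: ifP => _; rewrite ltry.
Qed.

Variables (a b : R) (phi dphi kappa : R -> R).
Hypotheses (ab : a <= b)
  (phi_derive : forall x, a <= x <= b -> is_derive x 1 phi (dphi x))
  (dphi_derive : forall x, a <= x <= b -> is_derive x 1 dphi (kappa x))
  (kappa_cont : {within `[a, b], continuous kappa})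
  (kappa_ge0 : forall x, a <= x <= b -> 0 <= kappa x).
Variables (F P k : R -> R).
Hypotheses (mF : measurable_fun setT F) (FE : forall x, a <= x <= b -> F x = phi x)
  (mP : measurable_fun setT P) (PE : forall x, a <= x <= b -> P x = dphi x)
  (mk : measurable_fun setT k) (kE : forall x, k x = (a <= x <= b)%R%:R * kappa x).
Variables (sg p : R).
Hypotheses (sg2 : 2 < sg) (p0 : 0 < p) (psg : p^-1 + (2 * sg)^-1 = 1).
(** By [psg] the exponent p' is 2 sg, so [q0] is p'/3, the endpoint exponent of the theorem. *)
Let q0 := 2 * sg / 3.
Let r := sg / (sg - 1).
Let gam := (sg - 1)^-1.

Let sg1 : 0 < sg - 1. Proof. by rewrite subr_gt0 (lt_trans _ sg2)// ltr1n. Qed.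
Let sg0 : 0 < sg. Proof. exact: lt_trans sg2. Qed.
Let r0 : 0 < r. Proof. by rewrite divr_gt0. Qed.
Let q00 : 0 < q0. Proof. by rewrite divr_gt0// mulr_gt0. Qed.

Let k0 x : 0 <= k x.
Proof. by rewrite kE; case: (boolP (a <= x <= b)) => [/kappa_ge0 h|_]; rewrite ?mul1r ?mul0r. Qed.

Let j (x : R) : R := (a <= x <= b)%R%:R.

Lemma L1_mask : L1 lebR k.
Proof.
apply/integrableP; split; first exact/measurable_EFinP.
have -> : (\int[lebR]_x `|(EFin \o k) x| = \int[leb]_(x in `[a, b]) (kappa x)%:E)%E.
  rewrite [RHS]integral_mkcond; apply: eq_integral => x _.
  rewrite /= ger0_norm// kE patchE mem_setE/= in_itv/=.
  by case: (a <= x <= b); rewrite ?mul1r ?mul0r.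
by rewrite (integral_derive_itv dphi_derive kappa_cont (lexx a) ab (lexx b)) ltry.
Qed.

Let jk x := j x + k x.

Let L1_jk : L1 lebR jk.
Proof.
have := @integrableD _ _ R lebR setT measurableT _ _ (L1_itv a b) L1_mask; exact.
Qed.

(** A cube root is at most 1 or at most its argument. This makes the arclength weight integrable on
    [[a, b]]. *)
Lemma powR_mask_le x : k x `^ 3^-1 <= j x + k x.
Proof.
rewrite kE /j; have [xab|_] := boolP (a <= x <= b); last first.
  by rewrite !mul0r addr0 powR0// invr_eq0.
rewrite !mul1r; have kx0 := kappa_ge0 xab.
have [k1|k1] := leP (kappa x) 1; last first.
  apply: (le_trans (ler1_powR (ltW k1) _)); last by rewrite lerDr.
  by rewrite invf_le1// ler1n.
apply: (@le_trans _ _ 1); last by rewrite lerDl.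
have h1 : 1 = 1 `^ 3^-1 :> R by rewrite powR1.
by rewrite [leRHS]h1 ge0_ler_powR ?nnegrE.
Qed.

Variables (w : R * R -> R) (f : R * R -> R) (bt : bool).
Hypotheses (mw : measurable_fun setT w) (w_le : forall st, `|w st| <= poisson2 st)
  (Lf : L1 leb2 f).

(** [bt] selects the cosine or the sine part of the Fourier integral; complex transforms are
    assembled from these parts in [fourier1E]. *)
Definition fhat (z : R * R) := \int[leb2]_x (f x * trig bt (z.1 * x.1 + z.2 * x.2)).

Definition osc (e : R * R) (x : R) :=
  \int[leb2]_st (fhat (x + e.1 * st.1, F x + e.2 * st.2) * w st).

Let mf := L1_measurable Lf.

Let Lw : L1 leb2 w.
Proof. exact: (L1_dom L1_poisson2 mw w_le). Qed.

Let mphase : measurable_fun setT (fun v : (R * R) * (R * R) => v.1.1 * v.2.1 + v.1.2 * v.2.2).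
Proof.
have m1 : measurable_fun setT (fun v : (R * R) * (R * R) => v.1.1).
  exact: (measurableT_comp measurable_fst measurable_fst).
have m2 : measurable_fun setT (fun v : (R * R) * (R * R) => v.1.2).
  exact: (measurableT_comp measurable_snd measurable_fst).
have m3 : measurable_fun setT (fun v : (R * R) * (R * R) => v.2.1).
  exact: (measurableT_comp measurable_fst measurable_snd).
have m4 : measurable_fun setT (fun v : (R * R) * (R * R) => v.2.2).
  exact: (measurableT_comp measurable_snd measurable_snd).
by apply: measurable_funD; apply: measurable_funM.
Qed.

Lemma measurable_fhat : measurable_fun setT fhat.
Proof.
rewrite /fhat; apply: (@measurable_Rintegral_param _ _ _ _ _ leb2
  (fun v : (R * R) * (R * R) => f v.2 * trig bt (v.1.1 * v.2.1 + v.1.2 * v.2.2))).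
apply: measurable_funM; first exact: (measurableT_comp mf measurable_snd).
exact: (measurableT_comp (measurable_trig bt) mphase).
Qed.

Let M := \int[leb2]_x `|f x|.

Let Lfk z : L1 leb2 (fun x : R * R => f x * trig bt (z.1 * x.1 + z.2 * x.2)).
Proof.
apply: (@L1_bounded_prod _ _ _ _ _ _ 1 Lf) => [|x]; last exact: trig_max.
apply: (measurableT_comp (measurable_trig bt)).
exact: (measurableT_comp mphase (measurable_pair1 z)).
Qed.

Lemma fhat_max z : `|fhat z| <= M.
Proof.
apply: (le_trans (le_normr_Rintegral measurableT (Lfk z))); apply: le_Rintegral => //.
- exact: (L1_norm (Lfk z)).
- exact: (L1_norm Lf).
- by move=> x _; rewrite normrM ler_piMr// trig_max.
Qed.

Let M0 : 0 <= M. Proof. exact: le_trans (fhat_max (0, 0)). Qed.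

Let Ma := M * \int[leb2]_st `|w st|.

Let mfs e : measurable_fun setT (fun v : R * (R * R) => fhat (v.1 + e.1 * v.2.1, F v.1 + e.2 * v.2.2)).
Proof.
have m21 : measurable_fun setT (fun X : R * (R * R) => X.2.1) by exact: (measurableT_comp measurable_fst measurable_snd).
have m22 : measurable_fun setT (fun X : R * (R * R) => X.2.2) by exact: (measurableT_comp measurable_snd measurable_snd).
apply: (measurableT_comp measurable_fhat); apply: measurable_fun_pair; apply: measurable_funD.
- exact: measurable_fst.
- by apply: measurable_funM => //; exact: measurable_cst.
- exact: (measurableT_comp mF measurable_fst).
- by apply: measurable_funM => //; exact: measurable_cst.
Qed.

Lemma measurable_osc e : measurable_fun setT (osc e).
Proof.
rewrite /osc; apply: (@measurable_Rintegral_param _ _ _ _ _ leb2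
  (fun v : R * (R * R) => fhat (v.1 + e.1 * v.2.1, F v.1 + e.2 * v.2.2) * w v.2)).
apply: measurable_funM; first exact: (mfs e).
exact: (measurableT_comp mw measurable_snd).
Qed.

Let Low (e : R * R) x : L1 leb2 (fun st : R * R => fhat (x + e.1 * st.1, F x + e.2 * st.2) * w st).
Proof.
under eq_fun do rewrite mulrC; apply: (@L1_bounded_prod _ _ _ _ _ _ M Lw) => [|st]; last exact: fhat_max.
exact: (measurableT_comp (mfs e) (measurable_pair1 x)).
Qed.

(** A bound through the L^1 norm of [f]. It serves to make [V] finite and is absent from the final
    estimate. *)
Lemma osc_max e x : `|osc e x| <= Ma.
Proof.
apply: (le_trans (le_normr_Rintegral measurableT (Low e x))).
rewrite /Ma -RintegralZl//; last exact: (L1_norm Lw).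
apply: le_Rintegral => //.
- exact: (L1_norm (Low e x)).
- exact: L1_scale (L1_norm Lw).
- by move=> st _; rewrite normrM ler_wpM2r// fhat_max.
Qed.

Let Ma0 : 0 <= Ma. Proof. exact: le_trans (osc_max (0, 0) 0). Qed.

Section selected.
Variables (E : R -> R * R) (l : seq (R * R)).
Hypotheses (mE : measurable_fun setT E) (El : forall x, E x \in l)
  (mEosc : measurable_fun setT (fun x => osc (E x) x))
  (l0 : forall e, e \in l -> (e.1 != 0) && (e.2 != 0)).

Let al x := `|osc (E x) x|.

Let al0 x : 0 <= al x. Proof. exact: normr_ge0. Qed.

Let mal : measurable_fun setT al.
Proof. exact: measurableT_comp. Qed.

Let mpow (u : R -> R) c : measurable_fun setT u -> measurable_fun setT (fun x => u x `^ c).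
Proof. by move=> mu; exact: (measurableT_comp (measurable_powR c) mu). Qed.

Let bounded_weight c : 0 <= c -> L1 lebR (fun x => al x `^ c * k x `^ 3^-1).
Proof.
move=> c0; have Ljk := L1_jk.
have L2 : L1 lebR (fun x => Ma `^ c * jk x).
  exact: L1_scale.
apply: (L1_dom L2) => [|x]; first by apply: measurable_funM; exact: mpow.
rewrite ger0_norm ?mulr_ge0 ?powR_ge0// ler_pM ?powR_ge0//; last exact: powR_mask_le.
by rewrite ge0_ler_powR ?nnegrE// osc_max.
Qed.

Let V := \int[lebR]_x (al x `^ q0 * k x `^ 3^-1).

Let V_EFin : V%:E = (\int[leb]_x (al x `^ q0 * k x `^ 3^-1)%:E)%E.
Proof. exact: Rintegral_EFin (bounded_weight (ltW q00)). Qed.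

Let q01 : 0 < q0 - 1.
Proof. by have s2 := sg2; rewrite subr_gt0 /q0 ltr_pdivlMr// mul1r; lra. Qed.

(** The dual function: paired with |osc| it gives back [V]. *)
Let g x := al x `^ (q0 - 1) * k x `^ 3^-1.

Let g0 x : 0 <= g x. Proof. by rewrite mulr_ge0 ?powR_ge0. Qed.

Let mg : measurable_fun setT g.
Proof. by apply: measurable_funM; exact: mpow. Qed.

Let sn x : R := if 0 <= osc (E x) x then 1 else -1.

Let sn1 x : `|sn x| <= 1. Proof. by rewrite /sn; case: ifP => _; rewrite ?normrN normr1. Qed.

Let snE x : sn x * osc (E x) x = al x.
Proof.
rewrite /sn /al; case: (leP 0 (osc (E x) x)) => h.
  by rewrite mul1r ger0_norm.
by rewrite mulN1r ltr0_norm.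
Qed.

Let gsn x := g x * sn x.

Let Lgsn : L1 lebR gsn.
Proof.
apply: (@L1_bounded_prod _ _ _ _ _ _ 1 (bounded_weight (ltW q01))) => //.
apply: measurable_fun_ifT; [|exact: measurable_cst|exact: measurable_cst].
by apply: measurable_fun_ler => //; exact: measurable_cst.
Qed.

Let u (X : R * (R * R)) := gsn X.1 * w X.2.

Let Lu : L1 m u. Proof. exact: (L1_tensor Lgsn Lw). Qed.

Let Lu0 : \int[m]_X `|u X| >= 0. Proof. exact: Rintegral_ge0. Qed.

Let kb (c : bool) (v : (R * R) * (R * (R * R))) :=
  trig c ((smear F E v.2).1 * v.1.1 + (smear F E v.2).2 * v.1.2).

Let mkb c : measurable_fun setT (kb c).
Proof.
have ms := measurable_smear mF mE.
apply: (measurableT_comp (measurable_trig c)).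
have ms2 : measurable_fun setT (fun v : (R * R) * (R * (R * R)) => smear F E v.2).
  exact: (measurableT_comp ms measurable_snd).
apply: measurable_funD; apply: measurable_funM.
- exact: (measurableT_comp measurable_fst ms2).
- exact: (measurableT_comp measurable_fst measurable_fst).
- exact: (measurableT_comp measurable_snd ms2).
- exact: (measurableT_comp measurable_snd measurable_fst).
Qed.

Let kb1 c v : `|kb c v| <= 1. Proof. exact: trig_max. Qed.

Let T c xi := \int[m]_X (u X * kb c (xi, X)).

Let mT c : measurable_fun setT (T c).
Proof.
rewrite /T; apply: (@measurable_Rintegral_param _ _ _ _ _ m (fun v : (R * R) * (R * (R * R)) => u v.2 * kb c v)).
apply: measurable_funM; last exact: mkb.
exact: (measurableT_comp (L1_measurable Lu) measurable_snd).
Qed.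

Let Luk c xi : L1 m (fun X => u X * kb c (xi, X)).
Proof.
apply: (@L1_bounded_prod _ _ _ _ _ _ 1 Lu) => [|X]; last exact: kb1.
exact: (measurableT_comp (mkb c) (measurable_pair1 xi)).
Qed.

Let T_max c xi : `|T c xi| <= \int[m]_X `|u X|.
Proof.
apply: (le_trans (le_normr_Rintegral measurableT (Luk c xi))); apply: le_Rintegral => //.
- exact: (L1_norm (Luk c xi)).
- exact: (L1_norm Lu).
- by move=> x _; rewrite normrM ler_piMr.
Qed.

(** The sign [sn] linearises the modulus, and Fubini moves the oscillating kernel from [f] to the
    measure carried by the displaced curve. *)
Let duality : V = \int[leb2]_xi (f xi * T bt xi).
Proof.
have L3 : L1 (pmeasure m leb2) (fun v => u v.1 * f v.2 * kb bt (v.2, v.1)).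
  apply: (@L1_bounded_prod _ _ _ _ _ _ 1 (L1_tensor Lu Lf)) => [|v]; last exact: kb1.
  apply: (measurableT_comp (mkb bt)); apply: measurable_fun_pair; [exact: measurable_snd|exact: measurable_fst].
have -> : \int[leb2]_xi (f xi * T bt xi) = \int[leb2]_xi \int[m]_X (u X * f xi * kb bt (xi, X)).
  apply: eq_Rintegral => xi _; rewrite -RintegralZl//; last exact: Luk.
  by apply: eq_Rintegral => X _; ring.
rewrite -(Rfubini L3)/=.
have -> : \int[m]_X \int[leb2]_xi (u X * f xi * kb bt (xi, X)) = \int[m]_X (u X * fhat (smear F E X)).
  apply: eq_Rintegral => X _; rewrite /fhat -RintegralZl//; last exact: Lfk.
  by apply: eq_Rintegral => xi _; rewrite mulrA.
have L4 : L1 m (fun X => u X * fhat (smear F E X)).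
  apply: (@L1_bounded_prod _ _ _ _ _ _ M Lu) => [|X]; last exact: fhat_max.
  exact: (measurableT_comp measurable_fhat (measurable_smear mF mE)).
rewrite (Rfubini12 L4); apply: eq_Rintegral => x _.
have -> : \int[leb2]_st (u (x, st) * fhat (smear F E (x, st))) = gsn x * osc (E x) x.
  rewrite /osc -RintegralZl//; last exact: Low.
  by apply: eq_Rintegral => st _; rewrite /u /smear/=; ring.
by rewrite /gsn -mulrA snE /g mulrAC -(mulr_powRB1 (al0 x) q00) (mulrC (al x)).
Qed.

(** The square modulus of the complex T. Only [T bt] is paired with [f], but both parts together
    make the kernel of the quadratic form a cosine of a difference. *)
Let tau xi := T true xi ^+ 2 + T false xi ^+ 2.

Let tau0 xi : 0 <= tau xi. Proof. by rewrite addr_ge0 ?sqr_ge0. Qed.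

Let mtau : measurable_fun setT tau.
Proof. by apply: measurable_funD; apply: measurable_funX; exact: mT. Qed.

Let tau_max xi : tau xi <= 2 * (\int[m]_X `|u X|) ^+ 2.
Proof.
have h c : T c xi ^+ 2 <= (\int[m]_X `|u X|) ^+ 2.
  by rewrite -real_normK ?num_real// lerXn2r ?nnegrE// T_max.
by rewrite /tau; have := h true; have := h false; lra.
Qed.

(** The box makes [U n] finite, so that [U_le] may divide by a power of it. *)
Let B (n : nat) (xi : R * R) : R := (- n%:R <= xi.1 <= n%:R)%R%:R * (- n%:R <= xi.2 <= n%:R)%R%:R.

Let B01 n xi : B n xi = 0 \/ B n xi = 1.
Proof. by rewrite /B; do 2 case: (_ <= _ <= _); rewrite ?mulr1 ?mulr0; [right|left|left|left]. Qed.

Let B0 n xi : 0 <= B n xi. Proof. by have [->|->] := B01 n xi. Qed.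

Let LB n : L1 leb2 (B n). Proof. exact: (L1_tensor (L1_itv _ _) (L1_itv _ _)). Qed.

Let Ltau n c : 0 <= c -> L1 leb2 (fun xi => B n xi * tau xi `^ c).
Proof.
move=> c0; apply: (@L1_bounded_prod _ _ _ _ _ _ ((2 * (\int[m]_X `|u X|) ^+ 2) `^ c) (LB n)).
  exact: (measurableT_comp (measurable_powR c) mtau).
have b0 : 0 <= 2 * (\int[m]_X `|u X|) ^+ 2 by apply: mulr_ge0 => //; exact: sqr_ge0.
move=> xi; rewrite (ger0_norm (powR_ge0 _ _)); apply: ge0_ler_powR.
- exact: c0.
- by rewrite nnegrE; exact: tau0.
- by rewrite nnegrE; exact: b0.
- exact: tau_max.
Qed.

Let U n := \int[leb2]_xi (B n xi * tau xi `^ sg).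

Let U0 n : 0 <= U n. Proof. by apply: Rintegral_ge0 => xi _; rewrite mulr_ge0 ?powR_ge0. Qed.

Let U_EFin n : (U n)%:E = (\int[leb2]_xi (B n xi * tau xi `^ sg)%:E)%E.
Proof. exact: Rintegral_EFin (Ltau n (ltW sg0)). Qed.

Let h n xi := B n xi * tau xi `^ (sg - 1).

(** Dictated by g^r = A k. The identities [E1] and [E2] below show that A^(2/(2-gam)) k is then
    again al^q0 k^(1/3), whose integral is [V]: here the exponents p'/3 and 1/3 are forced. *)
Let A x := al x `^ ((q0 - 1) * r) * k x `^ (r / 3 - 1).

(** With h = tau^(sg-1) on the box, [U n] is the integral of h |T|^2 and also that of h^r, so it
    occurs on both sides. *)
Let TTstar n : 0 < V -> 0 < U n -> (U n <= energy_const sg * U n `^ r^-1 * V `^ ((2 - gam) / r)).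
Proof.
move=> V0 Un0.
have Lh : L1 leb2 (h n) by exact: Ltau (ltW sg1).
have h0 xi : 0 <= h n xi by rewrite mulr_ge0 ?powR_ge0.
have hU : (\int[leb2]_z (h n z `^ r)%:E <= (U n)%:E)%E.
  rewrite U_EFin le_eqVlt; apply/orP; left; apply/eqP; apply: eq_integral => xi _.
  rewrite /h; have [->|->] := B01 n xi; first by rewrite !mul0r powR0// gt_eqF.
  by rewrite !mul1r -powRrM /r mulrC divfK// gt_eqF.
have g_out x : ~~ (a <= x <= b) -> g x = 0.
  by move=> /negbTE xab; rewrite /g kE xab mul0r powR0 ?mulr0// invr_eq0.
have mA : measurable_fun setT A by apply: measurable_funM; exact: mpow.
have A0 x : 0 <= A x by rewrite mulr_ge0 ?powR_ge0.
have gE x : g x `^ r = A x * k x.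
  rewrite /g /A powRM ?powR_ge0// -!powRrM -mulrA; congr (_ * _).
  by rewrite [RHS]mulrC mulr_powRB1 ?divr_gt0// (mulrC r).
have AV : (\int[leb]_x (A x `^ (2 / (2 - gam)) * k x)%:E <= V%:E)%E.
  rewrite V_EFin le_eqVlt; apply/orP; left; apply/eqP; apply: eq_integral => x _; congr EFin.
  have g2 : 2 - gam != 0.
    by apply: lt0r_neq0; rewrite subr_gt0 /gam invf_plt ?posrE//; have s2 := sg2; lra.
  have sg3 : 2 * sg - 3 != 0 by apply: lt0r_neq0; have s2 := sg2; lra.
  have sgm : sg - 1 != 0 by exact: lt0r_neq0.
  have E1 : (q0 - 1) * r * (2 / (2 - gam)) = q0.
    rewrite /q0 /r /gam; field; repeat (apply/andP; split); rewrite neq_lt; apply/orP; have s2 := sg2; (left; lra) || (right; lra).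
  have E2 : (r / 3 - 1) * (2 / (2 - gam)) + 1 = 3^-1.
    rewrite /r /gam; field; repeat (apply/andP; split); rewrite neq_lt; apply/orP; have s2 := sg2; (left; lra) || (right; lra).
  rewrite /A powRM ?powR_ge0// -!powRrM E1 -mulrA; congr (_ * _).
  have := k0 x; rewrite le_eqVlt => /orP[/eqP <-|kx0].
    by rewrite mulr0 powR0// invr_eq0.
  by rewrite -[X in _ * X](powRr1 (k0 x)) -powRD ?E2// (gt_eqF kx0) implybT.
have neg0 e : e \in map (fun e : R * R => (- e.1, - e.2)) l -> (e.1 != 0) && (e.2 != 0).
  by move=> /mapP[e' /l0 e'0 ->]/=; rewrite !oppr_eq0.
have en := energy_le ab phi_derive dphi_derive kappa_cont kappa_ge0 mF FE mP PE sg2 l0 neg0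
  Lh h0 Un0 hU mg g0 g_out mA A0 mk kE gE V0 AV.
have qf := @quadratic_form_le _ _ _ _ _ m leb2 u (h n) Lu Lh bool kb mkb kb1.
rewrite -lee_fin; apply: le_trans en.
have mabs : measurable_fun setT (fun z => `|hatc (h n) z|%:E : \bar R) by exact: measurable_abs_hatc (L1_measurable Lh).
have abs0 z : (0 <= `|hatc (h n) z|%:E :> \bar R)%E by rewrite lee_fin.
apply: le_trans (smear_pairs_le mF mg g0 mE El mabs abs0).
have -> : U n = \int[leb2]_z (h n z * \sum_i (\int[m]_x (u x * kb i (z, x))) ^+ 2).
  apply: eq_Rintegral => xi _; rewrite big_bool /h.
  change (B n xi * tau xi `^ sg = B n xi * tau xi `^ (sg - 1) * tau xi).
  by rewrite -mulrA [in RHS](mulrC (_ `^ _)) mulr_powRB1.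
apply: (le_trans qf); apply: le_integral_nonmeas => XY; first by rewrite lee_fin !mulr_ge0.
rewrite -EFinM lee_fin.
have -> : \int[leb2]_z (h n z * \sum_i (kb i (z, XY.1) * kb i (z, XY.2))) =
  hatc (h n) ((smear F E XY.1).1 - (smear F E XY.2).1, (smear F E XY.1).2 - (smear F E XY.2).2).
  apply: eq_Rintegral => z _; rewrite big_bool/= /kb /trig -cosB; congr (_ * cos _); ring.
have uw X : `|u X| <= g X.1 * poisson2 X.2.
  rewrite /u normrM /gsn normrM (ger0_norm (g0 _)); apply: ler_pM => //; first exact: mulr_ge0.
  by rewrite ler_piMr.
apply: ler_wpM2r => //; apply: ler_pM => //.
Qed.

Let U_le n : 0 < V -> U n `^ sg^-1 <= energy_const sg * V `^ ((2 - gam) / r).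
Proof.
move=> V0; have ec : 0 <= energy_const sg * V `^ ((2 - gam) / r) by rewrite /energy_const !mulr_ge0 ?powR_ge0.
have := U0 n; rewrite le_eqVlt => /orP[/eqP <-|Un0].
  by rewrite powR0// invr_eq0 gt_eqF.
have Ur : 0 < U n `^ r^-1 by exact: powR_gt0.
rewrite -(ler_pM2r Ur) -powRD; last by rewrite (gt_eqF Un0) implybT.
have -> : sg^-1 + r^-1 = 1 by rewrite /r; field; rewrite !lt0r_neq0.
by rewrite (powRr1 (U0 n)) mulrAC; exact: TTstar.
Qed.

Variables (Fp : R).
Hypotheses (Fp0 : 0 <= Fp) (fFp : (\int[leb2]_x (`|f x| `^ p)%:E <= Fp%:E)%E).

Let K := Fp `^ p^-1 * (energy_const sg * V `^ ((2 - gam) / r)) `^ 2^-1.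

Let trunc n : 0 < V -> (\int[leb2]_xi (`|f xi| * (B n xi * `|T bt xi|))%:E <= K%:E)%E.
Proof.
move=> V0.
have mabsf : measurable_fun setT (fun x => `|f x|) by exact: measurableT_comp.
have mBT : measurable_fun setT (fun xi => B n xi * `|T bt xi|).
  apply: measurable_funM; first exact: L1_measurable (LB n).
  by apply: measurableT_comp => //; exact: mT.
have BT0 xi : 0 <= B n xi * `|T bt xi| by exact: mulr_ge0.
have s0 : 0 < 2 * sg by exact: mulr_gt0.
have hB : (\int[leb2]_xi ((B n xi * `|T bt xi|) `^ (2 * sg))%:E <= (U n)%:E)%E.
  rewrite U_EFin; apply: le_integral_nonmeas => xi; first by rewrite lee_fin powR_ge0.
  rewrite lee_fin; have [->|->] := B01 n xi; first by rewrite !mul0r powR0// gt_eqF.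
  rewrite !mul1r powRrM powR_mulrn// real_normK ?num_real//.
  apply: ge0_ler_powR; rewrite ?nnegrE ?sqr_ge0 ?tau0 ?(ltW sg0)//.
  by rewrite /tau; case: bt; rewrite ?lerDl ?lerDr sqr_ge0.
have H := @hoelder_le _ _ R leb2 (fun x => `|f x|) (fun xi => B n xi * `|T bt xi|) p (2 * sg) Fp (U n)
  mabsf (fun x => normr_ge0 _) mBT BT0 p0 s0 psg Fp0 (U0 n) fFp hB.
apply: (le_trans H); rewrite lee_fin /K; apply: ler_wpM2l; first exact: powR_ge0.
rewrite invfM mulrC powRrM; apply: ge0_ler_powR; rewrite ?nnegrE ?powR_ge0 ?invr_ge0//.
  by rewrite /energy_const !mulr_ge0 ?powR_ge0.
exact: U_le.
Qed.

(** The bound [K] does not depend on the box, so the boxes may exhaust the plane. *)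
Let untrunc : 0 < V -> V <= K.
Proof.
move=> V0; pose H xi := (`|f xi| * `|T bt xi|)%:E : \bar R.
have mH : measurable_fun setT H.
  apply/measurable_EFinP; apply: measurable_funM; first exact: measurableT_comp.
  by apply: measurableT_comp => //; exact: mT.
have H0 xi : (0 <= H xi)%E by rewrite lee_fin mulr_ge0.
pose S n := [set xi : R * R | B n xi = 1].
have mS n : measurable (S n).
  have := L1_measurable (LB n) measurableT (measurable_set1 (1 : R)).
  by rewrite setTI.
have B1E n xi : S n xi <-> (- n%:R <= xi.1 <= n%:R) /\ (- n%:R <= xi.2 <= n%:R).
  rewrite /S/= /B; split; last by move=> [-> ->]; rewrite mulr1.
  by case: (_ <= _ <= _); case: (_ <= _ <= _); rewrite ?(mulr0, mul0r)// => /eqP; rewrite eq_sym oner_eq0.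
have Sh : {homo S : i k / (i <= k)%N >-> (i <= k)%O}.
  move=> i n' iN; rewrite subsetEset => xi /B1E[/andP[x1 x2] /andP[x3 x4]]; apply/B1E.
  have : i%:R <= n'%:R :> R by rewrite ler_nat.
  by move=> iN'; split; apply/andP; split; lra.
have SU : \bigcup_n S n = setT.
  apply/seteqP; split => // xi _; have h1 := archi_boundP (normr_ge0 xi.1).
  have h2 := archi_boundP (normr_ge0 xi.2); move: (Num.bound _) (Num.bound _) h1 h2 => n1 n2 h1 h2.
  exists (n1 + n2)%N => //; apply/B1E; rewrite natrD.
  have N1 : 0 <= n1%:R :> R by []. have N2 : 0 <= n2%:R :> R by [].
  by move: h1 h2; rewrite !ltr_norml => /andP[? ?] /andP[? ?]; split; apply/andP; split; lra.
have cv := @ge0_nondecreasing_set_cvg_integral _ (RR * RR)%type R S H leb2 Sh mS (fun i => measurable_funTS mH) (fun i x _ => H0 x).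
have LfT : L1 leb2 (fun xi => f xi * T bt xi).
  by apply: (@L1_bounded_prod _ _ _ _ _ _ _ Lf (mT bt)) => xi; exact: T_max.
have V1 : (V%:E <= \int[leb2]_xi H xi)%E.
  rewrite duality; apply: (@le_trans _ _ (\int[leb2]_xi `|f xi * T bt xi|)%:E).
    by rewrite lee_fin; apply: le_trans (ler_norm _) (le_normr_Rintegral measurableT LfT).
  rewrite (Rintegral_EFin (L1_norm LfT)) le_eqVlt; apply/orP; left; apply/eqP.
  by apply: eq_integral => xi _; rewrite normrM.
rewrite -lee_fin; apply: (le_trans V1); rewrite -SU -(cvg_lim _ cv)//.
apply: lime_le; first by apply/cvg_ex; eexists; exact: cv.
apply: nearW => n; apply: le_trans (trunc n V0).
rewrite [leLHS]integral_mkcond; apply: le_integral_nonmeas => xi; rewrite patchE.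
  by case: ifP.
case: ifPn => [|_]; last by rewrite lee_fin !mulr_ge0.
by rewrite inE /S/= => ->; rewrite mul1r.
Qed.

(** [K] is a constant times V^(1 - 1/q0), so for V > 0 the inequality V <= K can be solved for
    [V]. *)
Lemma selected_le :
  (\int[leb]_x (`|osc (E x) x| `^ q0 * k x `^ 3^-1)%:E <=
   ((energy_const sg `^ 2^-1 * Fp `^ p^-1) `^ q0)%:E)%E.
Proof.
rewrite -V_EFin lee_fin.
have V0 : 0 <= V by apply: Rintegral_ge0 => x _; rewrite mulr_ge0 ?powR_ge0.
move: V0; rewrite le_eqVlt => /orP[/eqP <-|V0]; first exact: powR_ge0.
have ec : 0 <= energy_const sg by rewrite /energy_const mulr_ge0 ?powR_ge0.
have K1 : K = energy_const sg `^ 2^-1 * Fp `^ p^-1 * V `^ (1 - q0^-1).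
  rewrite /K powRM ?powR_ge0// -powRrM mulrCA mulrA; congr (_ * _ `^ _).
  rewrite /r /gam /q0; field; repeat (apply/andP; split); rewrite neq_lt; apply/orP; have s2 := sg2; (left; lra) || (right; lra).
have VK := untrunc V0; rewrite K1 in VK.
have Vq : V `^ q0^-1 <= energy_const sg `^ 2^-1 * Fp `^ p^-1.
  have Vp : 0 < V `^ (1 - q0^-1) by exact: powR_gt0.
  rewrite -(ler_pM2r Vp) -powRD; last by rewrite (gt_eqF V0) implybT.
  by rewrite addrC subrK powRr1// ltW.
have -> : V = (V `^ q0^-1) `^ q0 by rewrite -powRrM mulVf ?gt_eqF// powRr1// ltW.
apply: ge0_ler_powR.
- exact: ltW.
- by rewrite nnegrE powR_ge0.
- by rewrite nnegrE; apply: mulr_ge0; exact: powR_ge0.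
- exact: Vq.
Qed.

End selected.

Lemma maximal_osc_le (Fp : R) (e0 : R * R) (l : seq (R * R)) :
  0 <= Fp -> (\int[leb2]_x (`|f x| `^ p)%:E <= Fp%:E)%E ->
  (forall e, e \in e0 :: l -> (e.1 != 0) && (e.2 != 0)) ->
  exists al : R -> R, [/\ measurable_fun setT al, forall x, 0 <= al x,
    forall e x, e \in e0 :: l -> `|osc e x| <= al x &
    (\int[leb]_x (al x `^ q0 * k x `^ 3^-1)%:E <=
     ((energy_const sg `^ 2^-1 * Fp `^ p^-1) `^ q0)%:E)%E].
Proof.
move=> Fp0 fFp l0.
have mv e : measurable_fun setT (fun x : RR => `|osc e x|%:E : \bar R).
  by apply/measurable_EFinP; apply: measurableT_comp => //; exact: measurable_osc.
have [E [El Emax mE]] := measurable_argmax mv e0 l.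
have mE1 : measurable_fun setT (fun x : RR => E x).
  by apply: (mE _ _ (fun e _ => e)) => e; exact: measurable_cst.
have mEosc : measurable_fun setT (fun x : RR => osc (E x) x).
  by apply: (mE _ _ osc) => e; exact: measurable_osc.
exists (fun x => `|osc (E x) x|); split.
- exact: measurableT_comp.
- by move=> x; exact: normr_ge0.
- by move=> e x el; have := Emax x e el; rewrite lee_fin.
- exact: selected_le.
Qed.

End core.

(** * Convexity, curvature and affine arclength on the interior of the interval *)

Section interval_geometry.
Context {R : realType}.
Local Notation leb := (@lebesgue_measure R).
Variables (I : set R) (phi kappa : R -> R).
Hypotheses (I_itv : is_interval I) (I_bnd : bounded_set I)
  (phi_convex : @convex_function R R^o I phi).

(** The interior of [I]: limits within [I] are ordinary derivatives there, and the endpoints are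
    negligible for [mu]. For empty [I] both bounds are 0 by convention and the interval is empty. *)
Definition inner_itv := `]inf I, sup I[%classic : set R.

Let has_sup_inf : I !=set0 -> has_sup I /\ has_inf I.
Proof.
move=> I0; have [M [_ HM]] := I_bnd.
have MI x : I x -> `|x| <= M + 1 by apply: HM; rewrite ltrDl.
split; split=> //; [exists (M + 1)|exists (- (M + 1))] => x /MI; rewrite ler_norml => /andP[]//.
Qed.

Let inner_bounds x : inner_itv x -> exists y z, [/\ I y, I z, y < x & x < z].
Proof.
rewrite /inner_itv/= in_itv/= => /andP[ix xs].
have I0 : I !=set0.
  apply/set0P/eqP => I0; move: ix xs; rewrite I0 inf0 sup0 => x1 x2.
  by have := lt_trans x1 x2; rewrite ltxx.
have [hs hi] := has_sup_inf I0.
have xi : 0 < x - inf I by rewrite subr_gt0.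
have sx : 0 < sup I - x by rewrite subr_gt0.
have [y Iy yx] := inf_adherent xi hi; have [z Iz xz] := sup_adherent sx hs.
exists y, z; split => //; first by move: yx; rewrite addrC subrK.
by move: xz; rewrite opprB addrC subrK.
Qed.

Lemma inner_itv_sub : inner_itv `<=` I.
Proof.
move=> x /inner_bounds[y [z [Iy Iz yx xz]]].
by apply: (I_itv Iy Iz); rewrite !ltW.
Qed.

Lemma inner_itv_nbhs x : inner_itv x -> nbhs x I.
Proof.
move=> xI; apply: (filterS inner_itv_sub); apply: open_nbhs_nbhs; split => //.
Qed.

Lemma inner_itv_pinch x : I x -> ~ inner_itv x -> x = inf I \/ x = sup I.
Proof.
move=> Ix; have [hs hi] : has_sup I /\ has_inf I by apply: has_sup_inf; exists x.
have ix : inf I <= x by apply: inf_lbound => //; exact: hi.2.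
have xs : x <= sup I by apply: sup_upper_bound.
move=> xn; move: ix; rewrite le_eqVlt => /orP[/eqP <-|ix]; first by left.
move: xs; rewrite le_eqVlt => /orP[/eqP ->|xs]; first by right.
by exfalso; apply: xn; rewrite /inner_itv/= in_itv/= ix xs.
Qed.

Lemma is_derive_inner (h dh : R -> R) x : is_derive_within I h dh -> inner_itv x ->
  is_derive x 1 h (dh x).
Proof.
move=> hI xI; have := hI x (inner_itv_sub xI).
have /nbhs_ballP[d0 /= d00 Hd0] := inner_itv_nbhs xI.
move=> /cvgrPdist_lt cv.
have C : (fun t : R => t^-1 *: (h (t *: (1 : R^o) + x) - h x) : R^o) @ 0^' --> (dh x : R^o).
  apply/cvgrPdist_lt => e e0; have := cv e e0 => /nbhs_ballP[d /= dpos Hd].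
  have m0 : 0 < Num.min d0 d by rewrite lt_min d00 dpos.
  apply/nbhs_ballP; exists (Num.min d0 d) => //= t.
  rewrite /ball/= sub0r normrN lt_min => /andP[td0 td] t0.
  have B c : `|t| < c -> ball x c (t + x).
    by move=> tc; rewrite /ball/= opprD addrCA subrr addr0 normrN.
  have tx : t + x != x by rewrite -subr_eq0 addrK.
  have := Hd (t + x) (B _ td) tx (Hd0 _ (B _ td0)).
  by rewrite addrK /GRing.scale/= mulr1 mulrC.
apply: DeriveDef; first by apply/cvg_ex; eexists; exact: C.
by rewrite /derive; apply: cvg_lim => //; exact: C.
Qed.

Hypothesis (phi_C2 : is_C2_within I phi kappa).

(** If kappa x < 0, then the mean value theorem, applied to phi on both sides of x and to its
    derivative in between, puts phi x above the average of two symmetric values, against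
    convexity. *)
Lemma kappa_ge0_inner x : inner_itv x -> 0 <= kappa x.
Proof.
have [_ [dphi [D1 D2]]] := phi_C2.
move=> xI; rewrite leNgt; apply/negP => kx.
have kc : {for x, continuous kappa}.
  have [kI _] := phi_C2.

  have W : {within inner_itv, continuous kappa} by apply: continuous_subspaceW kI; exact: inner_itv_sub.
  have oI : open inner_itv by exact: interval_open.
  by move: W; rewrite continuous_open_subspace// => /(_ x); apply; rewrite inE.
have /nbhs_ballP[d1 /= d10 H1] : \forall y \near x, kappa y < 0.
  exact: (cvgr_lt (kappa x) kc _ kx).
have /nbhs_ballP[d2 /= d20 H2] : nbhs x inner_itv.
  exact: open_nbhs_nbhs.
pose d := Num.min d1 d2 / 2.
have m0 : 0 < Num.min d1 d2 by rewrite lt_min d10 d20.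
have d0 : 0 < d by rewrite divr_gt0.
have near_x y : x - d <= y <= x + d -> kappa y < 0 /\ inner_itv y.
  move=> /andP[y1 y2]; have : `|x - y| < Num.min d1 d2.
    apply: (@le_lt_trans _ _ d); last by rewrite /d; lra.
    by rewrite ler_norml; apply/andP; split; lra.
  by rewrite lt_min => /andP[b1 b2]; split; [exact: H1|exact: H2].
have mvt (h dh : R -> R) y z : is_derive_within I h dh -> x - d <= y -> y < z -> z <= x + d ->
    exists2 c, y < c < z & h z - h y = dh c * (z - y).
  move=> hd xy yz zx.
  have hD u : y <= u <= z -> is_derive u 1 h (dh u).
    move=> /andP[yu uz]; apply: (is_derive_inner hd).
    by apply: (near_x u _).2; apply/andP; split; lra.
  have h1 u : u \in `]y, z[ -> is_derive u 1 h (dh u).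
    by rewrite in_itv/= => /andP[yu uz]; apply: hD; rewrite !ltW.
  have h2 : {within `[y, z], continuous h}.
    apply: continuous_in_subspaceT => u; rewrite inE/= in_itv/= => /hD Du.
    by apply/differentiable_continuous/derivable1_diffP; case: Du.
  by have [c] := MVT yz h1 h2; rewrite in_itv/= => cyz E; exists c.
have dd : x < x + d /\ x - d < x by split; lra.
have [c1 /andP[xc1 c1d] E1] := mvt phi dphi x (x + d) D1 (ltW dd.2) dd.1 (lexx _).
have [c2 /andP[xc2 c2d] E2] := mvt phi dphi (x - d) x D1 (lexx _) dd.2 (ltW dd.1).
have [c3 /andP[xc3 c3d] E3] := mvt dphi kappa c2 c1 D2 (ltW xc2) (lt_trans c2d xc1) (ltW c1d).
have k3 : kappa c3 < 0 by apply: (near_x c3 _).1; apply/andP; split; lra.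
have c12 : c2 < c1 := lt_trans c2d xc1.
have dc : dphi c1 < dphi c2 by rewrite -subr_lt0 E3 nmulr_rlt0// subr_gt0.
have mid : phi x <= 2^-1 * phi (x + d) + 2^-1 * phi (x - d).
  have h0 : 0 <= 2^-1 :> R by [].
  have h1 : 2^-1 <= 1 :> R by rewrite invf_le1// ler1n.
  have i1 : x + d \in I.
    by rewrite inE; apply: inner_itv_sub; apply: (near_x _ _).2; apply/andP; split; lra.
  have i2 : x - d \in I.
    by rewrite inE; apply: inner_itv_sub; apply: (near_x _ _).2; apply/andP; split; lra.
  have := phi_convex (Itv01 h0 h1) i1 i2.
  rewrite /conv/= /GRing.scale/= /unstable.onem.
  have -> : 1 - 2^-1 = 2^-1 :> R by lra.
  have -> : 2^-1 * (x + d) + 2^-1 * (x - d) = x :> R by lra.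
  rewrite [X in _ <= X -> _](_ : _ = 2^-1 * phi (x + d) + (1 - 2^-1) * phi (x - d))//.
  by have -> : 1 - 2^-1 = 2^-1 :> R by lra.
have : dphi c1 * d < dphi c2 * d by rewrite ltr_pM2r.
move: E1 E2; have -> : x + d - x = d by ring. have -> : x - (x - d) = d by ring.
lra.
Qed.

Lemma patch_inner_measurable (h : R -> R) : (forall x, inner_itv x -> {for x, continuous h}) ->
  measurable_fun setT (h \_ inner_itv).
Proof.
move=> hc; have mI : measurable inner_itv by exact: measurable_itv.
apply/(measurable_restrictT _ mI).
apply: open_continuous_measurable_fun; first exact: interval_open.
by move=> x; rewrite inE => /hc.
Qed.

Lemma kappa_continuous_inner x : inner_itv x -> {for x, continuous kappa}.
Proof.
move=> xI; have [kI _] := phi_C2.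
have W : {within inner_itv, continuous kappa} by apply: continuous_subspaceW kI; exact: inner_itv_sub.
have oI : open inner_itv by exact: interval_open.
by move: W; rewrite continuous_open_subspace// => /(_ x); apply; rewrite inE.
Qed.

(** [kappa] is cut off before the root is taken; the root of 0 is 0, so the weight is a measurable
    function on the whole line that vanishes off the interior. *)
Definition arc_weight x := (kappa \_ inner_itv) x `^ 3^-1.

Lemma measurable_arc_weight : measurable_fun setT arc_weight.
Proof.
apply: (measurableT_comp (measurable_powR 3^-1)).
by apply: patch_inner_measurable; exact: kappa_continuous_inner.
Qed.

Lemma arc_weight_ge0 x : 0 <= arc_weight x. Proof. exact: powR_ge0. Qed.

Variable mu : {measure set (measurableTypeR R) -> \bar R}.
Hypothesis mu_def : is_affine_arclength I kappa mu.

(** [mu] and the measure with density [arc_weight] can disagree only through the two endpoints, a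
    null set for Lebesgue measure. *)
Lemma integral_arclength (H : R -> \bar R) : measurable_fun setT H -> (forall x, (0 <= H x)%E) ->
  (\int[mu]_x H x = \int[leb]_x (H x * (arc_weight x)%:E))%E.
Proof.
move=> mH H0; rewrite -(integral_density leb measurable_arc_weight arc_weight_ge0 mH H0).
refine (@eq_measure_integral _ (measurableTypeR R) R setT _ mu H _) => A mA _; rewrite mu_def// /density.
have awE x : inner_itv x -> arc_weight x = kappa x `^ 3^-1.
  by move=> xI; rewrite /arc_weight patchE mem_set.
have awN x : ~ inner_itv x -> arc_weight x = 0.
  by move=> xI; rewrite /arc_weight patchE memNset// powR0// invr_eq0.
rewrite [LHS]integral_mkcond [RHS]integral_mkcond.
apply/eqP; rewrite eq_le; apply/andP; split; last first.
  apply: le_integral_nonmeas => x; rewrite !patchE.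
    by case: ifP => // _; rewrite lee_fin arc_weight_ge0.
  have [xA|xA] := pselect (A x); last first.
    by rewrite memNset//; case: ifP => // _; rewrite lee_fin powR_ge0.
  rewrite mem_set//; have [xI|xI] := pselect (inner_itv x).
    by rewrite mem_set ?awE//; split => //; exact: inner_itv_sub.
  by rewrite awN//; case: ifP => // _; rewrite lee_fin powR_ge0.
(* [kappa] may be nonzero at an endpoint belonging to [I]. The constant dominates the integrand
   there and is integrated over a null set. *)
pose c := kappa (inf I) `^ 3^-1 + kappa (sup I) `^ 3^-1.
pose g := ((fun x => (arc_weight x)%:E) \_ A : R -> \bar R).
pose pt := [set inf I; sup I] : set R.
have mpt : measurable pt by apply: measurableU; exact: measurable_set1.
have mg : measurable_fun setT g.
  by apply/(measurable_restrictT _ mA); apply: measurable_funTS; apply/measurable_EFinP; exact: measurable_arc_weight.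
have g0 x : (0 <= g x)%E by rewrite /g patchE; case: ifP => // _; rewrite lee_fin arc_weight_ge0.
have mi : measurable_fun setT (fun x : R => (c * \1_pt x)%:E : \bar R).
  by apply/measurable_EFinP; apply: measurable_funM; [exact: measurable_cst|exact: measurable_indic].
have c0 : 0 <= c by rewrite addr_ge0 ?powR_ge0.
have i0 (x : R) : (0 <= (c * \1_pt x)%:E :> \bar R)%E by rewrite lee_fin mulr_ge0.
have z : (\int[leb]_x (c * \1_pt x)%:E = 0)%E.
  under eq_integral do rewrite EFinM.
  have mind : measurable_fun setT (fun x : measurableTypeR R => (\1_pt x)%:E : \bar R).
    by apply/measurable_EFinP; exact: measurable_indic.
  have ind0 (x : R) : (0 <= (\1_pt x)%:E :> \bar R)%E by rewrite lee_fin.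
  rewrite ge0_integralZl//.
  have pt0 : leb pt = 0%E.
    by apply: countable_lebesgue_measure0; apply: finite_set_countable; exact: finite_set2.
  by rewrite integral_indic// setIT [X in (_ * X)%E]pt0 mule0.
apply: (@le_trans _ _ (\int[leb]_x (g x + (c * \1_pt x)%:E))%E); last first.
  by rewrite ge0_integralD// z adde0.
apply: le_integral_nonmeas => x; first by rewrite patchE; case: ifP => // _; rewrite lee_fin powR_ge0.
rewrite patchE; case: ifPn => [|_]; last by rewrite adde_ge0.
rewrite inE => -[xA xI]; have [xin|xin] := pselect (inner_itv x).
  by rewrite -awE// /g patchE mem_set// leeDl.
apply: (@le_trans _ _ (c * \1_pt x)%:E); last by rewrite leeDr.
have [xe|xe] := inner_itv_pinch xI xin; rewrite xe lee_fin indicE mem_set ?mulr1 /c//; try by [left|right].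
  by rewrite lerDl powR_ge0.
by rewrite lerDr powR_ge0.
Qed.

End interval_geometry.

(** * Smoothing a function of the plane at a fixed scale *)

Section oscr.
Context {R : realType}.
Local Notation leb := (@lebesgue_measure R).
Local Notation lebR := (leb : {sigma_finite_measure set (measurableTypeR R) -> \bar R}).
Local Notation RR := (measurableTypeR R).
Implicit Types (e z : R * R) (K : R * R -> \bar R) (H a d w : R * R -> R).

Definition affine2 z e (st : R * R) := (z.1 + e.1 * st.1, z.2 + e.2 * st.2).

Lemma measurable_affine2 z e : measurable_fun setT (affine2 z e).
Proof. exact: measurable_shift2. Qed.

Lemma integral_affine2 z e K : e.1 != 0 -> e.2 != 0 -> measurable_fun setT K ->
  (forall u, (0 <= K u)%E) ->
  (\int[leb2]_st K (affine2 z e st) = (`|e.1|^-1 * `|e.2|^-1)%:E * \int[leb2]_u K u)%E.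
Proof.
move=> e1 e2 mK K0.
have mKs : measurable_fun setT (fun st => K (affine2 z e st)).
  exact: (measurableT_comp mK (measurable_affine2 z e)).
have K0s st : (0 <= K (affine2 z e st))%E by [].
rewrite (integral_pmeasure12 lebR lebR mKs K0s) (integral_pmeasure12 lebR lebR mK K0).
have mI : measurable_fun setT (fun s => \int[lebR]_t K (s, t))%E.
  exact: (measurable_integral12 lebR mK K0).
have I0 s : (0 <= \int[lebR]_t K (s, t))%E by apply: integral_ge0 => t _; exact: K0.
have c20 : (0 <= (`|e.2|^-1)%:E :> \bar R)%E by rewrite lee_fin invr_ge0.
have inner s : (\int[lebR]_t K (affine2 z e (s, t)) =
    (`|e.2|^-1)%:E * \int[lebR]_t K (e.1 * s + z.1, t)%R)%E.
  rewrite /affine2/= (addrC z.1).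
  have mk : measurable_fun setT (fun t : R => K (e.1 * s + z.1, t)).
    exact: (measurableT_comp mK (measurable_pair1 (e.1 * s + z.1))).
  rewrite -(ge0_integral_affine z.2 e2 mk (fun t => K0 _)).
  by apply: eq_integral => t _; rewrite (addrC z.2).
under eq_integral do rewrite inner.
have mIs : measurable_fun setT (fun s => \int[lebR]_t K (e.1 * s + z.1, t)%R)%E.
  by apply: (measurableT_comp mI); exact: measurable_affine.
have I0s s : (0 <= \int[lebR]_t K (e.1 * s + z.1, t)%R)%E by exact: I0.
rewrite (@ge0_integralZl _ _ R lebR setT measurableT _ mIs (`|e.2|^-1)%:E (fun s _ => I0s s) c20).
rewrite (ge0_integral_affine z.1 e1 mI I0) muleA -EFinM.
by rewrite (mulrC `|e.2|^-1).
Qed.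

Lemma L1_affine2_ge0 z e H : e.1 != 0 -> e.2 != 0 -> L1 leb2 H -> (forall u, 0 <= H u) ->
  L1 leb2 (fun st => H (affine2 z e st)) /\
  \int[leb2]_st H (affine2 z e st) = `|e.1|^-1 * `|e.2|^-1 * \int[leb2]_u H u.
Proof.
move=> e1 e2 LH H0; have mH := L1_measurable LH.
have mHE : measurable_fun setT (fun u => (H u)%:E : \bar R) by exact/measurable_EFinP.
have HE0 u : (0 <= (H u)%:E :> \bar R)%E by rewrite lee_fin.
have E := integral_affine2 z e1 e2 mHE HE0.
have L : L1 leb2 (fun st => H (affine2 z e st)).
  apply/integrableP; split.
    by apply/measurable_EFinP; exact: (measurableT_comp mH (measurable_affine2 z e)).
  have -> : (\int[leb2]_x `|(EFin \o (fun st => H (affine2 z e st))) x| = \int[leb2]_st (H (affine2 z e st))%:E)%E.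
    by apply: eq_integral => st _; rewrite /= ger0_norm.
  by rewrite E -(Rintegral_EFin LH) -EFinM ltry.
split => //; have : ((\int[leb2]_st H (affine2 z e st))%:E =
    (`|e.1|^-1 * `|e.2|^-1 * \int[leb2]_u H u)%:E :> \bar R)%E.
  by rewrite (Rintegral_EFin L) E -(Rintegral_EFin LH) -EFinM.
by case.
Qed.

Lemma Rintegral_affine2 z e H : e.1 != 0 -> e.2 != 0 -> L1 leb2 H ->
  \int[leb2]_st H (affine2 z e st) = `|e.1|^-1 * `|e.2|^-1 * \int[leb2]_u H u.
Proof.
move=> e1 e2 LH; have mH := L1_measurable LH.
have part (G : R * R -> R) : L1 leb2 G -> L1 leb2 (fun u => Num.max (G u) 0).
  move=> LG; apply: (L1_dom (L1_norm LG)).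
    by apply: measurable_maxr; [exact: L1_measurable LG|exact: measurable_cst].
  by move=> u; rewrite ger0_norm ?le_max ?lexx ?orbT// ge_max ler_norm normr_ge0.
have Lp := part _ LH.
have Ln : L1 leb2 (fun u => Num.max (- H u) 0).
  by apply: part; rewrite (_ : (fun u => - H u) = (fun u => -1 * H u)); [exact: L1_scale|apply/funext => u; rewrite mulN1r].
have max0 (c : R) : 0 <= Num.max c 0 by rewrite le_max lexx orbT.
have HE u : H u = Num.max (H u) 0 - Num.max (- H u) 0.
  by rewrite /Num.max; case: ltP => h1; case: ltP => h2; lra.
have [Lp' Ep] := L1_affine2_ge0 z e1 e2 Lp (fun u => max0 _).
have [Ln' En] := L1_affine2_ge0 z e1 e2 Ln (fun u => max0 _).
under eq_Rintegral do rewrite HE.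
under [in RHS]eq_Rintegral do rewrite HE.
by rewrite RintegralB// RintegralB// Ep En; ring.
Qed.

(** The analogue of [osc] for a function given directly, such as a version of the Fourier transform
    of an L^p function. *)
Definition oscr a w e z := \int[leb2]_st (a (affine2 z e st) * w st).

Variable (w : R * R -> R) (Bd : R).
Hypotheses (mw : measurable_fun setT w) (Bd0 : 0 < Bd) (w_le : forall st, `|w st| <= Bd * poisson2 st).

Lemma poisson2_le1 (st : R * R) : poisson2 st <= 1.
Proof.
have h (t : R) : poisson 1 t <= 1.
  by rewrite /poisson expr1n mul1r invf_le1 ?lerDl ?sqr_ge0// ltr_pwDl ?sqr_ge0.
have h0 (t : R) : 0 <= poisson 1 t by rewrite ltW// poisson_gt0.
by rewrite -[leRHS](mulr1 1) /poisson2 ler_pM.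
Qed.

Lemma integral_poisson2_EFin : (\int[leb2]_st (poisson2 st)%:E = (pi ^+ 2)%:E :> \bar R)%E.
Proof.
have mE : measurable_fun setT (fun st : R * R => (poisson2 st)%:E : \bar R).
  by apply/measurable_EFinP; exact: measurable_poisson2.
have E0 (st : R * R) : (0 <= (poisson2 st)%:E :> \bar R)%E by rewrite lee_fin poisson2_ge0.
have p0 (t : R) : (0 <= (poisson 1 t)%:E :> \bar R)%E by rewrite lee_fin ltW// poisson_gt0.
have mp : measurable_fun setT (fun t : RR => (poisson 1 t)%:E : \bar R).
  by apply/measurable_EFinP; exact: measurable_poisson.
rewrite (integral_pmeasure12 lebR lebR mE E0).
have inner s : (\int[lebR]_t (poisson2 (s, t))%:E = pi%:E * (poisson 1 s)%:E)%E.
  under eq_integral do rewrite /poisson2/= EFinM.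
  by rewrite ge0_integralZl// integral_poisson1 muleC.
under eq_integral do rewrite inner.
by rewrite ge0_integralZl ?lee_fin ?pi_ge0// integral_poisson1 -EFinM expr2.
Qed.

(** Hoelder's inequality at a single dilation. The bound degenerates for small scales, so it serves
    finitely many dilations, with [rho] adapted to them. *)
Lemma oscr_error (p p' rho : R) d e z : 1 <= p -> 0 < p' -> p^-1 + p'^-1 = 1 -> 0 < e.1 -> 0 < e.2 ->
  measurable_fun setT d -> 0 <= rho -> (\int[leb2]_u (`|d u| `^ p')%:E <= rho%:E)%E ->
  L1 leb2 (fun st => d (affine2 z e st) * w st) /\
  `|oscr d w e z| <= Bd * (((e.1 * e.2)^-1 * rho) `^ p'^-1 * (pi ^+ 2) `^ p^-1).
Proof.
move=> p1 p'0 pp' e1 e2 md rho0 drho.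
have p0 : 0 < p by exact: lt_le_trans p1.
have md' : measurable_fun setT (fun st => `|d (affine2 z e st)|).
  by apply: measurableT_comp => //; exact: (measurableT_comp md (measurable_affine2 z e)).
have e10 : e.1 != 0 by exact: lt0r_neq0. have e20 : e.2 != 0 by exact: lt0r_neq0.
have ee0 : 0 <= (e.1 * e.2)^-1 by rewrite invr_ge0 mulr_ge0 ?ltW.
have h1 : (\int[leb2]_st (`|d (affine2 z e st)| `^ p')%:E <= ((e.1 * e.2)^-1 * rho)%:E)%E.
  have mK : measurable_fun setT (fun u => (`|d u| `^ p')%:E : \bar R).
    apply/measurable_EFinP; apply: (measurableT_comp (measurable_powR p')).
    exact: measurableT_comp.
  rewrite (integral_affine2 z e10 e20 mK (fun u => _)); last by move=> u; rewrite lee_fin powR_ge0.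
  rewrite !gtr0_norm// -invfM EFinM (mulrC e.1) mulrC.
  by apply: lee_wpmul2l => //; rewrite lee_fin.
have h2 : (\int[leb2]_st (poisson2 st `^ p)%:E <= (pi ^+ 2)%:E)%E.
  rewrite -integral_poisson2_EFin; apply: le_integral_nonmeas => st; first by rewrite lee_fin powR_ge0.
  rewrite lee_fin; have := poisson2_ge0 st; rewrite le_eqVlt => /orP[/eqP <-|st0].
    by rewrite powR0// gt_eqF.
  by apply: ge1r_powR => //; rewrite st0 poisson2_le1.
have pi20 : 0 <= pi ^+ 2 :> R by exact: sqr_ge0.
have rr : 0 <= (e.1 * e.2)^-1 * rho by exact: mulr_ge0.
have pp'' : p'^-1 + p^-1 = 1 by rewrite addrC.
have H := @hoelder_le _ _ R leb2 (fun st => `|d (affine2 z e st)|) poisson2 p' p _ _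
  md' (fun st => normr_ge0 _) measurable_poisson2 poisson2_ge0 p'0 p0 pp'' rr pi20 h1 h2.
set c := (_ `^ _ * _ `^ _) in H.
have LD : L1 leb2 (fun st => Bd * (`|d (affine2 z e st)| * poisson2 st)).
  apply: L1_scale; apply/integrableP; split.
    by apply/measurable_EFinP; apply: measurable_funM => //; exact: measurable_poisson2.
  apply: (@le_lt_trans _ _ c%:E); last exact: ltry.
  rewrite (_ : (\int[leb2]_x `|_| = \int[leb2]_st (`|d (affine2 z e st)| * poisson2 st)%:E)%E)//.
  by apply: eq_integral => st _; rewrite /= ger0_norm// mulr_ge0 ?poisson2_ge0.
have L : L1 leb2 (fun st => d (affine2 z e st) * w st).
  apply: (L1_dom LD); first by apply: measurable_funM => //; exact: (measurableT_comp md (measurable_affine2 z e)).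
  by move=> st; rewrite normrM mulrCA ler_wpM2l.
split => //; apply: (le_trans (le_normr_Rintegral measurableT L)).
apply: (@le_trans _ _ (\int[leb2]_st (Bd * (`|d (affine2 z e st)| * poisson2 st)))).
  apply: le_Rintegral => //; first exact: (L1_norm L).
  by move=> st _; rewrite normrM mulrCA ler_wpM2l.
rewrite -lee_fin (Rintegral_EFin LD) EFinM.
have mdp : measurable_fun setT (fun st => (`|d (affine2 z e st)| * poisson2 st)%:E : \bar R).
  by apply/measurable_EFinP; apply: measurable_funM => //; exact: measurable_poisson2.
have dp0 st : (0 <= (`|d (affine2 z e st)| * poisson2 st)%:E :> \bar R)%E.
  by rewrite lee_fin mulr_ge0 ?poisson2_ge0.
have Bd00 : (0 <= Bd%:E :> \bar R)%E by rewrite lee_fin ltW.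
under eq_integral do rewrite EFinM.
rewrite (@ge0_integralZl _ _ R leb2 setT measurableT _ mdp Bd%:E (fun st _ => dp0 st) Bd00).
exact: lee_wpmul2l.
Qed.

End oscr.

(** * Continuity in the dilation and countably many scales *)

Section dilation.
Context {R : realType}.
Local Notation RR := (measurableTypeR R).
Implicit Types (e z : R * R) (a : R * R -> R).

(** The approximants stay in [[x/2, x]]; this fixed ratio gives a common dominating function in
    [cvg_oscr]. *)
Lemma cvg_left_rat (x : R) : 0 < x -> x < 1 ->
  exists q : nat -> rat, (forall n, (x / 2 <= (ratr (q n) : R) <= x) /\ (0 < (ratr (q n) : R) < 1)) /\
    (ratr (q n) : R) @[n --> \oo] --> x.
Proof.
move=> x0 x1; pose lo (n : nat) := Num.max (x / 2) (x - n.+1%:R^-1).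
have lox n : lo n < x.
  by rewrite gt_max; apply/andP; split; [lra|rewrite ltrBlDr ltrDl invr_gt0].
have /choice[q Hq] : forall n, exists q : rat, ratr q \in `]lo n, x[ by move=> n; exact: rat_in_itvoo.
have Hq' n : (x / 2 < ratr (q n) < x) /\ x - n.+1%:R^-1 < ratr (q n).
  by have := Hq n; rewrite in_itv/= gt_max => /andP[/andP[-> ->] ->].
exists q; split.
  by move=> n; have [/andP[h1 h2] _] := Hq' n; split; apply/andP; split; lra.
apply: (@squeeze_cvgr _ _ _ _ (fun n => x - n.+1%:R^-1) (cst x)).
- by apply: nearW => n; have [/andP[_ h2] h3] := Hq' n; rewrite !ltW.
- rewrite -[X in _ --> X]subr0; apply: cvgB; first exact: cvg_cst.
  exact: cvg_harmonic.
- exact: cvg_cst.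
Qed.

(** Pairs of rationals are enumerated through their codes; a code that gives no admissible pair is
    sent to (1/2, 1/2). *)
Lemma dense_scales : exists ee : nat -> R * R,
  (forall k, (0 < (ee k).1 < 1) && (0 < (ee k).2 < 1)) /\
  forall e, 0 < e.1 < 1 -> 0 < e.2 < 1 -> exists s : nat -> nat,
    (forall n, e.1 / 2 <= (ee (s n)).1 <= e.1) /\
    (forall n, e.2 / 2 <= (ee (s n)).2 <= e.2) /\
    ((ee (s n)).1 @[n --> \oo] --> e.1) /\ ((ee (s n)).2 @[n --> \oo] --> e.2).
Proof.
pose ok (q : rat * rat) : bool := (0 < (ratr q.1 : R) < 1) && (0 < (ratr q.2 : R) < 1).
pose ee k : R * R := if @pickle_inv (rat * rat)%type k is Some q then
  if ok q then (ratr q.1, ratr q.2) else (2^-1, 2^-1) else (2^-1, 2^-1).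
have h2 : 0 < (2^-1 : R) < 1 by rewrite invr_gt0 ltr0n/= invf_lt1// ltr1n.
exists ee; split.
  move=> k; rewrite /ee; case: pickle_inv => [q|]; last by rewrite h2.
  by case: ifP => [/andP[q1 q2]|_]; rewrite /= ?q1 ?q2 ?h2.
move=> e /andP[e10 e11] /andP[e20 e21].
have [q1 [H1 C1]] := cvg_left_rat e10 e11; have [q2 [H2 C2]] := cvg_left_rat e20 e21.
have eeE n : ee (pickle (q1 n, q2 n)) = (ratr (q1 n), ratr (q2 n)).
  rewrite /ee pickleK_inv /ok/=.
  by have [_ ->] := H1 n; have [_ ->] := H2 n.
exists (fun n => pickle (q1 n, q2 n)); split; [|split; [|split]].
- by move=> n; rewrite eeE; have [] := H1 n.
- by move=> n; rewrite eeE; have [] := H2 n.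
- by under eq_fun do rewrite eeE.
- by under eq_fun do rewrite eeE.
Qed.

Variables (w : R * R -> R) (Bd : R).
Hypotheses (mw : measurable_fun setT w) (Bd0 : 0 < Bd) (w_le : forall st, `|w st| <= Bd * poisson2 st).

Definition dilate2 e (st : R * R) := (e.1 * e.2)^-1 * w (st.1 / e.1, st.2 / e.2).

(** A substitution moves the dilation from [a], which is merely measurable, to the weight, so
    continuity in the scale can be read off from [w]. *)
Lemma oscrE a e z : 0 < e.1 -> 0 < e.2 -> L1 leb2 (fun st => a (affine2 z e st) * w st) ->
  oscr a w e z = \int[leb2]_st (a (z.1 + st.1, z.2 + st.2) * dilate2 e st).
Proof.
move=> e1 e2 LH; have e10 := lt0r_neq0 e1; have e20 := lt0r_neq0 e2.
have LH' := L1_scale (e.1 * e.2)^-1 LH.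
have i1 : (e.1^-1, e.2^-1).1 != 0 by rewrite invr_eq0.
have i2 : (e.1^-1, e.2^-1).2 != 0 by rewrite invr_eq0.
have E := @Rintegral_affine2 R (0, 0) (e.1^-1, e.2^-1) _ i1 i2 LH'.
rewrite [X in _ = _ * X]RintegralZl// in E.
transitivity (\int[leb2]_st ((e.1 * e.2)^-1 * (a (affine2 z e (affine2 (0, 0) (e.1^-1, e.2^-1) st)) *
   w (affine2 (0, 0) (e.1^-1, e.2^-1) st)))).
  rewrite E /= !gtr0_norm ?invr_gt0// !invrK mulrA divff ?mul1r//.
  by rewrite mulf_neq0.
apply: eq_Rintegral => st _; rewrite /dilate2 mulrCA; congr (a (_, _) * (_ * w (_, _))).
- by rewrite /= add0r mulVKf.
- by rewrite /= add0r mulVKf.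
- by rewrite /= add0r mulrC.
- by rewrite /= add0r mulrC.
Qed.

Let poisson_half (x y t : R) : 0 < x -> x / 2 <= y <= x ->
  poisson 1 (t / y) <= 4 * poisson 1 ((x / 2)^-1 * t).
Proof.
move=> x0 /andP[xy yx]; have y0 : 0 < y by lra.
have pos (c : R) : 0 < 1 + c ^+ 2 by rewrite ltr_pwDl ?sqr_ge0.
rewrite /poisson !expr1n !mul1r ler_pdivlMr// mulrC ler_pdivrMr//.
have E : ((x / 2)^-1 * t) ^+ 2 = 4 * (t / x) ^+ 2 by field; exact: lt0r_neq0.
have T : (t / x) ^+ 2 <= (t / y) ^+ 2.
  rewrite !exprMn; apply: ler_wpM2l; first exact: sqr_ge0.
  by rewrite lerXn2r ?nnegrE ?invr_ge0 ?(ltW x0) ?(ltW y0)// lef_pV2 ?posrE.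
rewrite E; lra.
Qed.

(** 64 is 4 from the prefactor, as both scales may be halved, times 4 from each Poisson factor. *)
Lemma dilate2_le e e' st : 0 < e.1 -> 0 < e.2 ->
  e.1 / 2 <= e'.1 <= e.1 -> e.2 / 2 <= e'.2 <= e.2 ->
  `|dilate2 e' st| <= 64 * (e.1 * e.2)^-1 * Bd * poisson2 ((e.1 / 2)^-1 * st.1, (e.2 / 2)^-1 * st.2).
Proof.
move=> e1 e2 h1 h2; have /andP[h11 h12] := h1; have /andP[h21 h22] := h2.
have e10 : 0 < e'.1 by lra. have e20 : 0 < e'.2 by lra.
have P1 := poisson_half st.1 e1 h1; have P2 := poisson_half st.2 e2 h2.
have pp (c : R) : 0 <= poisson 1 c by rewrite ltW// poisson_gt0.
rewrite /dilate2 normrM ger0_norm; last by rewrite invr_ge0 mulr_ge0 ?ltW.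
have I1 : (e'.1 * e'.2)^-1 <= 4 * (e.1 * e.2)^-1.
  have -> : 4 * (e.1 * e.2)^-1 = (e.1 / 2 * (e.2 / 2))^-1 by field; rewrite !lt0r_neq0.
  rewrite lef_pV2 ?posrE ?mulr_gt0//.
  by apply: ler_pM => //; rewrite divr_ge0// ltW.
have I2 : `|w (st.1 / e'.1, st.2 / e'.2)| <= Bd * (4 * poisson 1 ((e.1 / 2)^-1 * st.1) * (4 * poisson 1 ((e.2 / 2)^-1 * st.2))).
  apply: (le_trans (w_le _)); rewrite ler_wpM2l ?(ltW Bd0)// /poisson2/=.
  exact: ler_pM.
apply: (@le_trans _ _ (4 * (e.1 * e.2)^-1 * (Bd * (4 * poisson 1 ((e.1 / 2)^-1 * st.1) * (4 * poisson 1 ((e.2 / 2)^-1 * st.2)))))).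
  by apply: ler_pM => //; rewrite invr_ge0 mulr_ge0 ?ltW.
by rewrite /poisson2/= le_eqVlt; apply/orP; left; apply/eqP; ring.
Qed.

Hypothesis (w_cont : forall (u v : nat -> R) s t,
  u n @[n --> \oo] --> s -> v n @[n --> \oo] --> t -> w (u n, v n) @[n --> \oo] --> w (s, t)).

Lemma cvg_oscr a e z (u : nat -> R * R) : measurable_fun setT a -> 0 < e.1 -> 0 < e.2 ->
  (forall e, 0 < e.1 -> 0 < e.2 -> L1 leb2 (fun st => a (affine2 z e st) * poisson2 st)) ->
  (forall n, e.1 / 2 <= (u n).1 <= e.1) -> (forall n, e.2 / 2 <= (u n).2 <= e.2) ->
  (u n).1 @[n --> \oo] --> e.1 -> (u n).2 @[n --> \oo] --> e.2 ->
  oscr a w (u n) z @[n --> \oo] --> oscr a w e z.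
Proof.
move=> ma e1 e2 Lap u1 u2 cu1 cu2.
have pu1 n : 0 < (u n).1 by have /andP[? _] := u1 n; lra.
have pu2 n : 0 < (u n).2 by have /andP[? _] := u2 n; lra.
have Law e' : 0 < e'.1 -> 0 < e'.2 -> L1 leb2 (fun st => a (affine2 z e' st) * w st).
  move=> h1 h2; apply: (L1_dom (L1_scale Bd (L1_norm (Lap e' h1 h2)))).
    by apply: measurable_funM => //; exact: (measurableT_comp ma (measurable_affine2 z e')).
  move=> st; rewrite normrM (normrM _ (poisson2 st)) (ger0_norm (poisson2_ge0 _)) mulrCA.
  exact: ler_wpM2l.
have E e' : 0 < e'.1 -> 0 < e'.2 ->
  oscr a w e' z = \int[leb2]_st (a (z.1 + st.1, z.2 + st.2) * dilate2 e' st).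
  by move=> h1 h2; apply: oscrE => //; exact: Law.
rewrite E//; under eq_fun do rewrite E//.
have mz : measurable_fun setT (fun st : R * R => a (z.1 + st.1, z.2 + st.2)).
  have := measurableT_comp ma (measurable_affine2 z (1, 1)).
  by apply: eq_measurable_fun => st _; rewrite /affine2/= !mul1r.
have mdil e' : measurable_fun setT (dilate2 e').
  apply: measurable_funM; first exact: measurable_cst.
  apply: (measurableT_comp mw); apply: measurable_fun_pair; apply: measurable_funM; try exact: measurable_cst.
    exact: measurable_fst.
  exact: measurable_snd.
pose g st := 64 * (e.1 * e.2)^-1 * Bd * (`|a (z.1 + st.1, z.2 + st.2)| * poisson2 ((e.1 / 2)^-1 * st.1, (e.2 / 2)^-1 * st.2)).
have h10 : 0 < e.1 / 2 by lra. have h20 : 0 < e.2 / 2 by lra.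
have Lg : L1 leb2 g.
  apply: L1_scale.
  have L := L1_norm (Lap (e.1 / 2, e.2 / 2) h10 h20).
  have i1 : ((e.1 / 2)^-1, (e.2 / 2)^-1).1 != 0 by rewrite invr_eq0 lt0r_neq0.
  have i2 : ((e.1 / 2)^-1, (e.2 / 2)^-1).2 != 0 by rewrite invr_eq0 lt0r_neq0.
  have [L' _] := L1_affine2_ge0 (0, 0) i1 i2 L (fun _ => normr_ge0 _).
  move: L'; congr (is_true (L1 leb2 _)); apply/funext => st.
  rewrite (normrM _ (poisson2 _)) (ger0_norm (poisson2_ge0 _)) /affine2/= !add0r.
  by rewrite !mulVKf ?lt0r_neq0.
have bound e' st : e.1 / 2 <= e'.1 <= e.1 -> e.2 / 2 <= e'.2 <= e.2 ->
    `|a (z.1 + st.1, z.2 + st.2) * dilate2 e' st| <= g st.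
  move=> b1 b2; rewrite normrM /g mulrCA ler_wpM2l//.
  exact: dilate2_le.
have bb (x : R) : 0 < x -> x / 2 <= x <= x by move=> x0; apply/andP; split; lra.
have D := @dominated_cvg _ _ R leb2 setT measurableT
  (fun n st => (a (z.1 + st.1, z.2 + st.2) * dilate2 (u n) st)%:E)
  (fun st => (a (z.1 + st.1, z.2 + st.2) * dilate2 e st)%:E) (fun st => (g st)%:E).
have {}D : (\int[leb2]_st (a (z.1 + st.1, z.2 + st.2) * dilate2 (u n) st)%:E)%E @[n --> \oo] -->
    (\int[leb2]_st (a (z.1 + st.1, z.2 + st.2) * dilate2 e st)%:E)%E.
  apply: D => //.
  - by move=> n; apply/measurable_EFinP; apply: measurable_funM; [exact: mz|exact: mdil].
  - move=> st _; apply: cvg_EFin; first exact: nearW.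
    apply: cvgM; first exact: cvg_cst.
    rewrite /dilate2; apply: cvgM.
      apply: cvgV; first by rewrite mulf_neq0 ?lt0r_neq0.
      exact: cvgM.
    apply: w_cont; apply: cvgM; try exact: cvg_cst; apply: cvgV => //; exact: lt0r_neq0.
  - by move=> n st _; rewrite lee_fin; exact: bound.
have Le : L1 leb2 (fun st => a (z.1 + st.1, z.2 + st.2) * dilate2 e st).
  apply: (L1_dom Lg); first by apply: measurable_funM; [exact: mz|exact: mdil].
  by move=> st; apply: bound; exact: bb.
rewrite -(Rintegral_EFin Le) in D.
exact: (fine_cvg D).
Qed.

End dilation.

Local Open Scope complex_scope.

(** * Real and imaginary parts of the smoothing kernel and of the transform *)

Section complex_components.
Context {R : realType}.
Local Notation RR := (measurableTypeR R).
Implicit Types (e z : R * R) (a : R * R -> R).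

Lemma normc_le_abs (A B : R) : Normc.normc (A +i* B) <= `|A| + `|B|.
Proof.
rewrite /Normc.normc -[leRHS]ger0_norm ?addr_ge0// -sqrtr_sqr ler_wsqrtr//.
rewrite sqrrD !real_normK ?num_real// lerD2r lerDl mulrn_wge0// mulr_ge0//.
Qed.

Lemma abs_Re_le (x : R[i]) : `|complex.Re x| <= Normc.normc x.
Proof.
case: x => x y /=; rewrite -sqrtr_sqr ler_wsqrtr// lerDl sqr_ge0//.
Qed.

Lemma abs_Im_le (x : R[i]) : `|complex.Im x| <= Normc.normc x.
Proof.
case: x => x y /=; rewrite -sqrtr_sqr ler_wsqrtr// lerDr sqr_ge0//.
Qed.

Lemma L1_dilate2 a (w : R * R -> R) e z : measurable_fun setT a -> measurable_fun setT w ->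
  0 < e.1 -> 0 < e.2 -> L1 leb2 (fun st => a (affine2 z e st) * w st) ->
  L1 leb2 (fun st => a (z.1 + st.1, z.2 + st.2) * dilate2 w e st).
Proof.
move=> ma mw e1 e2 LH; have e10 := lt0r_neq0 e1; have e20 := lt0r_neq0 e2.
have i1 : (e.1^-1, e.2^-1).1 != 0 by rewrite invr_eq0.
have i2 : (e.1^-1, e.2^-1).2 != 0 by rewrite invr_eq0.
have [L _] := @L1_affine2_ge0 R (0, 0) (e.1^-1, e.2^-1) _ i1 i2 (L1_norm LH) (fun _ => normr_ge0 _).
have mz : measurable_fun setT (fun st : R * R => a (z.1 + st.1, z.2 + st.2)).
  have := measurableT_comp ma (measurable_affine2 z (1, 1)).
  by apply: eq_measurable_fun => st _; rewrite /affine2/= !mul1r.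
have mdil : measurable_fun setT (dilate2 w e).
  apply: measurable_funM; first exact: measurable_cst.
  apply: (measurableT_comp mw); apply: measurable_fun_pair; apply: measurable_funM; try exact: measurable_cst.
    exact: measurable_fst.
  exact: measurable_snd.
apply: (L1_dom (L1_scale (e.1 * e.2)^-1 L)); first by apply: measurable_funM; [exact: mz|exact: mdil].
move=> st; rewrite /dilate2 /affine2/= !add0r !mulVKf// mulrCA normrM.
rewrite (ger0_norm (x := (e.1 * e.2)^-1)) ?invr_ge0 ?mulr_ge0 ?(ltW e1) ?(ltW e2)//.
by rewrite ![_ / _]mulrC.
Qed.

Variable chi : R -> R[i].
Hypothesis chi_schwartz : cschwartz chi.
Let c1 s := complex.Re (chi s).
Let c2 s := complex.Im (chi s).

(** The real part ([true]) and the imaginary part ([false]) of chi(s) chi(t). *)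
Definition profile (j : bool) (st : R * R) : R :=
  if j then c1 st.1 * c1 st.2 - c2 st.1 * c2 st.2 else c1 st.1 * c2 st.2 + c2 st.1 * c1 st.2.

Let schwartz_cont (g : R -> R) : schwartz g -> continuous g.
Proof.
move=> [D _] x; apply/differentiable_continuous/derivable1_diffP.
by have := D 0%N x.
Qed.

Let c1_cont : continuous c1. Proof. by apply: schwartz_cont; case: chi_schwartz. Qed.
Let c2_cont : continuous c2. Proof. by apply: schwartz_cont; case: chi_schwartz. Qed.

(** Bounds for g and s^2 g together give the decay of 1/(1+s^2); the added 1 makes the constant
    positive. *)
Lemma schwartz_poisson (g : R -> R) : schwartz g ->
  exists2 B : R, 0 < B & forall s, `|g s| <= B * poisson 1 s.
Proof.
move=> [_ S]; have [C0 H0] := S 0%N 0%N; have [C2 H2] := S 2%N 0%N.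
have N0 : 0 <= C0 by apply: le_trans (H0 0).
have N2 : 0 <= C2 by apply: le_trans (H2 0).
exists (C0 + C2 + 1); first by rewrite ltr_wpDl// addr_ge0.
move=> s; have pos : 0 < 1 + s ^+ 2 by rewrite ltr_pwDl ?sqr_ge0.
have := H0 s; have := H2 s; rewrite /= expr0 mul1r normrM (ger0_norm (sqr_ge0 s)) => h2 h0.
rewrite /poisson expr1n mul1r ler_pdivlMr// mulrDr mulr1 (mulrC `|g s|); lra.
Qed.

Lemma profile_cont j (u v : nat -> R) s t :
  u n @[n --> \oo] --> s -> v n @[n --> \oo] --> t -> profile j (u n, v n) @[n --> \oo] --> profile j (s, t).
Proof.
move=> cu cv.
have a1 := cvg_comp _ _ cu (c1_cont (x := s)); have a2 := cvg_comp _ _ cu (c2_cont (x := s)).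
have b1 := cvg_comp _ _ cv (c1_cont (x := t)); have b2 := cvg_comp _ _ cv (c2_cont (x := t)).
rewrite /profile/=; case: j.
  by apply: cvgB; apply: cvgM.
by apply: cvgD; apply: cvgM.
Qed.

Lemma measurable_profile j : measurable_fun setT (profile j).
Proof.
have m1 : measurable_fun setT (c1 : R -> R) by exact: continuous_measurable_fun.
have m2 : measurable_fun setT (c2 : R -> R) by exact: continuous_measurable_fun.
have m11 : measurable_fun setT (fun st : R * R => c1 st.1) by exact: (measurableT_comp m1 measurable_fst).
have m12 : measurable_fun setT (fun st : R * R => c1 st.2) by exact: (measurableT_comp m1 measurable_snd).
have m21 : measurable_fun setT (fun st : R * R => c2 st.1) by exact: (measurableT_comp m2 measurable_fst).
have m22 : measurable_fun setT (fun st : R * R => c2 st.2) by exact: (measurableT_comp m2 measurable_snd).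
rewrite /profile; case: j.
  by apply: measurable_funB; apply: measurable_funM.
by apply: measurable_funD; apply: measurable_funM.
Qed.

Lemma profile_bound : exists2 Bd : R, 0 < Bd & forall j st, `|profile j st| <= Bd * poisson2 st.
Proof.
have [S1 S2] := chi_schwartz.
have [B1 B10 H1] := schwartz_poisson S1; have [B2 B20 H2] := schwartz_poisson S2.
exists ((B1 + B2) ^+ 2); first by rewrite exprn_gt0// addr_gt0.
move=> j st; have p0 (s : R) : 0 <= poisson 1 s by rewrite ltW// poisson_gt0.
have K (g h : R -> R) C D : (forall s, `|g s| <= C * poisson 1 s) -> (forall s, `|h s| <= D * poisson 1 s) ->
    `|g st.1 * h st.2| <= C * D * poisson2 st.
  move=> hg hh; rewrite normrM /poisson2 mulrACA; exact: ler_pM.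
have pp := poisson2_ge0 st; have BB : 0 <= 2 * B1 * B2 by rewrite !mulr_ge0 ?ltW.
have BB1 : 0 <= B1 ^+ 2 by exact: sqr_ge0.
have BB2 : 0 <= B2 ^+ 2 by exact: sqr_ge0.
rewrite /profile; case: j.
  apply: (le_trans (ler_normB _ _)); apply: (le_trans (lerD (K _ _ _ _ H1 H1) (K _ _ _ _ H2 H2))).
  rewrite -mulrDl; apply: ler_wpM2r => //; rewrite -!expr2; lra.
apply: (le_trans (ler_normD _ _)); apply: (le_trans (lerD (K _ _ _ _ H1 H2) (K _ _ _ _ H2 H1))).
by rewrite -mulrDl; apply: ler_wpM2r => //; lra.
Qed.

Lemma cintegral_smooth (G : R * R -> R[i]) e z : 0 < e.1 -> 0 < e.2 -> cmeasurable G ->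
  (forall j, L1 leb2 (fun st => complex.Re (G (affine2 z e st)) * profile j st)) ->
  (forall j, L1 leb2 (fun st => complex.Im (G (affine2 z e st)) * profile j st)) ->
  cintegral (lebesgue2 R) (fun st : R * R =>
    G (z.1 + st.1, z.2 + st.2) * dilate chi e.1 st.1 * dilate chi e.2 st.2) =
  (oscr (fun u => complex.Re (G u)) (profile true) e z - oscr (fun u => complex.Im (G u)) (profile false) e z) +i*
  (oscr (fun u => complex.Re (G u)) (profile false) e z + oscr (fun u => complex.Im (G u)) (profile true) e z).
Proof.
move=> e1 e2 [mG1 mG2] L1' L2'.
have M1 j := L1_dilate2 mG1 (measurable_profile j) e1 e2 (L1' j).
have M2 j := L1_dilate2 mG2 (measurable_profile j) e1 e2 (L2' j).
rewrite (oscrE e1 e2 (L1' true)) (oscrE e1 e2 (L1' false)) (oscrE e1 e2 (L2' true)) (oscrE e1 e2 (L2' false)).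
rewrite -(RintegralB measurableT (M1 true) (M2 false)) -(RintegralD measurableT (M1 false) (M2 true)).
rewrite /cintegral; congr (_ +i* _); apply: eq_Rintegral => st _.
  rewrite /dilate2 /profile /dilate /c1 /c2 /=.
  case: (G _) => g1 g2; case: (chi _) => a1 a2; case: (chi _) => b1 b2 /=.
  by rewrite invfM; ring.
rewrite /dilate2 /profile /dilate /c1 /c2 /=.
case: (G _) => g1 g2; case: (chi _) => a1 a2; case: (chi _) => b1 b2 /=.
by rewrite invfM; ring.
Qed.

Lemma fourier1E (f : R * R -> R[i]) xi :
  L1 leb2 (fun x => complex.Re (f x)) -> L1 leb2 (fun x => complex.Im (f x)) ->
  fourier1 f xi = (fhat (fun x => complex.Re (f x)) true xi + fhat (fun x => complex.Im (f x)) false xi) +i*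
    (fhat (fun x => complex.Im (f x)) true xi - fhat (fun x => complex.Re (f x)) false xi).
Proof.
move=> Lr Li.
have mphase (bt : bool) : measurable_fun setT (fun x : R * R => trig bt (xi.1 * x.1 + xi.2 * x.2)).
  apply: (measurableT_comp (measurable_trig bt)).
  by apply: measurable_funD; apply: measurable_funM => //; exact: measurable_cst.
have K (g : R * R -> R) (bt : bool) : L1 leb2 g -> L1 leb2 (fun x => g x * trig bt (xi.1 * x.1 + xi.2 * x.2)).
  by move=> Lg; apply: (@L1_bounded_prod _ _ _ _ _ _ 1 Lg) => [|x]; [exact: mphase|exact: trig_max].
rewrite /fhat -(RintegralD measurableT (K _ true Lr) (K _ false Li)) -(RintegralB measurableT (K _ true Li) (K _ false Lr)).
rewrite /fourier1 /cintegral; congr (_ +i* _); apply: eq_Rintegral => x _.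
  by rewrite /= (mulrC xi.1) (mulrC xi.2); case: (f x) => f1 f2 /=; ring.
by rewrite /= (mulrC xi.1) (mulrC xi.2); case: (f x) => f1 f2 /=; ring.
Qed.

End complex_components.

(** * Elementary inequalities for finite sums *)

Lemma powR_sum_le (R : realType) (I : finType) (y q : R) (u : I -> R) : 0 < q -> 0 <= y ->
  (forall i, 0 <= u i) -> y <= \sum_i u i -> y `^ q <= #|I|%:R `^ q * \sum_i u i `^ q.
Proof.
move=> q0 y0 u0 yu.
have S0 : 0 <= \sum_i u i `^ q by apply: sumr_ge0 => i _; exact: powR_ge0.
move: y0; rewrite le_eqVlt => /orP[/eqP <-|y0].
  by rewrite powR0 ?gt_eqF// mulr_ge0 ?powR_ge0.
have [i yi] : exists i, y <= #|I|%:R * u i.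
  apply: contrapT => /forallNP H; have Hl i : #|I|%:R * u i < y by rewrite ltNge; apply/negP.
  have I0 : (0 < #|I|)%N.
    rewrite lt0n; apply/eqP => /card0_eq I0; move: yu; rewrite big_pred0//.
    by rewrite leNgt y0.
  have I0' : 0 < #|I|%:R :> R by rewrite ltr0n.
  have : #|I|%:R * \sum_i u i < #|I|%:R * y.
    have /existsP[i0 _] : [exists i : I, true] by apply/existsP; have /card_gt0P[i _] := I0; exists i.
    rewrite mulr_sumr (_ : #|I|%:R * y = \sum_(i : I) y); last by rewrite sumr_const mulr_natl.
    rewrite [ltLHS](bigD1 i0)//= [ltRHS](bigD1 i0)//=; apply: ltr_leD; first exact: Hl.
    by apply: ler_sum => i _; exact: ltW.
  by rewrite ltr_pM2l// ltNge yu.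
apply: (@le_trans _ _ ((#|I|%:R * u i) `^ q)).
  by apply: ge0_ler_powR; rewrite ?nnegrE ?(ltW q0) ?(ltW y0)// mulr_ge0.
rewrite powRM//; apply: ler_wpM2l; first exact: powR_ge0.
by rewrite (bigD1 i)//= lerDl sumr_ge0// => k _; exact: powR_ge0.
Qed.

Lemma seq_pos_lower_bound (R : realType) (T : eqType) (l : seq T) (r : T -> R) :
  (forall e, e \in l -> 0 < r e) -> exists2 c : R, 0 < c & forall e, e \in l -> c <= r e.
Proof.
elim: l => [_|e l IH H]; first by exists 1.
have [c c0 Hc] := IH (fun x xl => H x (mem_behead (s := e :: l) xl)).
exists (Num.min c (r e)); first by rewrite lt_min c0 H ?mem_head.
by move=> x; rewrite inE => /orP[/eqP ->|/Hc h]; rewrite ge_min ?lexx ?orbT ?h.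
Qed.

Lemma sum_bool3 (R : realType) (g : bool * bool * bool -> R) : \sum_i g i =
  g (true, true, true) + g (true, false, true) + g (false, true, true) + g (false, false, true) +
  g (true, true, false) + g (true, false, false) + g (false, true, false) + g (false, false, false).
Proof.
rewrite (eq_bigr (fun i => g (i.1.1, i.1.2, i.2))); last by case=> [[]].
rewrite -(pair_bigA _ (fun u v => g (u.1, u.2, v)))/=.
rewrite -(pair_bigA _ (fun u v => \sum_j g (u, v, j)))/= !big_bool/=.
ring.
Qed.

Lemma powRM_regroup (R : realType) (x y z t q : R) : 0 <= x -> 0 <= y -> 0 <= z -> 0 <= t ->
  x `^ q * (y * (z * t)) `^ q = (x * y * z) `^ q * t `^ q.
Proof.
move=> x0 y0 z0 t0; rewrite -powRM//; last by apply: mulr_ge0 => //; exact: mulr_ge0.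
rewrite -powRM//; last by apply: mulr_ge0 => //; exact: mulr_ge0.
by congr (_ `^ _); ring.
Qed.

Lemma norm_pair_le (R : realType) (o1 o2 o3 o4 s1 s2 s3 s4 s5 s6 s7 s8 h th : R) :
  `|o1| <= s1 + s4 + h -> `|o2| <= s5 + s8 + h -> `|o3| <= s3 + s2 + h -> `|o4| <= s7 + s6 + h ->
  4 * h <= th -> `|o1 - o4| + `|o2 + o3| <= s1 + s2 + s3 + s4 + s5 + s6 + s7 + s8 + th.
Proof.
move=> A1 A2 A3 A4 H; have B1 := ler_normB o1 o4; have B2 := ler_normD o2 o3; lra.
Qed.

(** * The estimate for finitely many scales and an approximable transform *)

Section finite_maximal.
Context {R : realType}.
Local Notation leb := (@lebesgue_measure R).
Local Notation lebR := (leb : {sigma_finite_measure set (measurableTypeR R) -> \bar R}).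
Local Notation RR := (measurableTypeR R).
Variables (a b : R) (phi dphi kappa : R -> R).
Hypotheses (ab : a <= b)
  (phi_derive : forall x, a <= x <= b -> is_derive x 1 phi (dphi x))
  (dphi_derive : forall x, a <= x <= b -> is_derive x 1 dphi (kappa x))
  (kappa_cont : {within `[a, b], continuous kappa})
  (kappa_ge0 : forall x, a <= x <= b -> 0 <= kappa x).
Variables (F P k : R -> R).
Hypotheses (mF : measurable_fun setT F) (FE : forall x, a <= x <= b -> F x = phi x)
  (mP : measurable_fun setT P) (PE : forall x, a <= x <= b -> P x = dphi x)
  (mk : measurable_fun setT k) (kE : forall x, k x = (a <= x <= b)%R%:R * kappa x).
Variables (sg p : R).
Hypotheses (sg2 : 2 < sg) (p1 : 1 < p) (psg : p^-1 + (2 * sg)^-1 = 1).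
Let q0 := 2 * sg / 3.
Let p0 : 0 < p. Proof. exact: lt_trans p1. Qed.
Let sg0 : 0 < sg. Proof. exact: lt_trans sg2. Qed.
Let q00 : 0 < q0. Proof. by rewrite divr_gt0// mulr_gt0. Qed.

Variables (w : bool -> R * R -> R) (Bd : R).
Hypotheses (mw : forall j, measurable_fun setT (w j)) (Bd0 : 0 < Bd)
  (w_le : forall j st, `|w j st| <= Bd * poisson2 st).

Let eta (e : R * R) rho := Bd * (((e.1 * e.2)^-1 * rho) `^ (2 * sg)^-1 * (pi ^+ 2) `^ p^-1) : R.

Let Lw j : L1 leb2 (w j).
Proof.
have L : L1 leb2 (fun st : R * R => Bd * poisson2 st) by exact: L1_scale L1_poisson2.
exact: (L1_dom L (mw j) (w_le j)).
Qed.

Let Lbw (f : R * R -> R) bt j e z : L1 leb2 f -> L1 leb2 (fun st => fhat f bt (affine2 z e st) * w j st).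
Proof.
move=> Lf; under eq_fun do rewrite mulrC.
apply: (@L1_bounded_prod _ _ _ _ _ _ (\int[leb2]_x `|f x|) (Lw j)) => [|st]; last exact: fhat_max.
exact: (measurableT_comp (measurable_fhat bt Lf) (measurable_affine2 z e)).
Qed.

(** By [fourier1E], c = 1 gives the real part and c = -1 the imaginary part of the transform. What
    remains is the approximation error, handled by [oscr_error]. *)
Let oscr_split (G g1 g2 : R * R -> R) (c rho : R) j e x : L1 leb2 g1 -> L1 leb2 g2 -> `|c| <= 1 ->
  measurable_fun setT G -> 0 < e.1 -> 0 < e.2 -> 0 <= rho ->
  (\int[leb2]_u (`|G u - (fhat g1 true u + c * fhat g2 false u)| `^ (2 * sg))%:E <= rho%:E)%E ->
  L1 leb2 (fun st => G (affine2 (x, F x) e st) * w j st) /\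
  `|oscr G (w j) e (x, F x)| <= `|osc F (w j) g1 true e x| + `|osc F (w j) g2 false e x| + eta e rho.
Proof.
move=> L1g L2g c1 mG e1 e2 rho0 hd; set z := (x, F x).
pose d u := G u - (fhat g1 true u + c * fhat g2 false u).
have md : measurable_fun setT d.
  apply: measurable_funB => //; apply: measurable_funD; first exact: measurable_fhat.
  by apply: measurable_funM; [exact: measurable_cst|exact: measurable_fhat].
have s0 : 0 < 2 * sg by exact: mulr_gt0.
have [Ld dle] := oscr_error (mw j) Bd0 (w_le j) z (ltW p1) s0 psg e1 e2 md rho0 hd.
have La := Lbw true j e z L1g; have Lb := L1_scale c (Lbw false j e z L2g).
have Lab := @integrableD _ _ R leb2 setT measurableT _ _ La Lb.
have GE st : G (affine2 z e st) * w j st = (fhat g1 true (affine2 z e st) * w j st +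
    c * (fhat g2 false (affine2 z e st) * w j st)) + d (affine2 z e st) * w j st.
  by rewrite /d; ring.
have LG : L1 leb2 (fun st => G (affine2 z e st) * w j st).
  under eq_fun do rewrite GE.
  exact: (@integrableD _ _ R leb2 setT measurableT _ _ Lab Ld).
split => //.
have -> : oscr G (w j) e z = osc F (w j) g1 true e x + c * osc F (w j) g2 false e x + oscr d (w j) e z.
  rewrite /oscr /osc -(RintegralZl c measurableT (Lbw false j e z L2g)).
  rewrite -(RintegralD measurableT La Lb) -(RintegralD measurableT Lab Ld).
  by apply: eq_Rintegral => st _; exact: GE.
apply: (le_trans (ler_normD _ _)); apply: lerD => //.
apply: (le_trans (ler_normD _ _)); apply: lerD => //.
by rewrite normrM ler_piMl.
Qed.

Definition osc_pair (G : R * R -> R[i]) e z :=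
  `|oscr (fun u => complex.Re (G u)) (w true) e z - oscr (fun u => complex.Im (G u)) (w false) e z| +
  `|oscr (fun u => complex.Re (G u)) (w false) e z + oscr (fun u => complex.Im (G u)) (w true) e z|.

(** Nine terms: eight real maximal functions, from the parts of [f], of the exponential and of the
    kernel, and the approximation error. Neither [[a, b]] nor the list of scales enters, which
    permits the limits in [maximal_majorant]. *)
Definition finite_maximal_const :=
  9%:R `^ q0 * (9%:R * ((Bd * energy_const sg `^ 2^-1 * (2 `^ p * 2) `^ p^-1) `^ q0 + 1)) : R.

Lemma finite_maximal (G : R * R -> R[i]) (t : R) (e0 : R * R) (l : seq (R * R)) (M : R -> R) :
  0 < t -> cmeasurable G ->
  (forall rho : R, 0 < rho -> exists f : R * R -> R[i], [/\
     L1 leb2 (fun x => complex.Re (f x)), L1 leb2 (fun x => complex.Im (f x)),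
     (\int[leb2]_x (Normc.normc (f x) `^ p)%:E <= (2 `^ p * 2 * t `^ p)%:E)%E &
     (\int[leb2]_x (Normc.normc (fourier1 f x - G x)%R `^ (2 * sg))%:E <= rho%:E)%E]) ->
  (forall e, e \in e0 :: l -> (0 < e.1) && (0 < e.2)) ->
  (forall x, 0 <= M x) ->
  (forall x, a <= x <= b -> exists2 e, e \in e0 :: l & M x <= osc_pair G e (x, F x)) ->
  (\int[leb]_x (M x `^ q0 * k x `^ 3^-1)%:E <= (finite_maximal_const * t `^ q0)%:E)%E.
Proof.
move=> t0 [mG1 mG2] approx l0 M0 Mle.
have ne0 e : e \in e0 :: l -> (e.1 != 0) && (e.2 != 0).
  by move=> /l0/andP[e1 e2]; rewrite !lt0r_neq0.
pose jk x := (a <= x <= b)%R%:R + k x.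
have k0 x : 0 <= k x.
  by rewrite kE; case: (boolP (a <= x <= b)) => [/kappa_ge0 h|_]; rewrite ?mul1r ?mul0r.
have jk0 x : 0 <= jk x by rewrite addr_ge0.
have Ljk : L1 lebR jk.
  exact: (@integrableD _ _ R lebR setT measurableT _ _ (L1_itv a b) (L1_mask ab dphi_derive kappa_cont kappa_ge0 mk kE)).
pose mass := \int[lebR]_x jk x.
have mass0 : 0 <= mass by exact: Rintegral_ge0.
(* The admissible pointwise error: [mass] bounds the integral of k^(1/3), so the q0-th power of the
   error integrates to at most t^q0. *)
pose theta := t * (mass + 1) `^ (- q0^-1).
have m10 : 0 < mass + 1 by rewrite ltr_wpDl.
have theta0 : 0 < theta by rewrite mulr_gt0// powR_gt0.
have thetaq : theta `^ q0 * mass <= t `^ q0.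
  rewrite /theta powRM ?powR_ge0 ?(ltW t0)// -powRrM mulNr mulVf ?gt_eqF// powR_inv1 ?(ltW m10)//.
  by rewrite -mulrA ler_piMr ?powR_ge0// mulrC ler_pdivrMr// mul1r lerDl.
pose cc := (pi ^+ 2) `^ p^-1 : R.
have cc0 : 0 < cc by rewrite powR_gt0// exprn_gt0// pi_gt0.
have s0 : 0 < 2 * sg by exact: mulr_gt0.
(* The value of [rho] at which 4 eta e rho = theta, the 4 counting the real integrals in [osc_pair].
   Over a finite list these values have a positive lower bound. *)
pose re (e : R * R) := (theta / (4 * Bd * cc)) `^ (2 * sg) * (e.1 * e.2).
have th4 : 0 < theta / (4 * Bd * cc) by rewrite divr_gt0// !mulr_gt0.
have re0 e : e \in e0 :: l -> 0 < re e.
  by move=> /l0/andP[e1 e2]; rewrite mulr_gt0 ?powR_gt0// mulr_gt0.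
have [rho rho0 rho_le] := seq_pos_lower_bound re0.
have eta_le e : e \in e0 :: l -> 4 * eta e rho <= theta.
  move=> el; have /andP[e1 e2] := l0 _ el; have ee : 0 < e.1 * e.2 by exact: mulr_gt0.
  have h : ((e.1 * e.2)^-1 * rho) `^ (2 * sg)^-1 <= theta / (4 * Bd * cc).
    have h1 : (e.1 * e.2)^-1 * rho <= (theta / (4 * Bd * cc)) `^ (2 * sg).
      by rewrite mulrC ler_pdivrMr//; exact: rho_le.
    apply: (@le_trans _ _ (((theta / (4 * Bd * cc)) `^ (2 * sg)) `^ (2 * sg)^-1)).
      apply: ge0_ler_powR => //.
      - by rewrite invr_ge0 ltW.
      - by rewrite nnegrE mulr_ge0 ?invr_ge0 ?ltW.
      - by rewrite nnegrE powR_ge0.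
    by rewrite -powRrM divff ?gt_eqF// powRr1// ltW.
  have e4 : 4 * eta e rho = 4 * Bd * cc * ((e.1 * e.2)^-1 * rho) `^ (2 * sg)^-1 by rewrite /eta -/cc; ring.
  rewrite e4; apply: (@le_trans _ _ (4 * Bd * cc * (theta / (4 * Bd * cc)))).
    by apply: ler_wpM2l => //; rewrite ltW// !mulr_gt0.
  by rewrite mulrC divfK// lt0r_neq0// !mulr_gt0.
have [f [Lf1 Lf2 fN fG]] := approx rho rho0.
pose fk (b : bool) x := if b then complex.Re (f x) else complex.Im (f x).
have Lfk b' : L1 leb2 (fk b') by case: b'.
have normc0 (y : R[i]) : 0 <= Normc.normc y by case: y => y1 y2 /=; exact: sqrtr_ge0.
have pw x e : e \in e0 :: l -> osc_pair G e (x, F x) <=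
    (\sum_(i : bool * bool * bool) `|osc F (w i.2) (fk i.1.1) i.1.2 e x|) + theta.
  move=> el; have /andP[e1 e2] := l0 _ el.
  have hre : (\int[leb2]_u (`|complex.Re (G u) - (fhat (fk true) true u + 1 * fhat (fk false) false u)| `^ (2 * sg))%:E <= rho%:E)%E.
    apply: le_trans fG; apply: le_integral_nonmeas => u; first by rewrite lee_fin powR_ge0.
    rewrite lee_fin; apply: ge0_ler_powR; rewrite ?nnegrE ?normc0 ?(ltW s0)//.
    rewrite distrC mul1r; have := abs_Re_le (fourier1 f u - G u); rewrite (fourier1E u Lf1 Lf2).
    by case: (G u) => G1 G2.
  have him : (\int[leb2]_u (`|complex.Im (G u) - (fhat (fk false) true u + -1 * fhat (fk true) false u)| `^ (2 * sg))%:E <= rho%:E)%E.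
    apply: le_trans fG; apply: le_integral_nonmeas => u; first by rewrite lee_fin powR_ge0.
    rewrite lee_fin; apply: ge0_ler_powR; rewrite ?nnegrE ?normc0 ?(ltW s0)//.
    rewrite distrC mulN1r; have := abs_Im_le (fourier1 f u - G u); rewrite (fourier1E u Lf1 Lf2).
    by case: (G u) => G1 G2.
  have n1 : `|1 : R| <= 1 by rewrite normr1.
  have nN1 : `|-1 : R| <= 1 by rewrite normrN normr1.
  have [_ A1] := oscr_split true x (Lfk true) (Lfk false) n1 mG1 e1 e2 (ltW rho0) hre.
  have [_ A2] := oscr_split false x (Lfk true) (Lfk false) n1 mG1 e1 e2 (ltW rho0) hre.
  have [_ A3] := oscr_split true x (Lfk false) (Lfk true) nN1 mG2 e1 e2 (ltW rho0) him.
  have [_ A4] := oscr_split false x (Lfk false) (Lfk true) nN1 mG2 e1 e2 (ltW rho0) him.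
  have et := eta_le e el.
  rewrite sum_bool3 /=.
  exact: (norm_pair_le A1 A2 A3 A4 et).
have Bdw j st : `|Bd^-1 * w j st| <= poisson2 st.
  by rewrite normrM gtr0_norm ?invr_gt0// mulrC ler_pdivrMr// mulrC.
pose Fp := 2 `^ p * 2 * t `^ p.
have Fp0 : 0 <= Fp by rewrite !mulr_ge0 ?powR_ge0.
have fkN b' : (\int[leb2]_x (`|fk b' x| `^ p)%:E <= Fp%:E)%E.
  apply: le_trans fN; apply: le_integral_nonmeas => x; first by rewrite lee_fin powR_ge0.
  rewrite lee_fin; apply: ge0_ler_powR; rewrite ?nnegrE ?normc0 ?(ltW p0)//.
  by rewrite /fk; case: b'; [exact: abs_Re_le|exact: abs_Im_le].
pose c8 := (Bd * energy_const sg `^ 2^-1 * (2 `^ p * 2) `^ p^-1) `^ q0.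
have c80 : 0 <= c8 by exact: powR_ge0.
(* [None] indexes the constant approximation error, the triples index the eight real maximal
   functions. *)
have fam : forall i : option (bool * bool * bool), exists al : R -> R,
  [/\ measurable_fun setT (al : RR -> R), forall x, 0 <= al x,
    match i with Some i => forall e x, e \in e0 :: l -> `|osc F (w i.2) (fk i.1.1) i.1.2 e x| <= al x
               | None => forall x, al x = theta end &
    (\int[leb]_x (al x `^ q0 * k x `^ 3^-1)%:E <= ((c8 + 1) * t `^ q0)%:E)%E].
  move=> [i|]; last first.
    exists (cst theta); split; [exact: measurable_cst|by move=> x; exact: ltW|by []|].
    apply: (@le_trans _ _ (\int[leb]_x (theta `^ q0 * jk x)%:E)%E).
      apply: le_integral_nonmeas => x; first by rewrite lee_fin mulr_ge0 ?powR_ge0.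
      rewrite lee_fin ler_wpM2l ?powR_ge0//.
      exact: (powR_mask_le kappa_ge0 kE).
    rewrite -(Rintegral_EFin (L1_scale (theta `^ q0) Ljk)) lee_fin (RintegralZl (theta `^ q0) measurableT Ljk).
    apply: (le_trans thetaq); rewrite mulrDl mul1r lerDr mulr_ge0 ?powR_ge0//.
  (* Division by [Bd] brings the kernel below [poisson2], as [maximal_osc_le] requires. *)
  have mwB : measurable_fun setT (fun st => Bd^-1 * w i.2 st).
    by apply: measurable_funM => //; exact: measurable_cst.
  have [al [mal al0 osc_al al_int]] := maximal_osc_le ab phi_derive dphi_derive kappa_cont kappa_ge0
    mF FE mP PE mk kE sg2 p0 psg i.1.2 mwB (Bdw i.2) (Lfk i.1.1) Fp0 (fkN i.1.1) ne0.
  exists (fun x => Bd * al x); split.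
  - by apply: measurable_funM => //; exact: measurable_cst.
  - by move=> x; rewrite mulr_ge0// ltW.
  - move=> e x el; have := osc_al e x el.
    have -> : osc F (fun st => Bd^-1 * w i.2 st) (fk i.1.1) i.1.2 e x = Bd^-1 * osc F (w i.2) (fk i.1.1) i.1.2 e x.
      rewrite /osc -(RintegralZl Bd^-1 measurableT (Lbw i.1.2 i.2 e (x, F x) (Lfk i.1.1))).
      by apply: eq_Rintegral => st _; rewrite mulrCA.
    by rewrite normrM gtr0_norm ?invr_gt0// mulrC ler_pdivrMr// mulrC.
  have E x : (((Bd * al x) `^ q0 * k x `^ 3^-1)%:E = (Bd `^ q0)%:E * (al x `^ q0 * k x `^ 3^-1)%:E)%E.
    by rewrite powRM ?(ltW Bd0)// -EFinM mulrA.
  under eq_integral do rewrite E.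
  have mak : measurable_fun setT (fun x : RR => (al x `^ q0 * k x `^ 3^-1)%:E : \bar R).
    apply/measurable_EFinP; apply: measurable_funM.
      exact: (measurableT_comp (measurable_powR q0) mal).
    exact: (measurableT_comp (measurable_powR 3^-1) mk).
  have ak0 x : (0 <= (al x `^ q0 * k x `^ 3^-1)%:E :> \bar R)%E by rewrite lee_fin mulr_ge0 ?powR_ge0.
  have BdE : (0 <= (Bd `^ q0)%:E :> \bar R)%E by rewrite lee_fin powR_ge0.
  rewrite (@ge0_integralZl _ _ R lebR setT measurableT _ mak _ (fun x _ => ak0 x) BdE).
  apply: (le_trans (lee_wpmul2l BdE al_int)); rewrite -EFinM lee_fin.
  have ec : 0 <= energy_const sg `^ 2^-1 by exact: powR_ge0.
  have -> : Bd `^ q0 * (energy_const sg `^ 2^-1 * Fp `^ p^-1) `^ q0 = c8 * t `^ q0.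
    have F1 : Fp `^ p^-1 = (2 `^ p * 2) `^ p^-1 * t.
      by rewrite /Fp powRM ?mulr_ge0 ?powR_ge0// -powRrM divff ?gt_eqF// powRr1// ltW.
    rewrite F1; by apply: powRM_regroup; [exact: ltW|exact: ec|exact: powR_ge0|exact: ltW].
  by rewrite ler_wpM2r ?powR_ge0// lerDl.
have /choice[al Hal] := fam.
have sumal x : a <= x <= b -> M x <= \sum_i al i x.
  move=> /Mle[e el Me]; apply: (le_trans Me); apply: (le_trans (pw x e el)).
  rewrite [leRHS](bigD1 None)//= [leRHS]addrC; apply: lerD; last by have [_ _ h _] := Hal None; rewrite h.
  rewrite [leRHS](reindex_omap (Some : bool * bool * bool -> _) id)/=; last by case.
  apply: (@le_trans _ _ (\sum_(i : bool * bool * bool) al (Some i) x)).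
    by apply: ler_sum => i _; have [_ _ h _] := Hal (Some i); exact: h.
  by rewrite le_eqVlt; apply/orP; left; apply/eqP; apply: eq_bigl => i; rewrite /= eqxx.
have card9 : #|{: option (bool * bool * bool)}|%:R = 9%:R :> R.
  by rewrite card_option !card_prod card_bool.
have mak i : measurable_fun setT (fun x : RR => (al i x `^ q0 * k x `^ 3^-1)%:E : \bar R).
  have [mal _ _ _] := Hal i; apply/measurable_EFinP; apply: measurable_funM.
    exact: (measurableT_comp (measurable_powR q0) mal).
  exact: (measurableT_comp (measurable_powR 3^-1) mk).
have ak0 i x : (0 <= (al i x `^ q0 * k x `^ 3^-1)%:E :> \bar R)%E by rewrite lee_fin mulr_ge0 ?powR_ge0.
have n90 : (0 <= (9%:R `^ q0)%:E :> \bar R)%E by rewrite lee_fin powR_ge0.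
apply: (@le_trans _ _ ((9%:R `^ q0)%:E * \sum_i \int[leb]_x (al i x `^ q0 * k x `^ 3^-1)%:E)%E).
  rewrite -(ge0_integral_sum lebR measurableT mak (fun i x _ => ak0 i x) (index_enum _)).
  have mS : measurable_fun setT (fun x : RR => (\sum_i (al i x `^ q0 * k x `^ 3^-1)%:E)%E : \bar R).
    exact: emeasurable_sum.
  have S0 x : (0 <= \sum_i (al i x `^ q0 * k x `^ 3^-1)%:E :> \bar R)%E by apply: sume_ge0 => i _; exact: ak0.
  rewrite -(@ge0_integralZl _ _ R lebR setT measurableT _ mS _ (fun x _ => S0 x) n90).
  apply: le_integral_nonmeas => x; first by rewrite lee_fin mulr_ge0 ?powR_ge0.
  rewrite sumEFin -EFinM lee_fin -mulr_suml mulrA.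
  have [xab|xab] := boolP (a <= x <= b); last first.
    by rewrite kE (negbTE xab) mul0r powR0 ?invr_eq0// !mulr0.
  apply: ler_wpM2r; first exact: powR_ge0.
  have := powR_sum_le q00 (M0 x) (fun i => _) (sumal x xab); rewrite card9; apply.
  by move=> i; have [_ h _ _] := Hal i.
apply: (@le_trans _ _ ((9%:R `^ q0)%:E * (9%:R * ((c8 + 1) * t `^ q0))%:E)%E).
  apply: lee_wpmul2l => //.
  apply: (@le_trans _ _ (\sum_(i : option (bool * bool * bool)) ((c8 + 1) * t `^ q0)%:E)%E).
    by apply: lee_sum => i _; have [_ _ _ h] := Hal i.
  by rewrite sumEFin lee_fin sumr_const -card9 mulr_natl.
by rewrite -EFinM lee_fin /finite_maximal_const -/c8 -!mulrA.
Qed.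

End finite_maximal.

(** * Norms of complex functions and conjugate exponents *)

Lemma normc_ge0 (R : realType) (y : R[i]) : 0 <= Normc.normc y.
Proof. by case: y => y1 y2 /=; exact: sqrtr_ge0. Qed.

Lemma measurable_normc d (T : measurableType d) (R : realType) (f : T -> R[i]) :
  cmeasurable f -> measurable_fun setT (fun x => Normc.normc (f x)).
Proof.
move=> [m1 m2].
rewrite (_ : (fun x => _) = (fun x => Num.sqrt (complex.Re (f x) ^+ 2 + complex.Im (f x) ^+ 2))).
  have ms : measurable_fun setT (@Num.sqrt R) by apply: continuous_measurable_fun; exact: sqrt_continuous.
  apply: (measurableT_comp ms).
  by apply: measurable_funD; apply: measurable_funX.
by apply/funext => x; case: (f x).
Qed.

Lemma hoelder_conjugate_EFin (R : realType) (p : R) : 1 < p ->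
  hoelder_conjugate p%:E = (p / (p - 1))%:E.
Proof.
move=> p1; have pn0 : (p == 0) = false by apply: gt_eqF; exact: lt_trans p1.
by rewrite /hoelder_conjugate /= eqe pn0 -EFinB inver subr_eq0 (gt_eqF p1).
Qed.

Lemma integral_le_of_Lnorm d (T : measurableType d) (R : realType)
    (m : {measure set T -> \bar R}) (p t : R) (g : T -> R) : 0 < p -> 0 <= t ->
  (forall x, 0 <= g x) -> (Lnorm m p%:E (EFin \o g) <= t%:E)%E ->
  (\int[m]_x (g x `^ p)%:E <= (t `^ p)%:E)%E.
Proof.
move=> p0 t0 g0 ht.
have -> : (\int[m]_x (g x `^ p)%:E = \int[m]_x (`|(EFin \o g) x| `^ p))%E.
  by apply: eq_integral => x _; rewrite /= ger0_norm.
rewrite -powR_Lnorm ?gt_eqF// -poweR_EFin; apply: gt0_ler_poweR => //; first exact: ltW.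
  by rewrite in_itv/= Lnorm_ge0 leey.
by rewrite in_itv/= leey lee_fin t0.
Qed.

Lemma measurable_oscr_graph (R : realType) (a w : R * R -> R) (F : R -> R) e :
  measurable_fun setT a -> measurable_fun setT w -> measurable_fun setT F ->
  measurable_fun setT (fun x : measurableTypeR R => oscr a w e (x, F x)).
Proof.
move=> ma mw mF.
rewrite /oscr; apply: (@measurable_Rintegral_param _ _ _ _ _ leb2
  (fun v : R * (R * R) => a (affine2 (v.1, F v.1) e v.2) * w v.2)).
apply: measurable_funM; last exact: (measurableT_comp mw measurable_snd).
have m21 : measurable_fun setT (fun X : R * (R * R) => X.2.1) by exact: (measurableT_comp measurable_fst measurable_snd).
have m22 : measurable_fun setT (fun X : R * (R * R) => X.2.2) by exact: (measurableT_comp measurable_snd measurable_snd).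
apply: (measurableT_comp ma); apply: measurable_fun_pair; apply: measurable_funD.
- exact: measurable_fst.
- by apply: measurable_funM => //; exact: measurable_cst.
- exact: (measurableT_comp mF measurable_fst).
- by apply: measurable_funM => //; exact: measurable_cst.
Qed.

(** * Approximation of the L^p Fourier transform by Fourier integrals *)

Section fourier_approximation.
Context {R : realType}.
Variables (p sg : R).
Hypotheses (p1 : 1 < p) (sgE : 2 * sg = p / (p - 1)).
Let p0 : 0 < p. Proof. exact: lt_trans p1. Qed.
Let s0 : 0 < 2 * sg. Proof. by rewrite sgE divr_gt0// subr_gt0. Qed.

Let cmeasurableB (f g : R * R -> R[i]) : cmeasurable f -> cmeasurable g -> cmeasurable (fun x => f x - g x).
Proof.
move=> [f1 f2] [g1 g2]; split.
  rewrite (_ : (fun x => _) = (fun x => complex.Re (f x) - complex.Re (g x))); first exact: measurable_funB.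
  by apply/funext => x; case: (f x); case: (g x).
rewrite (_ : (fun x => _) = (fun x => complex.Im (f x) - complex.Im (g x))); first exact: measurable_funB.
by apply/funext => x; case: (f x); case: (g x).
Qed.

(** A late term of the sequence in [is_fourier] is within t of [f]. [powR_sum_le] with two summands,
    each contributing t^p, yields the factor 2^p 2. *)
Lemma fourier_approximation (f G : R * R -> R[i]) (t : R) : 0 < t ->
  cmeasurable f -> (cLnorm (lebesgue2 R) p%:E f <= t%:E)%E -> is_fourier p%:E f G ->
  forall rho : R, 0 < rho -> exists g : R * R -> R[i], [/\
     L1 leb2 (fun x => complex.Re (g x)), L1 leb2 (fun x => complex.Im (g x)),
     (\int[leb2]_x (Normc.normc (g x) `^ p)%:E <= (2 `^ p * 2 * t `^ p)%:E)%E &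
     (\int[leb2]_x (Normc.normc (fourier1 g x - G x)%R `^ (2 * sg))%:E <= rho%:E)%E].
Proof.
move=> t0 mf ft [_ [Fn [FL cvF cvG]]] rho rho0.
rewrite (hoelder_conjugate_EFin p1) -sgE in cvG.
pose r1 := rho `^ (2 * sg)^-1.
have r10 : 0 < r1 by exact: powR_gt0.
have nF : \forall n \near \oo, (cLnorm (lebesgue2 R) p%:E (fun x => (Fn n x - f x)%R) <= t%:E)%E.
  have := cvF; move/fine_cvgP => [nfin c0]; near=> n.
  have fn : cLnorm (lebesgue2 R) p%:E (fun x => (Fn n x - f x)%R) \is a fin_num by near: n.
  rewrite -(fineK fn) lee_fin; near: n; exact: (cvgr_le 0 c0 t t0).
have nG : \forall n \near \oo, (cLnorm (lebesgue2 R) (2 * sg)%:E (fun x => (fourier1 (Fn n) x - G x)%R) <= r1%:E)%E.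
  have := cvG; move/fine_cvgP => [nfin c0]; near=> n.
  have fn : cLnorm (lebesgue2 R) (2 * sg)%:E (fun x => (fourier1 (Fn n) x - G x)%R) \is a fin_num by near: n.
  rewrite -(fineK fn) lee_fin; near: n; exact: (cvgr_le 0 c0 r1 r10).
have [n [Hn1 Hn2]] : exists n, (cLnorm (lebesgue2 R) p%:E (fun x => (Fn n x - f x)%R) <= t%:E)%E /\
   (cLnorm (lebesgue2 R) (2 * sg)%:E (fun x => (fourier1 (Fn n) x - G x)%R) <= r1%:E)%E.
  have [N1 _ HN1] := nF; have [N2 _ HN2] := nG.
  by exists (N1 + N2)%N; split; [apply: HN1 => /=; rewrite leq_addr|apply: HN2 => /=; rewrite leq_addl].
have [[mFn Fn1] _] := FL n; have [m1 m2] := mFn.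
have LN : L1 leb2 (fun x => Normc.normc (Fn n x)).
  apply/integrableP; split; first by apply/measurable_EFinP; exact: measurable_normc.
  rewrite /cLnorm Lnorm1 in Fn1; apply: le_lt_trans Fn1.
  by apply: le_integral_nonmeas => x /=; rewrite ?lee_fin.
exists (Fn n); split.
- apply: (L1_dom LN) => [|x]; [exact: m1|exact: abs_Re_le].
- apply: (L1_dom LN) => [|x]; [exact: m2|exact: abs_Im_le].
- have I1 := integral_le_of_Lnorm p0 (ltW t0) (fun x => normc_ge0 _) Hn1.
  have I2 := integral_le_of_Lnorm p0 (ltW t0) (fun x => normc_ge0 _) ft.
  have mA : measurable_fun setT (fun x => (Normc.normc (Fn n x - f x)%R `^ p)%:E : \bar R).
    apply/measurable_EFinP; apply: (measurableT_comp (measurable_powR p)).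
    by apply: measurable_normc; exact: cmeasurableB.
  have mB : measurable_fun setT (fun x => (Normc.normc (f x) `^ p)%:E : \bar R).
    by apply/measurable_EFinP; apply: (measurableT_comp (measurable_powR p)); exact: measurable_normc.
  have A0 x : (0 <= (Normc.normc (Fn n x - f x)%R `^ p)%:E :> \bar R)%E by rewrite lee_fin powR_ge0.
  have B0 x : (0 <= (Normc.normc (f x) `^ p)%:E :> \bar R)%E by rewrite lee_fin powR_ge0.
  have mAB : measurable_fun setT (fun x => ((Normc.normc (Fn n x - f x)%R `^ p)%:E + (Normc.normc (f x) `^ p)%:E : \bar R)%E).
    by apply: emeasurable_funD; [exact: mA|exact: mB].
  have AB0 x : (0 <= (Normc.normc (Fn n x - f x)%R `^ p)%:E + (Normc.normc (f x) `^ p)%:E :> \bar R)%E.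
    exact: adde_ge0.
  have c0 : (0 <= (2 `^ p)%:E :> \bar R)%E by rewrite lee_fin powR_ge0.
  apply: (@le_trans _ _ ((2 `^ p)%:E * \int[leb2]_x ((Normc.normc (Fn n x - f x)%R `^ p)%:E + (Normc.normc (f x) `^ p)%:E))%E).
    rewrite -(@ge0_integralZl _ _ R leb2 setT measurableT _ mAB _ (fun x _ => AB0 x) c0).
    apply: le_integral_nonmeas => x; first by rewrite lee_fin powR_ge0.
    rewrite -EFinD -EFinM lee_fin.
    have tri : Normc.normc (Fn n x) <= Normc.normc (Fn n x - f x) + Normc.normc (f x).
      by have := le_normcD (Fn n x - f x) (f x); rewrite subrK.
    have := @powR_sum_le R bool (Normc.normc (Fn n x)) p
      (fun b => if b then Normc.normc (Fn n x - f x) else Normc.normc (f x)) p0 (normc_ge0 _).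
    rewrite !big_bool/= card_bool; apply => //; by case; exact: normc_ge0.
  rewrite (@ge0_integralD _ _ R leb2 setT measurableT _ _ (fun x _ => A0 x) mA (fun x _ => B0 x) mB).
  apply: (@le_trans _ _ ((2 `^ p)%:E * ((t `^ p)%:E + (t `^ p)%:E))%E).
    by apply: lee_wpmul2l => //; exact: leeD.
  rewrite -EFinD -EFinM lee_fin le_eqVlt; apply/orP; left; apply/eqP; ring.
- have := integral_le_of_Lnorm s0 (ltW r10) (fun x => normc_ge0 _) Hn2.
  by rewrite /r1 -powRrM mulVf ?gt_eqF// powRr1// ltW.
Unshelve. all: by end_near.
Qed.

End fourier_approximation.

(** * Running maxima of a sequence *)

Section running_max.
Context {R : realType} {T : Type}.
Variable u : nat -> T -> R.

Fixpoint running_max n x : R :=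
  if n is n'.+1 then Num.max (running_max n' x) (u n x) else u 0%N x.

Lemma running_max_attained n x : exists2 i, (i <= n)%N & running_max n x = u i x.
Proof.
elim: n => [|n [i ni IH]]; first by exists 0%N.
rewrite /= /Num.max; case: ifP => _; first by exists n.+1.
by exists i => //; exact: leqW.
Qed.

Lemma running_max_nd n k x : (n <= k)%N -> running_max n x <= running_max k x.
Proof.
elim: k => [|k IH]; first by rewrite leqn0 => /eqP ->.
by rewrite leq_eqVlt => /orP[/eqP -> //|]; rewrite ltnS => /IH h /=; rewrite le_max h.
Qed.

Lemma running_max_ge n x : u n x <= running_max n x.
Proof. by case: n => [|n] //=; rewrite le_max lexx orbT. Qed.

End running_max.

(** * All scales and the whole interval, for p > 1 *)

Section majorant.
Context {R : realType}.
Local Notation leb := (@lebesgue_measure R).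
Local Notation RR := (measurableTypeR R).
Variables (I : set R) (phi kappa : R -> R).
Hypotheses (I_itv : is_interval I) (I_bnd : bounded_set I)
  (phi_convex : @convex_function R R^o I phi) (phi_C2 : is_C2_within I phi kappa).
Variable mu : {measure set RR -> \bar R}.
Hypothesis mu_def : is_affine_arclength I kappa mu.
Variable chi : R -> R[i].
Hypothesis chi_schwartz : cschwartz chi.
Variable p : R.
Hypotheses (p1 : 1 < p) (p43 : p < 4 / 3).

(** Continuity in the scale reduces the supremum to the sequence [ee]. The n-th step treats its
    first n+1 members on a compact interval that grows with n, so a single monotone limit exhausts
    both the scales and the interior of [I]. *)
Lemma maximal_majorant : exists2 C : R, 0 <= C &
  forall (t : R) (f G : R * R -> R[i]), 0 < t -> cmeasurable f ->
  (cLnorm (lebesgue2 R) p%:E f <= t%:E)%E -> is_fourier p%:E f G ->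
  exists H : R -> \bar R, [/\ measurable_fun setT (H : RR -> \bar R), forall x, (0 <= H x)%E,
    forall x, (maximal chi phi G x `^ (p / (p - 1) / 3) <= H x)%E &
    (\int[mu]_x H x <= (C * t `^ (p / (p - 1) / 3))%:E)%E].
Proof.
have p0 : 0 < p by exact: lt_trans p1.
have p10 : 0 < p - 1 by rewrite subr_gt0.
pose sg := p / (p - 1) / 2.
have sgE : 2 * sg = p / (p - 1) by rewrite /sg mulrC divfK.
have sg2 : 2 < sg.
  by rewrite /sg ltr_pdivlMr// ltr_pdivlMr//; have := p43; rewrite ltr_pdivlMr//; lra.
have psg : p^-1 + (2 * sg)^-1 = 1 by rewrite sgE; field; rewrite !lt0r_neq0.
have s0 : 0 < 2 * sg by rewrite mulr_gt0// (lt_trans _ sg2).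
pose q0 := 2 * sg / 3.
have q0E : p / (p - 1) / 3 = q0 by rewrite /q0 sgE.
have q00 : 0 < q0 by rewrite divr_gt0.
have [Bd Bd0 Bdle] := profile_bound chi_schwartz.
have mprof := measurable_profile chi_schwartz.
have [kC [dphi [D1 D2]]] := phi_C2.
have [ee [ee01 dense]] := @dense_scales R.
exists (finite_maximal_const sg p Bd).
  by rewrite /finite_maximal_const !mulr_ge0 ?powR_ge0// addr_ge0 ?powR_ge0.
move=> t f G t0 mf ft fou; rewrite q0E.
have [[mG GL] _] := fou; have [mG1 mG2] := mG.
rewrite (hoelder_conjugate_EFin p1) -sgE in GL.
pose NG := fine (cLnorm (lebesgue2 R) (2 * sg)%:E G).
have NG0 : 0 <= NG by apply: fine_ge0; exact: Lnorm_ge0.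
have hG : (\int[leb2]_x (Normc.normc (G x) `^ (2 * sg))%:E <= (NG `^ (2 * sg))%:E)%E.
  apply: (integral_le_of_Lnorm s0 NG0 (fun x => normc_ge0 _)).
  by rewrite fineK// ge0_fin_numE// Lnorm_ge0.
have NGp : 0 <= NG `^ (2 * sg) by exact: powR_ge0.
have hRe : (\int[leb2]_x (`|complex.Re (G x)| `^ (2 * sg))%:E <= (NG `^ (2 * sg))%:E)%E.
  apply: le_trans hG; apply: le_integral_nonmeas => x; first by rewrite lee_fin powR_ge0.
  by rewrite lee_fin; apply: ge0_ler_powR; rewrite ?nnegrE ?normc_ge0 ?(ltW s0)// abs_Re_le.
have hIm : (\int[leb2]_x (`|complex.Im (G x)| `^ (2 * sg))%:E <= (NG `^ (2 * sg))%:E)%E.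
  apply: le_trans hG; apply: le_integral_nonmeas => x; first by rewrite lee_fin powR_ge0.
  by rewrite lee_fin; apply: ge0_ler_powR; rewrite ?nnegrE ?normc_ge0 ?(ltW s0)// abs_Im_le.
have L1Re j e z : 0 < e.1 -> 0 < e.2 -> L1 leb2 (fun st => complex.Re (G (affine2 z e st)) * profile chi j st).
  by move=> e1 e2; have [] := oscr_error (mprof j) Bd0 (Bdle j) z (ltW p1) s0 psg e1 e2 mG1 NGp hRe.
have L1Im j e z : 0 < e.1 -> 0 < e.2 -> L1 leb2 (fun st => complex.Im (G (affine2 z e st)) * profile chi j st).
  by move=> e1 e2; have [] := oscr_error (mprof j) Bd0 (Bdle j) z (ltW p1) s0 psg e1 e2 mG2 NGp hIm.
have p2le (st : R * R) : `|poisson2 st| <= 1 * poisson2 st by rewrite mul1r ger0_norm// poisson2_ge0.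
have L1Rep z e : 0 < e.1 -> 0 < e.2 -> L1 leb2 (fun st => complex.Re (G (affine2 z e st)) * poisson2 st).
  by move=> e1 e2; have [] := oscr_error measurable_poisson2 ltr01 p2le z (ltW p1) s0 psg e1 e2 mG1 NGp hRe.
have L1Imp z e : 0 < e.1 -> 0 < e.2 -> L1 leb2 (fun st => complex.Im (G (affine2 z e st)) * poisson2 st).
  by move=> e1 e2; have [] := oscr_error measurable_poisson2 ltr01 p2le z (ltW p1) s0 psg e1 e2 mG2 NGp hIm.
have opt e x : 0 < e.1 -> 0 < e.2 ->
    Normc.normc (cintegral (lebesgue2 R) (fun st : R * R =>
      G (x + st.1, phi x + st.2) * dilate chi e.1 st.1 * dilate chi e.2 st.2)) <=
    osc_pair (profile chi) G e (x, phi x).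
  move=> e1 e2; have E := @cintegral_smooth R chi chi_schwartz G e (x, phi x) e1 e2 mG
    (fun j => L1Re j e _ e1 e2) (fun j => L1Im j e _ e1 e2).
  by rewrite [X in Normc.normc X]E; exact: normc_le_abs.
(* If the interior is empty the weight vanishes identically, and the constant +oo is an admissible
   majorant. *)
have [ab|ba] := ltP (inf I) (sup I); last first.
  exists (fun=> +oo%E); split.
  - exact: measurable_cst.
  - by move=> x; exact: leey.
  - by move=> x; exact: leey.
  have mcy : measurable_fun setT (fun _ : RR => +oo%E : \bar R) by exact: measurable_cst.
  have cy0 (x : R) : (0 <= (+oo : \bar R))%E by exact: leey.
  rewrite (integral_arclength I_itv I_bnd phi_C2 mu_def mcy cy0).
  rewrite (_ : (fun x => _) = cst 0%E).
    by rewrite integral0 lee_fin mulr_ge0 ?powR_ge0// /finite_maximal_const !mulr_ge0 ?powR_ge0// addr_ge0 ?powR_ge0.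
  apply/funext => x; rewrite /arc_weight patchE memNset ?powR0 ?invr_eq0 ?mule0//.
  by rewrite /inner_itv/= in_itv/= => /andP[h1 h2]; have := lt_trans h1 h2; rewrite ltNge ba.
(* The denominator n+2 ensures a_ n <= b_ n already for n = 0. *)
pose d (n : nat) := (sup I - inf I) / n.+2%:R.
pose a_ n := inf I + d n; pose b_ n := sup I - d n.
have len0 : 0 < sup I - inf I by rewrite subr_gt0.
have d0 n : 0 < d n by rewrite divr_gt0.
have dhalf n : d n <= (sup I - inf I) / 2.
  by rewrite /d ler_pM2l// lef_pV2 ?posrE// ler_nat.
have dnd n k : (n <= k)%N -> d k <= d n.
  by move=> nk; rewrite /d ler_pM2l// lef_pV2 ?posrE// ler_nat !ltnS.
have abn n : a_ n <= b_ n by have := dhalf n; rewrite /a_ /b_; lra.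
have Jin n x : a_ n <= x <= b_ n -> inner_itv I x.
  by move=> /andP[h1 h2]; rewrite /inner_itv/= in_itv/=; have := d0 n; move: h1 h2; rewrite /a_ /b_ => *; apply/andP; split; lra.
pose F := phi \_ (inner_itv I); pose P := dphi \_ (inner_itv I).
have contd (h dh : R -> R) (x : R) : is_derive x 1 h (dh x) -> {for x, continuous h}.
  by move=> Dh; apply/differentiable_continuous/derivable1_diffP; case: Dh.
have mF : measurable_fun setT F.
  by apply: patch_inner_measurable => x xI; apply: contd; exact: (is_derive_inner I_itv I_bnd D1 xI).
have mP : measurable_fun setT P.
  by apply: patch_inner_measurable => x xI; apply: contd; exact: (is_derive_inner I_itv I_bnd D2 xI).
have FE x : inner_itv I x -> F x = phi x by move=> xI; rewrite /F patchE mem_set.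
have PE x : inner_itv I x -> P x = dphi x by move=> xI; rewrite /P patchE mem_set.
pose k n x := (a_ n <= x <= b_ n)%R%:R * kappa x.
have mj n : measurable_fun setT (fun x : RR => a_ n <= (x : R) <= b_ n).
  by apply: measurable_and; apply: measurable_fun_ler => //; exact: measurable_cst.
have mk n : measurable_fun setT (k n).
  rewrite (_ : k n = (fun x => (a_ n <= x <= b_ n)%R%:R * (kappa \_ (inner_itv I)) x)); last first.
    apply/funext => x; rewrite /k; have [xab|_] := boolP (a_ n <= x <= b_ n); last by rewrite !mul0r.
    by rewrite patchE mem_set//; exact: (Jin n).
  apply: measurable_funM; first exact: (measurable_bool_natr (mj n)).
  apply: patch_inner_measurable => x xI.
  exact: (kappa_continuous_inner I_itv I_bnd phi_C2 xI).
pose Oc i x := osc_pair (profile chi) G (ee i) (x, F x).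
have Oc0 i x : 0 <= Oc i x by rewrite addr_ge0.
have mOc i : measurable_fun setT (fun x : RR => Oc i x).
  have m1 j := measurable_oscr_graph (ee i) mG1 (mprof j) mF.
  have m2 j := measurable_oscr_graph (ee i) mG2 (mprof j) mF.
  apply: measurable_funD; apply: measurableT_comp => //.
    exact: (measurable_funB (m1 true) (m2 false)).
  exact: (measurable_funD (m1 false) (m2 true)).
pose M := running_max Oc.
have M0 n x : 0 <= M n x by have [i _ E] := running_max_attained Oc n x; rewrite /M E.
have mM n : measurable_fun setT (fun x : RR => M n x).
  by elim: n => [|n IH] /=; [exact: mOc|apply: measurable_maxr].
have base n : (\int[leb]_x (M n x `^ q0 * k n x `^ 3^-1)%:E <= (finite_maximal_const sg p Bd * t `^ q0)%:E)%E.
  apply: (@finite_maximal R (a_ n) (b_ n) phi dphi kappa (abn n) _ _ _ _ F P (k n) mF _ mP _ (mk n) (fun x => erefl)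
    sg p sg2 p1 psg (profile chi) Bd mprof Bd0 Bdle G t (ee 0%N) (map ee (iota 1 n)) (M n) t0 mG
    (fourier_approximation p1 sgE t0 mf ft fou)).
  - by move=> x /Jin xI; exact: (is_derive_inner I_itv I_bnd D1 xI).
  - by move=> x /Jin xI; exact: (is_derive_inner I_itv I_bnd D2 xI).
  - apply: continuous_subspaceW kC => x /=; rewrite in_itv/= => /Jin xI.
    exact: (inner_itv_sub I_itv I_bnd xI).
  - by move=> x /Jin xI; exact: (kappa_ge0_inner I_itv I_bnd phi_convex phi_C2 xI).
  - by move=> x /Jin; exact: FE.
  - by move=> x /Jin; exact: PE.
  - move=> e el; have : e \in map ee (iota 0 n.+1) by [].
    by move=> /mapP[i _ ->]; have /andP[/andP[-> _] /andP[-> _]] := ee01 i.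
  - exact: M0.
  - move=> x _; have [i ni E] := running_max_attained Oc n x.
    exists (ee i); last by rewrite /M E.
    by have : ee i \in map ee (iota 0 n.+1) by apply: map_f; rewrite mem_iota.
pose inI (x : R) := (inf I < x) && (x < sup I).
have inIE x : inI x <-> inner_itv I x by rewrite /inner_itv/= in_itv.
(* Outside the interior the majorant is +oo, which costs nothing because [arc_weight] is 0 there and
   +oo times 0 is 0. *)
pose A n x : \bar R := if inI x then (M n x `^ q0)%:E else +oo%E.
have A0 n x : (0 <= A n x)%E by rewrite /A; case: ifP => _; rewrite ?leey// lee_fin powR_ge0.
have mA n : measurable_fun setT (A n : RR -> \bar R).
  apply: measurable_fun_ifT; last exact: measurable_cst.
    by apply: measurable_and; apply: measurable_fun_ltr => //; exact: measurable_cst.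
  by apply/measurable_EFinP; exact: (measurableT_comp (measurable_powR q0) (mM n)).
have And x : {homo A ^~ x : n m / (n <= m)%N >-> (n <= m)%E}.
  move=> n m nm; rewrite /A; case: ifP => // _; rewrite lee_fin; apply: ge0_ler_powR; rewrite ?nnegrE ?M0 ?(ltW q00)//.
  exact: running_max_nd.
pose H x := ereal_sup (range (A ^~ x)).
have AH x : A ^~ x @ \oo --> H x by exact: ereal_nondecreasing_cvgn (And x).
have H0 x : (0 <= H x)%E by apply: le_trans (A0 0%N x) (ereal_sup_ubound _); exists 0%N.
have mH : measurable_fun setT (H : RR -> \bar R).
  by apply: (emeasurable_fun_cvg (A : nat -> RR -> \bar R) H mA) => x _; exact: AH.
exists H; split => //.
- move=> x; have [xI|xI] := boolP (inI x); last first.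
    apply: (@le_trans _ _ (A 0%N x)); last by apply: ereal_sup_ubound; exists 0%N.
    by rewrite /A (negbTE xI) leey.
  have AM n : ((M n x `^ q0)%:E <= H x)%E.
    by apply: ereal_sup_ubound; exists n => //; rewrite /A xI.
  case E : (H x) => [s||]; [|by rewrite leey|by have := H0 x; rewrite E].
  have s00 : 0 <= s by have := H0 x; rewrite E.
  pose sr := s `^ q0^-1.
  have Ole i : Oc i x <= sr.
    apply: (le_trans (running_max_ge Oc i x)); rewrite -/(M i x).
    have -> : M i x = (M i x `^ q0) `^ q0^-1 by rewrite -powRrM divff ?gt_eqF// powRr1.
    apply: ge0_ler_powR; rewrite ?nnegrE ?powR_ge0 ?invr_ge0 ?(ltW q00)//.
    by have := AM i; rewrite E lee_fin.
  have Fx : F x = phi x by apply: FE; apply/inIE.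
  (* The bound at the scales [ee i] extends to every scale by continuity. *)
  have Oe e : 0 < e.1 < 1 -> 0 < e.2 < 1 -> osc_pair (profile chi) G e (x, phi x) <= sr.
    move=> e1 e2; have [u [u1 [u2 [cu1 cu2]]]] := dense e e1 e2.
    have /andP[e10 _] := e1; have /andP[e20 _] := e2.
    have cR j := cvg_oscr (mprof j) Bd0 (Bdle j) (@profile_cont R chi chi_schwartz j) mG1 e10 e20 (L1Rep (x, phi x)) u1 u2 cu1 cu2.
    have cI j := cvg_oscr (mprof j) Bd0 (Bdle j) (@profile_cont R chi chi_schwartz j) mG2 e10 e20 (L1Imp (x, phi x)) u1 u2 cu1 cu2.
    have C : osc_pair (profile chi) G (ee (u n)) (x, phi x) @[n --> \oo] --> osc_pair (profile chi) G e (x, phi x).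
      rewrite /osc_pair; apply: cvgD; apply: cvg_norm.
        exact: (cvgB (cR true) (cI false)).
      exact: (cvgD (cR false) (cI true)).
    rewrite -(cvg_lim _ C)//; apply: limr_le; first by apply/cvg_ex; eexists; exact: C.
    by apply: nearW => n; have := Ole (u n); rewrite /Oc Fx.
  have mx : (maximal chi phi G x <= sr%:E)%E.
    apply: ge_ereal_sup => y [e1 /= e1P [e2 /= e2P <-]]; rewrite lee_fin.
    have /andP[e10 _] := e1P; have /andP[e20 _] := e2P.
    by apply: (le_trans (opt (e1, e2) x e10 e20)); exact: Oe.
  have mx0 : (0 <= maximal chi phi G x)%E.
    have h : 0 < (2^-1 : R) < 1 by rewrite invr_gt0 ltr0n/= invf_lt1// ltr1n.
    apply: (@le_trans _ _ (Normc.normc (cintegral (lebesgue2 R) (fun st : R * R =>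
      G (x + st.1, phi x + st.2) * dilate chi 2^-1 st.1 * dilate chi 2^-1 st.2)))%:E); first by rewrite lee_fin normc_ge0.
    by apply: ereal_sup_ubound; exists 2^-1 => //; exists 2^-1.
  have -> : s%:E = (sr%:E `^ q0)%E by rewrite poweR_EFin /sr -powRrM mulVf ?gt_eqF// powRr1.
  by apply: gt0_ler_poweR; rewrite ?(ltW q00)// in_itv/= ?mx0 leey// lee_fin powR_ge0.
rewrite (integral_arclength I_itv I_bnd phi_C2 mu_def mH H0).
pose f_ n x : \bar R := (M n x `^ q0 * k n x `^ 3^-1)%:E.
have k0 n x : 0 <= k n x.
  rewrite /k; have [xab|_] := boolP (a_ n <= x <= b_ n); last by rewrite mul0r.
  by rewrite mul1r (kappa_ge0_inner I_itv I_bnd phi_convex phi_C2 (Jin n x xab)).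
have mf_ n : measurable_fun setT (f_ n : RR -> \bar R).
  apply/measurable_EFinP; apply: measurable_funM.
    exact: (measurableT_comp (measurable_powR q0) (mM n)).
  exact: (measurableT_comp (measurable_powR 3^-1) (mk n)).
have f0 n x : (0 <= f_ n x)%E by rewrite lee_fin mulr_ge0 ?powR_ge0.
have knd n m x : (n <= m)%N -> k n x <= k m x.
  move=> nm; have [xab|xab] := boolP (a_ n <= x <= b_ n); last first.
    by rewrite {1}/k (negbTE xab) mul0r.
  rewrite /k xab; have -> // : a_ m <= x <= b_ m.
  by have := dnd n m nm; move: xab; rewrite /a_ /b_ => /andP[h1 h2] h3; apply/andP; split; lra.
have fnd x : [set: RR] x -> nondecreasing_seq (f_ ^~ x).
  move=> _ n m nm; rewrite lee_fin; apply: ler_pM; rewrite ?powR_ge0//.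
    by apply: ge0_ler_powR; rewrite ?nnegrE ?M0 ?(ltW q00)//; exact: running_max_nd.
  by apply: ge0_ler_powR; rewrite ?nnegrE ?k0 ?invr_ge0//; exact: knd.
have lim_f x : f_ ^~ x @ \oo --> (H x * (arc_weight I kappa x)%:E)%E.
  have [xI|xI] := boolP (inI x); last first.
    have nI : ~ inner_itv I x by move=> /inIE; apply/negP.
    have -> : arc_weight I kappa x = 0.
      by rewrite /arc_weight patchE memNset// powR0// invr_eq0.
    rewrite mule0 (_ : f_ ^~ x = cst 0%E); first exact: cvg_cst.
    apply/funext => n; rewrite /f_ /k; have [/Jin//|_] := boolP (a_ n <= x <= b_ n).
    by rewrite mul0r powR0 ?mulr0// invr_eq0.
  have C := @cvgeZr _ \oo R (A ^~ x) (H x) (arc_weight I kappa x)%:E isT (AH x).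
  apply: cvg_trans C; apply: near_eq_cvg.
  have /andP[x1 x2] := xI.
  pose gap := Num.min (x - inf I) (sup I - x).
  have gap0 : 0 < gap by rewrite lt_min !subr_gt0 x1 x2.
  have r0 : 0 <= (sup I - inf I) / gap by rewrite divr_ge0// ltW.
  have bd := archi_boundP r0.
  exists (Num.bound ((sup I - inf I) / gap)) => // n /= nb.
  have dgap : d n <= gap.
    rewrite /d ler_pdivrMr// mulrC -ler_pdivrMr//; apply: (le_trans (ltW bd)).
    by rewrite ler_nat; apply: (leq_trans nb); rewrite -addn2 leq_addr.
  have xab : a_ n <= x <= b_ n.
    by move: dgap; rewrite le_min /a_ /b_ => /andP[g1 g2]; apply/andP; split; lra.
  have xin : inner_itv I x by exact: (proj1 (inIE x) xI).
  by rewrite /A /f_ xI /k xab mul1r -EFinM /arc_weight patchE (mem_set xin).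
have -> : (\int[leb]_x (H x * (arc_weight I kappa x)%:E) = \int[leb]_x limn (f_ ^~ x))%E.
  by apply: eq_integral => x _; apply/esym/cvg_lim => //; exact: lim_f.
rewrite (@monotone_convergence _ RR R leb setT measurableT f_ mf_ (fun n x _ => f0 n x) fnd).
apply: lime_le.
  apply: ereal_nondecreasing_is_cvgn => n m nm.
  by apply: le_integral_nonmeas => x; [exact: f0|exact: fnd].
by apply: nearW => n; exact: base.
Qed.

End majorant.

(** * Scaling, essential suprema and uniform constants *)

(** The estimates are stated for a positive bound t of the norm; letting t decrease to [N] includes
    the case N = 0. *)
Lemma le_scaled_of_forall_gt (R : realType) (L N : \bar R) (K : R) : 0 < K ->
  (0 <= N)%E -> (N < +oo)%E -> (forall t : R, 0 < t -> (N <= t%:E)%E -> (L <= (K * t)%:E)%E) ->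
  (L <= K%:E * N)%E.
Proof.
move=> K0 N0 Noo H; have Nfin : N \is a fin_num by rewrite ge0_fin_numE.
apply/lee_addgt0Pr => e e0; rewrite -(fineK Nfin) -EFinM -EFinD.
have eK : 0 < e / K by rewrite divr_gt0.
have Nf : 0 <= fine N by exact: fine_ge0.
have -> : K * fine N + e = K * (fine N + e / K) by rewrite mulrDr mulrCA divff ?mulr1// gt_eqF.
apply: H; first by rewrite ltr_wpDl.
by rewrite -[leLHS](fineK Nfin) lee_fin lerDl ltW.
Qed.

Lemma ae_mono d (T : measurableType d) (R : realType) (m : {measure set T -> \bar R})
    (A B : T -> Prop) : (forall x, A x -> B x) -> {ae m, forall x, A x} -> {ae m, forall x, B x}.
Proof.
move=> AB [N [mN N0 HN]]; exists N; split => // x /= nb; apply: HN => ax.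
exact/nb/AB.
Qed.

(** On a space of measure 0 the sup norm is 0 by convention, but there every property holds almost
    everywhere. *)
Lemma ae_le_of_Lnorm_infty d (T : measurableType d) (R : realType)
    (m : {measure set T -> \bar R}) (f : T -> \bar R) (t : R) :
  (Lnorm m +oo%E f <= t%:E)%E -> {ae m, forall x, (`|f x| <= t%:E)%E}.
Proof.
rewrite unlock /=; case: ifPn => [m0 /ess_supP//|].
rewrite -leNgt => m0 _; exists setT; split => //.
by apply/eqP; rewrite eq_le m0 measure_ge0.
Qed.

(** It trades a power depending on the exponent for a quantity that does not, which makes the
    constant of the theorem uniform in [q]. *)
Lemma powR_inv_le_add1 (R : realType) (z r : R) : 0 <= z -> 1 <= r -> z `^ r^-1 <= 1 + z.
Proof.
move=> z0 r1; have r0 : 0 < r by exact: lt_le_trans r1.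
have ri : r^-1 <= 1 by rewrite invf_le1.
have [z1|z1] := leP z 1; last first.
  by apply: (le_trans (ler1_powR (ltW z1) ri)); rewrite lerDr.
apply: (@le_trans _ _ 1); last by rewrite lerDl.
have h1 : 1 = 1 `^ r^-1 :> R by rewrite powR1.
by rewrite [leRHS]h1 ge0_ler_powR ?nnegrE// invr_ge0 ltW.
Qed.

(** * Smoothing of essentially bounded functions *)

Section bounded_symbol.
Context {R : realType}.
Variables (w : R * R -> R) (Bd : R).
Hypotheses (mw : measurable_fun setT w) (Bd0 : 0 < Bd) (w_le : forall st, `|w st| <= Bd * poisson2 st).

(** [a] is bounded only almost everywhere, so the excess of |a| over [c] is carried along as [K].
    Its integral is 0, and stays 0 under the affine substitution. *)
Lemma oscr_bounded (a : R * R -> R) (c : R) e z : 0 <= c -> measurable_fun setT a ->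
  {ae @leb2 R, forall u, `|a u| <= c} -> 0 < e.1 -> 0 < e.2 ->
  L1 leb2 (fun st => a (affine2 z e st) * w st) /\ `|oscr a w e z| <= c * (Bd * pi ^+ 2).
Proof.
move=> c0 ma ac e1 e2; have e10 := lt0r_neq0 e1; have e20 := lt0r_neq0 e2.
pose K u := Num.max (`|a u| - c) 0.
have K0 u : 0 <= K u by rewrite le_max lexx orbT.
have mK : measurable_fun setT K.
  apply: measurable_maxr; last exact: measurable_cst.
  by apply: measurable_funB; [exact: measurableT_comp|exact: measurable_cst].
have IK : (\int[leb2]_u (K u)%:E = 0)%E.
  rewrite (@ae_eq_integral _ _ R leb2 setT (cst 0%E) (fun u => (K u)%:E))//.
  - by rewrite integral0.
  - exact/measurable_EFinP.
  - by apply: ae_mono ac => u uc _ /=; rewrite /K; congr EFin; apply/max_idPr; rewrite subr_le0.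
have LK : L1 leb2 K.
  apply/integrableP; split; first exact/measurable_EFinP.
  rewrite (_ : (\int[leb2]_x `|_| = \int[leb2]_u (K u)%:E)%E); first by rewrite IK ltry.
  by apply: eq_integral => u _; rewrite /= ger0_norm.
have RK : \int[leb2]_u K u = 0 by have := Rintegral_EFin LK; rewrite IK => -[].
have [LKa IKa] := L1_affine2_ge0 z e10 e20 LK K0; rewrite RK mulr0 in IKa.
have LB : L1 leb2 (fun st : R * R => c * (Bd * poisson2 st)) by do 2 apply: L1_scale; exact: L1_poisson2.
have LBK := L1_scale Bd LKa.
have LS := @integrableD _ _ R leb2 setT measurableT _ _ LB LBK.
have bound st : `|a (affine2 z e st) * w st| <= c * (Bd * poisson2 st) + Bd * K (affine2 z e st).
  have h1 : `|a (affine2 z e st)| <= c + K (affine2 z e st) by rewrite /K -lerBlDl le_max lexx.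
  have p1 : Bd * poisson2 st <= Bd by rewrite ler_piMr ?(ltW Bd0)// poisson2_le1.
  rewrite normrM; apply: (@le_trans _ _ ((c + K (affine2 z e st)) * (Bd * poisson2 st))).
    exact: ler_pM.
  by rewrite mulrDl lerD2l mulrC ler_wpM2r.
have L : L1 leb2 (fun st => a (affine2 z e st) * w st).
  apply: (L1_dom LS) => //; apply: measurable_funM => //.
  exact: (measurableT_comp ma (measurable_affine2 z e)).
split => //; apply: (le_trans (le_normr_Rintegral measurableT L)).
apply: (@le_trans _ _ (\int[leb2]_st (c * (Bd * poisson2 st) + Bd * K (affine2 z e st)))).
  by apply: le_Rintegral => //; exact: (L1_norm L).
rewrite (RintegralD measurableT LB LBK) (RintegralZl Bd measurableT LKa) IKa mulr0 addr0.
rewrite (RintegralZl c measurableT (L1_scale Bd L1_poisson2)) (RintegralZl Bd measurableT L1_poisson2).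
have -> // : \int[leb2]_x (poisson2 x) = pi ^+ 2 :> R.
by have := Rintegral_EFin (@L1_poisson2 R); rewrite integral_poisson2_EFin => -[].
Qed.

End bounded_symbol.

(** * The endpoint p = 1 *)

Section endpoint.
Context {R : realType}.
Variable chi : R -> R[i].
Hypothesis chi_schwartz : cschwartz chi.

Lemma maximal_ge0 (phi : R -> R) (G : R * R -> R[i]) x : (0 <= maximal chi phi G x)%E.
Proof.
have h : 0 < (2^-1 : R) < 1 by rewrite invr_gt0 ltr0n/= invf_lt1// ltr1n.
apply: (@le_trans _ _ (Normc.normc (cintegral (lebesgue2 R) (fun st : R * R =>
  G (x + st.1, phi x + st.2) * dilate chi 2^-1 st.1 * dilate chi 2^-1 st.2)))%:E); first by rewrite lee_fin normc_ge0.
by apply: ereal_sup_ubound; exists 2^-1 => //; exists 2^-1.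
Qed.

(** The transform of an L^1 function is essentially bounded, and smoothing preserves this uniformly
    in the scales, at every point. Four real integrals with symbols bounded by 9 t give the 36. *)
Lemma maximal_endpoint : exists2 C : R, 0 <= C &
  forall (phi : R -> R) (t : R) (f G : R * R -> R[i]), 0 < t -> cmeasurable f ->
  (cLnorm (lebesgue2 R) 1 f <= t%:E)%E -> is_fourier 1 f G ->
  forall x, (maximal chi phi G x <= (C * t)%:E)%E.
Proof.
have [Bd Bd0 Bdle] := profile_bound chi_schwartz.
have mprof := measurable_profile chi_schwartz.
exists (36%:R * (Bd * pi ^+ 2)); first by rewrite mulr_ge0// mulr_ge0 ?sqr_ge0// ltW.
move=> phi t f G t0 mf ft [[mG _] [Fn [FL cvF cvG]]] x; have [mG1 mG2] := mG.
rewrite hoelder_conjugate1 in cvG.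
have pick (u : nat -> \bar R) : u n @[n --> \oo] --> 0%E -> \forall n \near \oo, (u n <= t%:E)%E.
  move=> /fine_cvgP[nfin c0]; near=> n.
  have fn : u n \is a fin_num by near: n.
  rewrite -(fineK fn) lee_fin; near: n; exact: (cvgr_le 0 c0 t t0).
have [N1 _ HN1] := pick _ cvF; have [N2 _ HN2] := pick _ cvG.
pose n := (N1 + N2)%N.
have Hn1 := HN1 n (leq_addr _ _); have Hn2 := HN2 n (leq_addl _ _).
have [[mFn Fn1] _] := FL n; have [m1 m2] := mFn.
have mD : cmeasurable (fun x => Fn n x - f x).
  have [f1 f2] := mf; split.
    rewrite (_ : (fun x => _) = (fun x => complex.Re (Fn n x) - complex.Re (f x))); first exact: measurable_funB.
    by apply/funext => y; case: (Fn n y); case: (f y).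
  rewrite (_ : (fun x => _) = (fun x => complex.Im (Fn n x) - complex.Im (f x))); first exact: measurable_funB.
  by apply/funext => y; case: (Fn n y); case: (f y).
have I1 (g : R * R -> R[i]) : (cLnorm (lebesgue2 R) 1 g <= t%:E)%E -> (\int[leb2]_y (Normc.normc (g y))%:E <= t%:E)%E.
  rewrite /cLnorm Lnorm1; apply: le_trans; apply: le_integral_nonmeas => y; first by rewrite lee_fin normc_ge0.
  exact: lee_abs.
have LN : L1 leb2 (fun x => Normc.normc (Fn n x)).
  apply/integrableP; split; first by apply/measurable_EFinP; exact: measurable_normc.
  rewrite /cLnorm Lnorm1 in Fn1; apply: le_lt_trans Fn1.
  by apply: le_integral_nonmeas => y /=; rewrite ?lee_fin.
have N2t : \int[leb2]_y Normc.normc (Fn n y) <= 2 * t.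
  rewrite -lee_fin (Rintegral_EFin LN).
  have mA : measurable_fun setT (fun y => (Normc.normc (Fn n y - f y)%R)%:E : \bar R).
    by apply/measurable_EFinP; exact: measurable_normc.
  have mB : measurable_fun setT (fun y => (Normc.normc (f y))%:E : \bar R).
    by apply/measurable_EFinP; exact: measurable_normc.
  apply: (@le_trans _ _ (\int[leb2]_y ((Normc.normc (Fn n y - f y)%R)%:E + (Normc.normc (f y))%:E))%E).
    apply: le_integral_nonmeas => y; first by rewrite lee_fin normc_ge0.
    by rewrite -EFinD lee_fin; have := le_normcD (Fn n y - f y) (f y); rewrite subrK.
  rewrite (@ge0_integralD _ _ R leb2 setT measurableT _ _ _ mA _ mB); last 2 first.
  - by move=> y _; rewrite lee_fin normc_ge0.
  - by move=> y _; rewrite lee_fin normc_ge0.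
  apply: (le_trans (leeD (I1 _ Hn1) (I1 _ ft))); rewrite -EFinD lee_fin; lra.
have LR : L1 leb2 (fun y => complex.Re (Fn n y)) by apply: (L1_dom LN) => [|y]; [exact: m1|exact: abs_Re_le].
have LI : L1 leb2 (fun y => complex.Im (Fn n y)) by apply: (L1_dom LN) => [|y]; [exact: m2|exact: abs_Im_le].
have hatb (g : R * R -> R) bt xi : L1 leb2 g -> (forall y, `|g y| <= Normc.normc (Fn n y)) -> `|fhat g bt xi| <= 2 * t.
  move=> Lg gle; apply: (le_trans (fhat_max bt Lg xi)); apply: le_trans N2t.
  by apply: le_Rintegral => //; exact: (L1_norm Lg).
have ae9 := ae_le_of_Lnorm_infty Hn2.
have four xi : `|complex.Re (fourier1 (Fn n) xi)| <= 4 * t /\ `|complex.Im (fourier1 (Fn n) xi)| <= 4 * t.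
  rewrite (fourier1E xi LR LI) /=.
  have h1 bt := hatb _ bt xi LR (fun y => abs_Re_le _).
  have h2 bt := hatb _ bt xi LI (fun y => abs_Im_le _).
  split.
    by apply: (le_trans (ler_normD _ _)); apply: (le_trans (lerD (h1 true) (h2 false))); lra.
  by apply: (le_trans (ler_normB _ _)); apply: (le_trans (lerD (h2 true) (h1 false))); lra.
(* Each part of [fourier1 (Fn n)] is at most 4 t and the error at most t, well within 9 t. *)
have c9 : 0 <= 9%:R * t by rewrite mulr_ge0// ltW.
have aeR : {ae @leb2 R, forall u, `|complex.Re (G u)| <= 9%:R * t}.
  apply: ae_mono ae9 => u /=; rewrite lee_fin ger0_norm ?normc_ge0// => hu; have [h _] := four u.
  have := abs_Re_le (fourier1 (Fn n) u - G u) => h3.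
  have E : complex.Re (fourier1 (Fn n) u - G u) = complex.Re (fourier1 (Fn n) u) - complex.Re (G u) by case: (fourier1 _ _) => ? ?; case: (G u).
  rewrite E in h3.
  have -> : complex.Re (G u) = complex.Re (fourier1 (Fn n) u) - (complex.Re (fourier1 (Fn n) u) - complex.Re (G u)) by ring.
  by apply: (le_trans (ler_normB _ _)); apply: (le_trans (lerD h (le_trans h3 hu))); have := t0; lra.
have aeI : {ae @leb2 R, forall u, `|complex.Im (G u)| <= 9%:R * t}.
  apply: ae_mono ae9 => u /=; rewrite lee_fin ger0_norm ?normc_ge0// => hu; have [_ h] := four u.
  have := abs_Im_le (fourier1 (Fn n) u - G u) => h3.
  have E : complex.Im (fourier1 (Fn n) u - G u) = complex.Im (fourier1 (Fn n) u) - complex.Im (G u) by case: (fourier1 _ _) => ? ?; case: (G u).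
  rewrite E in h3.
  have -> : complex.Im (G u) = complex.Im (fourier1 (Fn n) u) - (complex.Im (fourier1 (Fn n) u) - complex.Im (G u)) by ring.
  by apply: (le_trans (ler_normB _ _)); apply: (le_trans (lerD h (le_trans h3 hu))); have := t0; lra.
have main e1 e2 : 0 < e1 -> 0 < e2 -> Normc.normc (cintegral (lebesgue2 R) (fun st : R * R =>
    G (x + st.1, phi x + st.2) * dilate chi e1 st.1 * dilate chi e2 st.2)) <= 36%:R * (Bd * pi ^+ 2) * t.
  move=> e10 e20.
  have OR j := oscr_bounded (mprof j) Bd0 (Bdle j) (x, phi x) c9 mG1 aeR (e10 : 0 < (e1, e2).1) (e20 : 0 < (e1, e2).2).
  have OI j := oscr_bounded (mprof j) Bd0 (Bdle j) (x, phi x) c9 mG2 aeI (e10 : 0 < (e1, e2).1) (e20 : 0 < (e1, e2).2).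
  have E := @cintegral_smooth R chi chi_schwartz G (e1, e2) (x, phi x) e10 e20 mG (fun j => (OR j).1) (fun j => (OI j).1).
  rewrite [X in Normc.normc X]E; apply: (le_trans (normc_le_abs _ _)).
  apply: (le_trans (lerD (ler_normB _ _) (ler_normD _ _))).
  apply: (le_trans (lerD (lerD (OR true).2 (OI false).2) (lerD (OR false).2 (OI true).2))).
  by rewrite le_eqVlt; apply/orP; left; apply/eqP; ring.
apply: ge_ereal_sup => y [e1 /= e1P [e2 /= e2P <-]]; rewrite lee_fin.
have /andP[e10 _] := e1P; have /andP[e20 _] := e2P; exact: main.
Unshelve. all: by end_near.
Qed.

End endpoint.

(** * From pointwise bounds and majorants to L^q norms on a finite measure space *)

Lemma Lnorm_endpoint_le d (T : measurableType d) (R : realType) (m : {measure set T -> \bar R})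
    (q : \bar R) (g : T -> \bar R) (c : R) : (1 <= q)%E -> 0 <= c -> (m setT < +oo)%E ->
  (forall x, (0 <= g x)%E) -> (forall x, (g x <= c%:E)%E) ->
  (Lnorm m q g <= (c * (1 + fine (m setT)))%:E)%E.
Proof.
move=> q1 c0 moo g0 gc; have m0 : 0 <= fine (m setT) by apply: fine_ge0; exact: measure_ge0.
have mfin : m setT \is a fin_num by rewrite ge0_fin_numE// measure_ge0.
have cc : (c%:E <= (c * (1 + fine (m setT)))%:E)%E by rewrite lee_fin ler_peMr// lerDl.
case: q q1 => [r||]//; last first.
  move=> _; rewrite unlock /=; case: ifP => _; last by rewrite lee_fin mulr_ge0// addr_ge0.
  apply: le_trans cc; apply/ess_supP; exists set0; split; [exact: measurable0|exact: measure0|].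
  by move=> x /=; apply; rewrite gee0_abs.
rewrite lee_fin => r1; have r0 : 0 < r by exact: lt_le_trans r1.
rewrite unlock.
have I : (\int[m]_x (`|g x| `^ r) <= ((c `^ r) * fine (m setT))%:E)%E.
  rewrite EFinM (fineK mfin) -(integral_cst m measurableT).
  apply: le_integral_nonmeas => x; first exact: poweR_ge0.
  rewrite /= gee0_abs// -poweR_EFin; apply: gt0_ler_poweR; rewrite ?(ltW r0)//.
    by rewrite in_itv/= g0 leey.
  by rewrite in_itv/= lee_fin c0 leey.
apply: (@le_trans _ _ (((c `^ r) * fine (m setT))%:E `^ r^-1)%E).
  apply: gt0_ler_poweR => //; first by rewrite invr_ge0 ltW.
    by rewrite in_itv/= leey andbT; apply: integral_ge0 => x _; exact: poweR_ge0.
  by rewrite in_itv/= leey lee_fin mulr_ge0 ?powR_ge0.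
rewrite poweR_EFin lee_fin powRM ?powR_ge0// -powRrM divff ?gt_eqF// powRr1//.
by apply: ler_wpM2l => //; exact: powR_inv_le_add1.
Qed.

(** Only the majorant [H] of g^q0 has a known integral, so a pointwise comparison at height t
    replaces Hoelder's inequality for lowering the exponent. *)
Lemma Lnorm_le_of_majorant d (T : measurableType d) (R : realType) (m : {measure set T -> \bar R})
    (q0 r t C : R) (g H : T -> \bar R) : 1 <= r -> r <= q0 -> 0 < t -> 0 <= C -> (m setT < +oo)%E ->
  (forall x, (0 <= g x)%E) -> measurable_fun setT H -> (forall x, (0 <= H x)%E) ->
  (forall x, (g x `^ q0 <= H x)%E) -> (\int[m]_x H x <= (C * t `^ q0)%:E)%E ->
  (Lnorm m r%:E g <= (t * (1 + (fine (m setT) + C)))%:E)%E.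
Proof.
move=> r1 rq t0 C0 moo g0 mH H0 gH IH.
have r0 : 0 < r by exact: lt_le_trans r1.
have q00 : 0 < q0 by exact: lt_le_trans rq.
have m0 : 0 <= fine (m setT) by apply: fine_ge0; exact: measure_ge0.
have mfin : m setT \is a fin_num by rewrite ge0_fin_numE// measure_ge0.
have c0 : (0 <= (t `^ (r - q0))%:E :> \bar R)%E by rewrite lee_fin powR_ge0.
have tr0 : (0 <= (t `^ r)%:E :> \bar R)%E by rewrite lee_fin powR_ge0.
(* y^r <= t^r if y <= t, and y^r <= t^(r - q0) y^q0 otherwise *)
have pw x : (`|g x| `^ r <= (t `^ r)%:E + (t `^ (r - q0))%:E * H x)%E.
  rewrite gee0_abs//; have := gH x; have := g0 x; case: (g x) => [v||]//.
    rewrite lee_fin => v0; rewrite !poweR_EFin => vH.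
    have [vt|tv] := leP v t.
      apply: (@le_trans _ _ (t `^ r)%:E); last by rewrite leeDl// mule_ge0.
      by rewrite lee_fin ge0_ler_powR ?nnegrE ?(ltW r0) ?(ltW t0).
    apply: (@le_trans _ _ ((t `^ (r - q0))%:E * (v `^ q0)%:E)%E); last first.
      by apply: (le_trans (lee_wpmul2l c0 vH)); rewrite leeDr.
    have vp : 0 < v by exact: lt_trans tv.
    rewrite -EFinM lee_fin.
    have -> : v `^ r = v `^ (r - q0) * v `^ q0.
      by rewrite -powRD ?subrK// (gt_eqF vp) implybT.
    apply: ler_wpM2r; first exact: powR_ge0.
    rewrite -(opprB q0 r) !powRN lef_pV2 ?posrE ?powR_gt0//.
    by rewrite ge0_ler_powR ?nnegrE ?subr_ge0 ?(ltW t0) ?(ltW tv) ?(ltW vp).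
  move=> _; rewrite !poweRyr ?gt_eqF//; rewrite leye_eq => /eqP ->.
  by rewrite gt0_muley ?lte_fin ?powR_gt0// addey.
have I : (\int[m]_x (`|g x| `^ r) <= (t `^ r * (fine (m setT) + C))%:E)%E.
  have mcH : measurable_fun setT (fun x => ((t `^ (r - q0))%:E * H x)%E).
    by apply: emeasurable_funM => //; exact: measurable_cst.
  have cH0 x : (0 <= (t `^ (r - q0))%:E * H x)%E by exact: mule_ge0.
  apply: (@le_trans _ _ (\int[m]_x ((t `^ r)%:E + (t `^ (r - q0))%:E * H x))%E).
    by apply: le_integral_nonmeas => x; [exact: poweR_ge0|exact: pw].
  have mct : measurable_fun setT (fun _ : T => (t `^ r)%:E) by exact: measurable_cst.
  rewrite (@ge0_integralD _ _ R m setT measurableT _ _ (fun x _ => tr0) mct (fun x _ => cH0 x) mcH).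
  rewrite (integral_cst m measurableT (t `^ r)%:E).
  rewrite (@ge0_integralZl _ _ R m setT measurableT _ mH _ (fun x _ => H0 x) c0).
  rewrite mulrDr EFinD; apply: leeD; first by rewrite EFinM fineK.
  apply: (le_trans (lee_wpmul2l c0 IH)); rewrite -EFinM lee_fin mulrCA -powRD ?subrK 1?mulrC//.
  by rewrite (gt_eqF t0) implybT.
rewrite unlock; apply: (@le_trans _ _ ((t `^ r * (fine (m setT) + C))%:E `^ r^-1)%E).
  apply: gt0_ler_poweR => //; first by rewrite invr_ge0 ltW.
    by rewrite in_itv/= leey andbT; apply: integral_ge0 => x _; exact: poweR_ge0.
  by rewrite in_itv/= leey lee_fin mulr_ge0 ?powR_ge0// addr_ge0.
have mC : 0 <= fine (m setT) + C by exact: addr_ge0.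
rewrite poweR_EFin lee_fin powRM ?powR_ge0// -powRrM divff ?gt_eqF// powRr1 ?(ltW t0)//.
by apply: ler_wpM2l; [exact: ltW|exact: powR_inv_le_add1].
Qed.

Theorem theorem2p1 (R : realType)
  (I : set R) (I_itv : is_interval I) (I_bnd : bounded_set I)
  (phi kappa : R -> R)
  (phi_convex : @convex_function R R^o I phi)
  (phi_C2 : is_C2_within I phi kappa)
  (mu : {measure set (measurableTypeR R) -> \bar R})
  (mu_def : is_affine_arclength I kappa mu)
  (mu_fin : (mu [set: R] < +oo)%E)
  (chi : R -> R[i])
  (chi_schwartz : cschwartz chi)
  (chi_even : forall s, chi (- s) = chi s)
  (chi_int1 : cintegral (@lebesgue_measure R) chi = 1)
  (p : R) (p_ge1 : 1 <= p) (p_lt43 : p < 4 / 3) :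
  exists C : R, forall q : \bar R,
    (1 <= q)%E -> (3%:E * q <= hoelder_conjugate p%:E)%E ->
    forall f fhat : R * R -> R[i],
      in_cLp (lebesgue2 R) p%:E f ->
      is_fourier p%:E f fhat ->
      (Lnorm mu q (maximal chi phi fhat) <=
         C%:E * cLnorm (lebesgue2 R) p%:E f)%E.
Proof.
have m0 : 0 <= fine (mu [set: R]) by apply: fine_ge0; exact: measure_ge0.
move: p_ge1; rewrite le_eqVlt => /orP[/eqP pE|p1].
  have [C C0 HC] := maximal_endpoint chi_schwartz.
  (* [C] may be 0, while the scaling lemma asks for a positive constant. *)
  exists ((C + 1) * (1 + fine (mu [set: R]))) => q q1 _ f G [mf foo] fou.
  rewrite -pE in foo fou *.
  apply: le_scaled_of_forall_gt => //.
  - by rewrite mulr_gt0// ltr_wpDl// ltr01.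
  - exact: Lnorm_ge0.
  move=> t t0 ft; have Ct : 0 <= (C + 1) * t by rewrite mulr_ge0 ?addr_ge0// ltW.
  rewrite mulrAC; apply: Lnorm_endpoint_le => // x; first exact: maximal_ge0.
  apply: (le_trans (HC phi t f G t0 mf ft fou x)).
  by rewrite lee_fin ler_wpM2r ?(ltW t0)// lerDl.
have [C C0 HC] := maximal_majorant I_itv I_bnd phi_convex phi_C2 mu_def chi_schwartz p1 p_lt43.
exists (1 + (fine (mu [set: R]) + C)) => q q1 q3 f G [mf foo] fou.
have K0 : 0 < 1 + (fine (mu [set: R]) + C) by rewrite ltr_pwDl// addr_ge0.
apply: le_scaled_of_forall_gt => //; first exact: Lnorm_ge0.
move=> t t0 ft; have [H [mH H0 gH IH]] := HC t f G t0 mf ft fou.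
(* For p > 1 the conjugate exponent is finite, so 3 q <= p' rules out q = +oo and becomes q <= q0
   for real q. *)
move: q1 q3; rewrite (hoelder_conjugate_EFin p1); case: q => [r||]//; last first.
  by move=> _; rewrite gt0_muley ?lte_fin// leye_eq.
rewrite lee_fin => r1; rewrite -EFinM lee_fin => r3.
rewrite mulrC; apply: (@Lnorm_le_of_majorant _ _ R mu (p / (p - 1) / 3) r t C _ H) => //.
  by rewrite ler_pdivlMr// mulrC.
by move=> x; exact: maximal_ge0.
Qed.
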